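(* Let $f$ be a modular function whose Fourier series expansion at $i\infty$ has coefficients in a subfield $K$ of $\mathbb{C}$. Then $f$ is defined over $K$.
   Context: $\mathbb{H}$ is the upper half-plane and $j$ is the classical $j$-invariant on $\mathbb{H}$. A subgroup $\Gamma$ of $\mathrm{SL}(2,\mathbb{R})$ is commensurable to $\mathrm{SL}(2,\mathbb{Z})$ if $\Gamma\cap\mathrm{SL}(2,\mathbb{Z})$ has finite index in both; $X(\Gamma)$ is then the compact Riemann surface obtained by compactifying $\Gamma\backslash\mathbb{H}$ by cusps. A modular function is a meromorphic function on $\mathbb{H}$ that, for some such $\Gamma$, is the lift of the restriction to $\Gamma\backslash\mathbb{H}$ of a meromorphic function on $X(\Gamma)$. Every modular function $f$ is periodic: there is a least integer $h\ge1$ (its period) with $f(\tau+h)=f(\tau)$ for all $\tau\in\mathbb{H}$, and $f$ has a Fourier series expansion at $i\infty$ of the form $f(\tau)=\sum_{n=-\infty}^{\infty}a_n\exp\left(\frac{2\pi i n}{h}\tau\right)$ (valid for $\Im(\tau)$ large, with $a_{-n}=0$ for all sufficiently large $n$). A modular function $f$ is defined over a subfield $K$ of $\mathbb{C}$ if there is a polynomial $\Phi(X,Y)\in K[X,Y]$ that is irreducible over $\mathbb{C}$ and such that $\Phi(j,f)$ vanishes identically. *)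

(* Defs.v *)
From HB Require Import structures.
From mathcomp Require Import all_boot all_order all_algebra.
From mathcomp Require Import complex.
From mathcomp Require Import all_classical all_reals all_analysis.

Set Implicit Arguments.
Unset Strict Implicit.
Unset Printing Implicit Defensive.

Import Order.TTheory GRing.Theory Num.Theory.
Import numFieldNormedType.Exports.

Local Open Scope classical_set_scope.
Local Open Scope ring_scope.
Local Open Scope complex_scope.

(** Conventions.  The complex numbers are [R[i]] for [R : realType]; the Riemann
    sphere P^1(C) is [option R[i]] and the circle P^1(R) is [option R], with
    [None] the point at infinity.  Functions on the upper half-plane are total
    functions on [R[i]]; their values off the half-plane are never used. *)

Section Complex.
Variable R : realType.

Definition upper_half_plane : set R[i] := [set tau | 0 < complex.Im tau].

Definition expC (z : R[i]) : R[i] :=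
  (expR (complex.Re z))%:C *
  (cos (complex.Im z) +i* sin (complex.Im z)).

(** exp (2 pi i z) *)
Definition e2pi (z : R[i]) : R[i] := expC (2 * pi%:C * 'i%C * z).

(** The sum of [F n] over the integers n with - m <= n <= m. *)
Definition zsum (m : nat) (F : int -> R[i]) : R[i] :=
  \sum_(0 <= k < m.*2.+1) F (k%:Z - m%:Z).

(** [G] is a meromorphic germ at [z0], as a map to the Riemann sphere:
    G(z) = g(z) / (z - z0)^n with [g] holomorphic near [z0], the value at [z0]
    being infinity when there is a pole. *)
Definition meromorphic_at (G : R[i] -> option R[i]) (z0 : R[i]) : Prop :=
  exists (n : nat) (g : R[i] -> R[i]),
    [/\ \forall z \near (z0 : R[i]^o), derivable (g : R[i]^o -> R[i]^o) z 1,
        n = 0%N \/ g z0 != 0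
      & \forall z \near (z0 : R[i]^o),
          G z = if (z == z0) && (0 < n)%N then None
                else Some (g z / (z - z0) ^+ n)].

(** The sum of (m tau + n)^-k over the pairs of integers (m, n) != (0, 0).
    It is absolutely convergent for k >= 3, so the exhaustion by squares is
    immaterial. *)
Definition eisenstein (k : nat) (tau : R[i]) : R[i] :=
  lim ((fun N : nat =>
    (zsum N (fun m => zsum N (fun n =>
      if (m == 0) && (n == 0) then 0
      else (m%:~R * tau + n%:~R) ^- k))) : R[i]^o) @ \oo).

Definition g2 (tau : R[i]) : R[i] := 60 * eisenstein 4 tau.
Definition g3 (tau : R[i]) : R[i] := 140 * eisenstein 6 tau.

Definition jinv (tau : R[i]) : R[i] :=
  1728 * g2 tau ^+ 3 / (g2 tau ^+ 3 - 27 * g3 tau ^+ 2).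

End Complex.

Section Groups.
Variable R : realType.

Definition SL2R : set 'M[R]_2 := [set g | \det g = 1].

Definition SL2Z : set 'M[R]_2 :=
  [set g | SL2R g /\ forall i j, g i j \is a Num.int].

Definition subgroup_SL2R (Gamma : set 'M[R]_2) : Prop :=
  [/\ Gamma `<=` SL2R, Gamma 1,
      forall g h, Gamma g -> Gamma h -> Gamma (g * h)
    & forall g, Gamma g -> Gamma g^-1].

(** For a subgroup [H] of a group [G]. *)
Definition finite_index (H G : set 'M[R]_2) : Prop :=
  finite_set [set [set g * h | h in H] | g in G].

Definition commensurable_SL2Z (Gamma : set 'M[R]_2) : Prop :=
  finite_index (Gamma `&` SL2Z) Gamma /\ finite_index (Gamma `&` SL2Z) SL2Z.

Definition mobius (g : 'M[R]_2) (tau : R[i]) : R[i] :=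
  ((g 0 0)%:C * tau + (g 0 1)%:C) / ((g 1 0)%:C * tau + (g 1 1)%:C).

Definition mobius_bdry (g : 'M[R]_2) (s : option R) : option R :=
  match s with
  | Some x => if g 1 0 * x + g 1 1 == 0 then None
              else Some ((g 0 0 * x + g 0 1) / (g 1 0 * x + g 1 1))
  | None => if g 1 0 == 0 then None else Some (g 0 0 / g 1 0)
  end.

Definition parabolic (g : 'M[R]_2) : Prop :=
  [/\ SL2R g, (\tr g) ^+ 2 = 4, g <> 1 & g <> -1].

Definition cusp (Gamma : set 'M[R]_2) (s : option R) : Prop :=
  exists g, [/\ Gamma g, parabolic g & mobius_bdry g s = s].

Definition translation (t : R) : 'M[R]_2 :=
  \matrix_(i < 2, j < 2)
    (if i == j then 1 else if (i == 0) && (j == 1) then t else 0).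

(** With s = sigma(infinity): the [t] for which [+- translation t] is in
    sigma^-1 Gamma sigma are the integral multiples of [h]. *)
Definition cusp_width (Gamma : set 'M[R]_2) (sigma : 'M[R]_2) (h : R) : Prop :=
  0 < h /\
  forall t : R,
    (Gamma (sigma * translation t * sigma^-1) \/
     Gamma (- (sigma * translation t * sigma^-1)))
    <-> exists n : int, t = n%:~R * h.

(** [e] is the order of the stabilizer of [p] in the image of [Gamma] in the
    group of homographies, i.e. modulo +-1. *)
Definition elliptic_order (Gamma : set 'M[R]_2) (p : R[i]) (e : nat) : Prop :=
  ([set mobius g | g in [set g | Gamma g /\ mobius g p = p]] #= `I_e)%card.

End Groups.

Section ModularCurve.
Variable R : realType.

Inductive hpoint : Type :=
  | Inner of R[i]
  | Bdry of option R.

Definition hact (g : 'M[R]_2) (x : hpoint) : hpoint :=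
  match x with
  | Inner tau => Inner (mobius g tau)
  | Bdry s => Bdry (mobius_bdry g s)
  end.

(** The upper half-plane together with the cusps of [Gamma]. *)
Definition hstar (Gamma : set 'M[R]_2) : set hpoint :=
  [set x | match x with
           | Inner tau => upper_half_plane tau
           | Bdry s => cusp Gamma s
           end].

Definition orbit_of (Gamma : set 'M[R]_2) (x : hpoint) : set hpoint :=
  [set hact g x | g in Gamma].

(** The points of the compactified modular curve X(Gamma). *)
Definition modular_curve (Gamma : set 'M[R]_2) : Type :=
  {c : set hpoint | exists2 x, hstar Gamma x & c = orbit_of Gamma x}.

Definition modular_proj (Gamma : set 'M[R]_2) (x : hpoint)
    (hx : hstar Gamma x) : modular_curve Gamma :=
  exist _ (orbit_of Gamma x) (ex_intro2 _ _ x hx erefl).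

(** A meromorphic function on X(Gamma) is a map to the Riemann sphere that is
    meromorphic in the local coordinate centred at each point: at the image of
    [p] in the upper half-plane, with stabilizer of order [e] modulo +-1, the
    coordinate is ((tau - p) / (tau - conj p))^e; at the image of a cusp
    sigma(infinity) of width [h], it is exp (2 pi i sigma^-1(tau) / h), with
    value 0 at the cusp. *)
Definition meromorphic_inner (Gamma : set 'M[R]_2)
    (F : modular_curve Gamma -> option R[i]) (p : R[i]) : Prop :=
  exists (e : nat) (G : R[i] -> option R[i]),
    [/\ elliptic_order Gamma p e, meromorphic_at G 0
      & \forall tau \near (p : R[i]^o),
          forall htau : hstar Gamma (Inner tau),
          F (modular_proj htau) = G (((tau - p) / (tau - p^*)) ^+ e)].

Definition meromorphic_cusp (Gamma : set 'M[R]_2)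
    (F : modular_curve Gamma -> option R[i]) (sigma : 'M[R]_2) : Prop :=
  exists (h : R) (G : R[i] -> option R[i]),
    [/\ cusp_width Gamma sigma h, meromorphic_at G 0,
        forall hs : hstar Gamma (Bdry (mobius_bdry sigma None)),
          F (modular_proj hs) = G 0
      & exists2 M : R, 0 < M &
          forall (tau : R[i]) (htau : hstar Gamma (Inner (mobius sigma tau))),
          M < complex.Im tau ->
          F (modular_proj htau) = G (e2pi (tau / h%:C))].

Definition meromorphic_on_curve (Gamma : set 'M[R]_2)
    (F : modular_curve Gamma -> option R[i]) : Prop :=
  (forall p, upper_half_plane p -> meromorphic_inner F p) /\
  (forall sigma, SL2R sigma -> cusp Gamma (mobius_bdry sigma None) ->
     meromorphic_cusp F sigma).

Definition modular_function (f : R[i] -> option R[i]) : Prop :=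
  (forall tau, upper_half_plane tau -> meromorphic_at f tau) /\
  exists Gamma : set 'M[R]_2,
    [/\ subgroup_SL2R Gamma, commensurable_SL2Z Gamma
      & exists2 F : modular_curve Gamma -> option R[i],
          meromorphic_on_curve F
        & forall (tau : R[i]) (htau : hstar Gamma (Inner tau)),
            f tau = F (modular_proj htau)].

Definition is_periodic (f : R[i] -> option R[i]) (h : nat) : Prop :=
  forall tau, upper_half_plane tau -> f (tau + h%:R) = f tau.

Definition is_period (f : R[i] -> option R[i]) (h : nat) : Prop :=
  [/\ (0 < h)%N, is_periodic f h
    & forall k : nat, (0 < k)%N -> is_periodic f k -> (h <= k)%N].

(** f(tau) is the sum over all integers n of a_n exp (2 pi i n tau / h). *)
Definition fourier_expansion (f : R[i] -> option R[i]) (h : nat)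
    (a : int -> R[i]) : Prop :=
  (exists N : nat, forall n : nat, (N <= n)%N -> a (- n%:Z) = 0) /\
  exists2 M : R, 0 < M &
    forall tau : R[i], M < complex.Im tau ->
    exists2 w : R[i], f tau = Some w &
      (fun m : nat =>
         (zsum m (fun n => a n * e2pi (n%:~R / h%:R * tau))) : R[i]^o) @ \oo
        --> (w : R[i]^o).

End ModularCurve.

Definition irreducible_elt (A : idomainType) (p : A) : Prop :=
  [/\ p != 0, p \isn't a GRing.unit
    & forall q r : A, p = q * r ->
        q \is a GRing.unit \/ r \is a GRing.unit].

(** In [{poly {poly R[i]}}] the outer variable is X and the inner one is Y, as
    in the notation [Phi.[x, y]]. *)
Definition defined_over (R : realType) (f : R[i] -> option R[i])
    (K : {pred R[i]}) : Prop :=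
  exists Phi : {poly {poly R[i]}},
    [/\ forall i k : nat, Phi`_i`_k \in K, irreducible_elt Phi
      & forall (tau w : R[i]), upper_half_plane tau -> f tau = Some w ->
          Phi.[jinv tau, w] = 0].

(* Main.v *)
Require Import Defs.
From HB Require Import structures.
From mathcomp Require Import all_boot all_order all_algebra.
From mathcomp Require Import complex.
From mathcomp Require Import all_classical all_reals all_analysis.
From mathcomp Require Import ring lra zify.

Set Implicit Arguments.
Unset Strict Implicit.
Unset Printing Implicit Defensive.

Import Order.TTheory GRing.Theory Num.Theory.
Import numFieldNormedType.Exports.

Local Open Scope classical_set_scope.
Local Open Scope ring_scope.
Local Open Scope complex_scope.


(** The functions f and j satisfy some polynomial equation over the complex numbers. Their
    expansions at i oo turn its coefficients into a solution of linear equations over K, and a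
    complex solution can be replaced by one in K without spoiling irreducibility.

    Existence of an equation ([algebraic_relation]). Commensurability leaves only finitely many
    functions among the translates f(g tau), g in SL(2,Z), all periodic with at most a pole at i oo
    ([modular_translates]); a nonzero polynomial factor D(j) makes them holomorphic on the
    half-plane ([clear_poles_holoH]). Counting dimensions, some nontrivial combination of the
    monomials j^a (D(j) f)^b vanishes to a prescribed order at i oo together with all its
    translates. Every orbit meets the strip |Re| <= 1/2, Im >= 0.86, and there Schwarz' lemma in the
    parameter w = exp(2 pi i z / h) halves any bound valid for the whole family; so the combination
    is zero ([shrinking_eq0]).

    Irreducibility ([minimal_irreducible]). Among all relations take P of least degree in X and then
    with leading coefficient of least degree in Y. Holomorphic periodic functions on the half-plane
    with at most a pole at i oo form an integral domain ([periodic_integral]), so if P is a product,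
    one factor is again a relation and minimality makes the other a constant.

    Rationality ([relation_over_K]). The expansion of j has coefficients in every subfield
    ([asy_jinv]) and that of f has coefficients in K ([asy_fourier]), so P(j, f) = 0 amounts to a
    system of K-linear equations between the coefficients of P. A K-linear projection of their span
    onto K that sends the leading one to 1 ([rational_specialization]) preserves these equations; it
    yields a relation over K with the same degrees, hence minimal, hence irreducible over the
    complex numbers.

    The analysis rests on Goursat's theorem. Cauchy's formula along one period of a horizontal line
    ([cauchy_line]) gives Schwarz' lemma, expansions at i oo and Weierstrass' theorem. The
    expansions of the Eisenstein series come from Lipschitz' formula, proved by Herglotz' trick, and
    the discriminant has no zero because an explicit estimate for small q applies in the strip. *)

(** * Real-valued modulus of a complex number *)

Section ComplexModulus.
Variable R : realType.
Local Notation C := R[i].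
Implicit Types (z u v : C) (x y e : R).

(** The norm on [R[i]] takes its values in [R[i]]; a modulus with values in [R] brings estimates
    within reach of real linear arithmetic. *)
Definition cn z : R := Num.sqrt (complex.Re z ^+ 2 + complex.Im z ^+ 2).

Lemma cnE z : `|z| = (cn z)%:C.
Proof. by rewrite normc_def. Qed.

Lemma cn_ge0 z : 0 <= cn z.
Proof. exact: sqrtr_ge0. Qed.

Lemma cn0 : cn 0 = 0.
Proof. by apply: (@complexI R); rewrite -cnE normr0. Qed.

Lemma cn1 : cn 1 = 1.
Proof. by apply: (@complexI R); rewrite -cnE normr1. Qed.

Lemma cn_eq0 z : (cn z == 0) = (z == 0).
Proof. by rewrite -(inj_eq (@complexI R)) -cnE normr_eq0. Qed.

Lemma cn_gt0 z : (0 < cn z) = (z != 0).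
Proof. by rewrite lt_def cn_ge0 andbT cn_eq0. Qed.

Lemma cnM z u : cn (z * u) = cn z * cn u.
Proof. by apply: (@complexI R); rewrite -cnE normrM !cnE -rmorphM. Qed.

Lemma cnN z : cn (- z) = cn z.
Proof. by apply: (@complexI R); rewrite -!cnE normrN. Qed.

Lemma cnBC z u : cn (z - u) = cn (u - z).
Proof. by rewrite -cnN opprB. Qed.

Lemma cnV z : cn z^-1 = (cn z)^-1.
Proof. by apply: (@complexI R); rewrite -cnE normfV cnE fmorphV. Qed.

Lemma cnX z n : cn (z ^+ n) = cn z ^+ n.
Proof. by apply: (@complexI R); rewrite -cnE normrX cnE rmorphXn. Qed.

Lemma cnf z u : cn (z / u) = cn z / cn u.
Proof. by rewrite cnM cnV. Qed.

Lemma cnD z u : cn (z + u) <= cn z + cn u.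
Proof. by rewrite -lecR rmorphD/= -!cnE ler_normD. Qed.

Lemma cnB z u : cn (z - u) <= cn z + cn u.
Proof. by rewrite -(cnN u) cnD. Qed.

Lemma cnD3 z u v : cn (z - v) <= cn (z - u) + cn (u - v).
Proof. by apply: le_trans (cnD _ _); rewrite [in leRHS]addrA subrK. Qed.

Lemma cn_sub_ge z u : cn z - cn u <= cn (z - u).
Proof. by rewrite lerBlDr -{1}(subrK u z) cnD. Qed.

Lemma cn_real x : cn x%:C = `|x|.
Proof. by rewrite /cn/= expr0n/= addr0 sqrtr_sqr. Qed.

Lemma cn_nat n : cn n%:R = n%:R.
Proof. by have := cn_real n%:R; rewrite rmorph_nat => ->; rewrite normr_nat. Qed.

Lemma cn_i : cn 'i = 1.
Proof. by rewrite /cn/= expr0n/= add0r sqrtr_sqr normr1. Qed.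

Lemma cn_Re z : `|complex.Re z| <= cn z.
Proof. by rewrite /cn -sqrtr_sqr ler_wsqrtr// lerDl sqr_ge0. Qed.

Lemma cn_Im z : `|complex.Im z| <= cn z.
Proof. by rewrite /cn -sqrtr_sqr ler_wsqrtr// lerDr sqr_ge0. Qed.

Lemma cn_ReIm z : cn z <= `|complex.Re z| + `|complex.Im z|.
Proof.
rewrite [in leLHS](complexE z); apply: le_trans (cnD _ _) _.
by rewrite cnM cn_i mul1r !cn_real.
Qed.

Lemma cn_sqr z : cn z ^+ 2 = complex.Re z ^+ 2 + complex.Im z ^+ 2.
Proof. by rewrite sqr_sqrtr// addr_ge0// sqr_ge0. Qed.

Lemma cn_sum (I : Type) (r : seq I) (P : pred I) (F : I -> C) :
  cn (\sum_(i <- r | P i) F i) <= \sum_(i <- r | P i) cn (F i).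
Proof.
elim/big_rec2: _ => [|i y1 y2 _ h]; first by rewrite cn0.
by apply: le_trans (cnD _ _) _; rewrite lerD2l.
Qed.

Lemma cn_prod (I : Type) (r : seq I) (P : pred I) (F : I -> C) :
  cn (\prod_(i <- r | P i) F i) = \prod_(i <- r | P i) cn (F i).
Proof. by elim/big_rec2: _ => [|i y1 y2 _ <-]; rewrite ?cn1 ?cnM. Qed.

(** The constant k is fixed before e, so any crude multiple of a small quantity will do. Most
    vanishing statements below end this way. *)
Lemma cn_le_small z (k : R) : (forall e, 0 < e -> cn z <= k * e) -> z = 0.
Proof.
move=> h; apply/eqP; rewrite -cn_eq0; apply/negPn/negP => h0.
have z0 : 0 < cn z by rewrite lt_def h0 cn_ge0.
have k1 : 0 < `|k| + 1 by rewrite ltr_wpDl.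
have := h (cn z / (2 * (`|k| + 1))) (divr_gt0 z0 (mulr_gt0 (@ltr0n R 2) k1)).
have : k <= `|k| + 1 by rewrite (le_trans (ler_norm _))// lerDl.
move=> kk; suff : k * (cn z / (2 * (`|k| + 1))) < cn z by lra.
apply: (@le_lt_trans _ _ ((`|k| + 1) * (cn z / (2 * (`|k| + 1))))).
  by rewrite ler_wpM2r// divr_ge0 ?cn_ge0// mulr_ge0// ltW.
rewrite [X in X < _](_ : _ = cn z / 2); last by field; rewrite gt_eqF.
lra.
Qed.

Lemma cplx_eq z u : complex.Re z = complex.Re u -> complex.Im z = complex.Im u -> z = u.
Proof. by case: z; case: u => a b c d /= -> ->. Qed.

Lemma ReD z u : complex.Re (z + u) = complex.Re z + complex.Re u.
Proof. by case: z; case: u. Qed.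
Lemma ImD z u : complex.Im (z + u) = complex.Im z + complex.Im u.
Proof. by case: z; case: u. Qed.
Lemma ReN z : complex.Re (- z) = - complex.Re z.
Proof. by case: z. Qed.
Lemma ImN z : complex.Im (- z) = - complex.Im z.
Proof. by case: z. Qed.
Lemma ReM z u : complex.Re (z * u) =
  complex.Re z * complex.Re u - complex.Im z * complex.Im u.
Proof. by case: z; case: u. Qed.
Lemma ImM z u : complex.Im (z * u) =
  complex.Re z * complex.Im u + complex.Im z * complex.Re u.
Proof. by case: z; case: u. Qed.
Lemma Re_nat n : complex.Re (n%:R : C) = n%:R.
Proof. by rewrite -(rmorph_nat (real_complex R)). Qed.
Lemma Im_nat n : complex.Im (n%:R : C) = 0.
Proof. by rewrite -(rmorph_nat (real_complex R)). Qed.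
Lemma Re1 : complex.Re (1 : C) = 1. Proof. by []. Qed.
Lemma Im1 : complex.Im (1 : C) = 0. Proof. by []. Qed.

End ComplexModulus.

(** * Complex derivatives and limits with real tolerances *)

Section ComplexDerivative.
Variable R : realType.
Local Notation C := R[i].
Implicit Types (z u v d : C) (x y e : R) (F G : C -> C).

(** A first-order estimate instead of a limit of quotients: it makes sense at u = z as well, and its
    tolerances are real. [derivable_holo] connects it with the derivative of the library. *)
Definition hasder F z d := forall e, 0 < e -> exists2 r : R, 0 < r &
  forall u, cn (u - z) < r -> cn (F u - F z - d * (u - z)) <= e * cn (u - z).

Definition ccont F z := forall e, 0 < e -> exists2 r : R, 0 < r &
  forall u, cn (u - z) < r -> cn (F u - F z) <= e.

Definition holo F z := exists d, hasder F z d.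

Definition nearC z (P : C -> Prop) := exists2 r : R, 0 < r & forall u, cn (u - z) < r -> P u.

Lemma nearC_self z P : nearC z P -> P z.
Proof. by case=> r r0; apply; rewrite subrr cn0. Qed.

Lemma nearC_and z P Q : nearC z P -> nearC z Q -> nearC z (fun u => P u /\ Q u).
Proof.
move=> [r r0 hr] [s s0 hs]; exists (Num.min r s); first by rewrite lt_min r0.
by move=> u; rewrite lt_min => /andP[/hr ? /hs].
Qed.

Lemma nearC_imp z (P Q : C -> Prop) : (forall u, P u -> Q u) -> nearC z P -> nearC z Q.
Proof. by move=> h [r r0 hr]; exists r => // u /hr /h. Qed.

Lemma hasder_lip F z d : hasder F z d ->
  exists2 r : R, 0 < r & forall u, cn (u - z) < r -> cn (F u - F z) <= (cn d + 1) * cn (u - z).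
Proof.
move=> /(_ 1 ltr01)[r r0 hr]; exists r => // u /hr.
rewrite mul1r mulrDl mul1r -cnM => h.
have := cnD (F u - F z - d * (u - z)) (d * (u - z)); rewrite subrK; lra.
Qed.

Lemma hasder_cont F z d : hasder F z d -> ccont F z.
Proof.
move=> /hasder_lip[r r0 hr] e e0.
have d1 : 0 < cn d + 1 by have := cn_ge0 d; lra.
exists (Num.min r (e / (cn d + 1))); first by rewrite lt_min r0 divr_gt0.
move=> u; rewrite lt_min => /andP[/hr h]; rewrite ltr_pdivlMr// mulrC => h2.
exact/ltW/(le_lt_trans h).
Qed.

Lemma holo_cont F z : holo F z -> ccont F z.
Proof. by case=> d /hasder_cont. Qed.

Lemma hasder_near F G z d : nearC z (fun u => F u = G u) -> hasder F z d -> hasder G z d.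
Proof.
move=> FG hF e /hF[r r0 hr]; have h0 := nearC_self FG.
case: FG => s s0 hs; exists (Num.min r s); first by rewrite lt_min r0.
by move=> u; rewrite lt_min => /andP[/hr h /hs <-]; rewrite -h0.
Qed.

Lemma holo_near F G z : nearC z (fun u => F u = G u) -> holo F z -> holo G z.
Proof. by move=> h [d hd]; exists d; exact: hasder_near hd. Qed.

Lemma hasder_cst c z : hasder (fun=> c) z 0.
Proof. by move=> e e0; exists 1 => // u _; rewrite mul0r !subrr cn0 mulr_ge0 ?cn_ge0// ltW. Qed.

Lemma hasder_id z : hasder id z 1.
Proof. by move=> e e0; exists 1 => // u _; rewrite mul1r subrr cn0 mulr_ge0 ?cn_ge0// ltW. Qed.

Lemma hasder_add F G z d d' : hasder F z d -> hasder G z d' ->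
  hasder (fun u => F u + G u) z (d + d').
Proof.
move=> hF hG e e0; have e2 : 0 < e / 2 by rewrite divr_gt0.
have [r r0 hr] := hF _ e2; have [s s0 hs] := hG _ e2.
exists (Num.min r s); first by rewrite lt_min r0.
move=> u; rewrite lt_min => /andP[/hr h1 /hs h2].
rewrite [X in cn X](_ : _ = (F u - F z - d * (u - z)) + (G u - G z - d' * (u - z))); last by ring.
apply: le_trans (cnD _ _) _; lra.
Qed.

Lemma hasder_comp F G z d d' : hasder F z d -> hasder G (F z) d' ->
  hasder (fun u => G (F u)) z (d' * d).
Proof.
move=> hF hG e e0; have [l l0 hl] := hasder_lip hF.
set M := cn d + 1; have M0 : 0 < M by have := cn_ge0 d; rewrite /M; lra.
have e1 : 0 < e / (2 * M) by rewrite divr_gt0// mulr_gt0.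
have [s s0 hs] := hG _ e1.
have N0 : 0 < cn d' + 1 by have := cn_ge0 d'; lra.
have e2 : 0 < e / (2 * (cn d' + 1)) by rewrite divr_gt0// mulr_gt0.
have [r r0 hr] := hF _ e2.
exists (Num.min l (Num.min r (s / M))); first by rewrite !lt_min l0 r0 divr_gt0.
move=> u; rewrite !lt_min => /and3P[/hl h1 /hr h2]; rewrite ltr_pdivlMr// => h3.
have /hs h4 : cn (F u - F z) < s by apply: le_lt_trans h1 _; rewrite mulrC.
rewrite [X in cn X](_ : _ = (G (F u) - G (F z) - d' * (F u - F z)) +
   d' * (F u - F z - d * (u - z))); last by ring.
apply: le_trans (cnD _ _) _; rewrite cnM.
have a1 : e / (2 * M) * cn (F u - F z) <= e / 2 * cn (u - z).
  apply: (@le_trans _ _ (e / (2 * M) * (M * cn (u - z)))).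
    by rewrite ler_wpM2l// ltW.
  by rewrite le_eqVlt; apply/orP; left; apply/eqP; field; rewrite gt_eqF.
have a2 : cn d' * cn (F u - F z - d * (u - z)) <= e / 2 * cn (u - z).
  apply: (@le_trans _ _ ((cn d' + 1) * (e / (2 * (cn d' + 1)) * cn (u - z)))).
    by apply: ler_pM => //; rewrite ?cn_ge0//; lra.
  by rewrite le_eqVlt; apply/orP; left; apply/eqP; field; rewrite gt_eqF.
lra.
Qed.

Lemma hasder_sqr z : hasder (fun u => u ^+ 2) z (2 * z).
Proof.
move=> e e0; exists e => // u h.
rewrite [X in cn X](_ : _ = (u - z) * (u - z)); last by ring.
by rewrite cnM ler_wpM2r ?cn_ge0// ltW.
Qed.

Lemma hasder_scale a F z d : hasder F z d -> hasder (fun u => a * F u) z (a * d).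
Proof.
move=> hF; apply: (@hasder_comp F (fun u => a * u)) => // e e0; exists 1 => // u _.
by rewrite mulrBr subrr cn0 mulr_ge0 ?cn_ge0 ?ltW.
Qed.

Lemma hasder_eq F z d d' : d = d' -> hasder F z d -> hasder F z d'.
Proof. by move=> ->. Qed.

Lemma hasder_ext F G z d : F =1 G -> hasder F z d -> hasder G z d.
Proof. by move=> /funext ->. Qed.

(* FG = ((F + G)^2 - (F - G)^2) / 4 *)
Lemma hasder_mul F G z d d' : hasder F z d -> hasder G z d' ->
  hasder (fun u => F u * G u) z (d * G z + F z * d').
Proof.
move=> hF hG.
have hp := hasder_add hF hG; have hm := hasder_add hF (hasder_scale (-1) hG).
have hp2 := hasder_comp hp (hasder_sqr _); have hm2 := hasder_comp hm (hasder_sqr _).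
have := hasder_add (hasder_scale (4^-1) hp2) (hasder_scale (- 4^-1) hm2).
move=> H; apply: (hasder_ext (F := _)); last apply: (hasder_eq (d := _)); last exact: H.
  by move=> u /=; field.
by move=> /=; field.
Qed.

Lemma hasder_inv z : z != 0 -> hasder (fun u => u^-1) z (- (z ^- 2)).
Proof.
move=> z0 e e0; have nz : 0 < cn z by rewrite cn_gt0.
exists (Num.min (cn z / 2) (e * cn z ^+ 3 / 2)).
  by rewrite lt_min !divr_gt0// mulr_gt0// exprn_gt0.
move=> u; rewrite lt_min => /andP[h1 h2].
have uz : cn z / 2 <= cn u by have := cn_sub_ge z u; rewrite cnBC; lra.
have u0 : u != 0 by rewrite -cn_gt0; lra.
rewrite [X in cn X](_ : _ = (u - z) * ((u - z) / (u * z ^+ 2))); last first.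
  by field; rewrite u0 z0.
rewrite cnM [leLHS]mulrC ler_wpM2r ?cn_ge0//.
have nu : 0 < cn u by rewrite cn_gt0.
rewrite cnf cnM cnX ler_pdivrMr ?mulr_gt0 ?exprn_gt0//.
apply: (le_trans (ltW h2)).
rewrite [leLHS](_ : _ = e * (cn z / 2 * cn z ^+ 2)); last by ring.
by rewrite ler_pM2l// ler_pM2r ?exprn_gt0.
Qed.

Lemma holo_cst c z : holo (fun=> c) z.
Proof. by exists 0; exact: hasder_cst. Qed.
Lemma holo_id z : holo id z.
Proof. by exists 1; exact: hasder_id. Qed.
Lemma holo_add F G z : holo F z -> holo G z -> holo (fun u => F u + G u) z.
Proof. by move=> [d hd] [d' hd']; eexists; exact: hasder_add hd hd'. Qed.
Lemma holo_mul F G z : holo F z -> holo G z -> holo (fun u => F u * G u) z.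
Proof. by move=> [d hd] [d' hd']; eexists; exact: hasder_mul hd hd'. Qed.
Lemma holo_opp F z : holo F z -> holo (fun u => - F u) z.
Proof.
move=> hF; have := holo_mul (holo_cst (-1) z) hF.
by apply: holo_near; exists 1 => // u _; rewrite mulN1r.
Qed.
Lemma holo_sub F G z : holo F z -> holo G z -> holo (fun u => F u - G u) z.
Proof. by move=> hF hG; exact: holo_add hF (holo_opp hG). Qed.
Lemma holo_comp F G z : holo F z -> holo G (F z) -> holo (fun u => G (F u)) z.
Proof. by move=> [d hd] [d' hd']; eexists; exact: hasder_comp hd hd'. Qed.
Lemma holo_inv F z : holo F z -> F z != 0 -> holo (fun u => (F u)^-1) z.
Proof. by move=> hF h0; apply: (@holo_comp F (fun u => u^-1)) => //; eexists; exact: hasder_inv. Qed.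
Lemma holo_div F G z : holo F z -> holo G z -> G z != 0 -> holo (fun u => F u / G u) z.
Proof. by move=> hF hG h0; apply: holo_mul => //; exact: holo_inv. Qed.
Lemma holo_exp F z n : holo F z -> holo (fun u => F u ^+ n) z.
Proof.
move=> hF; elim: n => [|n ih].
  by have := holo_cst 1 z; apply: holo_near; exists 1 => // u _; rewrite expr0.
by have := holo_mul hF ih; apply: holo_near; exists 1 => // u _; rewrite exprS.
Qed.
Lemma holo_sum (I : Type) (r : seq I) (F : I -> C -> C) z :
  (forall i, holo (F i) z) -> holo (fun u => \sum_(i <- r) F i u) z.
Proof.
move=> h; elim: r => [|i r ih].
  by have := holo_cst 0 z; apply: holo_near; exists 1 => // u _; rewrite big_nil.
by have := holo_add (h i) ih; apply: holo_near; exists 1 => // u _; rewrite big_cons.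
Qed.
Lemma holo_prod (I : Type) (r : seq I) (F : I -> C -> C) z :
  (forall i, holo (F i) z) -> holo (fun u => \prod_(i <- r) F i u) z.
Proof.
move=> h; elim: r => [|i r ih].
  by have := holo_cst 1 z; apply: holo_near; exists 1 => // u _; rewrite big_nil.
by have := holo_mul (h i) ih; apply: holo_near; exists 1 => // u _; rewrite big_cons.
Qed.

Lemma holo_horner (p : {poly C}) F z : holo F z -> holo (fun u => p.[F u]) z.
Proof.
move=> hF; have : holo (fun u => \sum_(i < size p) p`_i * F u ^+ i) z.
  apply: (@holo_sum _ (index_enum _) (fun (i : 'I_(size p)) u => p`_i * F u ^+ i)) => i.
  by apply: holo_mul; [exact: holo_cst|exact: holo_exp].
by apply: holo_near; exists 1 => // u _; rewrite horner_coef.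
Qed.

Lemma ccont_comp F G z : ccont F z -> ccont G (F z) -> ccont (fun u => G (F u)) z.
Proof.
move=> hF hG e /hG[s s0 hs]; have [r r0 hr] := hF (s / 2) (divr_gt0 s0 (@ltr0n R 2)).
exists r => // u /hr h; apply: hs; lra.
Qed.

Lemma ccont_neq F z c : ccont F z -> F z != c -> nearC z (fun u => F u != c).
Proof.
move=> hF; rewrite -subr_eq0 -cn_gt0 => h0.
have [r r0 hr] := hF _ (divr_gt0 h0 (@ltr0n R 2)); exists r => // u /hr h.
apply/eqP => hu; move: h; rewrite hu cnBC; lra.
Qed.

Lemma near_nearC z (P : C -> Prop) : (\forall u \near (z : R[i]^o), P u) <-> nearC z P.
Proof.
split.
  move=> /nbhs_ballP[e /= e0 he].
  (* In the order of [R[i]], a positive radius has imaginary part 0. *)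
  have ec : e = (complex.Re e)%:C by move: e0; rewrite ltcE/= => /andP[/eqP ? _]; exact: cplx_eq.
  exists (complex.Re e); first by rewrite -ltcR -ec.
  by move=> u hu; apply: he; rewrite -ball_normE/= ec cnE ltcR cnBC.
move=> [r r0 hr]; apply/nbhs_ballP; exists r%:C => /=; first by rewrite ltcR.
by move=> u; rewrite -ball_normE/= cnE ltcR cnBC => /hr.
Qed.

Lemma derivable_holo F z : derivable (F : R[i]^o -> R[i]^o) z 1 -> holo F z.
Proof.
move=> /cvg_ex[d /cvgrPdist_le /= hd]; exists d => e e0.
have e0c : 0 < e%:C :> C by rewrite ltcR.
have /nbhs_ballP[s /= s0 hs] := hd _ e0c.
have ec : s = (complex.Re s)%:C by move: s0; rewrite ltcE/= => /andP[/eqP ? _]; exact: cplx_eq.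
exists (complex.Re s); first by rewrite -ltcR -ec.
move=> u hu; have [->|uz] := eqVneq u z; first by rewrite !subrr mulr0 subr0 cn0 mulr0.
have := hs (u - z); rewrite -ball_normE/= sub0r normrN cnE ec ltcR => /(_ hu).
rewrite subr_eq0 => /(_ uz).
have nz : 0 < cn (u - z) by rewrite cn_gt0 subr_eq0.
rewrite cnE lecR [_%:A]mulr1 subrK -[_ *: _]/((u - z)^-1 * (F u - F z)) => h.
rewrite [X in cn X](_ : _ = - ((u - z) * (d - (u - z)^-1 * (F u - F z)))); last first.
  by field; rewrite subr_eq0.
by rewrite cnN cnM [leLHS]mulrC ler_wpM2r ?cn_ge0.
Qed.

Definition seqlim (u : nat -> C) (l : C) := forall e : R, 0 < e -> exists N : nat,
  forall n, (N <= n)%N -> cn (u n - l) <= e.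

Lemma cvg_seqlim (u : nat -> C) l : (u : nat -> R[i]^o) @ \oo --> (l : R[i]^o) <-> seqlim u l.
Proof.
split.
  move=> /cvgrPdist_le h e e0.
  have e0c : 0 < e%:C :> C by rewrite ltcR.
  have [N _ hN] := h _ e0c; exists N => n Nn.
  by have := hN n Nn; rewrite /= cnE lecR cnBC.
move=> h; apply/cvgrPdist_le => e e0.
have ec : e = (complex.Re e)%:C by move: e0; rewrite ltcE/= => /andP[/eqP ? _]; exact: cplx_eq.
have : 0 < complex.Re e by rewrite -ltcR -ec.
move=> /h[N hN]; exists N => // n /= Nn; rewrite cnE ec lecR cnBC.
exact: hN.
Qed.

Lemma seqlim_uniq (u : nat -> C) l l' : seqlim u l -> seqlim u l' -> l = l'.
Proof.
move=> h h'; apply/eqP; rewrite -subr_eq0; apply/eqP.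
apply: (@cn_le_small _ _ 2) => e e0; have [N hN] := h _ e0; have [N' hN'] := h' _ e0.
have := hN (N + N')%N (leq_addr _ _); have := hN' (N + N')%N (leq_addl _ _).
move=> h1 h2; apply: le_trans (cnD3 _ (u (N + N')%N) _) _; rewrite cnBC; lra.
Qed.

Lemma lim_seqlim (u : nat -> C) l : seqlim u l -> lim ((u : nat -> R[i]^o) @ \oo) = l.
Proof. by move=> /cvg_seqlim h; apply/cvg_lim => //; exact: norm_hausdorff. Qed.

End ComplexDerivative.

(** * Bisection and Cousin's lemma *)

Section Bisection.
Variable R : realType.
Implicit Types (a b c d x y e : R).

Lemma half_pow_small x e : 0 < e -> exists n : nat, x / 2 ^+ n < e.
Proof.
move=> e0; exists (Num.bound `|x / e|).+1.
have h : x / e < (Num.bound `|x / e|)%:R.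
  by apply: le_lt_trans (ler_norm _) _; exact: archi_boundP.
rewrite ltr_pdivrMr ?exprn_gt0//.
move: h; rewrite ltr_pdivrMr// => /lt_trans; apply.
rewrite mulrC ltr_pM2l// -natrX ltr_nat.
by apply: ltn_trans (ltn_expl _ (isT : (1 < 2)%N)) _; rewrite ltn_exp2l.
Qed.

(** Selects a quarter on which P fails. The fourth one is taken without a test: if P holds on the
    other three and fails on the whole, it has to fail there. *)
Definition quadrant (P : R -> R -> R -> R -> Prop) (q : R * R * R * R) : R * R * R * R :=
  let: (a, b, c, d) := q in
  let m := (a + b) / 2 in let n := (c + d) / 2 in
  if ~~ `[< P a m c n >] then (a, m, c, n) else
  if ~~ `[< P m b c n >] then (m, b, c, n) else
  if ~~ `[< P a m n d >] then (a, m, n, d) else (m, b, n, d).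

Lemma sup_between (u v : nat -> R) : (forall n m, u n <= v m) ->
  exists x, forall n, u n <= x <= v n.
Proof.
move=> uv; exists (sup (range u)) => n; apply/andP; split.
  apply: ub_le_sup; last by exists n.
  by exists (v 0%N) => _ [m _ <-].
apply: sup_le_ub; first by exists (u 0%N), 0%N.
by move=> _ [m _ <-].
Qed.

(** Compactness in inductive form. If P failed, repeated quartering would give nested rectangles on
    which P fails; they shrink to a point (x, y), where the local hypothesis eventually contradicts
    this. *)
Lemma cousin2 (P : R -> R -> R -> R -> Prop) a b c d : a <= b -> c <= d ->
  (forall a' b' c' d', a <= a' -> a' <= b' -> b' <= b -> c <= c' -> c' <= d' -> d' <= d ->
    P a' ((a' + b') / 2) c' ((c' + d') / 2) -> P ((a' + b') / 2) b' c' ((c' + d') / 2) ->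
    P a' ((a' + b') / 2) ((c' + d') / 2) d' -> P ((a' + b') / 2) b' ((c' + d') / 2) d' ->
    P a' b' c' d') ->
  (forall x y, a <= x <= b -> c <= y <= d -> exists2 e, 0 < e &
    forall a' b' c' d', a <= a' -> a' <= x <= b' -> b' <= b -> c <= c' -> c' <= y <= d' -> d' <= d ->
      b' - a' < e -> d' - c' < e -> P a' b' c' d') ->
  P a b c d.
Proof.
move=> ab cd hq hl; apply: contrapT => hP.
pose q n := iter n (quadrant P) (a, b, c, d).
pose A n := (q n).1.1.1; pose B n := (q n).1.1.2; pose Cc n := (q n).1.2; pose D n := (q n).2.
have inv n : [/\ a <= A n, A n <= B n & B n <= b] /\ [/\ c <= Cc n, Cc n <= D n & D n <= d] /\
   ~ P (A n) (B n) (Cc n) (D n) /\ B n - A n = (b - a) / 2 ^+ n /\ D n - Cc n = (d - c) / 2 ^+ n.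
  elim: n => [|n]; first by rewrite /A /B /Cc /D /= !divr1.
  rewrite /A /B /Cc /D /q iterS; set s := iter n _ _; case: s => [[[a' b'] c'] d'] /=.
  move=> [[h1 h2 h3] [[h4 h5 h6] [h7 [h8 h9]]]].
  have E (z : R) n' : z / 2 ^+ n'.+1 = z / 2 ^+ n' / 2 by rewrite exprSr invfM mulrA.
  rewrite !E -h8 -h9.
  case: asboolP => /= h10; last by repeat split => //; lra.
  case: asboolP => /= h11; last by repeat split => //; lra.
  case: asboolP => /= h12; last by repeat split => //; lra.
  repeat split; try lra.
  by move=> h13; apply: h7; exact: hq.
have mono n : A n <= A n.+1 /\ B n.+1 <= B n /\ Cc n <= Cc n.+1 /\ D n.+1 <= D n.
  have := inv n; rewrite /A /B /Cc /D /q iterS; set s := iter n _ _.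
  case: s => [[[a' b'] c'] d'] /= [[h1 h2 h3] [[h4 h5 h6] _]].
  case: asboolP => /= _; last by lra.
  case: asboolP => /= _; last by lra.
  case: asboolP => /= _; last by lra.
  lra.
have iA : {homo A : m n / (m <= n)%N >-> m <= n}.
  by apply: homo_leq => // [x y z h1 h2|n]; [exact: le_trans h1 h2|have [] := mono n].
have iC : {homo Cc : m n / (m <= n)%N >-> m <= n}.
  by apply: homo_leq => // [x y z h1 h2|n]; [exact: le_trans h1 h2|have [_ [_ []]] := mono n].
have iB : {homo B : m n / (m <= n)%N >-> n <= m}.
  by apply: homo_leq => // [x y z h1 h2|n]; [exact: le_trans h2 h1|have [_ []] := mono n].
have iD : {homo D : m n / (m <= n)%N >-> n <= m}.
  by apply: homo_leq => // [x y z h1 h2|n]; [exact: le_trans h2 h1|have [_ [_ []]] := mono n].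
have [x hx] : exists x, forall n, A n <= x <= B n.
  apply: sup_between => n m; have [[_ h _] _] := inv (n + m)%N.
  have := iA _ _ (leq_addr m n); have := iB _ _ (leq_addl n m); lra.
have [y hy] : exists y, forall n, Cc n <= y <= D n.
  apply: sup_between => n m; have [_ [[_ h _] _]] := inv (n + m)%N.
  have := iC _ _ (leq_addr m n); have := iD _ _ (leq_addl n m); lra.
have [e e0 he] := hl x y (hx 0%N) (hy 0%N).
have [n hn] := half_pow_small (Num.max (b - a) (d - c)) e0.
have [[h1 h2 h3] [[h4 h5 h6] [h7 [h8 h9]]]] := inv n.
apply: h7; apply: he => //.
  rewrite h8; apply: le_lt_trans hn; rewrite ler_wpM2r ?invr_ge0 ?exprn_ge0//.
  by rewrite le_max lexx.
rewrite h9; apply: le_lt_trans hn; rewrite ler_wpM2r ?invr_ge0 ?exprn_ge0//.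
by rewrite le_max lexx orbT.
Qed.

(** The case of rectangles of height zero. *)
Lemma cousin1 (P : R -> R -> Prop) a b : a <= b ->
  (forall a' m b', a <= a' -> a' <= m -> m <= b' -> b' <= b -> P a' m -> P m b' -> P a' b') ->
  (forall x, a <= x <= b -> exists2 e, 0 < e &
    forall a' b', a <= a' -> a' <= x <= b' -> b' <= b -> b' - a' < e -> P a' b') ->
  P a b.
Proof.
move=> ab hq hl; apply: (@cousin2 (fun a' b' _ _ => P a' b') a b 0 0) => //.
  by move=> a' b' c' d' h1 h2 h3 _ _ _ p1 p2 _ _; apply: (hq _ ((a' + b') / 2)) => //; lra.
move=> x y xab _; have [e e0 he] := hl x xab; exists e => // a' b' c' d' h1 h2 h3 _ _ _ h4 _.
exact: he.
Qed.

End Bisection.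


(** * Integration of complex functions over a real interval *)

Section Integral.
Variable R : realType.
Local Notation C := R[i].
Implicit Types (a b c x y e t : R) (F G P Q : R -> C) (k : C).

(** The points y stay in [[a, b]], so the derivative is one-sided at the ends and primitives
    restrict to subintervals. *)
Definition prim a b F P := forall x, a <= x <= b -> forall e, 0 < e ->
  exists2 r, 0 < r & forall y, a <= y <= b -> `|y - x| < r ->
    cn (P y - P x - F x * (y - x)%:C) <= e * `|y - x|.

Definition contI a b F := forall x, a <= x <= b -> forall e, 0 < e ->
  exists2 r, 0 < r & forall y, a <= y <= b -> `|y - x| < r -> cn (F y - F x) <= e.

Lemma prim_sub a b a' b' F P : a <= a' -> b' <= b -> prim a b F P -> prim a' b' F P.
Proof.
move=> aa bb h x hx e e0; have [|r r0 hr] := h x _ e e0; first by lra.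
by exists r => // y hy; apply: hr; lra.
Qed.

Lemma contI_sub a b a' b' F : a <= a' -> b' <= b -> contI a b F -> contI a' b' F.
Proof.
move=> aa bb h x hx e e0; have [|r r0 hr] := h x _ e e0; first by lra.
by exists r => // y hy; apply: hr; lra.
Qed.

(** With slack e, differentiability gives the estimate on short intervals around each point; it is
    additive over adjacent intervals, so Cousin's lemma spreads it to [[a, b]]. It serves as mean
    value inequality, as uniqueness of primitives and as bound for integrals. *)
Lemma prim_bound a b F P M : a <= b -> prim a b F P ->
  (forall x, a <= x <= b -> cn (F x) <= M) -> cn (P b - P a) <= M * (b - a).
Proof.
move=> ab hP hM; suff H e : 0 < e -> cn (P b - P a) <= (M + e) * (b - a).
  apply/ler_addgt0Pl => e e0.
  have s0 : 0 < b - a + 1 by lra.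
  have := H _ (divr_gt0 e0 s0); rewrite mulrDl => h.
  suff : e / (b - a + 1) * (b - a) <= e by lra.
  by rewrite mulrAC -mulrA ger_pMr// ler_pdivrMr// mul1r; lra.
move=> e0; apply: (@cousin1 _ (fun u v => cn (P v - P u) <= (M + e) * (v - u))) => //.
  move=> u m v _ _ _ _ h1 h2; apply: le_trans (cnD3 _ (P m) _) _.
  apply: le_trans (lerD h2 h1) _; rewrite -mulrDr.
  by rewrite [X in _ * X](_ : _ = v - u)//; ring.
move=> x hx; have [r r0 hr] := hP x hx e e0; exists r => // u v h1 h2 h3 h4.
have pt y : a <= y <= b -> `|y - x| < r -> cn (P y - P x) <= (M + e) * `|y - x|.
  move=> hy hyx; have := hr _ hy hyx => hh.
  have := cnD (P y - P x - F x * (y - x)%:C) (F x * (y - x)%:C); rewrite subrK cnM cn_real.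
  have : cn (F x) * `|y - x| <= M * `|y - x| by rewrite ler_wpM2r// hM.
  rewrite mulrDl; lra.
apply: le_trans (cnD3 _ (P x) _) _.
have v1 : cn (P v - P x) <= (M + e) * (v - x).
  by have := pt v; rewrite ger0_norm ?subr_ge0; [apply; lra|lra].
have u1 : cn (P x - P u) <= (M + e) * (x - u).
  by rewrite cnBC; have := pt u; rewrite ler0_norm ?opprB ?subr_le0; [apply; lra|lra].
apply: le_trans (lerD v1 u1) _; rewrite -mulrDr.
by rewrite [X in _ * X](_ : _ = v - u)//; ring.
Qed.

Lemma prim_add a b F G P Q : prim a b F P -> prim a b G Q ->
  prim a b (fun x => F x + G x) (fun x => P x + Q x).
Proof.
move=> hP hQ x hx e e0; have e2 : 0 < e / 2 by rewrite divr_gt0.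
have [r r0 hr] := hP x hx _ e2; have [s s0 hs] := hQ x hx _ e2.
exists (Num.min r s); first by rewrite lt_min r0.
move=> y hy; rewrite lt_min => /andP[/(hr _ hy) h1 /(hs _ hy) h2].
rewrite [X in cn X](_ : _ = (P y - P x - F x * (y - x)%:C) + (Q y - Q x - G x * (y - x)%:C));
  last by ring.
apply: le_trans (cnD _ _) _; lra.
Qed.

Lemma prim_scale a b F P k : prim a b F P -> prim a b (fun x => k * F x) (fun x => k * P x).
Proof.
move=> hP x hx e e0; have k0 : 0 < cn k + 1 by have := cn_ge0 k; lra.
have [r r0 hr] := hP x hx _ (divr_gt0 e0 k0).
exists r => // y hy /(hr _ hy) h.
rewrite [X in cn X](_ : _ = k * (P y - P x - F x * (y - x)%:C)); last by ring.
rewrite cnM; apply: (@le_trans _ _ ((cn k + 1) * (e / (cn k + 1) * `|y - x|))).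
  by apply: ler_pM => //; rewrite ?cn_ge0//; lra.
by rewrite le_eqVlt; apply/orP; left; apply/eqP; field; rewrite gt_eqF.
Qed.

Lemma prim_eq a b F G P : (forall x, a <= x <= b -> F x = G x) -> prim a b F P -> prim a b G P.
Proof. by move=> FG hP x hx e e0; rewrite -FG//; exact: hP. Qed.

Lemma prim_uniq a b F P Q : a <= b -> prim a b F P -> prim a b F Q -> P b - P a = Q b - Q a.
Proof.
move=> ab hP hQ; apply/eqP; rewrite -subr_eq0; apply/eqP.
have h : prim a b (fun=> 0) (fun x => P x + -1 * Q x).
  by apply: prim_eq (prim_add hP (prim_scale (-1) hQ)) => x _; rewrite mulN1r subrr.
apply: (@cn_le_small _ _ 0) => e e0; rewrite mul0r.
have hb : cn (P b + -1 * Q b - (P a + -1 * Q a)) <= 0 * (b - a).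
  by apply: prim_bound h _ => // x _; rewrite cn0.
rewrite mul0r in hb; apply: le_trans hb.
by rewrite le_eqVlt; apply/orP; left; apply/eqP; congr cn; ring.
Qed.

(** The choice of primitive is immaterial by [prim_uniq]; the default 0 occurs only when there is no
    primitive. *)
Definition intg F a b : C := xget 0 [set v | exists2 P, prim a b F P & v = P b - P a].

Lemma intgE a b F P : a <= b -> prim a b F P -> intg F a b = P b - P a.
Proof.
move=> ab hP; rewrite /intg; case: xgetP => [v -> [Q hQ ->]|/(_ (P b - P a))].
  exact: prim_uniq hQ hP.
by case; exists P.
Qed.

(** Composition with this 1-Lipschitz retraction extends a continuous function on [[a, b]] to a
    continuous function on the line. *)
Let clamp a b x := Num.max a (Num.min b x).

Let clamp_in a b x : a <= b -> a <= clamp a b x <= b.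
Proof. by move=> ab; rewrite /clamp; rewrite le_max lexx/= ge_max ab ge_min lexx. Qed.

Let clamp_id a b x : a <= x <= b -> clamp a b x = x.
Proof. by move=> /andP[h1 h2]; rewrite /clamp min_r// max_r. Qed.

Let clamp_lip a b x y : a <= b -> `|clamp a b x - clamp a b y| <= `|x - y|.
Proof.
move=> ab; rewrite /clamp; have := ler_norm (x - y); have := ler_norm (y - x).
rewrite (distrC y x) => h1 h2; rewrite ler_norml.
rewrite /Num.max /Num.min /Order.max /Order.min.
by case: (ltP b x) => ?; case: (ltP b y) => ?; do 2?[case: (ltP a _) => ?]; lra.
Qed.

Let real_prim a b (g : R -> R) : a <= b -> continuous g ->
  exists p : R -> R, forall x, a <= x <= b -> forall e, 0 < e ->
  exists2 r, 0 < r & forall y, `|y - x| < r -> `|p y - p x - g x * (y - x)| <= e * `|y - x|.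
Proof.
move=> ab cg; pose mu := @lebesgue_measure R.
(* The margin of 1 on both sides puts [[a, b]] in the interior, where the fundamental theorem of
   calculus gives a two-sided derivative. *)
exists (fun y => \int[mu]_(t in [set` `[a - 1, y]]) (g t))%R => x hx e e0.
have ig : mu.-integrable `[a - 1, b + 1] (EFin \o g).
  apply: continuous_compact_integrable; first exact: segment_compact.
  by apply: continuous_subspaceT => z; exact: cg.
have [] := @continuous_FTC1_closed R g (a - 1) x (b + 1) _ ig _ (cg x); [lra|lra|].
set p := fun y : R => _.
move=> dp dpE.
have : h^-1 *: (p (h *: 1 + x) - p x) @[h --> 0^'] --> g x.
  by rewrite -dpE derive1E; exact: dp.
move=> /cvgrPdist_le /(_ _ e0) /nbhs_ballP[s /= s0 hs].
exists s => // y hy; have [->|yx] := eqVneq y x; first by rewrite !subrr mulr0 subr0 normr0 mulr0.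
have := hs (y - x); rewrite -ball_normE/= sub0r normrN => /(_ hy); rewrite subr_eq0 => /(_ yx).
rewrite [_%:A]mulr1 subrK => h.
rewrite [X in `|X|](_ : _ = - ((y - x) * (g x - (y - x)^-1 *: (p y - p x)))); last first.
  have key (D : R) : D - g x * (y - x) = - ((y - x) * (g x - (y - x)^-1 * D)).
    by field; rewrite subr_eq0.
  exact: key.
by rewrite normrN normrM [leLHS]mulrC ler_wpM2r.
Qed.

Lemma prim_exists a b F : a <= b -> contI a b F -> exists P, prim a b F P.
Proof.
move=> ab cF.
have cg (g : C -> R) : (forall z u, `|g z - g u| <= cn (z - u)) ->
    continuous (fun x => g (F (clamp a b x))).
  move=> hg x; apply/cvgrPdist_le => e e0.
  have [r r0 hr] := cF _ (clamp_in x ab) _ e0.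
  apply/nbhs_ballP; exists r => // y hy.
  rewrite distrC; apply: le_trans (hg _ _) _; apply: hr; first exact: clamp_in.
  by apply: le_lt_trans hy; rewrite distrC; exact: clamp_lip.
have [|p hp] := real_prim ab (cg (@complex.Re R) _).
  by move=> z u; apply: le_trans (cn_Re (z - u)); rewrite ReD ReN.
have [|q hq] := real_prim ab (cg (@complex.Im R) _).
  by move=> z u; apply: le_trans (cn_Im (z - u)); rewrite ImD ImN.
exists (fun x => p x +i* q x) => x hx e e0; have e2 : 0 < e / 2 by rewrite divr_gt0.
have [r r0 hr] := hp x hx _ e2; have [s s0 hs] := hq x hx _ e2.
exists (Num.min r s); first by rewrite lt_min r0.
move=> y hy; rewrite lt_min => /andP[/hr h1 /hs h2].
move: h1 h2; rewrite clamp_id//; case: (F x) => u v /= h1 h2.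
apply: le_trans (cn_ReIm _) _.
rewrite !ReD !ImD !ReN !ImN !ReM !ImM /= !mulr0 subr0 add0r.
lra.
Qed.

Lemma intg_split F a b c : a <= b -> b <= c -> contI a c F ->
  intg F a c = intg F a b + intg F b c.
Proof.
move=> ab bc /(prim_exists (le_trans ab bc))[P hP].
rewrite (intgE (le_trans ab bc) hP) (intgE ab (prim_sub (lexx _) bc hP)).
by rewrite (intgE bc (prim_sub ab (lexx _) hP)); ring.
Qed.

Lemma intg_add F G a b : a <= b -> contI a b F -> contI a b G ->
  intg (fun x => F x + G x) a b = intg F a b + intg G a b.
Proof.
move=> ab /(prim_exists ab)[P hP] /(prim_exists ab)[Q hQ].
by rewrite (intgE ab hP) (intgE ab hQ) (intgE ab (prim_add hP hQ)); ring.
Qed.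

Lemma intg_scale F a b k : a <= b -> contI a b F ->
  intg (fun x => k * F x) a b = k * intg F a b.
Proof.
move=> ab /(prim_exists ab)[P hP].
by rewrite (intgE ab hP) (intgE ab (prim_scale k hP)); ring.
Qed.

Lemma intg_bound F a b M : a <= b -> contI a b F -> (forall x, a <= x <= b -> cn (F x) <= M) ->
  cn (intg F a b) <= M * (b - a).
Proof. by move=> ab /(prim_exists ab)[P hP] hM; rewrite (intgE ab hP); exact: prim_bound hP hM. Qed.

Lemma intg_eq F G a b : a <= b -> contI a b F -> (forall x, a <= x <= b -> F x = G x) ->
  intg F a b = intg G a b.
Proof.
move=> ab /(prim_exists ab)[P hP] FG.
by rewrite (intgE ab hP) (intgE ab (prim_eq FG hP)).
Qed.

Lemma intg_shift F a b t : a <= b -> contI (a + t) (b + t) F ->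
  intg (fun x => F (x + t)) a b = intg F (a + t) (b + t).
Proof.
move=> ab cF; have abt : a + t <= b + t by rewrite lerD2r.
have [P hP] := prim_exists abt cF.
rewrite (intgE abt hP) (@intgE _ _ _ (fun x => P (x + t)))// => x hx e e0.
have [|r r0 hr] := hP (x + t) _ e e0; first by lra.
exists r => // y hy hyx; have := hr (y + t); rewrite opprD addrACA subrr addr0.
by apply => //; lra.
Qed.

Lemma contI_add a b F G : contI a b F -> contI a b G -> contI a b (fun x => F x + G x).
Proof.
move=> hP hQ x hx e e0; have e2 : 0 < e / 2 by rewrite divr_gt0.
have [r r0 hr] := hP x hx _ e2; have [s s0 hs] := hQ x hx _ e2.
exists (Num.min r s); first by rewrite lt_min r0.
move=> y hy; rewrite lt_min => /andP[/(hr _ hy) h1 /(hs _ hy) h2].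
rewrite opprD addrACA; apply: le_trans (cnD _ _) _; lra.
Qed.

Lemma contI_scale a b F k : contI a b F -> contI a b (fun x => k * F x).
Proof.
move=> hP x hx e e0; have k0 : 0 < cn k + 1 by have := cn_ge0 k; lra.
have [r r0 hr] := hP x hx _ (divr_gt0 e0 k0).
exists r => // y hy /(hr _ hy); rewrite ler_pdivlMr// => h.
rewrite -mulrBr cnM mulrDr mulr1 in h *; have := cn_ge0 (F y - F x); lra.
Qed.

Lemma contI_shift F a b t : contI (a + t) (b + t) F -> contI a b (fun x => F (x + t)).
Proof.
move=> hP x hx e e0; have [|r r0 hr] := hP (x + t) _ e e0; first by lra.
exists r => // y hy hyx; apply: hr; first by lra.
by rewrite opprD addrACA subrr addr0.
Qed.

Lemma contI_bounded F a b : a <= b -> contI a b F ->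
  exists2 M, 0 < M & forall x, a <= x <= b -> cn (F x) <= M.
Proof.
move=> ab cF.
apply: (@cousin1 _ (fun a' b' => exists2 M, 0 < M & forall x, a' <= x <= b' -> cn (F x) <= M)) => //.
  move=> a' m b' h1 h2 h3 h4 [M M0 hM] [N N0 hN]; exists (M + N); first lra.
  move=> x hx; have [xm|mx] := leP x m.
    have : cn (F x) <= M by apply: hM; lra. lra.
  have : cn (F x) <= N by apply: hN; lra. lra.
move=> x hx; have [r r0 hr] := cF x hx 1 ltr01; exists r => // a' b' h1 h2 h3 h4.
exists (cn (F x) + 1); first by have := cn_ge0 (F x); lra.
move=> y hy; have : cn (F y - F x) <= 1.
  by apply: hr; [lra|rewrite ltr_norml; lra].
have := cn_sub_ge (F y) (F x); lra.
Qed.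

Lemma contI_mul a b F G : a <= b -> contI a b F -> contI a b G -> contI a b (fun x => F x * G x).
Proof.
move=> ab cF cG x hx e e0.
have [M M0 hM] := contI_bounded ab cF; have [N N0 hN] := contI_bounded ab cG.
have e1 : 0 < e / (2 * N) by rewrite divr_gt0// mulr_gt0.
have e2 : 0 < e / (2 * M) by rewrite divr_gt0// mulr_gt0.
have [r r0 hr] := cF x hx _ e1; have [s s0 hs] := cG x hx _ e2.
exists (Num.min r s); first by rewrite lt_min r0.
move=> y hy; rewrite lt_min => /andP[/(hr _ hy) h1 /(hs _ hy) h2].
rewrite [X in cn X](_ : _ = (F y - F x) * G y + F x * (G y - G x)); last by ring.
apply: le_trans (cnD _ _) _; rewrite !cnM.
have t1 := ler_pM (cn_ge0 _) (cn_ge0 _) h1 (hN y hy).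
have t2 := ler_pM (cn_ge0 _) (cn_ge0 _) (hM x hx) h2.
apply: le_trans (lerD t1 t2) _; rewrite le_eqVlt; apply/orP; left; apply/eqP.
by field; rewrite !gt_eqF.
Qed.

End Integral.

(** * The complex exponential *)

Section Exponential.
Variable R : realType.
Local Notation C := R[i].
Implicit Types (z u v p : C) (x y e t a b : R) (F Q : C -> C).

Lemma prim_line Q F p v a b :
  (forall t, a <= t <= b -> hasder Q (p + v * t%:C) (F (p + v * t%:C))) ->
  prim a b (fun t => v * F (p + v * t%:C)) (fun t => Q (p + v * t%:C)).
Proof.
move=> h t ht e e0; have v0 : 0 < cn v + 1 by have := cn_ge0 v; lra.
have [r r0 hr] := h t ht _ (divr_gt0 e0 v0).
exists (r / (cn v + 1)); first exact: divr_gt0.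
move=> y _ hy; have E : p + v * y%:C - (p + v * t%:C) = v * (y - t)%:C.
  by rewrite rmorphB; ring.
have := hr (p + v * y%:C); rewrite E cnM cn_real => H.
rewrite [X in X * (y - t)%:C]mulrC -mulrA.
apply: le_trans (H _) _.
  move: hy; rewrite ltr_pdivlMr// => hy; apply: le_lt_trans hy.
  by rewrite mulrC ler_wpM2l// lerDl.
rewrite mulrA ler_wpM2r// -mulrA ger_pMr// mulrC ler_pdivrMr// mul1r lerDl//.
Qed.

Lemma mvt_segment F (F' : C -> C) z M :
  (forall t, 0 <= t <= 1 -> hasder F (z * t%:C) (F' (z * t%:C))) ->
  (forall t, 0 <= t <= 1 -> cn (F' (z * t%:C)) <= M) -> cn (F z - F 0) <= M * cn z.
Proof.
move=> h hM; have := @prim_line F F' 0 z 0 1.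
have E t : 0 + z * t%:C = z * t%:C by rewrite add0r.
move=> H; have hp : prim 0 1 (fun t => z * F' (0 + z * t%:C)) (fun t => F (0 + z * t%:C)).
  by apply: H => t ht; rewrite E; exact: h.
have E1 : F z = F (0 + z * 1%:C) by rewrite rmorph1 mulr1 add0r.
have E0 : F 0 = F (0 + z * 0%:C) by rewrite rmorph0 mulr0 add0r.
rewrite E1 E0; apply: (@le_trans _ _ (M * cn z * (1 - 0))); last by rewrite subr0 mulr1.
apply: (prim_bound ler01 hp) => t ht.
by rewrite E cnM mulrC ler_wpM2r ?cn_ge0// hM.
Qed.

Lemma expCD z u : expC (z + u) = expC z * expC u.
Proof.
rewrite /expC ReD ImD expRD cosD sinD rmorphM.
rewrite -[RHS]mulrACA; congr (_ * _).
by apply: cplx_eq; rewrite ?ReM ?ImM /=; ring.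
Qed.

Lemma cn_expC z : cn (expC z) = expR (complex.Re z).
Proof.
rewrite /expC cnM cn_real ger0_norm ?expR_ge0//.
by rewrite [cn _](_ : _ = 1) ?mulr1// /cn /= cos2Dsin2 sqrtr1.
Qed.

Lemma expC0 : expC 0 = 1 :> C.
Proof. by rewrite /expC /= expR0 cos0 sin0 mul1r. Qed.

Lemma expC_neq0 z : expC z != 0.
Proof. by rewrite -cn_gt0 cn_expC expR_gt0. Qed.

Lemma expCN z : expC (- z) = (expC z)^-1.
Proof.
by apply: (mulfI (expC_neq0 z)); rewrite divff ?expC_neq0// -expCD subrr expC0.
Qed.

Lemma expCMn z n : expC (n%:R * z) = expC z ^+ n.
Proof.
elim: n => [|n ih]; first by rewrite mul0r expC0 expr0.
by rewrite -addn1 natrD mulrDl mul1r expCD ih addn1 exprSr.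
Qed.

Let real_der (g : R -> R) x d : is_derive x 1 g d -> forall e, 0 < e ->
  exists2 r, 0 < r & forall y, `|y - x| < r -> `|g y - g x - d * (y - x)| <= e * `|y - x|.
Proof.
move=> [dg dgE] e e0.
have : h^-1 *: (g (h *: 1 + x) - g x) @[h --> 0^'] --> d by rewrite -dgE; exact: dg.
move=> /cvgrPdist_le /(_ _ e0) /nbhs_ballP[s /= s0 hs].
exists s => // y hy; have [->|yx] := eqVneq y x; first by rewrite !subrr mulr0 subr0 normr0 mulr0.
have := hs (y - x); rewrite -ball_normE/= sub0r normrN => /(_ hy); rewrite subr_eq0 => /(_ yx).
rewrite [_%:A]mulr1 subrK => h.
rewrite [X in `|X|](_ : _ = - ((y - x) * (d - (y - x)^-1 *: (g y - g x)))); last first.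
  have key (D : R) : D - d * (y - x) = - ((y - x) * (d - (y - x)^-1 * D)).
    by field; rewrite subr_eq0.
  exact: key.
by rewrite normrN normrM [leLHS]mulrC ler_wpM2r.
Qed.

(** With A, S and K the errors in exp a - 1 ~ a, sin b ~ b and cos b ~ 1, the error at a + ib is a
    sum of products, each at most a small multiple of e' n. The multiples add up to 11, below the 16
    in e' = e / 16. *)
Let hasder_expC0 : hasder (@expC R) 0 1.
Proof.
move=> e e0; pose e' := e / 16; have e'0 : 0 < e' by rewrite divr_gt0.
have [r r0 hr] := real_der (is_derive_expR 0) e'0.
have [s s0 hs] := real_der (is_derive_sin 0) e'0.
have [t t0 ht] := real_der (is_derive_cos 0) e'0.
exists (Num.min (Num.min r s) (Num.min t (Num.min 1 e'))).
  by rewrite !lt_min r0 s0 t0 ltr01 e'0.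
move=> u; rewrite subr0 !lt_min => /andP[/andP[h1 h2] /and3P[h3 h4 h5]].
move: h1 h2 h3 h4 h5; case: u => a b; set n := cn _ => h1 h2 h3 h4 h5.
have na : `|a| <= n := cn_Re (a +i* b); have nb : `|b| <= n := cn_Im (a +i* b).
have := hr a; have := hs b; have := ht b.
rewrite !(subr0, expR0, sin0, cos0, oppr0, mul0r, mul1r, addr0).
move=> /(_ (le_lt_trans nb h3)) Hc /(_ (le_lt_trans nb h2)) Hs /(_ (le_lt_trans na h1)) He.
rewrite expC0 ?mul1r.
set A := expR a - 1 - a in He; set S := sin b - b in Hs; set K := cos b - 1 in Hc.
rewrite [X in cn X](_ : _ = (A + A * K + a * K + K) +i* (A * S + a * S + A * b + a * b + S)); last first.
  by rewrite /expC; apply: cplx_eq; rewrite !(ReD, ImD, ReN, ImN, ReM, ImM) /= /A /S /K; ring.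
apply: le_trans (cn_ReIm _) _ => /=.
have n0 : 0 <= n := cn_ge0 _.
have HA : `|A| <= e' * n by apply: le_trans He _; rewrite ler_wpM2l// ltW.
have HK : `|K| <= e' * n by apply: le_trans Hc _; rewrite ler_wpM2l// ltW.
have HS : `|S| <= e' * n by apply: le_trans Hs _; rewrite ler_wpM2l// ltW.
have HK2 : `|K| <= 2 by rewrite /K ler_norml; have := cos_le1 b; have := cos_geN1 b; lra.
have HS1 : `|S| <= 2.
  by rewrite /S; have := sin_max b; have := ler_normB (sin b) b; lra.
have p1 : `|A * K| <= e' * n * 2 by rewrite normrM ler_pM.
have p2 : `|a * K| <= e' * n by rewrite normrM -[leRHS]mul1r ler_pM//; lra.
have q1 : `|A * S| <= e' * n * 2 by rewrite normrM ler_pM.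
have q2 : `|a * S| <= e' * n by rewrite normrM -[leRHS]mul1r ler_pM//; lra.
have q3 : `|A * b| <= e' * n by rewrite normrM -[leRHS]mulr1 ler_pM//; lra.
have q4 : `|a * b| <= e' * n by rewrite normrM mulrC -[leRHS]mulrC ler_pM//; lra.
have t1 := ler_normD (A + A * K + a * K) K.
have t2 := ler_normD (A + A * K) (a * K); have t3 := ler_normD A (A * K).
have t4 := ler_normD (A * S + a * S + A * b + a * b) S.
have t5 := ler_normD (A * S + a * S + A * b) (a * b).
have t6 := ler_normD (A * S + a * S) (A * b); have t7 := ler_normD (A * S) (a * S).
have -> : e = 16 * e' by rewrite /e'; field.
have : 0 <= e' * n by rewrite mulr_ge0// ltW.
lra.
Qed.

Lemma hasder_expC z : hasder (@expC R) z (expC z).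
Proof.
have := @hasder_comp R (fun u => u - z) (@expC R) z 1 1.
rewrite subrr => H.
have h1 : hasder (fun u => u - z) z 1.
  by apply: (hasder_eq _ (hasder_add (hasder_id z) (hasder_cst (- z) z))); rewrite addr0.
have := hasder_scale (expC z) (H h1 hasder_expC0); rewrite !mulr1.
by apply: hasder_ext => u; rewrite -expCD addrC subrK.
Qed.

Lemma holo_expC z : holo (@expC R) z.
Proof. by eexists; exact: hasder_expC. Qed.

Lemma cn_expC_le z : cn (expC z) <= expR (cn z).
Proof. by rewrite cn_expC ler_expR; apply: le_trans (ler_norm _) (cn_Re z). Qed.

Let in01 z t : 0 <= t <= 1 -> cn (z * t%:C) <= cn z.
Proof.
move=> /andP[t0 t1]; rewrite cnM cn_real ger0_norm//.
by rewrite -[leRHS]mulr1 ler_wpM2l ?cn_ge0.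
Qed.

Lemma expC_taylor1 z : cn (expC z - 1) <= expR (cn z) * cn z.
Proof.
rewrite -expC0; apply: (@mvt_segment _ (@expC R)) => t ht; first exact: hasder_expC.
by apply: le_trans (cn_expC_le _) _; rewrite ler_expR in01.
Qed.

(** Each Taylor remainder has the preceding one as derivative, so the mean value inequality on the
    segment from 0 to z raises the order by one. *)
Lemma expC_taylor2 z : cn (expC z - 1 - z) <= expR (cn z) * cn z ^+ 2.
Proof.
pose F u : C := expC u - 1 - u.
rewrite (_ : expC z - 1 - z = F z - F 0); last by rewrite /F expC0; ring.
rewrite expr2 mulrA; apply: (@mvt_segment F (fun u => expC u - 1)) => t ht.
  have h := hasder_add (hasder_add (hasder_expC (z * t%:C)) (hasder_cst (-1) _))
    (hasder_scale (-1) (hasder_id _)).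
  by apply: (hasder_ext _ (hasder_eq _ h)); [move=> u; rewrite /F; ring|ring].
apply: le_trans (expC_taylor1 _) _.
by rewrite ler_pM ?expR_ge0 ?cn_ge0 ?ler_expR// in01.
Qed.

Lemma expC_taylor3 z : cn (expC z - 1 - z - z ^+ 2 / 2) <= expR (cn z) * cn z ^+ 3.
Proof.
pose F u : C := expC u - 1 - u - u ^+ 2 / 2.
rewrite (_ : expC z - 1 - z - z ^+ 2 / 2 = F z - F 0); last first.
  by rewrite /F expC0; field.
rewrite exprSr mulrA; apply: (@mvt_segment F (fun u => expC u - 1 - u)) => t ht.
  have h := hasder_add (hasder_add (hasder_add (hasder_expC (z * t%:C)) (hasder_cst (-1) _))
    (hasder_scale (-1) (hasder_id _))) (hasder_scale (- 2^-1) (hasder_sqr _)).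
  apply: (hasder_ext _ (hasder_eq _ h)); first by move=> u; rewrite /F; field.
  by field.
apply: le_trans (expC_taylor2 _) _.
by rewrite ler_pM ?expR_ge0 ?exprn_ge0 ?cn_ge0 ?ler_expR ?in01// lerXn2r ?nnegrE ?cn_ge0// in01.
Qed.

Lemma Re_2pii z : complex.Re (2 * pi%:C * 'i%C * z) = - (2 * pi *  complex.Im z).
Proof. by rewrite !(ReM, ImM, Re_nat, Im_nat) /=; ring. Qed.

Lemma Im_2pii z : complex.Im (2 * pi%:C * 'i%C * z) = 2 * pi *  complex.Re z.
Proof. by rewrite !(ReM, ImM, Re_nat, Im_nat) /=; ring. Qed.

Lemma cn_e2pi z : cn (e2pi z) = expR (- (2 * pi *  complex.Im z)).
Proof. by rewrite /e2pi cn_expC Re_2pii. Qed.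

Lemma e2piD z u : e2pi (z + u) = e2pi z * e2pi u.
Proof. by rewrite /e2pi mulrDr expCD. Qed.

Lemma e2pi0 : e2pi 0 = 1 :> C.
Proof. by rewrite /e2pi mulr0 expC0. Qed.

Lemma e2piN z : e2pi (- z) = (e2pi z)^-1.
Proof. by rewrite /e2pi mulrN expCN. Qed.

Lemma e2pi_neq0 z : e2pi z != 0.
Proof. exact: expC_neq0. Qed.

Lemma e2piMn z n : e2pi (n%:R * z) = e2pi z ^+ n.
Proof. by rewrite /e2pi -expCMn; congr expC; ring. Qed.

Lemma e2pi1 : e2pi 1 = 1 :> C.
Proof.
rewrite /e2pi /expC Re_2pii Im_2pii /= mulr0 oppr0 expR0 mulr1 mulr_natl cos2pi sin2pi.
by apply: cplx_eq; rewrite !(ReM, ImM) /=; ring.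
Qed.

Lemma e2pi_nat n : e2pi n%:R = 1 :> C.
Proof. by rewrite -[n%:R]mulr1 e2piMn e2pi1 expr1n. Qed.

Lemma e2pi_half : e2pi 2^-1 = -1 :> C.
Proof.
have E : (2^-1 : C) = (2^-1 : R)%:C by rewrite fmorphV rmorph_nat.
rewrite /e2pi /expC Re_2pii Im_2pii E /= mulr0 oppr0 expR0.
have -> : 2 * pi * 2^-1 = pi :> R by field.
by rewrite cospi sinpi; apply: cplx_eq; rewrite !(ReM,ImM) /=; ring.
Qed.

Lemma hasder_e2pi z : hasder (@e2pi R) z (2 * pi%:C * 'i%C * e2pi z).
Proof.
rewrite mulrC; apply: (@hasder_comp R (fun u => 2 * pi%:C * 'i%C * u) (@expC R)).
  by apply: hasder_eq (hasder_scale _ (hasder_id z)); rewrite mulr1.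
exact: hasder_expC.
Qed.

Lemma holo_e2pi F z : holo F z -> holo (fun u => e2pi (F u)) z.
Proof. by move=> h; apply: holo_comp h _; eexists; exact: hasder_e2pi. Qed.

Lemma twopii_neq0 : 2 * pi%:C * 'i%C != 0 :> C.
Proof.
rewrite !mulf_neq0 ?pnatr_eq0//; last by rewrite -cn_gt0 cn_i.
by rewrite -cn_gt0 cn_real normr_gt0 gt_eqF// pi_gt0.
Qed.

(** The modulus forces Im z = 0; then cos (2 pi Re z) = 1 with |2 pi Re z| <= pi, a range on which
    cos determines the absolute value of the angle. *)
Lemma e2pi_eq1 z : `|complex.Re z| <= 2^-1 -> e2pi z = 1 -> z = 0.
Proof.
move=> hz h; have p0 := @pi_gt0 R.
have : cn (e2pi z) = 1 by rewrite h cn1.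
rewrite cn_e2pi -[X in _ = X]expR0 => /expR_inj /eqP.
rewrite oppr_eq0 !mulf_eq0 pnatr_eq0/= (gt_eqF p0)/= => /eqP Im0.
have : complex.Re (e2pi z) = 1 by rewrite h.
rewrite /e2pi /expC Re_2pii Im_2pii Im0 mulr0 oppr0 expR0 mul1r /=.
rewrite -cos_norm -[X in _ = X](@cos0 R) => /cos_inj H.
have : `|2 * pi *  complex.Re z| = 0.
  apply: H; last by rewrite in_itv/= lexx ltW.
  rewrite in_itv/= normr_ge0/= normrM gtr0_norm ?mulr_gt0//.
  have : 2 * pi * `|complex.Re z| <= 2 * pi * 2^-1 by rewrite ler_wpM2l// mulr_ge0// ltW.
  lra.
move=> /normr0_eq0/eqP; rewrite !mulf_eq0 pnatr_eq0/= (gt_eqF p0)/= => /eqP Re0.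
exact: cplx_eq.
Qed.

Lemma unit_circle_angle x y : x ^+ 2 + y ^+ 2 = 1 -> exists t, x = cos t /\ y = sin t.
Proof.
move=> h; have x1 : -1 <= x <= 1.
  by rewrite -ler_norml -(expr_le1 (n := 2))// real_normK ?num_real//; have := sqr_ge0 y; lra.
have E : Num.sqrt (1 - x ^+ 2) = `|y| by rewrite -h addrC addKr sqrtr_sqr.
have [y0|y0] := leP 0 y.
  by exists (acos x); rewrite acosK ?in_itv//= sin_acos// E ger0_norm.
exists (- acos x); rewrite cosN sinN acosK ?in_itv//= sin_acos// E ltr0_norm// opprK.
by [].
Qed.

Lemma e2pi_surj u : u != 0 -> exists z, e2pi z = u.
Proof.
move=> u0; have n0 : 0 < cn u by rewrite cn_gt0.
have p0 := @pi_gt0 R.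
have [] := @unit_circle_angle (complex.Re u / cn u) (complex.Im u / cn u).
  by rewrite !exprMn -mulrDl -cn_sqr -exprMn divff ?gt_eqF// expr1n.
move=> t [ht1 ht2].
exists ((t / (2 * pi)) +i* (- ln (cn u) / (2 * pi))).
rewrite /e2pi /expC Re_2pii Im_2pii /=.
have E1 (P L : R) : 0 < P -> - (2 * P * (- L / (2 * P))) = L.
  by move=> P0; field; rewrite gt_eqF.
have E2 (P L : R) : 0 < P -> 2 * P * (L / (2 * P)) = L by move=> P0; field; rewrite gt_eqF.
rewrite E1// E2// lnK ?posrE// -ht1 -ht2.
by apply: cplx_eq; rewrite !(ReM, ImM) /=; field; rewrite gt_eqF//.
Qed.

Lemma expR_small e : 0 < e -> exists Y, forall y, Y < y -> expR (- y) < e.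
Proof.
move=> e0; exists (- ln e) => y hy; rewrite -[X in _ < X](lnK e0) ltr_expR; lra.
Qed.

End Exponential.

(** * Rectangular contours and Goursat's theorem *)

Section Contour.
Variable R : realType.
Local Notation C := R[i].
Implicit Types (z u v p : C) (x y e t a b c d : R) (F G Q : C -> C).

Lemma contI_horizontal F a b c : (forall x, a <= x <= b -> ccont F (x +i* c)) ->
  contI a b (fun x => F (x +i* c)).
Proof.
move=> h x hx e e0; have [r r0 hr] := h x hx e e0; exists r => // y _ hy.
by apply: hr; rewrite [X in cn X](_ : _ = (y - x)%:C) ?cn_real//; apply: cplx_eq => /=; rewrite ?subrr.
Qed.

Lemma contI_vertical F c d a : (forall y, c <= y <= d -> ccont F (a +i* y)) ->
  contI c d (fun y => F (a +i* y)).
Proof.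
move=> h x hx e e0; have [r r0 hr] := h x hx e e0; exists r => // y _ hy.
apply: hr; rewrite [X in cn X](_ : _ = 'i%C * (y - x)%:C) ?cnM ?cn_i ?mul1r ?cn_real//.
by apply: cplx_eq; rewrite !(ReM, ImM) /=; ring.
Qed.

(** The boundary is traversed counterclockwise. *)
Definition contour F a b c d : C :=
  intg (fun x => F (x +i* c)) a b + 'i%C * intg (fun y => F (b +i* y)) c d
  - intg (fun x => F (x +i* d)) a b - 'i%C * intg (fun y => F (a +i* y)) c d.

Definition rect_cont F a b c d := forall x y, a <= x <= b -> c <= y <= d -> ccont F (x +i* y).

Lemma rect_cont_sub F a b c d a' b' c' d' : a <= a' -> b' <= b -> c <= c' -> d' <= d ->
  rect_cont F a b c d -> rect_cont F a' b' c' d'.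
Proof. by move=> h1 h2 h3 h4 h x y hx hy; apply: h; lra. Qed.

Lemma rect_contI F a b c d : a <= b -> c <= d -> rect_cont F a b c d ->
  [/\ contI a b (fun x => F (x +i* c)), contI a b (fun x => F (x +i* d)),
      contI c d (fun y => F (a +i* y)) & contI c d (fun y => F (b +i* y))].
Proof.
move=> ab cd h; split; [apply: contI_horizontal|apply: contI_horizontal|
  apply: contI_vertical|apply: contI_vertical] => x hx; apply: h => //; lra.
Qed.

Lemma contour_hsplit F a m b c d : a <= m -> m <= b -> c <= d -> rect_cont F a b c d ->
  contour F a b c d = contour F a m c d + contour F m b c d.
Proof.
move=> am mb cd h; have [h1 h2 h3 h4] := rect_contI (le_trans am mb) cd h.
by rewrite /contour (intg_split am mb h1) (intg_split am mb h2); ring.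
Qed.

Lemma contour_vsplit F a b c m d : a <= b -> c <= m -> m <= d -> rect_cont F a b c d ->
  contour F a b c d = contour F a b c m + contour F a b m d.
Proof.
move=> ab cm md h; have [h1 h2 h3 h4] := rect_contI ab (le_trans cm md) h.
by rewrite /contour (intg_split cm md h3) (intg_split cm md h4); ring.
Qed.

Lemma contour_bound_sides F a b c d M : a <= b -> c <= d ->
  contI a b (fun x => F (x +i* c)) -> contI a b (fun x => F (x +i* d)) ->
  contI c d (fun y => F (a +i* y)) -> contI c d (fun y => F (b +i* y)) ->
  (forall x, a <= x <= b -> cn (F (x +i* c)) <= M /\ cn (F (x +i* d)) <= M) ->
  (forall y, c <= y <= d -> cn (F (a +i* y)) <= M /\ cn (F (b +i* y)) <= M) ->
  cn (contour F a b c d) <= 2 * M * ((b - a) + (d - c)).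
Proof.
move=> ab cd h1 h2 h3 h4 hx hy.
rewrite /contour; apply: le_trans (cnB _ _) _; rewrite cnM cn_i mul1r.
have b4 := intg_bound cd h3 (fun y H => proj1 (hy y H)).
have b3 := intg_bound cd h4 (fun y H => proj2 (hy y H)).
have b1 := intg_bound ab h1 (fun x H => proj1 (hx x H)).
have b2 := intg_bound ab h2 (fun x H => proj2 (hx x H)).
have t1 := cnB (intg (fun x => F (x +i* c)) a b + 'i%C * intg (fun y => F (b +i* y)) c d)
  (intg (fun x => F (x +i* d)) a b).
have := cnD (intg (fun x => F (x +i* c)) a b) ('i%C * intg (fun y => F (b +i* y)) c d).
rewrite cnM cn_i mul1r; lra.
Qed.

Lemma contour_bound F a b c d M : a <= b -> c <= d -> rect_cont F a b c d ->
  (forall x y, a <= x <= b -> c <= y <= d -> cn (F (x +i* y)) <= M) ->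
  cn (contour F a b c d) <= 2 * M * ((b - a) + (d - c)).
Proof.
move=> ab cd h hM; have [h1 h2 h3 h4] := rect_contI ab cd h.
by apply: contour_bound_sides => // t ht; split; apply: hM; lra.
Qed.

Lemma contour_add F G a b c d : a <= b -> c <= d -> rect_cont F a b c d -> rect_cont G a b c d ->
  contour (fun z => F z + G z) a b c d = contour F a b c d + contour G a b c d.
Proof.
move=> ab cd hF hG; have [h1 h2 h3 h4] := rect_contI ab cd hF.
have [k1 k2 k3 k4] := rect_contI ab cd hG.
by rewrite /contour !intg_add//; ring.
Qed.

Lemma intg_horizontal_prim Q F a b c : a <= b ->
  (forall x, a <= x <= b -> hasder Q (x +i* c) (F (x +i* c))) ->
  intg (fun x => F (x +i* c)) a b = Q (b +i* c) - Q (a +i* c).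
Proof.
move=> ab h; apply: (@intgE _ _ _ _ (fun x => Q (x +i* c))) => //.
have E t : (0 +i* c) + 1 * t%:C = t +i* c by apply: cplx_eq; rewrite !(ReD,ImD,ReM,ImM)/=; ring.
move=> x hx e e0; have := @prim_line _ Q F (0 +i* c) 1 a b.
move=> /(_ _ x hx e e0)[|r r0 hr]; first by move=> t ht; rewrite E; exact: h.
by exists r => // y hy1 hy2; have := hr y hy1 hy2; rewrite !E !mul1r.
Qed.

Lemma intg_vertical_prim Q F c d a : c <= d ->
  (forall y, c <= y <= d -> hasder Q (a +i* y) (F (a +i* y))) ->
  'i%C * intg (fun y => F (a +i* y)) c d = Q (a +i* d) - Q (a +i* c).
Proof.
move=> cd h.
have E t : (a +i* 0) + 'i%C * t%:C = a +i* t by apply: cplx_eq; rewrite !(ReD,ImD,ReM,ImM)/=; ring.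
have hp : prim c d (fun y => 'i%C * F (a +i* y)) (fun y => Q (a +i* y)).
  move=> x hx e e0; have := @prim_line _ Q F (a +i* 0) 'i%C c d.
  move=> /(_ _ x hx e e0)[|r r0 hr]; first by move=> t ht; rewrite E; exact: h.
  by exists r => // y hy1 hy2; have := hr y hy1 hy2; rewrite !E.
have hp2 := prim_scale (- 'i%C) hp.
have ii : - 'i%C * 'i%C = 1 :> C by rewrite mulNr -expr2 sqr_i opprK.
rewrite (@intgE _ _ _ _ (fun y => - 'i%C * Q (a +i* y)))//; last first.
  by apply: prim_eq hp2 => x _; rewrite mulrA ii mul1r.
by rewrite -mulrBr mulrA mulrN -mulNr ii mul1r.
Qed.

Lemma contour_prim Q F a b c d : a <= b -> c <= d ->
  (forall x y, a <= x <= b -> c <= y <= d -> hasder Q (x +i* y) (F (x +i* y))) ->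
  contour F a b c d = 0.
Proof.
move=> ab cd h; rewrite /contour.
rewrite (@intg_horizontal_prim Q F a b c)//; last by move=> x hx; apply: h => //; lra.
rewrite (@intg_horizontal_prim Q F a b d)//; last by move=> x hx; apply: h => //; lra.
rewrite (@intg_vertical_prim Q F c d a)//; last by move=> x hx; apply: h => //; lra.
rewrite (@intg_vertical_prim Q F c d b)//; last by move=> x hx; apply: h => //; lra.
by ring.
Qed.

(** The tolerance e (width^2 + height^2) is additive under quartering, so the bound passes from the
    quarters to the rectangle. Near a point, F differs by a small multiple of the distance from its
    affine part, whose contour integral is 0. Cousin's lemma concludes. *)
Theorem goursat F a b c d : a <= b -> c <= d ->
  (forall x y, a <= x <= b -> c <= y <= d -> holo F (x +i* y)) -> contour F a b c d = 0.
Proof.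
move=> ab cd hF.
have cF : rect_cont F a b c d by move=> x y hx hy; apply: holo_cont; exact: hF.
apply: (@cn_le_small _ _ ((b - a) ^+ 2 + (d - c) ^+ 2)) => e e0.
pose P a b c d := cn (contour F a b c d) <= e * ((b - a) ^+ 2 + (d - c) ^+ 2).
suff : P a b c d by rewrite /P mulrC.
apply: (@cousin2 _ P) => //.
  rewrite /P => a' b' c' d' h1 h2 h3 h4 h5 h6; set m := (a' + b') / 2; set n := (c' + d') / 2.
  have hm : a' <= m <= b' by rewrite /m; lra.
  have hn : c' <= n <= d' by rewrite /n; lra.
  have [hm1 hm2] := andP hm; have [hn1 hn2] := andP hn.
  rewrite (@contour_hsplit F a' m b' c' d')//; last by apply: rect_cont_sub cF.
  rewrite (@contour_vsplit F a' m c' n d')//; last by apply: rect_cont_sub cF => //; lra.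
  rewrite (@contour_vsplit F m b' c' n d')//; last by apply: rect_cont_sub cF => //; lra.
  have E1 : m - a' = (b' - a') / 2 by rewrite /m; field.
  have E2 : b' - m = (b' - a') / 2 by rewrite /m; field.
  have E3 : n - c' = (d' - c') / 2 by rewrite /n; field.
  have E4 : d' - n = (d' - c') / 2 by rewrite /n; field.
  rewrite E1 E2 E3 E4 !expr_div_n => q1 q2 q3 q4.
  apply: le_trans (cnD _ _) _.
  have := cnD (contour F a' m c' n) (contour F a' m n d').
  have := cnD (contour F m b' c' n) (contour F m b' n d').
  lra.
move=> x y hx hy; have [D hD] := hF x y hx hy.
(* For sides l1 and l2 the perimeter estimate then gives e (l1 + l2)^2 / 2, which is at most e (l1^2
   + l2^2). *)
have e4 : 0 < e / 4 by rewrite divr_gt0.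
have [r r0 hr] := hD _ e4; exists (r / 2); first by rewrite divr_gt0.
move=> a' b' c' d' h1 h2 h3 h4 h5 h6 h7 h8; rewrite /P.
set z0 := x +i* y.
pose A z := F z0 + D * (z - z0); pose G z := F z + -1 * A z.
have ab' : a' <= b' by lra.
have cd' : c' <= d' by lra.
have cA : rect_cont A a' b' c' d'.
  move=> u v _ _; apply: holo_cont; apply: holo_add; first exact: holo_cst.
  by apply: holo_mul; [exact: holo_cst|apply: holo_sub; [exact: holo_id|exact: holo_cst]].
have cF' : rect_cont F a' b' c' d' by apply: rect_cont_sub cF => //; lra.
have hA : contour A a' b' c' d' = 0.
  apply: (@contour_prim (fun z => F z0 * z + D / 2 * (z - z0) ^+ 2)) => // u v _ _.
  have h := hasder_add (hasder_scale (F z0) (hasder_id (u +i* v))) (hasder_scale (D / 2)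
    (hasder_comp (hasder_add (hasder_id (u +i* v)) (hasder_cst (- z0) _)) (hasder_sqr _))).
  by apply: hasder_eq h; rewrite /A; field.
have cG : rect_cont G a' b' c' d'.
  move=> u v hu hv; apply: holo_cont; apply: holo_add; first by apply: hF; lra.
  apply: holo_mul; first exact: holo_cst.
  apply: holo_add; first exact: holo_cst.
  by apply: holo_mul; [exact: holo_cst|apply: holo_sub; [exact: holo_id|exact: holo_cst]].
have -> : contour F a' b' c' d' = contour G a' b' c' d'.
  have FE : F = (fun z => G z + A z) by apply/funext => z; rewrite /G; ring.
  by rewrite {1}FE contour_add// hA addr0.
set l1 := b' - a' in h7 *; set l2 := d' - c' in h8 *.
have l10 : 0 <= l1 by rewrite /l1; lra.
have l20 : 0 <= l2 by rewrite /l2; lra.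
apply: (@le_trans _ _ (2 * (e / 4 * (l1 + l2)) * (l1 + l2))).
  apply: contour_bound => // u v hu hv.
  have nz : cn ((u +i* v) - z0) <= l1 + l2.
    apply: le_trans (cn_ReIm _) _; rewrite /= /l1 /l2.
    by apply: lerD; rewrite ler_norml; lra.
  have := hr (u +i* v); rewrite -/z0 => H; apply: le_trans (le_trans (H _) _); last first.
  - by rewrite ler_wpM2l// ltW.
  - by apply: le_lt_trans nz _; lra.
  - by rewrite le_eqVlt; apply/orP; left; apply/eqP; congr cn; rewrite /G /A; ring.
have : 0 <= e * (l1 - l2) ^+ 2 by rewrite mulr_ge0 ?sqr_ge0// ltW.
rewrite [X in 0 <= X -> _](_ : _ = 2 * (e * (l1 ^+ 2 + l2 ^+ 2)) - e * (l1 + l2) ^+ 2); last by ring.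
rewrite [X in _ -> X <= _](_ : _ = e * (l1 + l2) ^+ 2 / 2); last by field.
lra.
Qed.

(** The four rectangles around the inner one contribute 0 by Goursat's theorem. The contour can thus
    be shrunk towards a singularity inside the inner rectangle. *)
Lemma contour_box F a x1 x2 b c y1 y2 d : a <= x1 -> x1 <= x2 -> x2 <= b ->
  c <= y1 -> y1 <= y2 -> y2 <= d ->
  (forall x y, a <= x <= b -> c <= y <= d -> [|| x <= x1, x2 <= x, y <= y1 | y2 <= y] ->
    holo F (x +i* y)) ->
  contour F a b c d = contour F x1 x2 y1 y2.
Proof.
move=> h1 h2 h3 k1 k2 k3 hF.
have ab : a <= b by apply: le_trans h1 (le_trans h2 h3).
have cd : c <= d by apply: le_trans k1 (le_trans k2 k3).
have z1 : contour F a x1 c d = 0.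
  apply: goursat => // x y /andP[p1 p2] hy; apply: hF; rewrite ?p2//.
  by rewrite p1 (le_trans p2)// (le_trans h2).
have z2 : contour F x2 b c d = 0.
  apply: goursat => // x y /andP[p1 p2] hy; apply: hF; rewrite ?p1 ?orbT//.
  by rewrite p2 (le_trans _ p1)// (le_trans h1).
have x1b := le_trans h2 h3; have ax2 := le_trans h1 h2.
have y1d := le_trans k2 k3; have cy2 := le_trans k1 k2.
have sx x : x1 <= x <= x2 -> a <= x <= b.
  by move=> /andP[p1 p2]; rewrite (le_trans h1)// (le_trans p2).
have z3 : contour F x1 x2 c y1 = 0.
  apply: goursat => // x y hx /andP[p1 p2]; apply: hF; rewrite ?p2 ?orbT//; first exact: sx.
  by rewrite p1 (le_trans p2).
have z4 : contour F x1 x2 y2 d = 0.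
  apply: goursat => // x y hx /andP[p1 p2]; apply: hF; rewrite ?p1 ?orbT//; first exact: sx.
  by rewrite p2 (le_trans _ p1).
have I1 x : a <= x <= b -> (x <= x1) || (x2 <= x) -> contI c d (fun y => F (x +i* y)).
  move=> hx hxx; apply: contI_vertical => y hy; apply/holo_cont/hF => //.
  by rewrite orbA hxx.
have I2 y : c <= y <= d -> (y <= y1) || (y2 <= y) -> contI a b (fun x => F (x +i* y)).
  move=> hy hyy; apply: contI_horizontal => x hx; apply/holo_cont/hF => //.
  by rewrite hyy !orbT.
have H y : c <= y <= d -> (y <= y1) || (y2 <= y) -> intg (fun x => F (x +i* y)) a b =
    intg (fun x => F (x +i* y)) a x1 + (intg (fun x => F (x +i* y)) x1 x2 + intg (fun x => F (x +i* y)) x2 b).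
  move=> hy hyy; rewrite -intg_split//; first by rewrite -intg_split//; exact: I2.
  exact: contI_sub h1 (lexx _) (I2 y hy hyy).
have V x : a <= x <= b -> (x <= x1) || (x2 <= x) -> intg (fun y => F (x +i* y)) c d =
    intg (fun y => F (x +i* y)) c y1 + (intg (fun y => F (x +i* y)) y1 y2 + intg (fun y => F (x +i* y)) y2 d).
  move=> hx hxx; rewrite -intg_split//; first by rewrite -intg_split//; exact: I1.
  exact: contI_sub k1 (lexx _) (I1 x hx hxx).
rewrite -[RHS](addr0 (contour F x1 x2 y1 y2)) -[X in _ = _ + X]z1.
rewrite -[X in _ = X + _]addr0 -[X in _ = _ + X + _]z2.
rewrite -[X in _ = X + _ + _]addr0 -[X in _ = _ + X + _ + _]z3.
rewrite -[X in _ = X + _ + _ + _]addr0 -[X in _ = _ + X + _ + _ + _]z4.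
rewrite /contour (H c) ?lexx ?k1 ?cd// (H d) ?lexx ?k3 ?cd ?orbT//.
rewrite (V x1) ?h1 ?lexx// (V x2) ?h3 ?lexx ?orbT ?ax2//; ring.
Qed.

End Contour.

(** * Cauchy's kernel for periodic functions on the half-plane *)

Section CauchyHalfPlane.
Variable R : realType.
Local Notation C := R[i].
Implicit Types (z u v p s : C) (x y e t a b c d : R) (F G Q : C -> C).

Definition holoH F := forall z, 0 < complex.Im z -> holo F z.

Definition perH (h : R) F := forall z, 0 < complex.Im z -> F (z + h%:C) = F z.

Definition qpar (h : R) z : C := e2pi (z / h%:C).

(** Vanishing to order at least m at the cusp i oo, in the local parameter w = exp(2 pi i z / h). *)
Definition bigO (h : R) (m : nat) F := exists Y B : R,
  forall z, Y < complex.Im z -> cn (F z) <= B * cn (qpar h z) ^+ m.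

Variable h : R.
Hypothesis h0 : 0 < h.

Let hn0 : h%:C != 0 :> C.
Proof. by rewrite -cn_gt0 cn_real normr_gt0 gt_eqF. Qed.

Lemma Im_divr z : complex.Im (z / h%:C) = complex.Im z / h.
Proof. by rewrite -fmorphV ImM /=; ring. Qed.

Lemma Re_divr z : complex.Re (z / h%:C) = complex.Re z / h.
Proof. by rewrite -fmorphV ReM /=; ring. Qed.

Lemma cn_qpar z : cn (qpar h z) = expR (- (2 * pi / h * complex.Im z)).
Proof. by rewrite /qpar cn_e2pi Im_divr; congr expR; ring. Qed.

Lemma qpar_neq0 z : qpar h z != 0.
Proof. exact: e2pi_neq0. Qed.

Lemma holo_qpar z : holo (qpar h) z.
Proof. by apply: holo_e2pi; apply: holo_mul; [exact: holo_id|exact: holo_cst]. Qed.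

Lemma qpar_per z : qpar h (z + h%:C) = qpar h z.
Proof. by rewrite /qpar mulrDl divff// e2piD e2pi1 mulr1. Qed.

Lemma kappa_gt0 : 0 < 2 * pi / h :> R.
Proof. by rewrite divr_gt0// mulr_gt0// pi_gt0. Qed.

Lemma qpar_small e : 0 < e -> exists Y, forall z, Y < complex.Im z -> cn (qpar h z) < e.
Proof.
move=> e0; have [Y hY] := expR_small e0; exists (Y / (2 * pi / h)) => z.
rewrite ltr_pdivrMr ?kappa_gt0// mulrC => /hY; by rewrite cn_qpar.
Qed.

Lemma cn_qpar_lt1 z : 0 < complex.Im z -> cn (qpar h z) < 1.
Proof. by move=> z0; rewrite cn_qpar expR_lt1 oppr_lt0 mulr_gt0// kappa_gt0. Qed.

Lemma cn_qpar_lt z u : complex.Im z < complex.Im u -> cn (qpar h u) < cn (qpar h z).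
Proof. by move=> zu; rewrite !cn_qpar ltr_expR ltrN2 ltr_pM2l// kappa_gt0. Qed.

Lemma qpar_sep z u : `|complex.Re (z - u)| <= h / 2 -> qpar h z = qpar h u -> z = u.
Proof.
move=> zu E; apply/eqP; rewrite -subr_eq0.
have : (z - u) / h%:C = 0.
  apply: e2pi_eq1.
    rewrite Re_divr normf_div (gtr0_norm h0).
    by rewrite ler_pdivrMr// mulrC.
  by rewrite mulrBl e2piD e2piN -/(qpar h z) E divff// qpar_neq0.
by move/eqP; rewrite mulf_eq0 invr_eq0 (negbTE hn0) orbF.
Qed.

(* The nonzero derivative of the local parameter makes the difference quotient of F bounded. *)
Lemma kernel_bounded F s : holo F s -> exists B r : R, 0 < r /\
  forall z, z != s -> cn (z - s) < r ->
    cn ((F z - F s) * (qpar h z / (qpar h z - qpar h s))) <= B.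
Proof.
move=> [D hD]; have [r1 r10 hr1] := hasder_lip hD.
have [E hE] : exists2 E, hasder (qpar h) s E & E != 0.
  exists (2 * pi%:C * 'i%C * qpar h s * (h%:C)^-1).
    apply: (@hasder_comp _ (fun z => z / h%:C) (@e2pi R)); last exact: hasder_e2pi.
    have := hasder_scale (h%:C)^-1 (hasder_id s); rewrite mulr1.
    by apply: hasder_ext => z; rewrite mulrC.
  by apply: mulf_neq0; [apply: mulf_neq0; [exact: twopii_neq0|exact: qpar_neq0]|rewrite invr_neq0].
rewrite -cn_gt0 => E0.
have [r2 r20 hr2] := hE _ (divr_gt0 E0 (@ltr0n R 2)).
have [r3 r30 hr3] := hasder_cont hE ltr01.
exists ((cn D + 1) * (cn (qpar h s) + 1) * (2 / cn E)), (Num.min r1 (Num.min r2 r3)).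
split; first by rewrite !lt_min r10 r20 r30.
move=> z zs; rewrite !lt_min => /and3P[/hr1 h1 /hr2 h2 /hr3 h3].
have nz : 0 < cn (z - s) by rewrite cn_gt0 subr_eq0.
have low : cn E / 2 * cn (z - s) <= cn (qpar h z - qpar h s).
  have := cn_sub_ge (E * (z - s)) (qpar h z - qpar h s).
  rewrite (cnBC (E * _)) cnM => hh; lra.
have pos : 0 < cn (qpar h z - qpar h s) by apply: lt_le_trans low; rewrite mulr_gt0// divr_gt0.
have qz : cn (qpar h z) <= cn (qpar h s) + 1.
  by have := cn_sub_ge (qpar h z) (qpar h s); lra.
rewrite [X in cn X]mulrA cnf. rewrite ler_pdivrMr// cnM.
apply: (@le_trans _ _ ((cn D + 1) * cn (z - s) * (cn (qpar h s) + 1))).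
  by rewrite ler_pM// ?cn_ge0.
have D0 := cn_ge0 D; have S0 := cn_ge0 (qpar h s).
rewrite [leLHS](_ : _ = (cn D + 1) * (cn (qpar h s) + 1) * (2 / cn E) * (cn E / 2 * cn (z - s))).
  apply: ler_wpM2l => //; apply: mulr_ge0; last by rewrite divr_ge0// ltW.
  by apply: mulr_ge0; lra.
by field; rewrite gt_eqF.
Qed.

(** Since dw = (2 pi i / h) w dz, the factor w / (w - w(s)) is Cauchy's kernel dw / (w - w(s)) up to
    a constant; subtracting F(s) removes the singularity at s. *)
Definition cauchy_kernel F s z : C := (F z - F s) * (qpar h z / (qpar h z - qpar h s)).

Lemma holo_kernel F s z : holo F z -> qpar h z != qpar h s -> holo (cauchy_kernel F s) z.
Proof.
move=> hF zs; apply: holo_mul; first by apply: holo_sub => //; exact: holo_cst.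
apply: holo_div; [exact: holo_qpar| |by rewrite subr_eq0].
by apply: holo_sub; [exact: holo_qpar|exact: holo_cst].
Qed.

(** In a rectangle one period wide around s, the parameter takes the value w(s) only at s, where the
    kernel stays bounded. Shrinking the contour to a square of half-side f bounds the integral by 8
    M f. *)
Lemma contour_ker F s y1 y2 : holoH F -> 0 < y1 -> y1 < complex.Im s -> complex.Im s < y2 ->
  contour (cauchy_kernel F s) (complex.Re s - h / 2) (complex.Re s + h / 2) y1 y2 = 0.
Proof.
move=> hF y10 y1s sy2; have s0 : 0 < complex.Im s by lra.
have [B [r [r0 hB]]] := kernel_bounded (hF s s0).
set x0 := complex.Re s; set y0 := complex.Im s in y1s sy2 s0 *.
have sE : s = x0 +i* y0 by exact: cplx_eq.
set a := x0 - h / 2; set b := x0 + h / 2.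
have hk x y : a <= x <= b -> y1 <= y <= y2 -> x +i* y != s -> holo (cauchy_kernel F s) (x +i* y).
  move=> hx hy xys; apply: holo_kernel; first by apply: hF => /=; lra.
  apply: contra xys => /eqP/qpar_sep -> //.
  rewrite ReD ReN /= -/x0 ler_norml; rewrite /a /b in hx; lra.
have neq x y : x != x0 \/ y != y0 -> x +i* y != s.
  by rewrite sE eq_complex /= negb_and => -[] ->; rewrite ?orbT.
pose M := `|B| + 1.
have M0 : 0 < M by rewrite ltr_wpDl.
apply: (@cn_le_small _ _ (8 * M)) => e e0.
pose f := Num.min (Num.min (h / 4) (r / 4)) (Num.min (Num.min ((y0 - y1) / 2) ((y2 - y0) / 2)) e).
have f0 : 0 < f by rewrite !lt_min !divr_gt0// ?e0 ?andbT; lra.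
have [f1 f2 f3 f4 f5] : [/\ f <= h / 4, f <= r / 4, f <= (y0 - y1) / 2, f <= (y2 - y0) / 2 & f <= e].
  by split; rewrite /f !ge_min lexx ?orbT.
have ax : a <= x0 - f by rewrite /a; lra.
have bx : x0 + f <= b by rewrite /b; lra.
have xfx : x0 - f <= x0 + f by lra.
have yfy : y0 - f <= y0 + f by lra.
have ay : y1 <= y0 - f by lra.
have by2 : y0 + f <= y2 by lra.
have nx1 : x0 - f != x0 by rewrite lt_eqF//; lra.
have nx2 : x0 + f != x0 by rewrite gt_eqF//; lra.
have ny1 : y0 - f != y0 by rewrite lt_eqF//; lra.
have ny2 : y0 + f != y0 by rewrite gt_eqF//; lra.
have f42 : 2 * f < r by lra.
clear f1 f2 f3 f4 y10 y1s sy2 hF e0.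
rewrite (@contour_box _ _ a (x0 - f) (x0 + f) b y1 (y0 - f) (y0 + f) y2)//; last first.
  move=> x y hx hy hbox; apply: hk => //; apply: neq; apply/orP.
  rewrite -negb_and; apply/negP => /andP[/eqP xe /eqP ye]; move: hbox.
  by rewrite xe ye => /or4P[] H; clear -H f0; lra.
have bM x y : x0 - f <= x <= x0 + f -> y0 - f <= y <= y0 + f -> x != x0 \/ y != y0 ->
    cn (cauchy_kernel F s (x +i* y)) <= M.
  move=> hx hy hn; apply: le_trans (hB _ (neq _ _ hn) _) _; last first.
    by rewrite /M (le_trans (ler_norm _))// lerDl.
  apply: le_lt_trans (cn_ReIm _) _; rewrite ReD ImD ReN ImN /= -/x0 -/y0.
  apply: le_lt_trans f42; rewrite mulr_natl mulr2n.
  by apply: lerD; rewrite ler_distl.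
have cH y : y0 - f <= y <= y0 + f -> y != y0 ->
    contI (x0 - f) (x0 + f) (fun x => cauchy_kernel F s (x +i* y)).
  move=> /andP[p1 p2] ny; apply: contI_horizontal => x /andP[p3 p4]; apply/holo_cont/hk.
  - by rewrite (le_trans ax)// (le_trans p4).
  - by rewrite (le_trans ay)// (le_trans p2).
  - by apply: neq; right.
have cV x : x0 - f <= x <= x0 + f -> x != x0 ->
    contI (y0 - f) (y0 + f) (fun y => cauchy_kernel F s (x +i* y)).
  move=> /andP[p1 p2] ny; apply: contI_vertical => y /andP[p3 p4]; apply/holo_cont/hk.
  - by rewrite (le_trans ax)// (le_trans p2).
  - by rewrite (le_trans ay)// (le_trans p4).
  - by apply: neq; left.
apply: (@le_trans _ _ (2 * M * (((x0 + f) - (x0 - f)) + ((y0 + f) - (y0 - f))))).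
  apply: contour_bound_sides => //.
  - by apply: cH; rewrite ?lexx.
  - by apply: cH; rewrite ?lexx ?yfy.
  - by apply: cV; rewrite ?lexx.
  - by apply: cV; rewrite ?lexx ?xfx.
  - by move=> x hx; split; apply: bM; rewrite ?lexx ?yfy //; right.
  - by move=> y hy; split; apply: bM; rewrite ?lexx ?xfx //; left.
rewrite [leLHS](_ : _ = 8 * M * f); last by ring.
by rewrite ler_wpM2l// mulr_ge0// ltW.
Qed.

End CauchyHalfPlane.

Section CauchyFormula.
Variable R : realType.
Local Notation C := R[i].
Implicit Types (z u v p s : C) (x y e t a b c d : R) (F G Q : C -> C).
Variable h : R.
Hypothesis h0 : 0 < h.

Let hn0 : h%:C != 0 :> C.
Proof. by rewrite -cn_gt0 cn_real normr_gt0 gt_eqF. Qed.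

Lemma contI_line F a b y : (forall x, holo F (x +i* y)) -> contI a b (fun x => F (x +i* y)).
Proof. by move=> hF; apply: contI_horizontal => x _; exact/holo_cont/hF. Qed.

Let contI_lineH F a b y : holoH F -> 0 < y -> contI a b (fun x => F (x +i* y)).
Proof. by move=> hF y0; apply: contI_line => x; exact: hF. Qed.

Let neq_line s y x : y < complex.Im s -> qpar h (x +i* y) != qpar h s.
Proof.
move=> ys; apply/eqP => /(congr1 (@cn R)) E; have := @cn_qpar_lt R h h0 (x +i* y) s ys.
by rewrite E ltxx.
Qed.

Let shiftE x y : (x + h) +i* y = x +i* y + h%:C.
Proof. by apply: cplx_eq; rewrite !(ReD, ImD) /= ?addr0. Qed.

(** On a rectangle one period wide the vertical sides cancel by periodicity. As the top rises, F
    stays bounded there while the kernel tends to 0 like w; so the bottom side contributes 0 as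
    well. *)
Let line_ker_eq0 F s y1 : holoH F -> perH h F -> bigO h 0 F -> 0 < y1 -> y1 < complex.Im s ->
  intg (fun x => cauchy_kernel h F s (x +i* y1)) (complex.Re s - h / 2) (complex.Re s + h / 2) = 0.
Proof.
move=> hF pF [Y [B hB]] y10 y1s; have s0 : 0 < complex.Im s by lra.
set a := complex.Re s - h / 2; set b := complex.Re s + h / 2.
have hh := h0.
have ab : a <= b by rewrite /a /b; lra.
have bah : b = a + h by rewrite /a /b; lra.
have q0 : 0 < cn (qpar h s) by rewrite cn_gt0 qpar_neq0.
pose K := (`|B| + cn (F s) + 1) * 2 / cn (qpar h s) * h.
have K0 : 0 < K.
  rewrite /K; apply: mulr_gt0 => //; apply: divr_gt0 => //; apply: mulr_gt0 => //.
  by rewrite ltr_wpDl// addr_ge0// cn_ge0.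
apply: (@cn_le_small _ _ K) => e e0.
have [Y1 hY1] := @qpar_small R h h0 _ e0.
have [Y2 hY2] := @qpar_small R h h0 _ (divr_gt0 q0 (@ltr0n R 2)).
pose y2 := Num.max (Num.max (complex.Im s) Y) (Num.max Y1 Y2) + 1.
have [m1 m2 m3 m4] : [/\ complex.Im s < y2, Y < y2, Y1 < y2 & Y2 < y2].
  by split; rewrite /y2 ltr_pwDr// !le_max lexx ?orbT.
have hk x y : 0 < y -> y != complex.Im s -> holo (cauchy_kernel h F s) (x +i* y).
  move=> yp ys; apply: holo_kernel; first exact: hF.
  apply/eqP => /(congr1 (@cn R)) E; case: (ltgtP y (complex.Im s)) ys => // ys _.
    by have := @cn_qpar_lt R h h0 (x +i* y) s ys; rewrite E ltxx.
  by have := @cn_qpar_lt R h h0 s (x +i* y) ys; rewrite E ltxx.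
have nb : `|complex.Re s - h / 2 - complex.Re s| = h / 2 by rewrite addrAC subrr add0r normrN ger0_norm// ltW// divr_gt0.
have hk2 x y : 0 < y -> x != complex.Re s -> a <= x <= b -> holo (cauchy_kernel h F s) (x +i* y).
  move=> yp xs hx; apply: holo_kernel; first exact: hF.
  apply/eqP => /(qpar_sep h0) E; move: xs; rewrite -E ?eqxx//.
  by rewrite ReD ReN /= ler_norml; rewrite /a /b in hx; lra.
have := @contour_ker R h h0 F s y1 y2 hF y10 y1s m1; rewrite -/a -/b /contour.
have an : a != complex.Re s by rewrite lt_eqF// /a; lra.
have -> : intg (fun y => cauchy_kernel h F s (b +i* y)) y1 y2 = intg (fun y => cauchy_kernel h F s (a +i* y)) y1 y2.
  apply: intg_eq; first lra.
    apply: contI_vertical => y hy; apply: holo_cont; apply: hk2; [lra| |lra].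
    by rewrite gt_eqF// /b; lra.
  by move=> y hy; rewrite bah shiftE /cauchy_kernel (qpar_per h0) pF//=; lra.
rewrite addrAC addrK => /eqP; rewrite subr_eq0 => /eqP ->.
apply: (@le_trans _ _ ((`|B| + cn (F s) + 1) * (e * 2 / cn (qpar h s)) * (b - a))); last first.
  by rewrite /K bah le_eqVlt; apply/orP; left; apply/eqP; ring.
apply: intg_bound => //.
  by apply: contI_line => x; apply: hk; [lra|rewrite gt_eqF].
move=> x hx; rewrite /cauchy_kernel cnM.
have hz : Y < complex.Im (x +i* y2) by [].
apply: ler_pM; rewrite ?cn_ge0//.
  have := hB _ hz; rewrite expr0 mulr1 => h1; have := cnB (F (x +i* y2)) (F s).
  by have := ler_norm B; lra.
have := hY1 (x +i* y2) m3; have := hY2 (x +i* y2) m4; set w := qpar h _ => w1 w2.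
have low : cn (qpar h s) / 2 <= cn (w - qpar h s).
  by have := cn_sub_ge (qpar h s) w; rewrite cnBC; lra.
rewrite cnf ler_pdivrMr; last by apply: lt_le_trans low; rewrite divr_gt0.
apply: (@le_trans _ _ (e * 2 / cn (qpar h s) * (cn (qpar h s) / 2))).
  by rewrite [leRHS](_ : _ = e) ?ltW//; field; rewrite gt_eqF.
by apply: ler_wpM2l low; apply: divr_ge0; [apply: mulr_ge0 => //; exact: ltW|exact: cn_ge0].
Qed.

(** The integrand is a nonzero power of w, which has a primitive with the same period. *)
Let line_q_eq0 s a y n : intg (fun x => (qpar h s / qpar h (x +i* y)) ^+ n.+1) a (a + h) = 0.
Proof.
pose k : C := - (2 * pi%:C * 'i%C * (n.+1%:R / h%:C)).
have kn0 : k != 0.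
  rewrite oppr_eq0 mulf_neq0 ?twopii_neq0// mulf_neq0 ?pnatr_eq0// invr_neq0//.
have E z : (qpar h s / qpar h z) ^+ n.+1 = qpar h s ^+ n.+1 * e2pi (- (n.+1%:R / h%:C) * z).
  have -> : e2pi (- (n.+1%:R / h%:C) * z) = (qpar h z ^+ n.+1)^-1.
    by rewrite -e2piMn -e2piN; congr e2pi; field.
  by rewrite exprMn exprVn.
pose Q z : C := qpar h s ^+ n.+1 * k^-1 * e2pi (- (n.+1%:R / h%:C) * z).
pose G z : C := qpar h s ^+ n.+1 * e2pi (- (n.+1%:R / h%:C) * z).
have -> : (fun x => (qpar h s / qpar h (x +i* y)) ^+ n.+1) = (fun x => G (x +i* y)).
  by apply/funext => x; rewrite E.
rewrite (@intg_horizontal_prim R Q G); last 2 first.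
- by rewrite lerDl ltW.
- move=> x _; have h1 := hasder_scale (- (n.+1%:R / h%:C)) (hasder_id (x +i* y)).
  have := hasder_scale (qpar h s ^+ n.+1 * k^-1) (hasder_comp h1 (hasder_e2pi _)).
  apply: hasder_eq.
  rewrite [LHS](_ : _ = qpar h s ^+ n.+1 * k^-1 * (k * e2pi (- (n.+1%:R / h%:C) * (x +i* y)))).
    by rewrite mulrA divfK.
  by rewrite /k; ring.
rewrite /Q shiftE mulrDr e2piD.
have -> : - (n.+1%:R / h%:C) * h%:C = - n.+1%:R by field.
by rewrite e2piN e2pi_nat invr1 mulr1 subrr.
Qed.


Let kq s z : C := qpar h z / (qpar h z - qpar h s).

Let kq_bound s y1 x : y1 < complex.Im s ->
  cn (kq s (x +i* y1)) <= (1 - cn (qpar h s) / cn (qpar h (0 +i* y1)))^-1.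
Proof.
move=> ys; have E : cn (qpar h (x +i* y1)) = cn (qpar h (0 +i* y1)) by rewrite !cn_qpar.
have := @cn_qpar_lt R h h0 (x +i* y1) s ys; rewrite /kq cnf E; set q := cn (qpar h (0 +i* y1)) => lt.
have q0 : 0 < q by apply: le_lt_trans lt; exact: cn_ge0.
have low := cn_sub_ge (qpar h (x +i* y1)) (qpar h s); rewrite E -/q in low.
have d0 : 0 < q - cn (qpar h s) by lra.
apply: (@le_trans _ _ (q / (q - cn (qpar h s)))).
  by rewrite ler_pM2l// lef_pV2// ?posrE//; apply: lt_le_trans low.
by rewrite le_eqVlt; apply/orP; left; apply/eqP; field; rewrite !gt_eqF//=; lra.
Qed.

Let holo_kq s z : qpar h z != qpar h s -> holo (kq s) z.
Proof.
move=> zs; apply: holo_div; [exact: holo_qpar| |by rewrite subr_eq0].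
by apply: holo_sub; [exact: holo_qpar|exact: holo_cst].
Qed.

Let contI_kq s a b y : y < complex.Im s -> contI a b (fun x => kq s (x +i* y)).
Proof. by move=> ys; apply: contI_line => x; apply: holo_kq; exact: neq_line. Qed.

Let kq_pow s x y n : y < complex.Im s -> (qpar h s / qpar h (x +i* y)) ^+ n * kq s (x +i* y) =
  (qpar h s / qpar h (x +i* y)) ^+ n + (qpar h s / qpar h (x +i* y)) ^+ n.+1 * kq s (x +i* y).
Proof.
move=> ys; rewrite exprSr -mulrA -[X in _ = X + _]mulr1 -mulrDr; congr (_ * _).
have := neq_line x ys; rewrite -subr_eq0 /kq => nz; field.
by rewrite nz qpar_neq0.
Qed.

(** Expand w / (w - w(s)) geometrically in w(s) / w: only the constant term has a nonzero integral
    over a period, and the remainders tend to 0 because |w(s)| < |w| on the line. *)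
Let line_kq s a y : y < complex.Im s -> intg (fun x => kq s (x +i* y)) a (a + h) = h%:C.
Proof.
move=> ys; have aah : a <= a + h by rewrite lerDl ltW.
pose J n : C := intg (fun x => (qpar h s / qpar h (x +i* y)) ^+ n * kq s (x +i* y)) a (a + h).
have hpow n z : holo (fun z => (qpar h s / qpar h z) ^+ n) z.
  apply: holo_exp; apply: holo_div; [exact: holo_cst|exact: holo_qpar|exact: qpar_neq0].
have cpow n : contI a (a + h) (fun x => (qpar h s / qpar h (x +i* y)) ^+ n).
  by apply: (@contI_line (fun z => (qpar h s / qpar h z) ^+ n)) => x; exact: hpow.
have cpk n : contI a (a + h) (fun x => (qpar h s / qpar h (x +i* y)) ^+ n * kq s (x +i* y)).
  apply: (@contI_line (fun z => (qpar h s / qpar h z) ^+ n * kq s z)) => x.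
  by apply: holo_mul; [exact: hpow|apply: holo_kq; exact: neq_line].
have JS n : J n = intg (fun x => (qpar h s / qpar h (x +i* y)) ^+ n) a (a + h) + J n.+1.
  by rewrite -intg_add//; apply: intg_eq => // x _; exact: kq_pow.
have J1 n : J 1%N = J n.+1 by elim: n => // n ->; rewrite JS line_q_eq0 add0r.
pose t := cn (qpar h s) / cn (qpar h (0 +i* y)).
have q0 : 0 < cn (qpar h (0 +i* y)) by rewrite cn_gt0 qpar_neq0.
have t0 : 0 <= t by rewrite divr_ge0// cn_ge0.
have t1 : t < 1 by rewrite ltr_pdivrMr// mul1r cn_qpar_lt.
have J10 : J 1%N = 0.
  apply: (@cn_le_small _ _ ((1 - t)^-1 * h)) => e e0.
  have [n hn] : exists n, t ^+ n <= e.
    have : (fun n => t ^+ n) @ \oo --> (0 : R) by apply: cvg_expr; rewrite ger0_norm.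
    move=> /cvgrPdist_le /(_ _ e0)[N _ hN]; exists N; have := hN N (leqnn N).
    by rewrite /= sub0r normrN ger0_norm// exprn_ge0.
  rewrite (J1 n); apply: le_trans (intg_bound aah (cpk _) (M := e * (1 - t)^-1) _) _; last first.
    by rewrite addrAC subrr add0r le_eqVlt; apply/orP; left; apply/eqP; ring.
  move=> x _; rewrite cnM; apply: ler_pM; rewrite ?cn_ge0//; last exact: kq_bound.
  apply: le_trans hn; rewrite cnX cnf.
  have -> : cn (qpar h (x +i* y)) = cn (qpar h (0 +i* y)) by rewrite !cn_qpar.
  by rewrite -/t exprS ler_piMl ?exprn_ge0// ltW.
have := JS 0%N; rewrite J10 addr0 /J => E.
have -> : intg (fun x => kq s (x +i* y)) a (a + h) =
    intg (fun x => (qpar h s / qpar h (x +i* y)) ^+ 0 * kq s (x +i* y)) a (a + h).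
  by apply: intg_eq => //; [exact: contI_kq|move=> x _; rewrite expr0 mul1r].
rewrite E (@intgE _ _ _ _ (fun x => x%:C))//; first by rewrite -rmorphB addrAC subrr add0r.
move=> x _ e e0; exists 1 => // u _ _.
by rewrite expr0 mul1r rmorphB subrr cn0 mulr_ge0// ltW.
Qed.

(* Cauchy's formula for a periodic function, with the kernel w / (w - w0) in the local
   parameter w = exp (2 pi i z / h) at infinity. *)
Lemma cauchy_line F s y1 : holoH F -> perH h F -> bigO h 0 F -> 0 < y1 -> y1 < complex.Im s ->
  intg (fun x => F (x +i* y1) * (qpar h (x +i* y1) / (qpar h (x +i* y1) - qpar h s)))
    (complex.Re s - h / 2) (complex.Re s - h / 2 + h) = h%:C * F s.
Proof.
move=> hF pF bF y10 ys; have := line_ker_eq0 hF pF bF y10 ys.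
have -> : complex.Re s + h / 2 = complex.Re s - h / 2 + h by field.
set a := complex.Re s - h / 2; have aah : a <= a + h by rewrite lerDl ltW.
have cFk : contI a (a + h) (fun x => F (x +i* y1) * kq s (x +i* y1)).
  apply: (@contI_line (fun z => F z * kq s z)) => x.
  by apply: holo_mul; [apply: hF|apply: holo_kq; exact: neq_line].
have ck := @contI_kq s a (a + h) _ ys.
rewrite -/(kq s _) => E.
suff : intg (fun x => F (x +i* y1) * kq s (x +i* y1)) a (a + h) + - F s * h%:C = 0.
  by move=> /eqP; rewrite mulNr subr_eq0 => /eqP ->; rewrite mulrC.
rewrite -(@line_kq s a _ ys) -intg_scale// -intg_add//; last exact: contI_scale.
rewrite -{}[RHS]E; apply: intg_eq => //; first by apply: contI_add => //; exact: contI_scale.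
by move=> x _; rewrite /cauchy_kernel /kq; ring.
Qed.

(* Schwarz lemma at infinity *)
Lemma schwarz_line F s y1 m M : holoH F -> perH h F -> bigO h m F -> 0 < y1 -> y1 < complex.Im s ->
  (forall x, complex.Re s - h / 2 <= x <= complex.Re s + h / 2 -> cn (F (x +i* y1)) <= M) ->
  cn (F s) <= expR (- (2 * pi / h * (complex.Im s - y1))) ^+ m /
    (1 - expR (- (2 * pi / h * (complex.Im s - y1)))) * M.
Proof.
move=> hF pF [Y [B hB]] y10 ys hM; set t := expR _.
set w1 := cn (qpar h (0 +i* y1)); have w10 : 0 < w1 by rewrite cn_gt0 qpar_neq0.
have tE : t = cn (qpar h s) / w1.
  by rewrite /w1 !cn_qpar -expRN -expRD; congr expR => /=; ring.
(* Cauchy's formula is applied to F / w^m, which is still bounded at infinity; |w| is constant on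
   the line of height y1. *)
pose G z : C := F z / qpar h z ^+ m.
have hG : holoH G.
  by move=> z z0; apply: holo_div; [exact: hF|apply: holo_exp; exact: holo_qpar|rewrite expf_neq0// qpar_neq0].
have pG : perH h G by move=> z z0; rewrite /G (pF _ z0) (qpar_per h0).
have bG : bigO h 0 G.
  exists Y, B => z hz; rewrite /G cnf cnX expr0 mulr1 ler_pdivrMr; first exact: hB.
  by rewrite exprn_gt0// cn_gt0 qpar_neq0.
have M0 : 0 <= M by apply: le_trans (hM (complex.Re s) _); [exact: cn_ge0|have := h0; lra].
have := cauchy_line hG pG bG y10 ys => /(congr1 (@cn R)).
rewrite cnM cn_real gtr0_norm// => E.
set a := complex.Re s - h / 2 in E hM; have aah : a <= a + h by rewrite lerDl ltW.
have cGk : contI a (a + h) (fun x => G (x +i* y1) * kq s (x +i* y1)).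
  apply: (@contI_line (fun z => G z * kq s z)) => x.
  by apply: holo_mul; [apply: hG|apply: holo_kq; exact: neq_line].
have b := intg_bound aah cGk (M := M / w1 ^+ m * (1 - t)^-1) _.
have nG : cn (G s) = cn (F s) / cn (qpar h s) ^+ m by rewrite /G cnf cnX.
have q0 : 0 < cn (qpar h s) ^+ m by rewrite exprn_gt0// cn_gt0 qpar_neq0.
have : h * cn (G s) <= M / w1 ^+ m * (1 - t)^-1 * h.
  rewrite -E; apply: le_trans (b _) _; last by rewrite addrAC subrr add0r.
  move=> x hx; rewrite cnM; apply: ler_pM; rewrite ?cn_ge0//; last by rewrite tE; exact: kq_bound.
  rewrite /G cnf cnX (_ : cn (qpar h (x +i* y1)) = w1); last by rewrite /w1 !cn_qpar.
  rewrite ler_pM2r ?invr_gt0 ?exprn_gt0//; apply: hM; rewrite /a in hx *; have := h0; lra.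
rewrite mulrC ler_pM2r// nG ler_pdivrMr// => H; apply: le_trans H _.
by rewrite tE expr_div_n le_eqVlt; apply/orP; left; apply/eqP; ring.
Qed.

Let pow_small t e : 0 <= t -> t < 1 -> 0 < e -> exists n, t ^+ n <= e.
Proof.
move=> t0 t1 e0; have : (fun n => t ^+ n) @ \oo --> (0 : R) by apply: cvg_expr; rewrite ger0_norm.
move=> /cvgrPdist_le /(_ _ e0)[N _ hN]; exists N; have := hN N (leqnn N).
by rewrite /= sub0r normrN ger0_norm// exprn_ge0.
Qed.

(** In [schwarz_line], started at half the height of s, the maximum on the line is fixed while the
    factor t^m with t < 1 tends to 0. This is the identity principle at the cusp. *)
Lemma flat_eq0 F : holoH F -> perH h F -> (forall m, bigO h m F) ->
  forall s, 0 < complex.Im s -> F s = 0.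
Proof.
move=> hF pF bF s s0; pose y1 := complex.Im s / 2.
have y10 : 0 < y1 by rewrite divr_gt0.
have y1s : y1 < complex.Im s by rewrite /y1; lra.
have ab : complex.Re s - h / 2 <= complex.Re s + h / 2 by have := h0; lra.
have [M M0 hM] := contI_bounded ab (@contI_lineH F _ _ _ hF y10).
have := schwarz_line hF pF (bF _) y10 y1s hM; set t := expR _ => H.
have t0 : 0 <= t by exact: expR_ge0.
have t1 : t < 1 by rewrite expR_lt1 oppr_lt0 mulr_gt0 ?kappa_gt0// subr_gt0.
apply: (@cn_le_small _ _ ((1 - t)^-1 * M)) => e e0.
have [n hn] := pow_small t0 t1 e0; apply: le_trans (H n) _.
rewrite -[leLHS]mulrA [leLHS]mulrC; apply: ler_wpM2l hn.
by apply: mulr_ge0; [rewrite invr_ge0 subr_ge0 ltW|exact: ltW].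
Qed.

Lemma perH_int F (n : int) z : perH h F -> 0 < complex.Im z -> F (z + (n%:~R * h)%:C) = F z.
Proof.
move=> pF; have pn (k : nat) u : 0 < complex.Im u -> F (u + (k%:R * h)%:C) = F u.
  move=> u0; elim: k => [|k ih]; first by rewrite mul0r addr0.
  rewrite -addn1 natrD mulrDl mul1r rmorphD addrA pF//.
  by rewrite ImD /= addr0.
case: n => k z0; first exact: pn.
rewrite NegzE mulrNz mulNr rmorphN -(@pn k.+1 (z - (k.+1%:R * h)%:C)) ?subrK//.
by rewrite ImD ImN /= oppr0 addr0.
Qed.

Lemma qpar_int z (n : int) : qpar h (z + (n%:~R * h)%:C) = qpar h z.
Proof.
rewrite /qpar mulrDl e2piD rmorphM mulfK// rmorph_int.
suff -> : e2pi (n%:~R : C) = 1 by rewrite mulr1.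
by case: n => k; [exact: e2pi_nat|rewrite NegzE mulrNz e2piN e2pi_nat invr1].
Qed.

Let intg_per (G : R -> C) a b : a <= b -> b <= a + h -> (forall x, G (x + h) = G x) ->
  (forall a b, contI a b G) -> intg G a (a + h) = intg G b (b + h).
Proof.
move=> ab bah pG cG; have hh := h0.
rewrite (@intg_split _ G a b (a + h))// (@intg_split _ G b (a + h) (b + h))//; last by rewrite lerD2r.
rewrite addrC; congr (_ + _).
rewrite -[RHS]intg_shift//; apply: intg_eq => //.
Qed.

(** The limit is the mean of F over a period at height 1. Cauchy's kernel is 1 plus w(s) / w times
    the kernel, so F(s) minus the mean is an integral of size |w(s)|. *)
Lemma limit_at_infinity F : holoH F -> perH h F -> bigO h 0 F ->
  exists k : C, bigO h 1 (fun z => F z - k).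
Proof.
move=> hF pF bF; have hh := h0.
pose G x : C := F (x +i* 1).
have cG a b : contI a b G by apply: contI_lineH => //; exact: ltr01.
have pG x : G (x + h) = G x by rewrite /G shiftE pF/=.
pose c := (h%:C)^-1 * intg G 0 h.
have hab : - h <= 2 * h by lra.
have [M M0 hM] := contI_bounded hab (cG _ _).
pose w1 := cn (qpar h (0 +i* 1)); have w10 : 0 < w1 by rewrite cn_gt0 qpar_neq0.
have [Y1 hY1] := @qpar_small R h h0 _ (divr_gt0 w10 (@ltr0n R 2)).
exists c, (Num.max 1 Y1), (M * 2 / w1) => s.
rewrite gt_max expr1 => /andP[s1 /hY1 qs].
(* Moving s into 0 <= Re < h keeps the path of integration inside [-h, 2h], where the single bound M
   is available. *)
pose n : int := - Num.floor (complex.Re s / h).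
pose s' := s + (n%:~R * h)%:C.
have Is : complex.Im s' = complex.Im s by rewrite ImD /= addr0.
have [r0 r1] : 0 <= complex.Re s' /\ complex.Re s' < h.
  rewrite ReD /= /n mulrNz mulNr; have := floor_le (complex.Re s / h).
  have := lt_succ_floor (complex.Re s / h).
  rewrite ltr_pdivrMr// ler_pdivlMr// intrD mulrDl mul1r; lra.
have s0 : 0 < complex.Im s by lra.
rewrite -(perH_int n pF s0) -(qpar_int s n) -/s'; rewrite -(qpar_int s n) -/s' in qs.
set a := complex.Re s' - h / 2.
have aah : a <= a + h by lra.
have s1' : 1 < complex.Im s' by rewrite Is.
have E : intg (fun x => F (x +i* 1) * kq s' (x +i* 1)) a (a + h) = h%:C * F s' :=
  cauchy_line hF pF bF ltr01 s1'.
have I0 : intg G a (a + h) = intg G 0 h.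
  have [a0|a0] := leP a 0.
    by rewrite (@intg_per G a 0)// ?add0r// /a; lra.
  by rewrite -[X in _ = intg _ _ X]add0r (@intg_per G 0 a)// ?add0r ?(ltW a0)// /a; lra.
pose Er x : C := G x * ((qpar h s' / qpar h (x +i* 1)) * kq s' (x +i* 1)).
have cE : contI a (a + h) Er.
  apply: (@contI_line (fun z => F z * ((qpar h s' / qpar h z) * kq s' z))) => x.
  apply: holo_mul; first by apply: hF; exact: ltr01.
  apply: holo_mul; last by apply: holo_kq; exact: neq_line.
  by apply: holo_div; [exact: holo_cst|exact: holo_qpar|exact: qpar_neq0].
have Fs : F s' - c = (h%:C)^-1 * intg Er a (a + h).
  have S : intg (fun x => F (x +i* 1) * kq s' (x +i* 1)) a (a + h) =
      intg G a (a + h) + intg Er a (a + h).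
    rewrite -intg_add//; apply: intg_eq => //.
      apply: (@contI_line (fun z => F z * kq s' z)) => x.
      by apply: holo_mul; [apply: hF; exact: ltr01|apply: holo_kq; exact: neq_line].
    move=> x _; rewrite /Er; have := @kq_pow s' x 1 0 s1'.
    by rewrite expr0 expr1 mul1r => {1}->; rewrite mulrDr mulr1.
  rewrite /c -I0 -[LHS](mulKf hn0) mulrBr mulVKf// -E; congr (_ * _).
  by rewrite S addrAC subrr add0r.
rewrite Fs cnM cnV cn_real gtr0_norm//.
have t1 : cn (qpar h s') / w1 <= 2^-1 by rewrite ler_pdivrMr// mulrC; lra.
have := intg_bound aah cE (M := M * (cn (qpar h s') / w1 * 2)) _.
have -> : a + h - a = h by ring.
move=> b; rewrite mulrC ler_pdivrMr//.
apply: le_trans (b _) _; last by rewrite le_eqVlt; apply/orP; left; apply/eqP; ring.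
move=> x hx; rewrite /Er cnM; apply: ler_pM; rewrite ?cn_ge0//.
  by apply: hM; rewrite /a in hx; lra.
rewrite cnM cnf (_ : cn (qpar h (x +i* 1)) = w1); last by rewrite /w1 !cn_qpar.
apply: ler_wpM2l; first by rewrite divr_ge0// cn_ge0.
apply: le_trans (kq_bound _ s1') _; rewrite -/w1 -[leRHS]invrK lef_pV2 ?posrE ?invr_gt0//; lra.
Qed.

(** Taylor expansion at w = 0, one coefficient at a time: subtract the limit at infinity, divide by
    w and repeat. *)
Lemma bigO_poly F m : holoH F -> perH h F -> bigO h 0 F ->
  exists p : {poly C}, bigO h m (fun z => F z - p.[qpar h z]).
Proof.
elim: m F => [|m ih] F hF pF bF.
  by case: bF => Y [B hB]; exists 0, Y, B => z /hB; rewrite horner0 subr0.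
have [c [Y [B hB]]] := limit_at_infinity hF pF bF.
pose G z : C := (F z - c) / qpar h z.
have [|||p [Y' [B' hB']]] := ih G.
- move=> z z0; apply: holo_div; [|exact: holo_qpar|exact: qpar_neq0].
  by apply: holo_sub; [exact: hF|exact: holo_cst].
- by move=> z z0; rewrite /G (pF _ z0) (qpar_per h0).
- exists Y, B => z /hB; rewrite /G cnf expr1 expr0 mulr1 ler_pdivrMr//.
  by rewrite cn_gt0 qpar_neq0.
exists (c%:P + 'X * p), (Num.max Y Y'), B' => z; rewrite gt_max => /andP[_ /hB'].
rewrite !hornerE => H.
rewrite [X in cn X](_ : _ = (G z - p.[qpar h z]) * qpar h z); last first.
  by rewrite /G; field; exact: qpar_neq0.
by rewrite cnM exprSr mulrA ler_wpM2r// cn_ge0.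
Qed.

Lemma hasder_quadratic F G z k (B : R) : hasder G z k ->
  nearC z (fun u => cn (F u - G u) <= B * cn (u - z) ^+ 2) -> hasder F z k.
Proof.
move=> hG near; have Fz : F z = G z.
  apply/eqP; rewrite -subr_eq0 -cn_eq0; apply/eqP/le_anti; rewrite cn_ge0 andbT.
  by have := nearC_self near; rewrite subrr cn0 expr0n mulr0.
move=> e e0; have e2 : 0 < e / 2 by rewrite divr_gt0.
have [r r0 hr] := hG _ e2; case: near => r' r'0 hr'.
have B1 : 0 < `|B| + 1 by rewrite ltr_wpDl.
exists (Num.min r (Num.min r' (e / 2 / (`|B| + 1)))); first by rewrite !lt_min r0 r'0 divr_gt0.
move=> u; rewrite !lt_min => /and3P[/hr h1 /hr' h2]; rewrite ltr_pdivlMr// => h3.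
rewrite [X in cn X](_ : _ = (F u - G u) + (G u - G z - k * (u - z))); last by rewrite Fz; ring.
apply: le_trans (cnD _ _) _.
suff : cn (F u - G u) <= e / 2 * cn (u - z) by lra.
apply: le_trans h2 _; rewrite expr2 mulrA; apply: ler_wpM2r; first exact: cn_ge0.
apply: le_trans (ltW h3); rewrite mulrC; apply: ler_wpM2l; first exact: cn_ge0.
by apply: le_trans (ler_norm B) _; rewrite lerDl.
Qed.

Let kq_lower s s0 y1 x : y1 < complex.Im s -> cn (qpar h s) <= cn (qpar h s0) ->
  cn (qpar h (0 +i* y1)) - cn (qpar h s0) <= cn (qpar h (x +i* y1) - qpar h s).
Proof.
move=> ys ss; have -> : cn (qpar h (0 +i* y1)) = cn (qpar h (x +i* y1)) by rewrite !cn_qpar.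
have := cn_sub_ge (qpar h (x +i* y1)) (qpar h s); lra.
Qed.

(* Weierstrass' theorem, by differentiating Cauchy's formula under the integral sign. *)
Lemma holoH_limit (u : nat -> C -> C) F :
  (forall n, holoH (u n)) -> (forall n, perH h (u n)) -> (forall n, bigO h 0 (u n)) ->
  (forall y1 e, 0 < y1 -> 0 < e -> exists N : nat, forall n, (N <= n)%N ->
     forall z, y1 <= complex.Im z -> cn (u n z - F z) <= e) -> holoH F.
Proof.
move=> hu pu bu hlim s0 s00; have hh := h0.
pose y1 := complex.Im s0 / 2; have y10 : 0 < y1 by rewrite divr_gt0.
pose y2 := complex.Im s0 * (3 / 4).
pose G x : C := F (x +i* y1).
have cG a b : contI a b G.
  move=> x hx e e0; have e3 : 0 < e / 3 by rewrite divr_gt0.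
  have [N hN] := hlim y1 _ y10 e3; have hN1 x' := hN N (leqnn N) (x' +i* y1) (lexx _).
  have [r r0 hr] := @contI_lineH (u N) a b _ (hu N) y10 x hx _ e3; exists r => // y hy hyx.
  have t1 := hr y hy hyx; have t2 := hN1 x; have t3 := hN1 y.
  apply: le_trans (cnD3 _ (u N (y +i* y1)) _) _; rewrite cnBC.
  have := cnD3 (u N (y +i* y1)) (u N (x +i* y1)) (F (x +i* y1)); rewrite /G; lra.
(* For all s with |Re s - Re s0| <= h / 4 the point Re s - h / 2 lies between a and a + h, so by
   periodicity one path serves all these s. *)
pose a := complex.Re s0 - h / 2 - h / 4.
have aah : a <= a + h by lra.
pose q2 := cn (qpar h (0 +i* y2)); pose q1 := cn (qpar h (0 +i* y1)).
have q12 : q2 < q1 by apply: cn_qpar_lt => //=; rewrite /y1 /y2; lra.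
have d0 : 0 < q1 - q2 by lra.
have near_s s : cn (s - s0) < Num.min (h / 4) (complex.Im s0 / 4) ->
    [/\ y2 < complex.Im s, y1 < complex.Im s & `|complex.Re s - complex.Re s0| <= h / 4].
  rewrite lt_min => /andP[n1 n2]; have := cn_Re (s - s0); have := cn_Im (s - s0).
  rewrite ReD ImD ReN ImN => i1 i2; have : `|complex.Im s - complex.Im s0| < complex.Im s0 / 4 by lra.
  rewrite ltr_norml => i3; rewrite /y1 /y2; split; try lra.
have low s x : y2 < complex.Im s -> q1 - q2 <= cn (qpar h (x +i* y1) - qpar h s).
  move=> ys; apply: (@kq_lower s (0 +i* y2)).
    by apply: le_lt_trans ys; rewrite /y1 /y2; lra.
  by apply/ltW/cn_qpar_lt.
(* Cauchy's formula passes to the limit F, by uniform convergence on the line of height y1 and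
   convergence at s. *)
have formula s : cn (s - s0) < Num.min (h / 4) (complex.Im s0 / 4) ->
    intg (fun x => G x * kq s (x +i* y1)) a (a + h) = h%:C * F s.
  move=> /near_s[ys2 ys1 hre]; have ck := @contI_kq s a (a + h) _ ys1.
  have cGk : contI a (a + h) (fun x => G x * kq s (x +i* y1)) by exact: contI_mul.
  apply/eqP; rewrite -subr_eq0; apply/eqP.
  apply: (@cn_le_small _ _ (q1 / (q1 - q2) * h + h)) => e e0.
  have [N hN] := hlim y1 _ y10 e0; have {}hN := hN N (leqnn N).
  have cu : contI a (a + h) (fun x => u N (x +i* y1) * kq s (x +i* y1)).
    by apply: contI_mul => //; exact: contI_lineH.
  have E : intg (fun x => u N (x +i* y1) * kq s (x +i* y1)) a (a + h) = h%:C * u N s.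
    rewrite -(cauchy_line (hu N) (pu N) (bu N) y10 ys1).
    apply: (@intg_per (fun x => u N (x +i* y1) * kq s (x +i* y1))).
    - by rewrite ler_norml in hre; rewrite /a; lra.
    - by rewrite ler_norml in hre; rewrite /a; lra.
    - by move=> x; rewrite shiftE pu//= /kq (qpar_per h0).
    - move=> a' b' x hx; have ab' : a' <= b' by case/andP: hx => p1 p2; exact: le_trans p1 p2.
      have c1 := @contI_lineH (u N) a' b' y1 (hu N) y10.
      exact: contI_mul ab' c1 (@contI_kq s a' b' y1 ys1) _ hx.
  have D : intg (fun x => G x * kq s (x +i* y1)) a (a + h) - h%:C * F s =
     intg (fun x => G x * kq s (x +i* y1) + -1 * (u N (x +i* y1) * kq s (x +i* y1))) a (a + h)
     + h%:C * (u N s - F s).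
    by rewrite intg_add ?intg_scale// ?E; [ring|exact: contI_scale].
  rewrite D mulrDl; apply: le_trans (cnD _ _) _; apply: lerD.
    apply: le_trans (intg_bound aah _ (M := q1 / (q1 - q2) * e) _) _.
    - by apply: contI_add => //; exact: contI_scale.
    - move=> x hx; rewrite (_ : _ + _ = kq s (x +i* y1) * (G x - u N (x +i* y1))); last by ring.
      rewrite cnM; apply: ler_pM; rewrite ?cn_ge0//; last by rewrite cnBC hN.
      rewrite /kq cnf (_ : cn (qpar h (x +i* y1)) = q1); last by rewrite /q1 !cn_qpar.
      rewrite ler_pM2l; last by rewrite /q1 cn_gt0 qpar_neq0.
      by rewrite lef_pV2 ?posrE//; [exact: low|apply: lt_le_trans d0 (low _ _ ys2)].
    - by rewrite (_ : a + h - a = h) ?le_eqVlt; [apply/orP; left; apply/eqP; ring|ring].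
  rewrite cnM cn_real gtr0_norm// ler_pM2l//; apply: hN; exact: ltW.
have s0n : cn (s0 - s0) < Num.min (h / 4) (complex.Im s0 / 4).
  by rewrite subrr cn0 lt_min !divr_gt0.
have [MG MG0 hMG] := contI_bounded aah (cG a (a + h)).
pose k2 s0 z : C := qpar h z / (qpar h z - qpar h s0) ^+ 2.
have [ys02 ys01 _] := near_s _ s0n.
have ck2 : contI a (a + h) (fun x => G x * k2 s0 (x +i* y1)).
  apply: contI_mul => //; apply: contI_line => x.
  apply: holo_div; [exact: holo_qpar| |by rewrite expf_neq0// subr_eq0 neq_line].
  by apply: holo_exp; apply: holo_sub; [exact: holo_qpar|exact: holo_cst].
pose A := (h%:C)^-1 * intg (fun x => G x * k2 s0 (x +i* y1)) a (a + h).
have [w' hw'] := holo_qpar h s0.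
have [rl rl0 hrl] := hasder_lip hw'.
exists (A * w').
pose Bq := MG * (q1 / (q1 - q2) ^+ 3).
apply: (@hasder_quadratic F (fun s => F s0 + A * (qpar h s - qpar h s0)) s0 _ (Bq * (cn w' + 1) ^+ 2)).
  have := hasder_add (hasder_cst (F s0 - A * qpar h s0) s0) (hasder_scale A hw'); rewrite add0r.
  by apply: hasder_ext => s; ring.
exists (Num.min rl (Num.min (h / 4) (complex.Im s0 / 4))).
  by rewrite !lt_min rl0 !divr_gt0.
move=> s; rewrite lt_min => /andP[/hrl lips hs]; have [ys2 ys1 _] := near_s _ hs.
(* With v = w(s) - w(s0) and x = w - w(s0), one has 1 / (x - v) = 1 / x + v / x^2 + v^2 / (x^2 (x -
   v)); [k3] is the kernel of the quadratic remainder. *)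
pose k3 z : C := qpar h z / ((qpar h z - qpar h s) * (qpar h z - qpar h s0) ^+ 2).
have ck3 : contI a (a + h) (fun x => G x * k3 (x +i* y1)).
  apply: contI_mul => //; apply: contI_line => x.
  apply: holo_div; [exact: holo_qpar| |by rewrite mulf_neq0 ?expf_neq0// subr_eq0 neq_line].
  apply: holo_mul; first by apply: holo_sub; [exact: holo_qpar|exact: holo_cst].
  by apply: holo_exp; apply: holo_sub; [exact: holo_qpar|exact: holo_cst].
have E : F s - (F s0 + A * (qpar h s - qpar h s0)) =
    (qpar h s - qpar h s0) ^+ 2 * ((h%:C)^-1 * intg (fun x => G x * k3 (x +i* y1)) a (a + h)).
  have S : intg (fun x => G x * kq s (x +i* y1)) a (a + h) =
     intg (fun x => G x * kq s0 (x +i* y1)) a (a + h) +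
     ((qpar h s - qpar h s0) * intg (fun x => G x * k2 s0 (x +i* y1)) a (a + h) +
      (qpar h s - qpar h s0) ^+ 2 * intg (fun x => G x * k3 (x +i* y1)) a (a + h)).
    have c0 : contI a (a + h) (fun x => G x * kq s0 (x +i* y1)).
      by apply: contI_mul => //; exact: contI_kq.
    have t1 := contI_scale (qpar h s - qpar h s0) ck2.
    have t2 := contI_scale ((qpar h s - qpar h s0) ^+ 2) ck3.
    rewrite -(intg_scale _ aah ck2) -(intg_scale _ aah ck3) -(intg_add aah t1 t2).
    rewrite -(intg_add aah c0 (contI_add t1 t2)).
    apply: (intg_eq aah (contI_mul aah (cG _ _) (@contI_kq s a (a + h) y1 ys1))).
    move=> x _; rewrite /kq /k2 /k3.
    have n1 := neq_line x ys1; have n2 := neq_line x ys01; rewrite -subr_eq0 in n1; rewrite -subr_eq0 in n2.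
    by field; rewrite n1 n2.
  rewrite (formula _ hs) (formula _ s0n) in S.
  have -> : F s = (h%:C)^-1 * (h%:C * F s) by rewrite mulKf.
  by rewrite S /A; field.
rewrite E cnM cnX; have n0 := cn_ge0 (s - s0).
have I : cn ((h%:C)^-1 * intg (fun x => G x * k3 (x +i* y1)) a (a + h)) <= Bq.
  rewrite cnM cnV cn_real gtr0_norm// mulrC ler_pdivrMr//.
  apply: le_trans (intg_bound aah ck3 (M := Bq) _) _; last by rewrite (_ : a + h - a = h)//; ring.
  move=> x hx; rewrite cnM; apply: ler_pM; rewrite ?cn_ge0//; first exact: hMG.
  rewrite /k3 cnf cnM cnX (_ : cn (qpar h (x +i* y1)) = q1); last by rewrite /q1 !cn_qpar.
  rewrite ler_pM2l; last by rewrite /q1 cn_gt0 qpar_neq0.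
  have l1 := low s x ys2; have l2 := low s0 x ys02.
  rewrite lef_pV2 ?posrE ?mulr_gt0 ?exprn_gt0//; try exact: lt_le_trans d0 _.
  rewrite exprS; apply: ler_pM; rewrite ?exprn_ge0 ?(ltW d0)//.
  by apply: lerXn2r; rewrite ?nnegrE ?cn_ge0 ?(ltW d0).
apply: le_trans (ler_pM (exprn_ge0 _ (cn_ge0 _)) (cn_ge0 _) _ I) _; last first.
  rewrite [leRHS](_ : _ = ((cn w' + 1) * cn (s - s0)) ^+ 2 * Bq)//; ring.
by apply: lerXn2r; rewrite ?nnegrE ?cn_ge0// mulr_ge0// addr_ge0// cn_ge0.
Qed.

End CauchyFormula.

(** * Identity principle on discs *)

Section LocalIdentity.
Variable R : realType.
Local Notation C := R[i].
Implicit Types (z u p : C) (r : R) (F : C -> C).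

(* A disc is uniformized by p + r exp (2 pi i z), which turns vanishing near the centre
   into vanishing near i oo. *)
Lemma disc_identity F p r : 0 < r -> (forall z, cn (z - p) < r -> holo F z) ->
  nearC p (fun z => F z = 0) -> forall z, cn (z - p) < r -> F z = 0.
Proof.
move=> r0 hF [d d0 hd] z zr.
have [->|zp] := eqVneq z p; first by apply: hd; rewrite subrr cn0.
have rn0 : r%:C != 0 :> C by rewrite -cn_gt0 cn_real normr_gt0 gt_eqF.
pose G u := F (p + r%:C * qpar 1 u).
have inr u : 0 < complex.Im u -> cn (p + r%:C * qpar 1 u - p) < r.
  move=> u0; rewrite addrAC subrr add0r cnM cn_real gtr0_norm// gtr_pMr//.
  exact: cn_qpar_lt1.
have hG : holoH G.
  move=> u u0; apply: (@holo_comp _ (fun u => p + r%:C * qpar 1 u) F).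
    by apply: holo_add; [exact: holo_cst|apply: holo_mul; [exact: holo_cst|exact: holo_qpar]].
  by apply: hF; exact: inr.
have pG : perH 1 G by move=> u _; rewrite /G qpar_per.
have bG m : bigO 1 m G.
  have [Y hY] := @qpar_small R 1 ltr01 _ (divr_gt0 d0 r0).
  exists Y, 0 => u /hY; rewrite ltr_pdivlMr// => hu; rewrite mul0r /G hd ?cn0//.
  by rewrite addrAC subrr add0r cnM cn_real gtr0_norm// mulrC.
have zr0 : (z - p) / r%:C != 0 by rewrite mulf_neq0 ?invr_neq0// subr_eq0.
have [u hu] := e2pi_surj zr0.
have E : qpar 1 u = (z - p) / r%:C by rewrite /qpar rmorph1 divr1.
have u0 : 0 < complex.Im u.
  have : cn (qpar 1 u) < 1.
    by rewrite E cnf cn_real (gtr0_norm r0) ltr_pdivrMr// mul1r.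
  by rewrite cn_qpar expR_lt1 oppr_lt0 pmulr_rgt0// (@kappa_gt0 _ 1).
have := flat_eq0 ltr01 hG pG bG u0.
by rewrite /G E mulrC divfK// addrC subrK.
Qed.

Definition blows_up F := forall A : R, exists Y : R, forall z, Y < complex.Im z -> A < cn (F z).

(* Vanishing near p propagates to the disc of radius Im p, hence upwards towards i oo. *)
Lemma blowup_not_locally_constant F p k : holoH F -> blows_up F -> 0 < complex.Im p ->
  ~ nearC p (fun z => F z = k).
Proof.
move=> hF bF p0 hp.
pose P n : C := complex.Re p +i* ((3 / 2) ^+ n * complex.Im p).
have nP n : nearC (P n) (fun z => F z - k = 0).
  elim: n => [|n ih].
    rewrite /P expr0 mul1r (_ : _ +i* _ = p); last exact: cplx_eq.
    by apply: nearC_imp hp => z ->; rewrite subrr.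
  set y := (3 / 2) ^+ n * complex.Im p.
  have y0 : 0 < y by rewrite mulr_gt0// exprn_gt0.
  have Pn : P n = complex.Re p +i* y by [].
  have h := @disc_identity (fun z => F z - k) (P n) y y0 _ ih.
  exists (y / 2); first by rewrite divr_gt0.
  move=> u hu; apply: h => [z hz|].
    apply: holo_sub; last exact: holo_cst.
    apply: hF; have := cn_Im (z - P n); rewrite ImD ImN Pn /= ler_norml; lra.
  have E : cn (P n.+1 - P n) = y / 2.
    have -> : P n.+1 - P n = 'i%C * (y / 2)%:C.
      by rewrite /P exprS; apply: cplx_eq; rewrite !(ReD, ImD, ReN, ImN, ReM, ImM) /= /y; field.
    by rewrite cnM cn_i mul1r cn_real gtr0_norm// divr_gt0.
  have := cnD3 u (P n.+1) (P n); lra.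
have [Y hY] := bF (cn k).
have [n hn] : exists n, Y < complex.Im (P n).
  exists (Num.bound (`|Y| / complex.Im p * 2)) => /=.
  set N := Num.bound _.
  have h : `|Y| / complex.Im p * 2 < N%:R.
    by apply: archi_boundP; rewrite mulr_ge0// divr_ge0// ltW.
  have h2 : (N%:R : R) / 2 + 1 <= (3 / 2) ^+ N.
    elim: N {h} => [|N ih]; first by rewrite mul0r add0r expr0.
    rewrite exprS -addn1 natrD; have : 0 <= N%:R :> R by []. lra.
  have h3 : `|Y| / complex.Im p < (3 / 2) ^+ N by lra.
  by rewrite ltr_pdivrMr// in h3; apply: le_lt_trans h3; exact: ler_norm.
have := nearC_self (nP n); move/eqP; rewrite subr_eq0 => /eqP E.
by have := hY _ hn; rewrite E ltxx.
Qed.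

End LocalIdentity.

(** * Orders of vanishing at infinity *)

Section Asymptotics.
Variable R : realType.
Local Notation C := R[i].
Implicit Types (z : C) (F G : C -> C) (m n : nat) (p q : {poly C}).
Variable h : R.
Hypothesis h0 : 0 < h.
Local Notation w := (qpar h).
Local Notation O := (bigO h).

Lemma bigO_pos m F : O m F -> exists Y B : R, [/\ 0 <= Y, 0 <= B &
  forall z, Y < complex.Im z -> cn (F z) <= B * cn (w z) ^+ m].
Proof.
move=> [Y [B hB]]; exists (Num.max 0 Y), `|B|; split; rewrite ?le_max ?lexx// => z.
rewrite gt_max => /andP[_ /hB /le_trans]; apply; apply: ler_wpM2r; last exact: ler_norm.
by rewrite exprn_ge0// cn_ge0.
Qed.

Lemma bigO_near m F G : (exists Y, forall z, Y < complex.Im z -> F z = G z) -> O m F -> O m G.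
Proof.
move=> [Y' FG] [Y [B hB]]; exists (Num.max Y Y'), B => z; rewrite gt_max => /andP[/hB + /FG <-].
by [].
Qed.

Lemma bigO_ext m F G : F =1 G -> O m F -> O m G.
Proof. by move=> /funext ->. Qed.

Lemma bigO_add m F G : O m F -> O m G -> O m (fun z => F z + G z).
Proof.
move=> [Y [B hB]] [Y' [B' hB']]; exists (Num.max Y Y'), (B + B') => z.
rewrite gt_max => /andP[/hB h1 /hB' h2]; apply: le_trans (cnD _ _) _.
by rewrite mulrDl lerD.
Qed.

Lemma bigO_mul m n F G : O m F -> O n G -> O (m + n) (fun z => F z * G z).
Proof.
move=> /bigO_pos[Y [B [_ B0 hB]]] /bigO_pos[Y' [B' [_ B0' hB']]].
exists (Num.max Y Y'), (B * B') => z.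
rewrite gt_max => /andP[/hB h1 /hB' h2]; rewrite cnM exprD.
rewrite [leRHS]mulrACA; apply: ler_pM; rewrite ?cn_ge0//.
Qed.

Lemma bigO_le m n F : (n <= m)%N -> O m F -> O n F.
Proof.
move=> nm /bigO_pos[Y [B [Y0 B0 hB]]]; exists Y, B => z hz; apply: le_trans (hB z hz) _.
apply: ler_wpM2l => //; apply: ler_wiXn2l => //; first exact: cn_ge0.
by apply: ltW; apply: cn_qpar_lt1 => //; exact: le_lt_trans hz.
Qed.

Lemma bigO_cst k : O 0 (fun=> k).
Proof. by exists 0, (cn k) => z _; rewrite expr0 mulr1. Qed.

Lemma bigO_scale m k F : O m F -> O m (fun z => k * F z).
Proof. by move=> /(bigO_mul (bigO_cst k)). Qed.

Lemma bigO_opp m F : O m F -> O m (fun z => - F z).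
Proof. by move=> [Y [B hB]]; exists Y, B => z /hB; rewrite cnN. Qed.

Lemma bigO_sub m F G : O m F -> O m G -> O m (fun z => F z - G z).
Proof. by move=> hF hG; exact: bigO_add hF (bigO_opp hG). Qed.

Lemma bigO_0 m : O m (fun=> 0).
Proof. by exists 0, 0 => z _; rewrite cn0 mul0r. Qed.

Lemma bigO_sum m (I : Type) (r : seq I) (F : I -> C -> C) :
  (forall i, O m (F i)) -> O m (fun z => \sum_(i <- r) F i z).
Proof.
move=> hF; elim: r => [|i r ih].
  by apply: bigO_ext (bigO_0 m) => z; rewrite big_nil.
by apply: bigO_ext (bigO_add (hF i) ih) => z; rewrite big_cons.
Qed.

Lemma bigO_w n : O n (fun z => w z ^+ n).
Proof. by exists 0, 1 => z _; rewrite mul1r cnX. Qed.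

Lemma bigO_horner p : O 0 (fun z => p.[w z]).
Proof.
elim/poly_ind: p => [|p k ih]; first by apply: bigO_ext (bigO_0 0) => z; rewrite horner0.
apply: bigO_ext (bigO_add (bigO_le (leq0n 1) (bigO_mul ih (bigO_w 1))) (bigO_cst k)) => z.
by rewrite !hornerE.
Qed.

Lemma bigO1_small F e : O 1 F -> 0 < e -> exists Y, forall z, Y < complex.Im z -> cn (F z) < e.
Proof.
move=> /bigO_pos[Y [B [Y0 B0 hB]]] e0; have B1 : 0 < B + 1 by lra.
have [Y' hY'] := @qpar_small R h h0 _ (divr_gt0 e0 B1).
exists (Num.max Y Y') => z; rewrite gt_max => /andP[/hB + /hY']; rewrite expr1 ltr_pdivlMr//.
have := cn_ge0 (w z); rewrite mulrDr mulr1 [cn (w z) * B]mulrC; lra.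
Qed.

Lemma bigO1_cst k : O 1 (fun=> k) -> k = 0.
Proof.
move=> hk; apply: (@cn_le_small _ _ 1) => e e0; have [Y hY] := bigO1_small hk e0.
by rewrite mul1r; apply/ltW/(hY (0 +i* (Y + 1))) => /=; rewrite ltrDl.
Qed.

Lemma bigO_divw m F : O m.+1 (fun z => F z * w z) -> O m F.
Proof.
move=> [Y [B hB]]; exists Y, B => z /hB; rewrite cnM exprSr mulrA ler_pM2r//.
by rewrite cn_gt0 qpar_neq0.
Qed.

Lemma bigO_divwn m n F : O (m + n) (fun z => F z * w z ^+ n) -> O m F.
Proof.
elim: n F => [|n ih] F; first by rewrite addn0; apply: bigO_ext => z; rewrite mulr1.
rewrite addnS => H; apply: ih; apply: bigO_divw; apply: bigO_ext H => z.
by rewrite exprSr mulrA.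
Qed.

(** Uniqueness of expansions in w: the constant term is O(w), hence zero, and dividing by w lowers m
    by one. *)
Lemma poly_flat m p : O m (fun z => p.[w z]) -> forall i, (i < m)%N -> p`_i = 0.
Proof.
elim/poly_ind: p m => [|p k ih] [|m] // H i; first by rewrite coef0.
have k0 : k = 0.
  apply: bigO1_cst; apply: bigO_ext (bigO_sub (bigO_le (ltn0Sn m) H) (bigO_mul (bigO_horner p) (bigO_w 1))) => z.
  by rewrite !hornerE addrAC subrr add0r.
rewrite coefD coefC coefMX k0; case: i => [|i] im; first by rewrite addr0.
rewrite /= addr0; apply: (ih m) => //; apply: bigO_divw.
by apply: bigO_ext H => z; rewrite !hornerE k0 addr0.
Qed.

Lemma bigO_inv F k : k != 0 -> O 1 (fun z => F z - k) -> O 0 (fun z => (F z)^-1).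
Proof.
rewrite -cn_gt0 => k0 hF; have [Y hY] := bigO1_small hF (divr_gt0 k0 (@ltr0n R 2)).
exists Y, (2 / cn k) => z /hY hz; rewrite expr0 mulr1 cnV -[leRHS]invrK.
have low : cn k / 2 < cn (F z) by have := cn_sub_ge k (F z); rewrite cnBC; lra.
rewrite lef_pV2 ?posrE ?invf_div ?ltW//; last by rewrite divr_gt0.
by apply: lt_trans low; rewrite divr_gt0.
Qed.

End Asymptotics.

(** * Expansions at infinity with coefficients in K *)

Section RationalExpansions.
Variable R : realType.
Local Notation C := R[i].
Implicit Types (z k : C) (F G : C -> C) (m n : nat) (p q : {poly C}).
Variable h : R.
Hypothesis h0 : 0 < h.
Local Notation w := (qpar h).
Local Notation O := (bigO h).
Variable K : divringClosed C.

(** A Laurent expansion over K at the cusp, in asymptotic form: w^N F agrees with a polynomial over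
    K to every order. By [poly_flat] the coefficients below the order of agreement are determined by
    F, so the polynomials for different m are compatible. *)
Definition asy F := exists N, forall m, exists2 p, p \is a polyOver K &
  O m (fun z => F z * w z ^+ N - p.[w z]).

Lemma asy_near F G : (exists Y, forall z, Y < complex.Im z -> F z = G z) -> asy F -> asy G.
Proof.
move=> [Y FG] [N hN]; exists N => m; have [p pK hp] := hN m; exists p => //.
by apply: bigO_near hp; exists Y => z /FG ->.
Qed.

Lemma asy_ext F G : F =1 G -> asy F -> asy G.
Proof. by move=> /funext ->. Qed.

Lemma asy_bound F : asy F -> exists N, O 0 (fun z => F z * w z ^+ N).
Proof.
move=> [N hN]; exists N; have [p _ hp] := hN 0%N.
by apply: bigO_ext (bigO_add hp (bigO_horner h0 p)) => z; rewrite subrK.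
Qed.

Lemma asy_cst k : k \in K -> asy (fun=> k).
Proof.
move=> kK; exists 0%N => m; exists k%:P; first by rewrite polyOverC.
by apply: bigO_ext (bigO_0 h m) => z; rewrite hornerC mulr1 subrr.
Qed.

Lemma asy_w : asy w.
Proof.
exists 0%N => m; exists 'X; first exact: polyOverX.
by apply: bigO_ext (bigO_0 h m) => z; rewrite hornerX mulr1 subrr.
Qed.

Lemma asy_widen F N N' : (N <= N')%N ->
  (forall m, exists2 p, p \is a polyOver K & O m (fun z => F z * w z ^+ N - p.[w z])) ->
  (forall m, exists2 p, p \is a polyOver K & O m (fun z => F z * w z ^+ N' - p.[w z])).
Proof.
move=> NN hN m; have [p pK hp] := hN m; exists (p * 'X^(N' - N)).
  by rewrite rpredM// rpredX// polyOverX.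
apply: bigO_ext (bigO_le h0 _ (bigO_mul hp (bigO_w h (N' - N)))) => [z|]; last exact: leq_addr.
by rewrite hornerM hornerXn mulrBl -mulrA -exprD subnKC.
Qed.

Lemma asy_add F G : asy F -> asy G -> asy (fun z => F z + G z).
Proof.
move=> [N hN] [N' hN']; exists (N + N')%N => m.
have [p pK hp] := asy_widen (leq_addr N' N) hN m.
have [q qK hq] := asy_widen (leq_addl N N') hN' m.
exists (p + q); first by rewrite rpredD.
by apply: bigO_ext (bigO_add hp hq) => z; rewrite hornerD; ring.
Qed.

Lemma asy_mul F G : asy F -> asy G -> asy (fun z => F z * G z).
Proof.
move=> aF aG; have [NG bG] := asy_bound aG; move: aF aG => [N hN] [N' hN'].
exists (N + N')%N => m.
have [p pK hp] := hN (m + NG)%N; have [q qK hq] := hN' m.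
exists (p * q); first by rewrite rpredM.
have b1 : O m (fun z => (F z * w z ^+ N - p.[w z]) * (G z * w z ^+ N')).
  have := bigO_mul (bigO_mul hp bG) (bigO_w h N'); rewrite addn0 => H.
  apply: (@bigO_divwn _ h m NG); apply: bigO_ext (bigO_le h0 (leq_addr N' _) H) => z.
  by ring.
apply: bigO_ext (bigO_add b1 (bigO_mul (bigO_horner h0 p) hq)) => z.
by rewrite hornerM exprD; ring.
Qed.

Lemma asy_scale k F : k \in K -> asy F -> asy (fun z => k * F z).
Proof. by move=> kK; exact: asy_mul (asy_cst kK). Qed.

Lemma asy_exp F n : asy F -> asy (fun z => F z ^+ n).
Proof.
move=> aF; elim: n => [|n ih]; first by apply: asy_ext (asy_cst (rpred1 K)) => z.
by apply: asy_ext (asy_mul aF ih) => z; rewrite exprS.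
Qed.

Lemma asy_sub F G : asy F -> asy G -> asy (fun z => F z - G z).
Proof.
move=> aF aG; apply: asy_ext (asy_add aF (@asy_scale (-1) G _ aG)) => [z|].
  by rewrite mulN1r.
by rewrite rpredN rpred1.
Qed.

Lemma asy_sum (I : Type) (r : seq I) (F : I -> C -> C) :
  (forall i, asy (F i)) -> asy (fun z => \sum_(i <- r) F i z).
Proof.
move=> aF; elim: r => [|i r ih].
  by apply: asy_ext (asy_cst (rpred0 K)) => z; rewrite big_nil.
by apply: asy_ext (asy_add (aF i) ih) => z; rewrite big_cons.
Qed.

(* Truncated geometric series *)
Lemma poly_inv_mod p n : p \is a polyOver K -> p`_0 != 0 ->
  exists2 s, s \is a polyOver K & exists t, p * s = 1 + 'X^n * t.
Proof.
move=> pK p0; pose e := 1 - (p`_0)^-1 *: p.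
have cK : (p`_0)^-1 \in K by rewrite rpredV; exact: (polyOverP pK).
have eK : e \is a polyOver K by rewrite rpredB ?rpred1// polyOverZ.
have [t et] : exists t, e = 'X * t.
  have /factor_theorem[t ht] : root e 0.
    by rewrite /root /e !hornerE horner_coef0 mulVf// subrr.
  by exists t; rewrite ht subr0 mulrC.
exists ((p`_0)^-1 *: \sum_(i < n) e ^+ i).
  by rewrite polyOverZ// rpred_sum// => i _; rewrite rpredX.
exists (- t ^+ n).
have -> : p = (p`_0) *: (1 - e) by rewrite /e opprB addrC subrK scalerA divff// scale1r.
rewrite -scalerAl -scalerAr scalerA coefZ coefB et coefXM /= coef1 /= subr0 mulr1 divff// scale1r.
by rewrite -et mulrN -exprMn -et -opprB mulNr -subrX1 opprB.
Qed.

(** If F starts with k w^n, the polynomial approximating w^N F is X^(N+n) r with r(0) = k. Inverting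
    r modulo X^m over K gives the expansion of w^n / F. *)
Lemma asy_inv F n k : k != 0 -> O n.+1 (fun z => F z - k * w z ^+ n) -> asy F ->
  asy (fun z => (F z)^-1).
Proof.
(* The factor X^(N+n) costs N + n orders and m must remain; one more secures the coefficient k even
   for m = 0. *)
move=> k0 hF [N hN]; exists n => m; set M := (N + n + m).+1.
have [p pK hp] := hN M.
have low : O (N + n).+1 (fun z => p.[w z] - k * w z ^+ (N + n)).
  have a := bigO_le h0 (_ : (N + n).+1 <= M)%N hp.
  have b := bigO_mul (bigO_w h N) hF.
  rewrite addnS in b; apply: bigO_ext (bigO_sub b (a _)) => [z|]; last by rewrite /M ltnS leq_addr.
  by rewrite exprD; ring.
have pc i : (i < (N + n).+1)%N -> p`_i = if i == (N + n)%N then k else 0.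
  move=> iN; have := @poly_flat _ h h0 (N + n).+1 (p - k *: 'X^(N + n)) _ i iN.
  rewrite coefB coefZ coefXn => H; apply/eqP; rewrite -subr_eq0; apply/eqP.
  rewrite -[RHS]H; first by case: ifP; rewrite ?mulr1 ?mulr0.
  by apply: bigO_ext low => z; rewrite !hornerE.
pose r := \poly_(i < size p) p`_(i + (N + n)).
have rK : r \is a polyOver K.
  by apply: polyOver_poly => i _; exact: (polyOverP pK).
have r0 : r`_0 = k.
  rewrite coef_poly add0n pc// eqxx; case: ltnP => // sp.
  by have := pc (N + n)%N (leqnn _); rewrite eqxx nth_default ?(leq_trans sp)// => <-.
have pr : p = 'X^(N + n) * r.
  apply/polyP => i; rewrite coefXnM; case: ltnP => iN.
    by rewrite pc ?ltnS 1?ltnW// ltn_eqF.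
  rewrite coef_poly subnK//; case: ltnP => // si.
  by rewrite nth_default//; apply: leq_trans si _; exact: leq_subr.
have [|s sK [t st]] := @poly_inv_mod r m rK; first by rewrite r0.
exists s => //.
have lead : O 1 (fun z => F z / w z ^+ n - k).
  apply: (@bigO_divwn _ h 1 n); apply: bigO_ext hF => z.
  by rewrite mulrBl divfK// expf_neq0// qpar_neq0.
have inv0 := bigO_inv h0 k0 lead.
have rem : O m (fun z => F z / w z ^+ n - r.[w z]).
  apply: (@bigO_divwn _ h m (N + n)).
  have := bigO_le h0 (_ : m + (N + n) <= M)%N hp; move=> H.
  apply: bigO_ext (H _) => [z|]; last by rewrite /M addnC ltnW.
  by rewrite pr hornerM hornerXn exprD; field; rewrite expf_neq0// qpar_neq0.
have tail : O m (fun z => r.[w z] * s.[w z] - 1).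
  have H := bigO_mul (bigO_w h m) (bigO_horner h0 t); rewrite addn0 in H.
  apply: bigO_ext H => z.
  by rewrite -hornerM st hornerD hornerM hornerXn hornerC addrAC subrr add0r.
have key : O m (fun z => (F z / w z ^+ n)^-1 *
    (- ((F z / w z ^+ n - r.[w z]) * s.[w z] + (r.[w z] * s.[w z] - 1)))).
  have := bigO_mul inv0 (bigO_opp (bigO_add _ tail)); rewrite add0n; apply.
  by have := bigO_mul rem (bigO_horner h0 s); rewrite addn0.
apply: bigO_near key.
have k1 : 0 < cn k by rewrite cn_gt0.
have [Y hY] := bigO1_small h0 lead k1.
exists Y => z /hY hz.
have Fz : F z != 0.
  by apply: contraTneq hz => ->; rewrite mul0r sub0r cnN ltxx.
by field; rewrite Fz expf_neq0// qpar_neq0.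
Qed.

Lemma asy_horner2 (P : {poly {poly C}}) F G : (forall i l : nat, P`_i`_l \in K) ->
  asy F -> asy G -> asy (fun z => P.[F z, G z]).
Proof.
move=> PK aF aG.
have a : asy (fun z => \sum_(i < size P) (\sum_(l < size P`_i) P`_i`_l * G z ^+ l) * F z ^+ i).
  apply: (@asy_sum _ _ (fun (i : 'I_(size P)) z =>
    (\sum_(l < size P`_i) P`_i`_l * G z ^+ l) * F z ^+ i)) => i.
  apply: asy_mul; last exact: asy_exp.
  apply: (@asy_sum _ _ (fun (l : 'I_(size P`_i)) z => P`_i`_l * G z ^+ l)) => l.
  by apply: asy_scale; [exact: PK|exact: asy_exp].
apply: asy_ext a => z; rewrite [P.[_]]horner_coef horner_sum; apply: eq_bigr => i _.
by rewrite hornerM horner_exp hornerC horner_coef.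
Qed.

End RationalExpansions.

(** * Sequences and symmetric sums over the integers *)

Section Sequences.
Variable R : realType.
Local Notation C := R[i].
Implicit Types (u v : nat -> C) (z l : C).

Lemma seqlim_ext u v l : u =1 v -> seqlim u l -> seqlim v l.
Proof. by move=> /funext ->. Qed.

Lemma seqlim_cst l : seqlim (fun=> l) l.
Proof. by move=> e e0; exists 0%N => n _; rewrite subrr cn0 ltW. Qed.

Lemma seqlim_add u v l l' : seqlim u l -> seqlim v l' -> seqlim (fun n => u n + v n) (l + l').
Proof.
move=> hu hv e e0; have e2 : 0 < e / 2 by rewrite divr_gt0.
have [N hN] := hu _ e2; have [N' hN'] := hv _ e2; exists (maxn N N') => n.
rewrite geq_max => /andP[/hN h1 /hN' h2].
rewrite opprD addrACA; apply: le_trans (cnD _ _) _; lra.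
Qed.

Lemma seqlim_scale k u l : seqlim u l -> seqlim (fun n => k * u n) (k * l).
Proof.
move=> hu e e0; have k0 : 0 < cn k + 1 by have := cn_ge0 k; lra.
have [N hN] := hu _ (divr_gt0 e0 k0); exists N => n /hN; rewrite -mulrBr cnM ler_pdivlMr//.
have := cn_ge0 (u n - l); rewrite mulrDr mulr1 [_ * cn k]mulrC; lra.
Qed.

Lemma seqlim_sub u v l l' : seqlim u l -> seqlim v l' -> seqlim (fun n => u n - v n) (l - l').
Proof.
move=> hu hv; apply: (@seqlim_ext (fun n => u n + -1 * v n)); first by move=> n; rewrite mulN1r.
by rewrite -[- l']mulN1r; apply: seqlim_add => //; exact: seqlim_scale.
Qed.

Lemma seqlim_sub_seq u l (s : nat -> nat) : (forall n, (n <= s n)%N) -> seqlim u l ->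
  seqlim (fun n => u (s n)) l.
Proof. by move=> hs hu e /hu[N hN]; exists N => n Nn; apply: hN; exact: leq_trans (hs n). Qed.

Lemma seqlim_shift u l : seqlim (fun n => u n.+1) l -> seqlim u l.
Proof. by move=> hu e /hu[N hN]; exists N.+1 => -[//|n]; exact: hN. Qed.

Lemma seqlim_le u l z (B : R) N : seqlim u l -> (forall n, (N <= n)%N -> cn (u n - z) <= B) ->
  cn (l - z) <= B.
Proof.
move=> hu hB; apply/ler_addgt0Pl => e /hu[M hM].
have := hB _ (leq_maxl N M); have := hM _ (leq_maxr N M); rewrite cnBC.
have := cnD3 l (u (maxn N M)) z; lra.
Qed.

Lemma inv_nat_small (c e : R) : 0 <= c -> 0 < e -> exists N : nat,
  forall n, (N <= n)%N -> c / n.+1%:R <= e.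
Proof.
move=> c0 e0; exists (Num.bound (c / e)) => n Nn.
rewrite ler_pdivrMr// mulrC -ler_pdivrMr//; apply/ltW.
apply: lt_le_trans (archi_boundP _) _; first by rewrite divr_ge0// ltW.
by rewrite ler_nat; apply: leq_trans Nn _.
Qed.

(** Completeness, one coordinate at a time: the intervals of radius [B n] around the n-th terms meet
    pairwise, so [sup_between] gives a common point. *)
Lemma cauchy_bound u (B : nat -> R) N : (forall e, 0 < e -> exists n, (N <= n)%N /\ B n <= e) ->
  (forall m n, (N <= n)%N -> (n <= m)%N -> cn (u m - u n) <= B n) ->
  exists l, seqlim u l.
Proof.
move=> hB hu.
have real (g : C -> R) : (forall z z', `|g z - g z'| <= cn (z - z')) ->
    exists x, forall n, (N <= n)%N -> `|g (u n) - x| <= B n.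
  move=> hg.
  have [|x hx] := @sup_between R (fun n => g (u (N + n)%N) - B (N + n)%N)
      (fun n => g (u (N + n)%N) + B (N + n)%N).
    move=> n m; case: (leqP n m) => nm.
      have := le_trans (hg (u (N + m)%N) (u (N + n)%N)) (hu _ _ (leq_addr _ _) _).
      rewrite leq_add2l => /(_ nm); rewrite ler_norml.
      have := le_trans (cn_ge0 _) (hu (N + m)%N (N + m)%N (leq_addr _ _) (leqnn _)); lra.
    have := le_trans (hg (u (N + n)%N) (u (N + m)%N)) (hu _ _ (leq_addr _ _) _).
    rewrite leq_add2l => /(_ (ltnW nm)); rewrite ler_norml.
    have := le_trans (cn_ge0 _) (hu (N + n)%N (N + n)%N (leq_addr _ _) (leqnn _)); lra.
  exists x => n Nn; have := hx (n - N)%N; rewrite subnKC// ler_norml; lra.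
have [|x hx] := real (@complex.Re R).
  by move=> z z'; apply: le_trans (cn_Re (z - z')); rewrite ReD ReN.
have [|y hy] := real (@complex.Im R).
  by move=> z z'; apply: le_trans (cn_Im (z - z')); rewrite ImD ImN.
exists (x +i* y) => e e0; have e3 : 0 < e / 3 by rewrite divr_gt0.
have [M [NM hM]] := hB _ e3; exists M => n Mn.
apply: le_trans (cnD3 _ (u M) _) _.
have h1 := hu _ _ NM Mn; have h2 := cn_ReIm (u M - (x +i* y)).
move: h2; rewrite ReD ImD ReN ImN /=; have := hx M NM; have := hy M NM; lra.
Qed.

Lemma zsum0 (F : int -> C) : zsum 0 F = F 0.
Proof. by rewrite /zsum big_nat1. Qed.

Lemma zsumS N (F : int -> C) : zsum N.+1 F = zsum N F + (F N.+1%:Z + F (- N.+1%:Z)).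
Proof.
rewrite /zsum doubleS big_nat_recr//= big_nat_recl//=.
have -> : \sum_(0 <= i < N.*2.+1) F (i.+1%:Z - N.+1%:Z) = \sum_(0 <= i < N.*2.+1) F (i%:Z - N%:Z).
  by apply: eq_bigr => i _; congr F; lia.
have -> : 0%N%:Z - N.+1%:Z = - N.+1%:Z by lia.
have -> : N.*2.+2%:Z - N.+1%:Z = N.+1%:Z by lia.
by ring.
Qed.

Lemma zsum_scale N k (F : int -> C) : zsum N (fun n => k * F n) = k * zsum N F.
Proof. by rewrite /zsum mulr_sumr. Qed.

Lemma zsum_sub N (F G : int -> C) : zsum N (fun n => F n - G n) = zsum N F - zsum N G.
Proof. by rewrite /zsum sumrB. Qed.

Lemma eq_zsum N (F G : int -> C) : F =1 G -> zsum N F = zsum N G.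
Proof. by move=> /funext ->. Qed.

Lemma zsum_bound N (F : int -> C) (B : R) : (forall n, cn (F n) <= B) ->
  cn (zsum N F) <= (N.*2.+1)%:R * B.
Proof.
move=> hF; apply: le_trans (cn_sum _ _ _) _; apply: le_trans (ler_sum _ (fun i _ => hF _)) _.
by rewrite sumr_const_nat subn0 mulr_natl.
Qed.

Lemma zsum_opp N (F : int -> C) : zsum N (fun n => F (- n)) = zsum N F.
Proof.
elim: N => [|N ih]; first by rewrite !zsum0 oppr0.
by rewrite !zsumS ih opprK [F (- _) + _]addrC.
Qed.

Lemma zsum_shift N (F : int -> C) :
  zsum N (fun n => F (n + 1)) = zsum N F + (F (N%:Z + 1) - F (- N%:Z)).
Proof.
elim: N => [|N ih]; first by rewrite !zsum0 oppr0 add0r addrC subrK.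
rewrite !zsumS ih.
have -> : N.+1%:Z = N%:Z + 1 by lia.
have -> : - (N%:Z + 1) + 1 = - N%:Z by lia.
by ring.
Qed.

End Sequences.

(** * The sum of (z + n)^-k over the integers n *)

Section LipschitzSums.
Variable R : realType.
Local Notation C := R[i].
Implicit Types (z l : C) (c : R) (n m N M : nat).
Variable k : nat.
Hypothesis k4 : (4 <= k)%N.

Definition psi_partial z N : C := zsum N (fun n : int => (z + n%:~R) ^- k).

(** Telescopes the tail of the series of n^-4 to N^-3. *)
Let tele N : (1 <= N)%N -> (N.+1%:R ^- 4 : R) <= N%:R ^- 3 - N.+1%:R ^- 3.
Proof.
move=> N1; have N0 : (0 : R) < N%:R by rewrite ltr0n.
rewrite -natr1; set x : R := N%:R in N0 *.
have x1 : 0 < x + 1 by lra.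
rewrite -subr_ge0 [X in 0 <= X](_ : _ =
   ((3 * x ^+ 2 + 3 * x + 1) * (x + 1) - x ^+ 3) / (x ^+ 3 * (x + 1) ^+ 4)).
  apply: divr_ge0; last by rewrite mulr_ge0// exprn_ge0// ltW.
  rewrite [X in 0 <= X](_ : _ = 2 * x ^+ 3 + 6 * x ^+ 2 + 4 * x + 1); last by ring.
  have := exprn_gt0 3 N0; have := exprn_gt0 2 N0; lra.
by field; rewrite !gt_eqF.
Qed.

Let term_bound z c n : 0 < c -> (1 <= n)%N -> c * n%:R <= cn z ->
  cn (z ^- k) <= c ^- k * n%:R ^- 4.
Proof.
move=> c0 n1 cz; have n0 : (0 : R) < n%:R by rewrite ltr0n.
have cn0 : 0 < c * n%:R by rewrite mulr_gt0.
rewrite cnV cnX; apply: (@le_trans _ _ ((c * n%:R) ^- k)).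
  by rewrite lef_pV2 ?posrE ?exprn_gt0//; [apply: lerXn2r; rewrite ?nnegrE ?cn_ge0// ltW|exact: lt_le_trans cz].
rewrite exprMn invfM ler_pM2l ?invr_gt0 ?exprn_gt0//.
rewrite lef_pV2 ?posrE ?exprn_gt0//; apply: ler_weXn2l => //.
by rewrite ler1n.
Qed.

(** The rate depends on z only through c. This uniformity, with the exponent 3, is what allows
    summation over 2N + 1 rows in [eis_partial_psi]. *)
Lemma psi_partial_cauchy z c n0 : 0 < c ->
  (forall n, (n0 <= n)%N -> c * n%:R <= cn (z + n%:R) /\ c * n%:R <= cn (z - n%:R)) ->
  forall M N, (maxn 1 n0 <= N)%N -> (N <= M)%N ->
  cn (psi_partial z M - psi_partial z N) <= 2 * c ^- k * N%:R ^- 3.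
Proof.
move=> c0 hz M N; rewrite geq_max => /andP[N1 N0] NM.
have ck : 0 < c ^- k by rewrite invr_gt0 exprn_gt0.
suff : cn (psi_partial z M - psi_partial z N) <= 2 * c ^- k * (N%:R ^- 3 - M%:R ^- 3).
  move=> /le_trans; apply; apply: ler_wpM2l; first by rewrite mulr_ge0// ltW.
  by rewrite gerBl invr_ge0 exprn_ge0.
elim: M NM => [|M ih]; first by rewrite leqn0 => /eqP ->; rewrite !subrr cn0 mulr0.
rewrite leq_eqVlt => /orP[/eqP ->|]; first by rewrite !subrr cn0 mulr0.
rewrite ltnS => NM; have := ih NM.
have M1 := leq_trans N1 NM; have := tele M1.
have [h1 h2] := hz M.+1 (leq_trans N0 (leqW NM)).
have t1 := term_bound c0 (ltn0Sn M) h1; have t2 := term_bound c0 (ltn0Sn M) h2.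
rewrite /psi_partial zsumS.
have E1 : (z + M.+1%:Z%:~R : C) = z + M.+1%:R by [].
have E2 : (z + (- M.+1%:Z)%:~R : C) = z - M.+1%:R by rewrite mulrNz.
rewrite E1 E2; set A := zsum M _; set B := zsum N _; set T1 := (z + _) ^- k; set T2 := (z - _) ^- k.
move=> h3 h4.
rewrite [X in cn X](_ : _ = (A - B) + (T1 + T2)); last by ring.
apply: le_trans (cnD _ _) _; have := cnD T1 T2 => h5.
have : c ^- k * M.+1%:R ^- 4 <= c ^- k * (M%:R ^- 3 - M.+1%:R ^- 3) by rewrite ler_wpM2l// ltW.
rewrite !mulrBr in h4 *.
move: (c ^- k) (N%:R ^- 3) (M%:R ^- 3) (M.+1%:R ^- 3) (M.+1%:R ^- 4) h4 t1 t2 => a b d e f.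
move: (cn _) (cn _) (cn _) (cn _) h5 => u v w x; clear; lra.
Qed.

(** At an integer z the singular term is 0 by the convention for the inverse of 0, so [psi k 0] is 2
    zeta(k) for even k. *)
Definition psi z : C := xget 0 [set l | seqlim (psi_partial z) l].

Let far z n : ((Num.bound (2 * cn z)).+1 <= n)%N ->
  2^-1 * n%:R <= cn (z + n%:R) /\ 2^-1 * n%:R <= cn (z - n%:R).
Proof.
move=> hn; have b : 2 * cn z < n%:R.
  apply: lt_le_trans (archi_boundP _) _; first by rewrite mulr_ge0// cn_ge0.
  by rewrite ler_nat ltnW.
have := cn_sub_ge n%:R z; rewrite cnBC cn_nat => h1.
have := cn_sub_ge n%:R (- z); rewrite opprK cnN cn_nat [n%:R + z]addrC => h2.
by split; lra.
Qed.

Lemma psi_lim z : seqlim (psi_partial z) (psi z).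
Proof.
rewrite /psi; case: xgetP => [l -> //|hno].
have h2 : (0 : R) < 2^-1 by rewrite invr_gt0.
have hc := psi_partial_cauchy h2 (@far z).
set n0 := (Num.bound (2 * cn z)).+1 in hc.
have [|l hl] := @cauchy_bound R (psi_partial z) (fun N => 2 * 2^-1 ^- k * N%:R ^- 3) (maxn 1 n0) _ hc.
  move=> e e0.
  have c0 : 0 <= 2 * 2^-1 ^- k :> R by rewrite mulr_ge0// invr_ge0 exprn_ge0.
  have [N hN] := inv_nat_small c0 e0; exists (N + maxn 1 n0)%N; split; first exact: leq_addl.
  apply: le_trans (hN N (leqnn N)); apply: ler_wpM2l => //.
  have p : (N.+1 <= N + maxn 1 n0)%N by rewrite -addn1 leq_add2l leq_maxl.
  have q0 : (0 < N + maxn 1 n0)%N by apply: leq_trans p.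
  rewrite lef_pV2 ?posrE ?exprn_gt0 ?ltr0n// -natrX ler_nat.
  by apply: leq_trans p _; rewrite -{1}[(N + _)%N]expn1 leq_pexp2l.
by exfalso; exact: (hno l).
Qed.

Lemma psi_tail z c : 0 < c ->
  (forall n, (1 <= n)%N -> c * n%:R <= cn (z + n%:R) /\ c * n%:R <= cn (z - n%:R)) ->
  forall N, (1 <= N)%N -> cn (psi z - psi_partial z N) <= 2 * c ^- k * N%:R ^- 3.
Proof.
move=> c0 hz N N1; apply: (@seqlim_le _ _ _ _ _ N (psi_lim z)) => M NM.
by apply: (psi_partial_cauchy c0 hz) => //; rewrite maxnn.
Qed.

Lemma psi_uniq z l : seqlim (psi_partial z) l -> psi z = l.
Proof. exact: seqlim_uniq (psi_lim z). Qed.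

Let term_small z : seqlim (fun N => (z + N%:R) ^- k) 0 /\ seqlim (fun N => (z - N%:R) ^- k) 0.
Proof.
suff H (s : nat -> C) : (forall n, ((Num.bound (2 * cn z)).+1 <= n)%N -> 2^-1 * n%:R <= cn (s n)) ->
    seqlim (fun N => s N ^- k) 0.
  by split; apply: H => n /far[].
move=> hs e e0; have h2 : (0 : R) < 2^-1 by rewrite invr_gt0.
have c0 : 0 <= 2^-1 ^- k :> R by rewrite invr_ge0 exprn_ge0.
have [N hN] := inv_nat_small c0 e0; exists (maxn N.+1 (Num.bound (2 * cn z)).+1) => n.
rewrite geq_max => /andP[Nn /hs nn]; rewrite subr0.
have n1 : (1 <= n)%N by apply: leq_trans Nn.
apply: le_trans (term_bound h2 n1 nn) _; case: n Nn n1 {nn} => // n Nn _.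
apply: le_trans (hN n Nn); apply: ler_wpM2l => //.
by rewrite lef_pV2 ?posrE ?exprn_gt0 ?ltr0n// -natrX ler_nat -{1}[n.+1]expn1 leq_pexp2l.
Qed.

Lemma psi_per z : psi (z + 1) = psi z.
Proof.
apply: psi_uniq.
have [h1 _] := term_small (z + 1); have [_ h2] := term_small z.
have := seqlim_add (psi_lim z) (seqlim_sub h1 h2); rewrite subr0 addr0; apply: seqlim_ext => N.
rewrite /psi_partial.
have -> : (fun n : int => (z + 1 + n%:~R) ^- k) = (fun n : int => (z + (n + 1)%:~R) ^- k).
  by apply/funext => n; rewrite intrD addrA addrAC.
rewrite (zsum_shift N (fun n : int => (z + n%:~R) ^- k)); congr (_ + (_ - _)).
  by congr (_ ^- _); rewrite intrD -[N%:Z%:~R]/(N%:R); ring.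
by rewrite mulrNz.
Qed.

Lemma psi_even z : ~~ odd k -> psi (- z) = psi z.
Proof.
move=> ek; apply: psi_uniq; apply: seqlim_ext (psi_lim z) => N.
rewrite /psi_partial -zsum_opp; apply: eq_zsum => n.
have -> : - z + n%:~R = - (z - n%:~R) by ring.
by rewrite mulrNz exprNn -signr_odd (negbTE ek) mul1r.
Qed.

(** Halving z and z + 1 separates the even integers from the odd ones. *)
Lemma psi_dup z : psi (z / 2) + psi ((z + 1) / 2) = 2 ^+ k * psi z.
Proof.
have [h1 _] := term_small (z + 1).
have hs : seqlim (fun N => (z + 1 + N.*2%:R) ^- k) 0.
  by apply: (seqlim_sub_seq (s := double)) h1 => n; rewrite -addnn leq_addr.
have hp : seqlim (fun N => psi_partial z N.*2) (psi z).
  by apply: seqlim_sub_seq (psi_lim z) => n; rewrite -addnn leq_addr.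
(* The odd integers run from 1 - 2N to 2N + 1, so the two sums up to N give the sum up to 2N plus
   one extra term, which tends to 0. *)
have := seqlim_scale (2 ^+ k) (seqlim_add hp hs); rewrite addr0.
apply: seqlim_uniq; apply: seqlim_ext (seqlim_add (psi_lim (z / 2)) (psi_lim ((z + 1) / 2))) => N.
have E (y : C) : (y / 2) ^- k = 2 ^+ k * y ^- k.
  by rewrite exprMn exprVn invfM invrK mulrC.
elim: N => [|N ih].
  by rewrite /psi_partial !zsum0 !addr0 !E mulrDr.
rewrite /psi_partial doubleS !zsumS -!/(psi_partial _ _).
rewrite addrACA ih.
have e1 : z / 2 + N.+1%:Z%:~R = (z + N.*2.+2%:R) / 2.
  by rewrite -[N.+1%:Z%:~R]/(N.+1%:R) -[N.*2.+2]/(N.+1.*2) -mul2n natrM; field.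
have e2 : z / 2 + (- N.+1%:Z)%:~R = (z - N.*2.+2%:R) / 2.
  by rewrite mulrNz -[N.*2.+2]/(N.+1.*2) -mul2n natrM; field.
have e3 : (z + 1) / 2 + N.+1%:Z%:~R = (z + 1 + N.*2.+2%:R) / 2.
  by rewrite -[N.+1%:Z%:~R]/(N.+1%:R) -[N.*2.+2]/(N.+1.*2) -mul2n natrM; field.
have e4 : (z + 1) / 2 + (- N.+1%:Z)%:~R = (z - N.*2.+1%:R) / 2.
  by rewrite mulrNz -[N.+1%:Z%:~R]/(N.+1%:R) -(natr1 N.*2) -(natr1 N) -mul2n natrM; field.
rewrite e1 e2 e3 e4 !E !mulrNz.
have e5 : z + 1 + N.*2%:R = z + N.*2.+1%:Z%:~R.
  by rewrite -[N.*2.+1%:Z%:~R]/(N.*2.+1%:R) -natr1; ring.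
rewrite e5; ring.
Qed.

End LipschitzSums.

(** * Herglotz' trick *)

Section Herglotz.
Variable R : realType.
Local Notation C := R[i].
Implicit Types (z l : C) (D : C -> C) (M : R).

(** Contains a translate of every point of the half-plane, and also the real point 1/2, which gives
    access to zeta(4) and zeta(6); the pole 0 is excluded. *)
Definition half_strip z := [/\ `|complex.Re z| <= 2^-1, 0 <= complex.Im z & z != 0].

(* Herglotz' trick: halving contracts the bound, since 2^s 2 2^-k <= 1/2 for s = k - 2. *)
Lemma herglotz D s M : (forall z, D (z + 1) = D z) ->
  (forall z, half_strip z -> D (z / 2) + D ((z + 1) / 2) = 2 ^+ s.+2 * D z) ->
  (forall z, half_strip z -> cn (D z) <= M * (1 + cn z ^- s)) ->
  forall z, half_strip z -> D z = 0.
Proof.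
move=> pD dD bD.
have step N : (forall z, half_strip z -> cn (D z) <= N * (1 + cn z ^- s)) ->
    forall z, half_strip z -> cn (D z) <= N / 2 * (1 + cn z ^- s).
  move=> hN z [h1 h2 h3]; have n0 : 0 < cn z by rewrite cn_gt0.
  have zs : 0 < cn z ^- s by rewrite invr_gt0 exprn_gt0.
  have N0 : 0 <= N.
    have := le_trans (cn_ge0 _) (hN z _); rewrite pmulr_lge0; last by lra.
    by apply; split.
  have R2 (u : C) : complex.Re (u / 2) = complex.Re u / 2.
    have -> : u / 2 = u * (2^-1 : R)%:C by rewrite fmorphV rmorph_nat.
    by rewrite ReM /=; ring.
  have I2 (u : C) : complex.Im (u / 2) = complex.Im u / 2.
    have -> : u / 2 = u * (2^-1 : R)%:C by rewrite fmorphV rmorph_nat.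
    by rewrite ImM /=; ring.
  have n2 (u : C) : cn (u / 2) = cn u / 2 by rewrite cnf cn_nat.
  have half u : half_strip u -> cn z / 2 <= cn u -> cn (D u) <= N * (1 + 2 ^+ s * cn z ^- s).
    move=> hu zu; apply: le_trans (hN u hu) _; apply: ler_wpM2l => //; rewrite lerD2l.
    rewrite -[leRHS]invrK invfM invrK -[(2 ^+ s)^-1]exprVn -exprMn mulrC.
    rewrite lef_pV2 ?posrE ?exprn_gt0 ?divr_gt0//; last by apply: lt_le_trans zu; rewrite divr_gt0.
    by apply: lerXn2r => //; rewrite nnegrE ?cn_ge0// divr_ge0// cn_ge0.
  have b1 : cn (D (z / 2)) <= N * (1 + 2 ^+ s * cn z ^- s).
    apply: half; last by rewrite n2.
    split; [rewrite R2 normrM (@ger0_norm _ 2^-1)//; lra|rewrite I2; lra|].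
    by rewrite mulf_neq0 ?invr_neq0 ?pnatr_eq0.
  have b2 : cn (D ((z + 1) / 2)) <= N * (1 + 2 ^+ s * cn z ^- s).
    have [re0|re0] := leP (complex.Re z) 0.
      apply: half; last first.
        rewrite n2 ler_pM2r ?invr_gt0// -(@ler_pXn2r _ 2)// ?nnegrE ?cn_ge0// !cn_sqr ReD ImD Re1 Im1 addr0.
        rewrite lerD2r -subr_ge0 (_ : _ - _ = 2 * complex.Re z + 1); last by ring.
        by rewrite ler_norml in h1; lra.
      split; [rewrite R2 ReD Re1|by rewrite I2 ImD /= addr0 divr_ge0|].
        by rewrite ler_norml in h1; rewrite ler_norml; lra.
      apply/eqP => /(congr1 (@complex.Re R)); rewrite R2 ReD Re1 => E.
      by rewrite ler_norml in h1; lra.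
    (* For Re z > 0 the point (z + 1) / 2 leaves the strip, but its translate (z - 1) / 2 does
       not. *)
    have -> : (z + 1) / 2 = (z - 1) / 2 + 1 by field.
    rewrite pD; apply: half; last first.
      rewrite n2 ler_pM2r ?invr_gt0// -(@ler_pXn2r _ 2)// ?nnegrE ?cn_ge0// !cn_sqr ReD ImD ReN ImN Re1 Im1 oppr0 addr0.
      rewrite lerD2r -subr_ge0 (_ : _ - _ = 1 - 2 * complex.Re z); last by ring.
      by rewrite ler_norml in h1; lra.
    split; [rewrite R2 ReD ReN Re1|by rewrite I2 ImD ImN /= oppr0 addr0 divr_ge0|].
      by rewrite ler_norml in h1; rewrite ler_norml; lra.
    apply/eqP => /(congr1 (@complex.Re R)); rewrite R2 ReD ReN Re1 => E.
    by rewrite ler_norml in h1; lra.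
  have := dD z (And3 h1 h2 h3) => /(congr1 (@cn R)); rewrite cnM cnX cn_nat => E.
  have p0 : (0 : R) < 2 ^+ s by rewrite exprn_gt0.
  have p1 : (1 : R) <= 2 ^+ s by rewrite exprn_ege1// ler1n.
  rewrite -(ler_pM2l (exprn_gt0 s.+2 (@ltr0n R 2))) -E.
  apply: le_trans (cnD _ _) _; apply: le_trans (lerD b1 b2) _.
  rewrite !exprS -subr_ge0 [X in 0 <= X](_ : _ = 2 * N * (2 ^+ s - 1)); last by field; rewrite expf_neq0// gt_eqF.
  by rewrite mulr_ge0 ?mulr_ge0// subr_ge0.
have all n : forall z, half_strip z -> cn (D z) <= M / 2 ^+ n * (1 + cn z ^- s).
  elim: n => [|n ih]; first by rewrite divr1.
  move=> z hz; have := step _ ih z hz; rewrite exprSr invfM mulrA; exact.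
move=> z hz; apply: (@cn_le_small _ _ (1 + cn z ^- s)) => e e0.
have [n hn] := half_pow_small M e0; apply: le_trans (all n z hz) _.
by rewrite mulrC; apply: ler_wpM2l (ltW hn); rewrite addr_ge0// invr_ge0 exprn_ge0// cn_ge0.
Qed.

End Herglotz.

(** * Lipschitz' formula for the exponents 4 and 6 *)

Section LipschitzFormula.
Variable R : realType.
Local Notation C := R[i].
Implicit Types (z X q a b : C).

Let bD z X (A B : R) : cn z <= A -> cn X <= B -> cn (z + X) <= A + B.
Proof. by move=> h1 h2; apply: le_trans (cnD _ _) _; exact: lerD. Qed.
Let bN z (A : R) : cn z <= A -> cn (- z) <= A.
Proof. by rewrite cnN. Qed.
Let bM z X (A B : R) : cn z <= A -> cn X <= B -> cn (z * X) <= A * B.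
Proof. by move=> h1 h2; rewrite cnM ler_pM ?cn_ge0. Qed.
Let bX z (A : R) n : cn z <= A -> cn (z ^+ n) <= A ^+ n.
Proof.
by move=> h1; rewrite cnX lerXn2r ?nnegrE ?cn_ge0//; apply: le_trans h1; exact: cn_ge0.
Qed.
Let bC (n : nat) : cn (n%:R : C) <= n%:R.
Proof. by rewrite cn_nat. Qed.
Let b1 : cn (1 : C) <= 1.
Proof. by rewrite cn1. Qed.

Ltac bnd := repeat match goal with
  | |- is_true (cn (_ + _) <= _) => apply: bD
  | |- is_true (cn (- _) <= _) => apply: bN
  | |- is_true (cn (_^-1 ^+ _) <= _) => apply: bX
  | |- is_true (cn (_ * _) <= _) => apply: bM
  | |- is_true (cn (_ ^+ _) <= _) => apply: bX
  | |- is_true (cn 1 <= _) => exact: b1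
  | |- is_true (cn (_%:R) <= _) => exact: bC
  | |- _ => eassumption
  end.

Definition twopii : C := 2 * pi%:C * 'i%C.

Lemma e2piE z : e2pi z = expC (twopii * z).
Proof. by []. Qed.

Let cn_twopii : cn twopii = 2 * pi.
Proof. by rewrite /twopii cnM cn_i mulr1 cnM cn_nat cn_real gtr0_norm// pi_gt0. Qed.

Let twopii0 : 0 < cn twopii.
Proof. by rewrite cn_gt0 twopii_neq0. Qed.

(* With q = exp X, the quantity 1 - q behaves like -X, and (1 - q)^2 = X^2 q + O(X^4). *)
Lemma one_sub_exp_small : exists A eta : R, 0 < eta /\ eta <= 1 /\ forall X, X != 0 -> cn X <= eta ->
  [/\ cn ((1 - expC X) / X) <= A, cn (X / (1 - expC X)) <= A, cn (expC X) <= A,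
      cn (((1 - expC X) ^+ 2 - X ^+ 2 * expC X) / X ^+ 4) <= A & 1 - expC X != 0].
Proof.
pose E : R := expR 1; have E0 : 0 < E by exact: expR_gt0.
pose B : R := 4^-1 + (2 * (E * (1 + 2^-1)) + E ^+ 2 + E).
exists (E + 2 + B), (Num.min 1 (2 * E)^-1); split; first by rewrite lt_min ltr01 invr_gt0 mulr_gt0.
split; first by rewrite ge_min lexx.
move=> X X0; rewrite le_min => /andP[X1 X2].
have nX : 0 < cn X by rewrite cn_gt0.
have eX : expR (cn X) <= E by rewrite ler_expR.
have B0 : 0 <= B by rewrite /B !addr_ge0// ?mulr_ge0 ?exprn_ge0 ?addr_ge0// ltW.
set q := expC X.
have r1 : cn ((q - 1) / X) <= E.
  by rewrite cnf ler_pdivrMr//; apply: le_trans (expC_taylor1 _) _; rewrite ler_wpM2r// cn_ge0.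
have r2 : cn ((q - 1 - X) / X ^+ 2) <= E.
  rewrite cnf cnX ler_pdivrMr ?exprn_gt0//; apply: le_trans (expC_taylor2 _) _.
  by rewrite ler_wpM2r// exprn_ge0// cn_ge0.
have r3 : cn ((q - 1 - X - X ^+ 2 / 2) / X ^+ 3) <= E.
  rewrite cnf cnX ler_pdivrMr ?exprn_gt0//; apply: le_trans (expC_taylor3 _) _.
  by rewrite ler_wpM2r// exprn_ge0// cn_ge0.
have low : 2^-1 <= cn ((1 - q) / X).
  have E1 : (1 - q) / X = - 1 - ((q - 1 - X) / X ^+ 2) * X by field.
  have := cn_sub_ge (- 1) ((q - 1 - X) / X ^+ 2 * X); rewrite -E1 cnN cn1.
  have : cn ((q - 1 - X) / X ^+ 2 * X) <= 2^-1.
    rewrite cnM; apply: le_trans (ler_pM (cn_ge0 _) (cn_ge0 _) r2 X2) _.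
    by rewrite invfM mulrCA divff ?gt_eqF// mulr1.
  lra.
have q1 : 1 - q != 0.
  apply: contraTneq low => ->; rewrite mul0r cn0 -ltNge invr_gt0; lra.
split => //.
- by rewrite -[1 - q]opprB mulNr cnN; apply: le_trans r1 _; lra.
- rewrite -[X / _]invrK cnV invf_div; apply: (@le_trans _ _ 2); last by lra.
  by rewrite -[leRHS]invrK lef_pV2// posrE ?invr_gt0//; apply: lt_le_trans low; rewrite invr_gt0.
- rewrite (_ : q = ((q - 1) / X) * X + 1); last by field.
  apply: le_trans (bD (bM r1 X1) b1) _; lra.
set s := (q - 1 - X - X ^+ 2 / 2) / X ^+ 3 in r3; set t := (q - 1 - X) / X ^+ 2 in r2.
rewrite [X in cn X](_ : _ = 4^-1 + (2 * (s * (1 + X / 2)) + s ^+ 2 * X ^+ 2 - t)); last first.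
  by rewrite /s /t; field.
have i4 : cn (4^-1 : C) <= 4^-1 by rewrite cnV cn_nat.
have hX : cn (X / 2) <= 2^-1 by rewrite cnf cn_nat -[leRHS]mul1r ler_wpM2r.
have c2 : cn (2 : C) <= 2 by rewrite cn_nat.
apply: le_trans (bD i4 (bD (bD (bM c2 (bM r3 (bD b1 hX))) (bM (bX 2 r3) (bX 2 X1))) (bN r2))) _.
by rewrite expr1n mulr1 /B; lra.
Qed.

(** Away from 0 in the half-strip, either |q| stays below 1 by a fixed amount, which gives [k1], or
    the argument of q is at least g in absolute value, which gives [k2]. *)
Lemma one_sub_exp_large (eta : R) : 0 < eta -> exists2 kap : R, 0 < kap &
  forall z, `|complex.Re z| <= 2^-1 -> 0 <= complex.Im z -> eta <= cn (twopii * z) ->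
    kap <= cn (1 - e2pi z).
Proof.
move=> eta0; have p0 := @pi_gt0 R.
pose g := Num.min (eta / 2) pi; have g0 : 0 < g by rewrite lt_min p0 divr_gt0.
have cg : cos g < 1.
  rewrite -(@cos0 R) ltr_cos ?in_itv/= ?lexx ?(ltW p0) ?(ltW g0)//=.
  by rewrite ge_min lexx orbT.
pose k1 := 1 - expR (- (eta / 2)); pose k2 := Num.sqrt (2 * expR (- (eta / 2)) * (1 - cos g)).
have k10 : 0 < k1 by rewrite subr_gt0 expR_lt1 oppr_lt0 divr_gt0.
have k20 : 0 < k2 by rewrite sqrtr_gt0 mulr_gt0 ?mulr_gt0 ?expR_gt0 ?subr_gt0.
exists (Num.min k1 k2); first by rewrite lt_min k10.
move=> z hre him hz; rewrite ge_min.
pose a := - (2 * pi * complex.Im z); pose b := 2 * pi * complex.Re z.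
have Ez : e2pi z = (expR a * cos b) +i* (expR a * sin b).
  by rewrite e2piE /expC Re_2pii Im_2pii -/a -/b; apply: cplx_eq; rewrite !(ReM, ImM) /=; ring.
have a0 : a <= 0 by rewrite /a oppr_le0 !mulr_ge0// ltW.
have [ha|ha] := leP a (- (eta / 2)).
  apply/orP; left; have := cn_sub_ge 1 (e2pi z); rewrite cn1 cn_e2pi -/a.
  have : expR a <= expR (- (eta / 2)) by rewrite ler_expR.
  by rewrite /k1; lra.
apply/orP; right; have hb : eta / 2 <= `|b|.
  have := cn_ReIm (twopii * z); rewrite Re_2pii Im_2pii -/a -/b (ler0_norm a0); lra.
have bpi : `|b| <= pi.
  rewrite /b normrM gtr0_norm ?mulr_gt0//.
  have : 2 * pi * `|complex.Re z| <= 2 * pi * 2^-1 by rewrite ler_wpM2l// mulr_ge0// ltW.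
  lra.
have cb : cos b <= cos g.
  rewrite -(cos_norm b) leNgt; apply/negP; rewrite ltr_cos ?in_itv/= ?normr_ge0 ?bpi ?(ltW g0)//=.
    by apply/negP; rewrite -leNgt; apply: le_trans hb; rewrite ge_min lexx.
  by rewrite ge_min lexx orbT.
rewrite -(@ler_pXn2r _ 2) ?nnegrE ?cn_ge0 ?(ltW k20)// /k2 sqr_sqrtr; last first.
  by rewrite !mulr_ge0 ?expR_ge0// subr_ge0 ltW.
rewrite cn_sqr Ez ReD ImD ReN ImN /=.
have ea : expR (- (eta / 2)) <= expR a by rewrite ler_expR ltW.
have -> : (1 - expR a * cos b) ^+ 2 + (0 - expR a * sin b) ^+ 2 =
    (1 - expR a) ^+ 2 + 2 * expR a * (1 - cos b).
  transitivity (1 - 2 * expR a * cos b + expR a ^+ 2 * (cos b ^+ 2 + sin b ^+ 2)); first by ring.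
  by rewrite cos2Dsin2; ring.
apply: (@le_trans _ _ (2 * expR a * (1 - cos b))); last by rewrite lerDr sqr_ge0.
apply: ler_pM; rewrite ?mulr_ge0 ?expR_ge0 ?subr_ge0 ?(ltW cg)//; first by rewrite ler_wpM2l.
lra.
Qed.

(** Closed forms of the power series of n^3 q^n, and below of n^5 q^n, for n >= 1; the numerators
    are Eulerian polynomials. *)
Definition lip4 q : C := q * (1 + 4 * q + q ^+ 2) / (1 - q) ^+ 4.
Definition lip6 q : C :=
  q * (1 + 26 * q + 66 * q ^+ 2 + 26 * q ^+ 3 + q ^+ 4) / (1 - q) ^+ 6.

(** In the strip the terms n = 1 and n = -1 are at most 2^k each, and the tail after them adds at
    most twice 2^k. *)
Let psi_main k z : (4 <= k)%N -> `|complex.Re z| <= 2^-1 -> 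
  cn (psi k z - z ^- k) <= 4 * 2^-1 ^- k.
Proof.
move=> k4 hz; have h2 : (0 : R) < 2^-1 by rewrite invr_gt0.
have far n : (1 <= n)%N -> 2^-1 * n%:R <= cn (z + n%:R) /\ 2^-1 * n%:R <= cn (z - n%:R).
  move=> n1; have n1' : (1 : R) <= n%:R by rewrite ler1n.
  have := cn_Re (z + n%:R); have := cn_Re (z - n%:R); rewrite !ReD ReN Re_nat.
  rewrite ler_norml in hz.
  have := ler_norm (complex.Re z + n%:R); have := ler_norm (- (complex.Re z - n%:R)).
  by rewrite normrN => *; split; lra.
have := psi_tail k4 h2 far (leqnn 1); rewrite expr1n invr1 mulr1 => t.
rewrite (_ : psi k z - z ^- k = (psi k z - psi_partial k z 1) + ((z + 1) ^- k + (z - 1) ^- k)); last first.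
  by rewrite /psi_partial zsumS zsum0 addr0 mulrNz /=; ring.
apply: le_trans (cnD _ _) _.
have [f1 f2] := far 1%N (leqnn 1); rewrite mulr1 in f1 f2.
have T (u : C) : 2^-1 <= cn u -> cn (u ^- k) <= 2^-1 ^- k.
  move=> hu; rewrite cnV cnX lef_pV2 ?posrE ?exprn_gt0//; last by apply: lt_le_trans hu.
  by apply: lerXn2r; rewrite ?nnegrE ?cn_ge0// ltW.
have := cnD ((z + 1) ^- k) ((z - 1) ^- k); have := T _ f1; have := T _ f2.
move: t; move: (2^-1 ^- k) => c; lra.
Qed.

(** Supplies the growth hypothesis of [herglotz]. Far from 0 both sides are bounded, by [psi_main]
    and [one_sub_exp_large]. Near 0 the poles of c L(q) and z^-k cancel down to order s, the
    cofactor W being built from quantities that [one_sub_exp_small] bounds. *)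
Let strip_bound (L : C -> C) (c : C) k s (W : C -> C -> C -> C -> C) :
  (4 <= k)%N -> (s <= k)%N ->
  (exists M, forall q, cn q <= 1 -> cn (L q * (1 - q) ^+ k) <= M) ->
  (forall A, exists M, forall a b q X, cn a <= A -> cn a^-1 <= A -> cn b <= A -> cn q <= A -> cn X <= 1 ->
    cn (W a b q X) <= M) ->
  (forall z q, z != 0 -> 1 - q != 0 -> let X := twopii * z in
     c * L q - z ^- k = twopii ^+ k * X ^- s *
       W ((1 - q) / X) (((1 - q) ^+ 2 - X ^+ 2 * q) / X ^+ 4) q X) ->
  exists M, forall z, half_strip z -> cn (psi k z - c * L (e2pi z)) <= M * (1 + cn z ^- s).
Proof.
move=> k4 sk [ML hL] hW hid.
have [A [eta [eta0 [eta1 hA]]]] := one_sub_exp_small.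
have [kap kap0 hkap] := one_sub_exp_large eta0.
have [MW hMW] := hW A.
have kk : (0 : R) <= 4 * 2^-1 ^- k by rewrite mulr_ge0// invr_ge0 exprn_ge0// invr_ge0.
pose M1 := cn twopii ^+ k * cn twopii ^- s * MW.
pose M2 := cn c * (ML / kap ^+ k) + (eta / cn twopii) ^- k.
exists (4 * 2^-1 ^- k + `|M1| + `|M2|) => z [h1 h2 h3].
have n0 : 0 < cn z by rewrite cn_gt0.
have zs : 0 < cn z ^- s by rewrite invr_gt0 exprn_gt0.
rewrite (_ : psi k z - _ = (psi k z - z ^- k) - (c * L (e2pi z) - z ^- k)); last by ring.
apply: le_trans (cnB _ _) _; have p := psi_main k4 h1.
suff : cn (c * L (e2pi z) - z ^- k) <= `|M1| * cn z ^- s + `|M2|.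
  have key (p' c' y u v x : R) : p' <= c' -> y <= u * x + v -> 0 <= c' -> 0 <= u -> 0 <= v -> 0 <= x ->
      p' + y <= (c' + u + v) * (1 + x).
    move=> g1 g2 g3 g4 g5 g6; have := mulr_ge0 g3 g6; have := mulr_ge0 g5 g6; lra.
  by move=> H; apply: key; rewrite ?normr_ge0// ltW.
have X0 : twopii * z != 0 by rewrite mulf_neq0 ?twopii_neq0.
have [hX|hX] := leP (cn (twopii * z)) eta.
  have [a1 a2 a3 a4 a5] := hA _ X0 hX; rewrite -e2piE in a1 a2 a3 a4 a5.
  rewrite hid//= cnM cnM cnV !cnX cnM exprMn invfM; clear a5.
  have w := hMW _ _ _ _ a1 (_ : cn ((1 - e2pi z) / (twopii * z))^-1 <= A) a4 a3 (le_trans hX eta1).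
  rewrite invf_div in w; have {}w := w a2.
  move: w; set Wv := W _ _ _ _ => w.
  apply: (@le_trans _ _ (M1 * cn z ^- s)); last first.
    apply: (@le_trans _ _ (`|M1| * cn z ^- s)); last by rewrite lerDl.
    by rewrite ler_wpM2r ?ler_norm// ltW.
  rewrite /M1 -!mulrA ler_wpM2l ?exprn_ge0 ?cn_ge0// ler_wpM2l ?invr_ge0 ?exprn_ge0 ?cn_ge0//.
  by rewrite [leLHS]mulrC ler_pM2r.
apply: (@le_trans _ _ M2); last first.
  apply: le_trans (ler_norm _) _; rewrite lerDr mulr_ge0//; exact: ltW.
have kq := hkap z h1 h2 (ltW hX).
apply: le_trans (cnB _ _) _; rewrite /M2 cnM.
have q1 : cn (e2pi z) <= 1.
  by rewrite cn_e2pi expR_le1 oppr_le0 !mulr_ge0// pi_ge0.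
have e0 : 0 < cn (1 - e2pi z) by apply: lt_le_trans kq.
apply: lerD.
  apply: ler_wpM2l; first exact: cn_ge0.
  have := hL _ q1; rewrite cnM cnX -ler_pdivlMr ?exprn_gt0// => H; apply: le_trans H _.
  have ML0 : 0 <= ML by apply: le_trans (hL _ q1); exact: cn_ge0.
  apply: ler_wpM2l => //; rewrite lef_pV2 ?posrE ?exprn_gt0//.
  by apply: lerXn2r; rewrite ?nnegrE ?cn_ge0// ltW.
rewrite cnV cnX lef_pV2 ?posrE ?exprn_gt0 ?divr_gt0//.
apply: lerXn2r; [by rewrite nnegrE divr_ge0// ltW|by rewrite nnegrE cn_ge0|].
by rewrite ler_pdivrMr// mulrC -cnM ltW.
Qed.

Lemma lip4_strip z : half_strip z -> psi 4 z = twopii ^+ 4 / 6 * lip4 (e2pi z).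
Proof.
have q1 (u : C) : half_strip u -> 1 - e2pi u != 0.
  move=> [h1 _ u0]; rewrite subr_eq0; apply: contraNneq u0 => E.
  by apply/eqP; apply: e2pi_eq1.
(* With a = (1 - q) / X and b = ((1 - q)^2 - X^2 q) / X^4, this is X^2 ([lip4] q / 6 - X^-4),
   rewritten as a polynomial in a, a^-1, b, q and X. *)
pose W a b q X : C := - ((a ^+ 2 + 2 * (q * b) + X ^+ 2 * b ^+ 2) * a^-1 ^+ 4)
  + 7 * (6^-1 * a^-1 ^+ 2) - 6^-1 * (X * a^-1).
have [|||||M hM] := @strip_bound lip4 (twopii ^+ 4 / 6) 4 2 W.
- by [].
- by [].
- exists (1 * (1 + 4 * 1 + 1 ^+ 2) + 0) => q hq; have [->|q0] := eqVneq (1 - q) 0.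
    by rewrite expr0n mulr0 cn0.
  by rewrite /lip4 divfK ?expf_neq0// addr0; bnd.
- move=> A; have i6 : cn (6^-1 : C) <= 6^-1 by rewrite cnV cn_nat.
  by eexists => a b q X h1 h2 h3 h4 h5; rewrite /W; bnd.
- move=> z0 q z00 q0 X; rewrite /W /lip4 /X; field.
  by rewrite z00 q0 twopii_neq0.
move=> hz; apply/eqP; rewrite -subr_eq0; apply/eqP.
apply: (@herglotz R (fun z => psi 4 z - twopii ^+ 4 / 6 * lip4 (e2pi z)) 2 M) => //.
  by move=> u; rewrite psi_per// e2piD e2pi1 mulr1.
move=> u hu; have d := psi_dup (k := 4) isT u; have qu := q1 u hu.
have E1 : e2pi u = e2pi (u / 2) ^+ 2 by rewrite -e2piMn; congr e2pi; field.
have E2 : e2pi ((u + 1) / 2) = - e2pi (u / 2).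
  by rewrite mulrDl mul1r e2piD e2pi_half mulrN1.
rewrite mulrBr -d E2 E1 /lip4; rewrite E1 in qu.
set q := e2pi (u / 2) in qu *.
have F : 1 - q ^+ 2 = (1 + q) * (1 - q) by ring.
have /andP[qp qm] : (1 + q != 0) && (1 - q != 0) by rewrite -negb_or -mulf_eq0 -F.
by field; rewrite qm qu opprK qp.
Qed.

Lemma lip6_strip z : half_strip z -> psi 6 z = twopii ^+ 6 / 120 * lip6 (e2pi z).
Proof.
have q1 (u : C) : half_strip u -> 1 - e2pi u != 0.
  move=> [h1 _ u0]; rewrite subr_eq0; apply: contraNneq u0 => E.
  by apply/eqP; apply: e2pi_eq1.
pose W a b q X : C := - ((3 * a ^+ 2 - X * a ^+ 3 + 3 * (q ^+ 2 * b) + 3 * (q * (X ^+ 2 * b ^+ 2))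
   + X ^+ 4 * b ^+ 3) * a^-1 ^+ 6)
  + 120^-1 * (390 * a^-1 ^+ 4 - 180 * (X * a^-1 ^+ 3) + 31 * (X ^+ 2 * a^-1 ^+ 2) - X ^+ 3 * a^-1).
have [|||||M hM] := @strip_bound lip6 (twopii ^+ 6 / 120) 6 4 W.
- by [].
- by [].
- exists (1 * (1 + 26 * 1 + 66 * 1 ^+ 2 + 26 * 1 ^+ 3 + 1 ^+ 4) + 0) => q hq; have [->|q0] := eqVneq (1 - q) 0.
    by rewrite expr0n mulr0 cn0.
  by rewrite /lip6 divfK ?expf_neq0// addr0; bnd.
- move=> A; have i6 : cn (120^-1 : C) <= 120^-1 by rewrite cnV cn_nat.
  by eexists => a b q X h1 h2 h3 h4 h5; rewrite /W; bnd.
- move=> z0 q z00 q0 X; rewrite /W /lip6 /X; field.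
  by rewrite z00 q0 twopii_neq0.
move=> hz; apply/eqP; rewrite -subr_eq0; apply/eqP.
apply: (@herglotz R (fun z => psi 6 z - twopii ^+ 6 / 120 * lip6 (e2pi z)) 4 M) => //.
  by move=> u; rewrite psi_per// e2piD e2pi1 mulr1.
move=> u hu; have d := psi_dup (k := 6) isT u; have qu := q1 u hu.
have E1 : e2pi u = e2pi (u / 2) ^+ 2 by rewrite -e2piMn; congr e2pi; field.
have E2 : e2pi ((u + 1) / 2) = - e2pi (u / 2).
  by rewrite mulrDl mul1r e2piD e2pi_half mulrN1.
rewrite mulrBr -d E2 E1 /lip6; rewrite E1 in qu.
set q := e2pi (u / 2) in qu *.
have F : 1 - q ^+ 2 = (1 + q) * (1 - q) by ring.
have /andP[qp qm] : (1 + q != 0) && (1 - q != 0) by rewrite -negb_or -mulf_eq0 -F.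
by field; rewrite qm qu opprK qp.
Qed.

End LipschitzFormula.

(** * Eisenstein series summed by rows *)

Section EisensteinSeries.
Variable R : realType.
Local Notation C := R[i].
Implicit Types (z q tau : C).

Let to_strip (D : C -> C) : (forall z, D (z + 1) = D z) -> (forall z, half_strip z -> D z = 0) ->
  forall z, 0 < complex.Im z -> D z = 0.
Proof.
move=> pD hD z z0.
have pn (n : nat) u : D (u + n%:R) = D u.
  by elim: n => [|n ih]; rewrite ?addr0// -natr1 addrA pD.
have pz (n : int) u : D (u + n%:~R) = D u.
  case: n => n; first exact: pn.
  by rewrite NegzE mulrNz -(pn n.+1 (u - _)) subrK.
pose n := Num.floor (complex.Re z + 2^-1).
have Rn : complex.Re (n%:~R : C) = n%:~R by rewrite -(rmorph_int (real_complex R)).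
have In : complex.Im (n%:~R : C) = 0 by rewrite -(rmorph_int (real_complex R)).
rewrite -(pz (- n)) mulrNz; apply: hD; split.
- rewrite ReD ReN Rn; have := floor_le (complex.Re z + 2^-1); have := lt_succ_floor (complex.Re z + 2^-1).
  by rewrite -/n intrD => h1 h2; rewrite ler_norml; lra.
- by rewrite ImD ImN In oppr0 addr0 ltW.
- by apply: contraTneq z0 => /(congr1 (@complex.Im R)); rewrite ImD ImN In oppr0 addr0 => ->; rewrite ltxx.
Qed.

Lemma lipschitz4 z : 0 < complex.Im z -> psi 4 z = twopii R ^+ 4 / 6 * lip4 (e2pi z).
Proof.
move=> z0; apply/eqP; rewrite -subr_eq0; apply/eqP.
apply: (to_strip (D := fun z => psi 4 z - twopii R ^+ 4 / 6 * lip4 (e2pi z))) => // u.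
  by rewrite psi_per// e2piD e2pi1 mulr1.
by move/lip4_strip => ->; rewrite subrr.
Qed.

Lemma lipschitz6 z : 0 < complex.Im z -> psi 6 z = twopii R ^+ 6 / 120 * lip6 (e2pi z).
Proof.
move=> z0; apply/eqP; rewrite -subr_eq0; apply/eqP.
apply: (to_strip (D := fun z => psi 6 z - twopii R ^+ 6 / 120 * lip6 (e2pi z))) => // u.
  by rewrite psi_per// e2piD e2pi1 mulr1.
by move/lip6_strip => ->; rewrite subrr.
Qed.

Let half_half : half_strip (2^-1 : C).
Proof.
have E : (2^-1 : C) = (2^-1 : R)%:C by rewrite fmorphV rmorph_nat.
by split; rewrite ?invr_neq0 ?pnatr_eq0// E //= ger0_norm// invr_ge0.
Qed.

(* The duplication formula at 0 gives 2 zeta(k) = psi k 0 from the value at 1/2. *)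
Let psi0E k : (4 <= k)%N -> (2 ^+ k - 1) * psi k 0 = psi k 2^-1 :> C.
Proof.
move=> k4; have := psi_dup k4 (0 : C); rewrite mul0r add0r mul1r => h.
by rewrite mulrBl mul1r -h addrAC subrr add0r.
Qed.

Let nat_neq (n : nat) : (n.+1%:R : C) != 0. Proof. by rewrite pnatr_eq0. Qed.

Lemma zeta4 : psi 4 0 = twopii R ^+ 4 / 720.
Proof.
have := @psi0E 4 isT; rewrite (lip4_strip half_half) e2pi_half /lip4 => h.
have n15 : (2 ^+ 4 - 1 : C) = 15 by ring.
have two : 1 - -1 = 2 :> C by ring.
by apply: (mulfI (nat_neq 14)); rewrite -{1}n15 h two; field.
Qed.

Lemma zeta6 : psi 6 0 = - (twopii R ^+ 6 / (120 * 252)).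
Proof.
have := @psi0E 6 isT; rewrite (lip6_strip half_half) e2pi_half /lip6 => h.
have n15 : (2 ^+ 6 - 1 : C) = 63 by ring.
have two : 1 - -1 = 2 :> C by ring.
by apply: (mulfI (nat_neq 62)); rewrite -{1}n15 h two; field.
Qed.

Definition eis_partial k tau N : C := zsum N (fun m => psi_partial k (m%:~R * tau) N).

Let eis_summand k tau (m n : int) : (0 < k)%N ->
  (if (m == 0) && (n == 0) then 0 else (m%:~R * tau + n%:~R) ^- k) = (m%:~R * tau + n%:~R) ^- k.
Proof.
by move=> k0; case: ifP => // /andP[/eqP -> /eqP ->]; rewrite mul0r addr0 expr0n (gtn_eqF k0) invr0.
Qed.

Lemma eisenstein_lim k tau l : (0 < k)%N -> seqlim (eis_partial k tau) l -> eisenstein k tau = l.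
Proof.
move=> k0 hl; rewrite /eisenstein; apply: lim_seqlim; apply: seqlim_ext hl => N.
by apply: eq_zsum => m; apply: eq_zsum => n; rewrite eis_summand.
Qed.

(** Since |m tau + n| >= c |n| for every m, cutting a row at |n| <= N costs O(N^-3) uniformly in m.
    The 2N + 1 rows of the square lose O(N^-2) altogether. *)
Lemma eis_partial_psi k tau l : (4 <= k)%N -> 0 < complex.Im tau ->
  seqlim (fun N => zsum N (fun m => psi k (m%:~R * tau))) l -> seqlim (eis_partial k tau) l.
Proof.
move=> k4 t0 hl.
have nt : 0 < cn tau by rewrite cn_gt0; apply: contraTneq t0 => ->; rewrite /= ltxx.
(* The distance from n to the real line spanned by tau is |n| Im tau / |tau|. *)
pose c := complex.Im tau / cn tau; have c0 : 0 < c by rewrite divr_gt0.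
have far (m : int) (s : C) (n : nat) : s = n%:R \/ s = - n%:R -> c * n%:R <= cn (m%:~R * tau + s).
  move=> hs; rewrite /c mulrAC ler_pdivrMr//.
  have -> : cn (m%:~R * tau + s) * cn tau = cn ((m%:~R * tau + s) * conjc tau).
    by rewrite cnM; congr (_ * _); rewrite /cn; case: (tau) => u v /=; rewrite sqrrN.
  apply: le_trans (cn_Im _).
  have -> : complex.Im ((m%:~R * tau + s) * conjc tau) =
     complex.Im s * complex.Re tau - complex.Re s * complex.Im tau.
    have Rm : complex.Re (m%:~R : C) = m%:~R by rewrite -(rmorph_int (real_complex R)).
    have Im : complex.Im (m%:~R : C) = 0 by rewrite -(rmorph_int (real_complex R)).
    rewrite ImM ReD ImD ReM ImM Rm Im; case: (tau) => u v /=; ring.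
  have nI : 0 <= n%:R * complex.Im tau by rewrite mulr_ge0// ltW.
  rewrite [leLHS]mulrC; case: hs => ->; rewrite ?ReN ?ImN Re_nat Im_nat.
    by rewrite mul0r sub0r normrN ger0_norm.
  by rewrite oppr0 mul0r sub0r mulNr opprK ger0_norm.
have tl (m : int) N : (1 <= N)%N ->
    cn (psi_partial k (m%:~R * tau) N - psi k (m%:~R * tau)) <= 2 * c ^- k * N%:R ^- 3.
  by move=> N1; rewrite cnBC; apply: psi_tail => // n _; split; apply: far; [left|right].
rewrite -[l]add0r; apply: seqlim_ext (seqlim_add (_ : seqlim (fun N =>
   eis_partial k tau N - zsum N (fun m => psi k (m%:~R * tau))) 0) hl) => [N|].
  by rewrite subrK.
move=> e e0.
have k0 : 0 <= 3 * (2 * c ^- k) :> R by rewrite !mulr_ge0// invr_ge0 exprn_ge0// ltW.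
have [N0 hN0] := inv_nat_small k0 e0; exists N0.+1 => -[//|N]; rewrite ltnS => Nn.
rewrite subr0 /eis_partial -zsum_sub.
apply: le_trans (zsum_bound _ (fun m => tl m N.+1 isT)) _.
apply: le_trans (hN0 N Nn).
have N1 : (1 : R) <= N.+1%:R by rewrite ler1n.
have h2 : (N.+1.*2.+1%:R : R) <= 3 * N.+1%:R.
  by rewrite -natr1 -mul2n natrM; lra.
have ck : 0 <= 2 * c ^- k * N.+1%:R ^- 3 :> R.
  by rewrite !mulr_ge0// invr_ge0 exprn_ge0// ltW.
apply: le_trans (ler_wpM2r ck h2) _.
have key (u v : R) : v != 0 -> 3 * v * (u * v ^- 3) = 3 * u / v * v^-1 by move=> v0; field.
rewrite key ?pnatr_eq0//.
rewrite -[leRHS]mulr1; apply: ler_wpM2l; first by rewrite divr_ge0.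
by rewrite invf_le1// ltr0n.
Qed.

Lemma zsum_psi k tau N : (4 <= k)%N -> ~~ odd k ->
  zsum N (fun m => psi k (m%:~R * tau)) = psi k 0 + 2 * \sum_(m < N) psi k (m.+1%:R * tau).
Proof.
move=> k4 ok; elim: N => [|N ih]; first by rewrite zsum0 big_ord0 mul0r mulr0 addr0.
by rewrite zsumS ih big_ord_recr/= mulrNz mulNr psi_even//; ring.
Qed.

End EisensteinSeries.

(** * Lambert series *)

Section LambertSeries.
Variable R : realType.
Local Notation C := R[i].
Implicit Types (x q : C) (L : C -> C).

Definition lambert_partial L q N : C := \sum_(m < N) L (q ^+ m.+1).

Definition lambert L q : C := xget 0 [set l | seqlim (lambert_partial L q) l].

Lemma lambert_partial_tail L q (B : R) M N : 0 <= B -> cn q < 1 ->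
  (forall x, cn x <= cn q -> cn (L x) <= B * cn x) -> (N <= M)%N ->
  cn (lambert_partial L q M - lambert_partial L q N) <= B * cn q ^+ N.+1 / (1 - cn q).
Proof.
move=> B0 q1 hL NM; set r := cn q in q1 *; have r0 : 0 <= r := cn_ge0 q.
have d0 : 0 < 1 - r by rewrite subr_gt0.
suff : cn (lambert_partial L q M - lambert_partial L q N) <= B * (r ^+ N.+1 - r ^+ M.+1) / (1 - r).
  move=> /le_trans; apply; apply: ler_wpM2r; first by rewrite invr_ge0 ltW.
  by apply: ler_wpM2l => //; rewrite gerBl exprn_ge0.
elim: M NM => [|M ih]; first by rewrite leqn0 => /eqP ->; rewrite !subrr cn0 mulr0 mul0r.
rewrite leq_eqVlt => /orP[/eqP ->|]; first by rewrite !subrr cn0 mulr0 mul0r.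
rewrite ltnS => NM; have := ih NM => h.
rewrite {1}/lambert_partial big_ord_recr/= -/(lambert_partial L q M) addrAC.
apply: le_trans (cnD _ _) _.
have t : cn (L (q ^+ M.+1)) <= B * r ^+ M.+1.
  have := hL (q ^+ M.+1); rewrite cnX -/r; apply.
  by rewrite exprS ler_piMr// exprn_ile1// ltW.
have -> : B * (r ^+ N.+1 - r ^+ M.+2) / (1 - r) = B * (r ^+ N.+1 - r ^+ M.+1) / (1 - r) + B * r ^+ M.+1.
  by rewrite [r ^+ M.+2]exprS; field; rewrite gt_eqF.
exact: lerD.
Qed.

Lemma lambert_lim L q (B : R) : 0 <= B -> cn q < 1 ->
  (forall x, cn x <= cn q -> cn (L x) <= B * cn x) ->
  seqlim (lambert_partial L q) (lambert L q).
Proof.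
move=> B0 q1 hL; rewrite /lambert; case: xgetP => [l -> //|hno].
have r0 : 0 <= cn q := cn_ge0 q.
have hc M N : (0 <= N)%N -> (N <= M)%N -> _ := fun _ => @lambert_partial_tail L q B M N B0 q1 hL.
have [|l hl] := @cauchy_bound R _ (fun N => B * cn q ^+ N.+1 / (1 - cn q)) 0%N _ hc.
  move=> e e0; have d0 : 0 < 1 - cn q by rewrite subr_gt0.
  have k0 : 0 < (B + 1) / (1 - cn q) by rewrite divr_gt0// ltr_wpDl.
  have : (fun n => cn q ^+ n) @ \oo --> (0 : R) by apply: cvg_expr; rewrite ger0_norm.
  move=> /cvgrPdist_le /(_ _ (divr_gt0 e0 k0))[N _ hN]; exists N; split => //.
  have := hN N.+1 (leqnSn N); rewrite /= sub0r normrN ger0_norm ?exprn_ge0// ler_pdivlMr// => h.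
  apply: le_trans h; rewrite mulrAC mulrC; apply: ler_wpM2l; first exact: exprn_ge0.
  by rewrite ler_pM2r ?invr_gt0// lerDl.
by exfalso; exact: (hno l).
Qed.

Lemma lambert_tail L q (B : R) N : 0 <= B -> cn q < 1 ->
  (forall x, cn x <= cn q -> cn (L x) <= B * cn x) ->
  cn (lambert L q - lambert_partial L q N) <= B * cn q ^+ N.+1 / (1 - cn q).
Proof.
move=> B0 q1 hL; apply: (@seqlim_le _ _ _ _ _ N (lambert_lim B0 q1 hL)) => M NM.
exact: lambert_partial_tail.
Qed.

End LambertSeries.

(** * The forms E4 and E6, the discriminant, and the invariance of j *)

Section ModularForms.
Variable R : realType.
Local Notation C := R[i].
Implicit Types (z q x tau : C) (L : C -> C).

Let bD z x (A B : R) : cn z <= A -> cn x <= B -> cn (z + x) <= A + B.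
Proof. by move=> h1 h2; apply: le_trans (cnD _ _) _; exact: lerD. Qed.
Let bN z (A : R) : cn z <= A -> cn (- z) <= A.
Proof. by rewrite cnN. Qed.
Let bM z x (A B : R) : cn z <= A -> cn x <= B -> cn (z * x) <= A * B.
Proof. by move=> h1 h2; rewrite cnM ler_pM ?cn_ge0. Qed.
Let bX z (A : R) n : cn z <= A -> cn (z ^+ n) <= A ^+ n.
Proof.
by move=> h1; rewrite cnX lerXn2r ?nnegrE ?cn_ge0//; apply: le_trans h1; exact: cn_ge0.
Qed.
Let bC (n : nat) : cn (n%:R : C) <= n%:R.
Proof. by rewrite cn_nat. Qed.
Let b1 : cn (1 : C) <= 1.
Proof. by rewrite cn1. Qed.

Ltac bnd := repeat match goal with
  | |- is_true (cn (_ + _) <= _) => apply: bD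
  | |- is_true (cn (- _) <= _) => apply: bN
  | |- is_true (cn (_ * _) <= _) => apply: bM
  | |- is_true (cn (_ ^+ _) <= _) => apply: bX
  | |- is_true (cn 1 <= _) => exact: b1
  | |- is_true (cn (_%:R) <= _) => exact: bC
  | |- _ => eassumption
  end.

Lemma qpar1 z : qpar 1 z = e2pi z.
Proof. by rewrite /qpar rmorph1 divr1. Qed.

Let sub1_ge x (r : R) : cn x <= r -> 1 - r <= cn (1 - x).
Proof. by move=> xr; have := cn_sub_ge 1 x; rewrite cn1; lra. Qed.


Let frac_bound (p : C) (B r : R) n x : r < 1 -> cn x <= r -> cn p <= B ->
  cn (x * p / (1 - x) ^+ n) <= B / (1 - r) ^+ n * cn x.
Proof.
move=> r1 xr pB; have d0 : 0 < 1 - r by rewrite subr_gt0.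
have low := sub1_ge xr; have d1 : 0 < cn (1 - x) by apply: lt_le_trans low.
rewrite -mulrA cnM mulrC; apply: ler_wpM2r; first exact: cn_ge0.
rewrite cnf cnX; apply: ler_pM => //; rewrite ?cn_ge0 ?invr_ge0 ?exprn_ge0 ?cn_ge0//.
rewrite lef_pV2 ?posrE ?exprn_gt0//.
by apply: lerXn2r; rewrite ?nnegrE ?cn_ge0 ?(ltW d0).
Qed.

Lemma lip4_bound (r : R) : r < 1 -> exists2 B : R, 0 <= B & forall x, cn x <= r -> cn (lip4 x) <= B * cn x.
Proof.
move=> r1; exists ((1 + 4 * `|r| + `|r| ^+ 2) / (1 - r) ^+ 4).
  by rewrite divr_ge0 ?exprn_ge0 ?subr_ge0 ?ltW// !addr_ge0// ?mulr_ge0.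
move=> x xr; have xa : cn x <= `|r| by apply: le_trans xr (ler_norm _).
by apply: frac_bound => //; bnd.
Qed.

Lemma lip6_bound (r : R) : r < 1 -> exists2 B : R, 0 <= B & forall x, cn x <= r -> cn (lip6 x) <= B * cn x.
Proof.
move=> r1; exists ((1 + 26 * `|r| + 66 * `|r| ^+ 2 + 26 * `|r| ^+ 3 + `|r| ^+ 4) / (1 - r) ^+ 6).
  by rewrite divr_ge0 ?exprn_ge0 ?subr_ge0 ?ltW// !addr_ge0// ?mulr_ge0 ?exprn_ge0.
move=> x xr; have xa : cn x <= `|r| by apply: le_trans xr (ler_norm _).
by apply: frac_bound => //; bnd.
Qed.

Let sub1_neq0 x : cn x < 1 -> 1 - x != 0.
Proof. by move=> x1; rewrite -cn_gt0; apply: lt_le_trans (sub1_ge (lexx _)); rewrite subr_gt0. Qed.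

Lemma holo_lip4 x : cn x < 1 -> holo (@lip4 R) x.
Proof.
move=> x1; apply: holo_div; last by rewrite expf_neq0// sub1_neq0.
  apply: holo_mul; first exact: holo_id.
  apply: holo_add; last exact: (holo_exp 2 (holo_id x)).
  by apply: holo_add; [exact: holo_cst|apply: holo_mul; [exact: holo_cst|exact: holo_id]].
by apply: (@holo_exp _ (fun u => 1 - u)); apply: holo_sub; [exact: holo_cst|exact: holo_id].
Qed.

Lemma holo_lip6 x : cn x < 1 -> holo (@lip6 R) x.
Proof.
move=> x1; apply: holo_div; last by rewrite expf_neq0// sub1_neq0.
  apply: holo_mul; first exact: holo_id.
  have hX n := holo_exp n (holo_id x).
  apply: holo_add; last exact: (hX 4).
  apply: holo_add; last by apply: holo_mul; [exact: holo_cst|exact: (hX 3)].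
  apply: holo_add; last by apply: holo_mul; [exact: holo_cst|exact: (hX 2)].
  by apply: holo_add; [exact: holo_cst|apply: holo_mul; [exact: holo_cst|exact: holo_id]].
by apply: (@holo_exp _ (fun u => 1 - u)); apply: holo_sub; [exact: holo_cst|exact: holo_id].
Qed.

(** The partial sums are periodic, bounded at infinity and converge geometrically on each half-plane
    Im >= y1, so Weierstrass' theorem [holoH_limit] applies. *)
Lemma holoH_lambert L :
  (forall r : R, r < 1 -> exists2 B : R, 0 <= B & forall x, cn x <= r -> cn (L x) <= B * cn x) ->
  (forall x, cn x < 1 -> holo L x) -> holoH (fun tau => lambert L (qpar 1 tau)).
Proof.
move=> hB hL.
apply: (@holoH_limit R 1 ltr01 (fun N tau => lambert_partial L (qpar 1 tau) N)).
- move=> N z z0; apply: (@holo_sum _ _ (index_enum _) (fun (m : 'I_N) z => L (qpar 1 z ^+ m.+1))) => m.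
  apply: (@holo_comp _ (fun z => qpar 1 z ^+ m.+1) L); first by apply: holo_exp; exact: holo_qpar.
  by apply: hL; rewrite cnX exprn_ilt1// ?cn_ge0// cn_qpar_lt1.
- by move=> N z _; rewrite qpar_per.
- move=> N; apply: (@bigO_sum _ 1 0 _ (index_enum _) (fun (m : 'I_N) z => L (qpar 1 z ^+ m.+1))) => m.
  pose r := cn (qpar 1 (0 +i* 1 : C)).
  have r1 : r < 1 by apply: cn_qpar_lt1 => //=.
  have [B B0 hr] := hB _ r1; exists 1, B => z z1; rewrite expr0 mulr1.
  have qr : cn (qpar 1 z) < r by apply: cn_qpar_lt.
  have qm : cn (qpar 1 z ^+ m.+1) <= r.
    rewrite cnX exprS; apply: le_trans (ltW qr); rewrite ler_piMr ?cn_ge0// exprn_ile1 ?cn_ge0//.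
    by apply: ltW; apply: lt_trans qr r1.
  apply: le_trans (hr _ qm) _; rewrite ler_piMr//; apply: le_trans qm _; exact: ltW.
move=> y1 e y10 e0; pose r := cn (qpar 1 (0 +i* y1 : C)).
have r1 : r < 1 by apply: cn_qpar_lt1 => //=.
have r0 : 0 <= r := cn_ge0 _; have d0 : 0 < 1 - r by rewrite subr_gt0.
have [B B0 hr] := hB _ r1.
have k0 : 0 < (B + 1) / (1 - r) by rewrite divr_gt0// ltr_wpDl.
have : (fun n => r ^+ n) @ \oo --> (0 : R) by apply: cvg_expr; rewrite ger0_norm.
move=> /cvgrPdist_le /(_ _ (divr_gt0 e0 k0))[N _ hN]; exists N => n Nn z zy.
have qr : cn (qpar 1 z) <= r.
  by rewrite /r !cn_qpar ler_expR lerN2 ler_pM2l// kappa_gt0.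
have q1 : cn (qpar 1 z) < 1 by apply: le_lt_trans qr r1.
rewrite cnBC; apply: le_trans (lambert_tail n B0 q1 (fun x hx => hr x (le_trans hx qr))) _.
have := hN n.+1 (leqW Nn); rewrite /= sub0r normrN ger0_norm ?exprn_ge0// ler_pdivlMr// => h.
apply: le_trans h; rewrite -mulrA mulrC -mulrA.
apply: ler_pM; rewrite ?exprn_ge0 ?cn_ge0//.
- by rewrite mulr_ge0// invr_ge0 subr_ge0 ltW.
- by apply: lerXn2r; rewrite ?nnegrE ?cn_ge0.
rewrite mulrC; apply: ler_pM; rewrite ?invr_ge0 ?subr_ge0 ?(ltW q1)// ?lerDl//.
by rewrite lef_pV2 ?posrE ?subr_gt0// lerB.
Qed.

(** The Eisenstein series of weights 4 and 6 with constant term 1; collecting powers of q in the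
    Lambert series would give the divisor sums sigma_3 and sigma_5. [disc] is 1728 times the usual
    discriminant form. *)
Definition e4 tau : C := 1 + 240 * lambert (@lip4 R) (qpar 1 tau).
Definition e6 tau : C := 1 - 504 * lambert (@lip6 R) (qpar 1 tau).
Definition disc tau : C := e4 tau ^+ 3 - e6 tau ^+ 2.

Lemma holoH_e4 : holoH e4.
Proof.
move=> z z0; apply: holo_add; first exact: holo_cst.
by apply: holo_mul; [exact: holo_cst|exact: (holoH_lambert lip4_bound holo_lip4)].
Qed.

Lemma holoH_e6 : holoH e6.
Proof.
move=> z z0; apply: holo_sub; first exact: holo_cst.
by apply: holo_mul; [exact: holo_cst|exact: (holoH_lambert lip6_bound holo_lip6)].
Qed.

Lemma e4_per tau : e4 (tau + 1) = e4 tau.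
Proof. by rewrite /e4 -(qpar_per ltr01 tau) rmorph1. Qed.

Lemma e6_per tau : e6 (tau + 1) = e6 tau.
Proof. by rewrite /e6 -(qpar_per ltr01 tau) rmorph1. Qed.

Let twn0 : twopii R != 0. Proof. exact: twopii_neq0. Qed.

Let ImM_nat (n : nat) tau : 0 < complex.Im tau -> 0 < complex.Im (n.+1%:R * tau).
Proof. by move=> t0; rewrite ImM Re_nat Im_nat mul0r addr0 mulr_gt0. Qed.

Lemma eis4_lim tau : 0 < complex.Im tau ->
  seqlim (eis_partial 4 tau) (twopii R ^+ 4 / 720 * e4 tau).
Proof.
move=> t0; apply: eis_partial_psi => //.
have q1 := @cn_qpar_lt1 R 1 ltr01 tau t0.
have [B B0 hB] := lip4_bound q1.
have := seqlim_add (@seqlim_cst R (psi 4 0)) (seqlim_scale (twopii R ^+ 4 / 3) (lambert_lim B0 q1 hB)).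
rewrite zeta4 => H; have -> : twopii R ^+ 4 / 720 * e4 tau =
   twopii R ^+ 4 / 720 + twopii R ^+ 4 / 3 * lambert (@lip4 R) (qpar 1 tau) by rewrite /e4; field.
apply: seqlim_ext H => N; rewrite zsum_psi// zeta4 /lambert_partial !mulr_sumr; congr (_ + _).
by apply: eq_bigr => m _; rewrite lipschitz4 ?ImM_nat// e2piMn qpar1; field.
Qed.

Lemma eis6_lim tau : 0 < complex.Im tau ->
  seqlim (eis_partial 6 tau) (- (twopii R ^+ 6 / (120 * 252)) * e6 tau).
Proof.
move=> t0; apply: eis_partial_psi => //.
have q1 := @cn_qpar_lt1 R 1 ltr01 tau t0.
have [B B0 hB] := lip6_bound q1.
have := seqlim_add (@seqlim_cst R (psi 6 0)) (seqlim_scale (twopii R ^+ 6 / 60) (lambert_lim B0 q1 hB)).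
rewrite zeta6 => H; have -> : - (twopii R ^+ 6 / (120 * 252)) * e6 tau =
   - (twopii R ^+ 6 / (120 * 252)) + twopii R ^+ 6 / 60 * lambert (@lip6 R) (qpar 1 tau) by rewrite /e6; field.
apply: seqlim_ext H => N; rewrite zsum_psi// zeta6 /lambert_partial !mulr_sumr; congr (_ + _).
by apply: eq_bigr => m _; rewrite lipschitz6 ?ImM_nat// e2piMn qpar1; field.
Qed.

Lemma jinvE tau : 0 < complex.Im tau -> jinv tau = 1728 * e4 tau ^+ 3 / disc tau.
Proof.
move=> t0; rewrite /jinv /g2 /g3 (eisenstein_lim _ (eis4_lim t0))// (eisenstein_lim _ (eis6_lim t0))// /disc.
have i12 : (12 : C) != 0 by rewrite pnatr_eq0.
(* The factor common to g2^3 and 27 g3^2, which cancels in j. *)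
pose k : C := (twopii R ^+ 4 / 12) ^+ 3.
have k0 : k != 0 by apply: expf_neq0; apply: mulf_neq0; [exact: expf_neq0|rewrite invr_neq0].
have E1 : (60 * (twopii R ^+ 4 / 720 * e4 tau)) ^+ 3 = k * e4 tau ^+ 3 by rewrite /k; field.
have E2 : 27 * (140 * (- (twopii R ^+ 6 / (120 * 252)) * e6 tau)) ^+ 2 = k * e6 tau ^+ 2 by rewrite /k; field.
have key (c a b : C) : c * (k * a) / (k * b) = c * a / b.
  by rewrite mulrCA invfM mulrACA divff// mul1r.
by rewrite E1 E2 -mulrBr key.
Qed.

(** Replacing tau by -1/tau exchanges the two indices up to sign. A square of indices is stable
    under this, so the transformation law holds for every partial sum. *)
Let eis_partial_S k tau N : ~~ odd k -> tau != 0 ->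
  eis_partial k (- tau^-1) N = tau ^+ k * eis_partial k tau N.
Proof.
move=> ok t0; rewrite /eis_partial /psi_partial.
transitivity (zsum N (fun m => zsum N (fun n => tau ^+ k * ((n%:~R * tau + (- m)%:~R) ^- k)))).
  apply: eq_zsum => m; apply: eq_zsum => n.
  have -> : m%:~R * - tau^-1 + n%:~R = (n%:~R * tau + (- m)%:~R) / tau.
    by rewrite mulrNz; field.
  by rewrite exprMn exprVn invfM invrK mulrC.
rewrite -zsum_scale.
transitivity (zsum N (fun n => zsum N (fun m => tau ^+ k * ((n%:~R * tau + (- m)%:~R) ^- k)))).
  by rewrite /zsum exchange_big.
apply: eq_zsum => n; rewrite -zsum_scale.
exact: (@zsum_opp R N (fun m => tau ^+ k * ((n%:~R * tau + m%:~R) ^- k))).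
Qed.

Let Im_S tau : 0 < complex.Im tau -> tau != 0 /\ 0 < complex.Im (- tau^-1).
Proof.
move=> t0; have nz : tau != 0 by apply: contraTneq t0 => ->; rewrite ltxx.
split => //; rewrite ImN; case: tau t0 nz => u v /= v0 nz.
by rewrite opprK divr_gt0// ltr_wpDl ?sqr_ge0// exprn_gt0.
Qed.

Lemma e4_S tau : 0 < complex.Im tau -> e4 (- tau^-1) = tau ^+ 4 * e4 tau.
Proof.
move=> t0; have [nz s0] := Im_S t0.
have := seqlim_ext (fun N => esym (@eis_partial_S 4 tau N isT nz)) (seqlim_scale (tau ^+ 4) (eis4_lim t0)).
move=> /(seqlim_uniq (eis4_lim s0)); rewrite mulrCA => /mulfI; apply.
by apply: mulf_neq0; [exact: expf_neq0|rewrite invr_eq0 pnatr_eq0].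
Qed.

Lemma e6_S tau : 0 < complex.Im tau -> e6 (- tau^-1) = tau ^+ 6 * e6 tau.
Proof.
move=> t0; have [nz s0] := Im_S t0.
have := seqlim_ext (fun N => esym (@eis_partial_S 6 tau N isT nz)) (seqlim_scale (tau ^+ 6) (eis6_lim t0)).
move=> /(seqlim_uniq (eis6_lim s0)); rewrite mulrCA => /mulfI; apply.
by rewrite oppr_eq0; apply: mulf_neq0; [exact: expf_neq0|rewrite invr_eq0; apply: mulf_neq0; rewrite pnatr_eq0].
Qed.

Lemma disc_S tau : 0 < complex.Im tau -> disc (- tau^-1) = tau ^+ 12 * disc tau.
Proof. by move=> t0; rewrite /disc e4_S// e6_S//; ring. Qed.

Lemma disc_per tau : disc (tau + 1) = disc tau.
Proof. by rewrite /disc e4_per e6_per. Qed.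

Lemma jinv_S tau : 0 < complex.Im tau -> jinv (- tau^-1) = jinv tau.
Proof.
move=> t0; have [nz s0] := Im_S t0.
have key (k c a b : C) : k != 0 -> c * (k * a) / (k * b) = c * a / b.
  by move=> k0; rewrite mulrCA invfM mulrACA divff// mul1r.
by rewrite (jinvE t0) (jinvE s0) disc_S// e4_S// exprMn -exprM key// expf_neq0.
Qed.

Lemma jinv_per tau : 0 < complex.Im tau -> jinv (tau + 1) = jinv tau.
Proof.
move=> t0; have t1 : 0 < complex.Im (tau + 1) by rewrite ImD Im1 addr0.
by rewrite (jinvE t1) (jinvE t0) disc_per e4_per.
Qed.

End ModularForms.

(** * Expansions of E4 and E6 over K *)

Section JExpansion.
Variable R : realType.
Local Notation C := R[i].
Implicit Types (z q x tau : C) (L F : C -> C) (p : {poly C}).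

Lemma poly_bounded p : exists2 B : R, 0 <= B & forall x, cn x <= 1 -> cn p.[x] <= B.
Proof.
exists (\sum_(i < size p) cn p`_i); first by apply: sumr_ge0 => i _; exact: cn_ge0.
move=> x x1; rewrite horner_coef; apply: le_trans (cn_sum _ _ _) _; apply: ler_sum => i _.
by rewrite cnM cnX ler_piMr ?cn_ge0// exprn_ile1 ?cn_ge0.
Qed.

Variable K : divringClosed C.

(** Up to O(q^M) only the first M terms L(q^(m+1)) count, and in each of them L may be replaced by a
    polynomial over K. *)
Lemma asy_lambert L (B : R) : 0 <= B -> (forall x, cn x <= 2^-1 -> cn (L x) <= B * cn x) ->
  (forall M : nat, exists2 p, p \is a polyOver K & exists2 B' : R, 0 <= B' &
    forall x, cn x <= 2^-1 -> cn (L x - p.[x]) <= B' * cn x ^+ M) ->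
  asy 1 K (fun tau => lambert L (qpar 1 tau)).
Proof.
move=> B0 hB hp; exists 0%N => M; have [p pK [B' B'0 hB']] := hp M.
exists (\sum_(m < M) (p \Po 'X^(m.+1))).
  by apply: rpred_sum => m _; rewrite polyOver_comp// rpredX// polyOverX.
have i2 : (0 : R) < 2^-1 by rewrite invr_gt0.
have [Y hY] := @qpar_small R 1 ltr01 _ i2.
exists Y, (2 * B + M%:R * B') => z /hY; set q := qpar 1 z => /ltW q2.
have q0 : 0 <= cn q := cn_ge0 q.
rewrite expr0 mulr1.
have q1 : cn q < 1 by lra.
have t := lambert_tail M B0 q1 (fun x hx => hB x (le_trans hx q2)).
rewrite [X in cn X](_ : _ = (lambert L q - lambert_partial L q M) +
   (\sum_(m < M) (L (q ^+ m.+1) - p.[q ^+ m.+1]))); last first.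
  rewrite sumrB -/(lambert_partial L q M) horner_sum.
  rewrite [X in _ = _ + (_ - X)](_ : _ = \sum_(m < M) (p \Po 'X^(m.+1)).[q]); first by ring.
  by apply: eq_bigr => m _; rewrite horner_comp hornerXn.
apply: le_trans (cnD _ _) _; rewrite mulrDl; apply: lerD.
  apply: le_trans t _; rewrite exprSr ler_pdivrMr ?subr_gt0//.
  have key (u v : R) : 0 <= u -> 0 <= v -> v <= 2^-1 -> u * v <= 2 * u * (1 - v).
    move=> u0 v0 v2; have : u * v <= u * 2^-1 by rewrite ler_wpM2l.
    lra.
  rewrite mulrA (_ : 2 * B * _ = 2 * (B * cn q ^+ M)); last by ring.
  by apply: key => //; rewrite mulr_ge0// exprn_ge0.
apply: le_trans (cn_sum _ _ _) _.
apply: (@le_trans _ _ (\sum_(m < M) B' * cn q ^+ M)); last first.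
  by rewrite sumr_const card_ord -mulrA mulr_natl.
apply: ler_sum => m _.
have qm : cn (q ^+ m.+1) <= cn q by rewrite cnX exprS ler_piMr// exprn_ile1// ltW.
apply: le_trans (hB' _ (le_trans qm q2)) _; apply: ler_wpM2l => //.
by apply: lerXn2r; rewrite ?nnegrE ?cn_ge0.
Qed.

Let natK (n : nat) : (n%:R : C) \in K. Proof. exact: rpred_nat. Qed.

(** [poly_inv_mod] inverts (1 - X)^k modulo X^M over K; the remainder is controlled because 1 - x
    stays away from 0 for |x| <= 1/2. *)
Let expand (A : {poly C}) k (L : C -> C) : A \is a polyOver K ->
  (forall x, L x = A.[x] / (1 - x) ^+ k) ->
  forall M : nat, exists2 p, p \is a polyOver K & exists2 B' : R, 0 <= B' &
    forall x, cn x <= 2^-1 -> cn (L x - p.[x]) <= B' * cn x ^+ M.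
Proof.
move=> AK hL M; pose D : {poly C} := (1 - 'X) ^+ k.
have DK : D \is a polyOver K by rewrite rpredX// rpredB ?rpred1// polyOverX.
have D0 : D`_0 != 0.
  by rewrite -horner_coef0 /D horner_exp !hornerE expf_neq0// oner_neq0.
have [s sK [t st]] := poly_inv_mod M DK D0.
exists (A * s); first by rewrite rpredM.
have [B B0 hB] := poly_bounded (A * t); exists (B * 2 ^+ k).
  by rewrite mulr_ge0// exprn_ge0.
move=> x x2; have x1 : cn x <= 1 by lra.
have low : 2^-1 <= cn (1 - x) by have := cn_sub_ge 1 x; rewrite cn1; lra.
have n0 : 1 - x != 0 by rewrite -cn_gt0; apply: lt_le_trans low; rewrite invr_gt0.
have E : L x - (A * s).[x] = - ((A * t).[x] * x ^+ M / (1 - x) ^+ k).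
  have : (1 - x) ^+ k * s.[x] = 1 + x ^+ M * t.[x].
    have := congr1 (fun p => p.[x]) st; rewrite /D hornerM horner_exp !hornerE.
    by [].
  move=> H; rewrite hL !hornerM.
  apply: (mulIf (expf_neq0 k n0)); rewrite mulrBl divfK ?expf_neq0// mulNr divfK ?expf_neq0//.
  by rewrite -mulrA [s.[x] * _]mulrC H; ring.
rewrite E cnN cnf cnM !cnX ler_pdivrMr ?exprn_gt0 ?cn_gt0//.
have -> : B * 2 ^+ k * cn x ^+ M * cn (1 - x) ^+ k = (B * cn x ^+ M) * (2 * cn (1 - x)) ^+ k.
  by rewrite exprMn; ring.
rewrite -[leLHS]mulr1; apply: ler_pM; rewrite ?mulr_ge0 ?exprn_ge0 ?cn_ge0//.
  by rewrite ler_wpM2r ?exprn_ge0 ?cn_ge0// hB.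
by rewrite exprn_ege1//; lra.
Qed.

Let half1 : (2^-1 : R) < 1. Proof. lra. Qed.

Lemma asy_e4 : asy 1 K (@e4 R).
Proof.
apply: asy_add => //; first exact: asy_cst (rpred1 K).
apply: asy_scale => //; have [B B0 hB] := lip4_bound half1.
apply: asy_lambert B0 hB _.
apply: (@expand ('X * (1 + 4%:R%:P * 'X + 'X^2)) 4).
  by rewrite !(rpredM, rpredD, rpred1, rpredX, polyOverX, polyOverC, natK).
by move=> x; rewrite /lip4 !hornerE.
Qed.

Lemma asy_e6 : asy 1 K (@e6 R).
Proof.
apply: asy_sub => //; first exact: asy_cst (rpred1 K).
apply: asy_scale => //; have [B B0 hB] := lip6_bound half1.
apply: asy_lambert B0 hB _.
apply: (@expand ('X * (1 + 26%:R%:P * 'X + 66%:R%:P * 'X^2 + 26%:R%:P * 'X^3 + 'X^4)) 6).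
  by rewrite !(rpredM, rpredD, rpred1, rpredX, polyOverX, polyOverC, natK).
by move=> x; rewrite /lip6 !hornerE.
Qed.

End JExpansion.

(** * Numerical estimate of the discriminant for small q *)

Section DiscriminantBounds.
Variable R : realType.
Local Notation C := R[i].
Implicit Types (z q x tau : C) (L F : C -> C) (p : {poly C}).

Let bD z x (A B : R) : cn z <= A -> cn x <= B -> cn (z + x) <= A + B.
Proof. by move=> h1 h2; apply: le_trans (cnD _ _) _; exact: lerD. Qed.
Let bN z (A : R) : cn z <= A -> cn (- z) <= A.
Proof. by rewrite cnN. Qed.
Let bM z x (A B : R) : cn z <= A -> cn x <= B -> cn (z * x) <= A * B.
Proof. by move=> h1 h2; rewrite cnM ler_pM ?cn_ge0. Qed.
Let bX z (A : R) n : cn z <= A -> cn (z ^+ n) <= A ^+ n.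
Proof.
by move=> h1; rewrite cnX lerXn2r ?nnegrE ?cn_ge0//; apply: le_trans h1; exact: cn_ge0.
Qed.
Let bC (n : nat) : cn (n%:R : C) <= n%:R.
Proof. by rewrite cn_nat. Qed.
Let b1 : cn (1 : C) <= 1.
Proof. by rewrite cn1. Qed.

Ltac bnd := repeat match goal with
  | |- is_true (cn (_ + _) <= _) => apply: bD
  | |- is_true (cn (- _) <= _) => apply: bN
  | |- is_true (cn (_ * _) <= _) => apply: bM
  | |- is_true (cn (_ ^+ _) <= _) => apply: bX
  | |- is_true (cn 1 <= _) => exact: b1
  | |- is_true (cn (_%:R) <= _) => exact: bC
  | |- _ => eassumption
  end.

(** For Im tau >= 0.86, the bound pi >= 3 gives |q| <= exp(-5.16) <= 1/170; see [qpar1_domain]. *)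
Let t : R := 170^-1.
Let t0 : 0 < t. Proof. by rewrite invr_gt0. Qed.
Let t1 : 0 < 1 - t.
Proof. by rewrite subr_gt0 invf_lt1// ltr1n. Qed.

Let sub1_ge x (r : R) : cn x <= r -> 1 - r <= cn (1 - x).
Proof. by move=> xr; have := cn_sub_ge 1 x; rewrite cn1; lra. Qed.

Let frac (m p : C) (B c : R) n x : cn x <= t -> cn p <= B -> B <= c * (1 - t) ^+ n ->
  cn (m * p / (1 - x) ^+ n) <= c * cn m.
Proof.
move=> xt pB Bc; have low := sub1_ge xt; have d1 : 0 < cn (1 - x) by apply: lt_le_trans low.
have B0 : 0 <= B := le_trans (cn_ge0 p) pB.
have e0 : 0 < (1 - t) ^+ n by rewrite exprn_gt0.
have c0 : 0 <= c by have := le_trans B0 Bc; rewrite pmulr_lge0.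
rewrite -mulrA cnM mulrC; apply: ler_wpM2r; first exact: cn_ge0.
rewrite cnf cnX ler_pdivrMr ?exprn_gt0//; apply: (le_trans pB (le_trans Bc _)).
by apply: ler_wpM2l => //; apply: lerXn2r; rewrite ?nnegrE ?cn_ge0 ?(ltW t1).
Qed.

Let sub_neq0 x : cn x <= t -> 1 - x != 0.
Proof. by move=> xt; rewrite -cn_gt0; apply: lt_le_trans (sub1_ge xt). Qed.

Let sum2 (L : C -> C) q (c B : R) : cn q <= t -> 0 <= B -> (forall x, cn x <= cn q -> cn (L x) <= B * cn x) ->
  B <= c * (1 - t) -> cn (lambert L q - L q - L (q ^+ 2)) <= c * cn q ^+ 3.
Proof.
move=> qt B0 hB Bc; have q0 := cn_ge0 q.
have q1 : cn q < 1 by move: t1; lra.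
have := lambert_tail 2 B0 q1 hB.
rewrite /lambert_partial big_ord_recl big_ord1 /= expr1 => h.
rewrite -[X in cn X]addrA -opprD; apply: le_trans h _.
rewrite mulrAC; apply: ler_wpM2r; first exact: exprn_ge0.
have c0 : 0 <= c by have := le_trans B0 Bc; rewrite pmulr_lge0.
rewrite ler_pdivrMr ?subr_gt0//; apply: (le_trans Bc).
by apply: ler_wpM2l => //; lra.
Qed.

Let sqt q : cn q <= t -> cn (q ^+ 2) <= cn q /\ cn (q ^+ 2) <= t.
Proof.
move=> qt; have q0 := cn_ge0 q; have tt : t <= 1 by move: t1; lra.
have h : cn (q ^+ 2) <= cn q by rewrite cnX expr2 ler_piMl//; lra.
by split => //; lra.
Qed.

(** The coefficients are sigma_3(1) = 1 and sigma_3(2) = 9, the latter made of 8 from L(q) and 1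
    from L(q^2). The terms from L(q^3) on are estimated as a tail. *)
Lemma lambert4_small q : cn q <= t ->
  cn (lambert (@lip4 R) q - q - 9 * q ^+ 2) <= 30 * cn q ^+ 3.
Proof.
move=> qt; have q0 := cn_ge0 q; have [q2 q2t] := sqt qt.
have s := @sum2 (@lip4 R) q (107/100) (105/100) qt.
have {}s : cn (lambert (@lip4 R) q - lip4 q - lip4 (q ^+ 2)) <= 107/100 * cn q ^+ 3.
  apply: s; [lra| |by rewrite /t; lra].
  move=> x xq; have xt := le_trans xq qt; rewrite /lip4.
  by apply: (@frac _ _ (1 + 4 * t + t ^+ 2) _ _ _) => //; [bnd|rewrite /t; lra].
have e1 : lip4 q - q - 8 * q ^+ 2 = q ^+ 3 * (27 - 44 * q + 31 * q ^+ 2 - 8 * q ^+ 3) / (1 - q) ^+ 4.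
  by rewrite /lip4; field; exact: sub_neq0.
have f1 : cn (lip4 q - q - 8 * q ^+ 2) <= 28 * cn q ^+ 3.
  rewrite e1 -cnX; apply: (@frac _ _ (27 + 44 * t + 31 * t ^+ 2 + 8 * t ^+ 3) _ _ _) => //; first by bnd.
  by rewrite /t; lra.
set y := q ^+ 2 in q2 q2t s *.
have e2 : lip4 y - y = y ^+ 2 * (8 - 5 * y + 4 * y ^+ 2 - y ^+ 3) / (1 - y) ^+ 4.
  by rewrite /lip4; field; exact: sub_neq0.
have f2 : cn (lip4 y - y) <= 9 * cn y ^+ 2.
  rewrite e2 -cnX; apply: (@frac _ _ (8 + 5 * t + 4 * t ^+ 2 + t ^+ 3) _ _ _) => //; first by bnd.
  by rewrite /t; lra.
have f3 : 9 * cn y ^+ 2 <= 9 * t * cn q ^+ 3.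
  rewrite /y cnX -exprM -[9 * t * _]mulrA ler_pM2l// (exprS _ 3).
  by rewrite ler_wpM2r// exprn_ge0.
rewrite (_ : lambert (@lip4 R) q - q - 9 * y = (lambert (@lip4 R) q - lip4 q - lip4 y) +
   ((lip4 q - q - 8 * y) + (lip4 y - y))); last by ring.
have q3 : 0 <= cn q ^+ 3 by rewrite exprn_ge0.
apply: le_trans (bD s (bD f1 (le_trans f2 f3))) _.
rewrite -mulrDl -mulrDl ler_wpM2r// /t; lra.
Qed.

Lemma lambert6_small q : cn q <= t ->
  cn (lambert (@lip6 R) q - q - 33 * q ^+ 2) <= 260 * cn q ^+ 3.
Proof.
move=> qt; have q0 := cn_ge0 q; have [q2 q2t] := sqt qt.
have s := @sum2 (@lip6 R) q (122/100) (120/100) qt.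
have {}s : cn (lambert (@lip6 R) q - lip6 q - lip6 (q ^+ 2)) <= 122/100 * cn q ^+ 3.
  apply: s; [lra| |by rewrite /t; lra].
  move=> x xq; have xt := le_trans xq qt; rewrite /lip6.
  by apply: (@frac _ _ (1 + 26 * t + 66 * t ^+ 2 + 26 * t ^+ 3 + t ^+ 4) _ _ _) => //; [bnd|rewrite /t; lra].
have e1 : lip6 q - q - 32 * q ^+ 2 = q ^+ 3 * (243 - 434 * q + 626 * q ^+ 2 - 474 * q ^+ 3
    + 191 * q ^+ 4 - 32 * q ^+ 5) / (1 - q) ^+ 6.
  by rewrite /lip6; field; exact: sub_neq0.
have f1 : cn (lip6 q - q - 32 * q ^+ 2) <= 256 * cn q ^+ 3.
  rewrite e1 -cnX; apply: (@frac _ _ (243 + 434 * t + 626 * t ^+ 2 + 474 * t ^+ 3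
    + 191 * t ^+ 4 + 32 * t ^+ 5) _ _ _) => //; first by bnd.
  by rewrite /t; lra.
set y := q ^+ 2 in q2 q2t s *.
have e2 : lip6 y - y = y ^+ 2 * (32 + 51 * y + 46 * y ^+ 2 - 14 * y ^+ 3 + 6 * y ^+ 4 - y ^+ 5) / (1 - y) ^+ 6.
  by rewrite /lip6; field; exact: sub_neq0.
have f2 : cn (lip6 y - y) <= 34 * cn y ^+ 2.
  rewrite e2 -cnX; apply: (@frac _ _ (32 + 51 * t + 46 * t ^+ 2 + 14 * t ^+ 3 + 6 * t ^+ 4 + t ^+ 5) _ _ _) => //; first by bnd.
  by rewrite /t; lra.
have f3 : 34 * cn y ^+ 2 <= 34 * t * cn q ^+ 3.
  rewrite /y cnX -exprM -[34 * t * _]mulrA ler_pM2l// (exprS _ 3).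
  by rewrite ler_wpM2r// exprn_ge0.
rewrite (_ : lambert (@lip6 R) q - q - 33 * y = (lambert (@lip6 R) q - lip6 q - lip6 y) +
   ((lip6 q - q - 32 * y) + (lip6 y - y))); last by ring.
have q3 : 0 <= cn q ^+ 3 by rewrite exprn_ge0.
apply: le_trans (bD s (bD f1 (le_trans f2 f3))) _.
rewrite -mulrDl -mulrDl ler_wpM2r// /t; lra.
Qed.

(** The expansion starts 1728 (q - 24 q^2). The constant 160 is below 170, so for |q| <= 1/170 the
    linear term dominates, which is [disc_neq0_small]. *)
Lemma disc_estimate tau : cn (qpar 1 tau) <= t ->
  cn (disc tau - 1728 * qpar 1 tau) <= 1728 * 160 * cn (qpar 1 tau) ^+ 2.
Proof.
set q := qpar 1 tau => qt; rewrite /disc /e4 /e6 -/q.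
have a4 := lambert4_small qt; have a6 := lambert6_small qt.
set A := lambert _ q in a4 *; set B := lambert _ q in a6 *.
set x := cn q in qt a4 a6 *; have x0 : 0 <= x := cn_ge0 q.
have xq : cn q <= x by [].
have x2 : x ^+ 2 <= t * x by rewrite expr2 ler_wpM2r.
have x3 : x ^+ 3 <= t * x ^+ 2 by rewrite exprS ler_wpM2r// exprn_ge0.
have x20 : 0 <= x ^+ 2 by rewrite exprn_ge0.
have x30 : 0 <= x ^+ 3 by rewrite exprn_ge0.
have Aq : cn (A - q) <= 92/10 * x ^+ 2.
  rewrite (_ : A - q = (A - q - 9 * q ^+ 2) + 9 * q ^+ 2); last by ring.
  apply: le_trans (bD a4 (bM (bC 9) (bX 2 xq))) _; move: x3; rewrite /t; lra.
have Aq' : cn (A + q) <= 206/100 * x.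
  rewrite (_ : A + q = (A - q) + 2 * q); last by ring.
  apply: le_trans (bD Aq (bM (bC 2) xq)) _; move: x2; rewrite /t; lra.
have Aa : cn A <= 106/100 * x.
  rewrite (_ : A = (A - q) + q); last by ring.
  apply: le_trans (bD Aq xq) _; move: x2; rewrite /t; lra.
have Bq : cn (B - q) <= 346/10 * x ^+ 2.
  rewrite (_ : B - q = (B - q - 33 * q ^+ 2) + 33 * q ^+ 2); last by ring.
  apply: le_trans (bD a6 (bM (bC 33) (bX 2 xq))) _; move: x3; rewrite /t; lra.
have Bq' : cn (B + q) <= 221/100 * x.
  rewrite (_ : B + q = (B - q) + 2 * q); last by ring.
  apply: le_trans (bD Bq (bM (bC 2) xq)) _; move: x2; rewrite /t; lra.
(* The linear terms add up to 720 + 1008 = 1728, the quadratic ones to -1728 times 24. All the rest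
   is cubic in q and is absorbed through |q|^3 <= t |q|^2. *)
rewrite [X in cn X](_ : _ = - (1728 * 24 * q ^+ 2) + (720 * (A - q - 9 * q ^+ 2) +
   (1008 * (B - q - 33 * q ^+ 2) + (3 * 240 ^+ 2 * ((A - q) * (A + q)) +
    (- (504 ^+ 2 * ((B - q) * (B + q))) + 240 ^+ 3 * A ^+ 3))))); last by ring.
have -> : 1728 * 160 * x ^+ 2 = 1728 * 24 * x ^+ 2 + (1728 * 136 * x ^+ 2) by ring.
apply: bD; first by bnd.
have tot : 720 * (30 * x ^+ 3) + (1008 * (260 * x ^+ 3) + (3 * 240 ^+ 2 * (92/10 * x ^+ 2 * (206/100 * x)) +
   (504 ^+ 2 * (346/10 * x ^+ 2 * (221/100 * x)) + 240 ^+ 3 * (106/100 * x) ^+ 3))) <= 1728 * 136 * x ^+ 2.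
  have E1 : 92/10 * x ^+ 2 * (206/100 * x) = (92 * 206 / 1000) * x ^+ 3 by field.
  have E2 : 346/10 * x ^+ 2 * (221/100 * x) = (346 * 221 / 1000) * x ^+ 3 by field.
  have E3 : (106/100 * x) ^+ 3 = (106/100) ^+ 3 * x ^+ 3 by rewrite exprMn.
  rewrite E1 E2 E3; move: x3; rewrite /t; lra.
by apply: le_trans tot; bnd.
Qed.

Lemma disc_neq0_small tau : cn (qpar 1 tau) <= t -> disc tau != 0.
Proof.
move=> qt; have h := disc_estimate qt; apply: contraTneq h => ->.
have x0 : 0 < cn (qpar 1 tau) by rewrite cn_gt0 qpar_neq0.
rewrite sub0r cnN cnM cn_nat -ltNge; set x := cn _ in qt x0 *.
have x2 : x ^+ 2 <= t * x by rewrite expr2 ler_wpM2r// ltW.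
move: x2; rewrite /t; lra.
Qed.

(** It suffices that cos (3/2) > 0. This follows from cos x >= 1 - x^2 / 2 at x = 3/8 by doubling
    the angle twice; that inequality is the square of |exp(ix) - 1| <= |x|. *)
Lemma pi_ge3 : (3 : R) <= pi.
Proof.
have c1 (x : R) : 1 - x ^+ 2 / 2 <= cos x.
  have := @mvt_segment R (@expC R) (@expC R) (0 +i* x) 1.
  have E (s : R) : (0 +i* x) * s%:C = 0 +i* (x * s) by apply: cplx_eq; rewrite !(ReM, ImM) /=; ring.
  move=> /(_ _ _); rewrite mul1r => H.
  have {}H : cn (expC (0 +i* x) - expC 0) <= cn (0 +i* x : C).
    apply: H => s _; first exact: hasder_expC.
    by rewrite E cn_expC /= expR0.
  have : cn (expC (0 +i* x) - expC 0) ^+ 2 <= cn (0 +i* x : C) ^+ 2.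
    by apply: lerXn2r; rewrite ?nnegrE ?cn_ge0.
  rewrite !cn_sqr expC0 /expC /= expR0 ?(ReD, ImD, ReN, ImN, ReM, ImM) /=.
  have := cos2Dsin2 x; move: (cos x) (sin x) => c s; lra.
have c2 : 0 < cos (3 / 2 : R).
  have -> : (3 / 2 : R) = ((3 / 8) *+ 2) *+ 2 by rewrite !mulr2n; field.
  rewrite !cos_mulr2n; have := c1 (3 / 8); set c := cos _ => hc.
  have h1 : (929 / 1000 : R) <= c by lra.
  have h2 : (929 / 1000 : R) ^+ 2 <= c ^+ 2 by apply: lerXn2r; rewrite ?nnegrE; lra.
  have h3 : (725 / 1000 : R) <= c ^+ 2 *+ 2 - 1 by lra.
  have h4 : (725 / 1000 : R) ^+ 2 <= (c ^+ 2 *+ 2 - 1) ^+ 2 by apply: lerXn2r; rewrite ?nnegrE; lra.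
  lra.
have p0 := @pi_gt0 R; have p2 := @pihalf_02 R.
rewrite leNgt; apply/negP => p3.
have : cos (3 / 2 : R) <= cos (pi / 2 : R).
  rewrite leNgt ltr_cos ?in_itv/=; last 2 first.
  - by have := pi_ge2 R; lra.
  - by lra.
  by rewrite -leNgt; lra.
rewrite cos_pihalf; lra.
Qed.

(** Start from exp(y) >= 1 + y at y = 5.16 / 1024 and square ten times. The decimals are successive
    square roots of 170, rounded up so that each step is an inequality between explicit
    fractions. *)
Lemma expR_516 : (170 : R) <= expR (516 / 100).
Proof.
have sq (a b y : R) : 0 <= a -> b <= a ^+ 2 -> a <= expR (y / 2) -> b <= expR y.
  move=> a0 ba ay; apply: le_trans ba _; rewrite [y]splitr expRD expr2.
  by apply: ler_pM.
have h0 : (1 + (5 + 39 / 1000) / 1000 : R) <= expR (516 / 100 / 2 / 2 / 2 / 2 / 2 / 2 / 2 / 2 / 2 / 2).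
  by apply: le_trans (expR_ge1Dx _); lra.
apply: (sq (13 + (10 + 58 / 100) / 100) 170); [by lra|by lra|].
apply: (sq (3 + (62 + 2 / 100) / 100) (13 + (10 + 58 / 100) / 100)); [by lra|by lra|].
apply: (sq (1 + (90 + 27 / 100) / 100) (3 + (62 + 2 / 100) / 100)); [by lra|by lra|].
apply: (sq (1 + (37 + 94 / 100) / 100) (1 + (90 + 27 / 100) / 100)); [by lra|by lra|].
apply: (sq (1 + (174 + 490 / 1000) / 1000) (1 + (37 + 94 / 100) / 100)); [by lra|by lra|].
apply: (sq (1 + (83 + 739 / 1000) / 1000) (1 + (174 + 490 / 1000) / 1000)); [by lra|by lra|].
apply: (sq (1 + (41 + 28 / 1000) / 1000) (1 + (83 + 739 / 1000) / 1000)); [by lra|by lra|].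
apply: (sq (1 + (20 + 308 / 1000) / 1000) (1 + (41 + 28 / 1000) / 1000)); [by lra|by lra|].
apply: (sq (1 + (10 + 103 / 1000) / 1000) (1 + (20 + 308 / 1000) / 1000)); [by lra|by lra|].
apply: (sq (1 + (5 + 39 / 1000) / 1000) (1 + (10 + 103 / 1000) / 1000)); [by lra|by lra|].
exact: h0.
Qed.

End DiscriminantBounds.

(** * Homographies and reduction to a strip by S and T *)

Section Homographies.
Variable R : realType.
Local Notation C := R[i].
Implicit Types (tau z : C) (g u : 'M[R]_2).

Lemma det2 g : \det g = g 0 0 * g 1 1 - g 0 1 * g 1 0.
Proof.
rewrite (expand_det_row _ 0) !big_ord_recl big_ord0 addr0.
rewrite /cofactor !det_mx11 !mxE /= expr0 mul1r expr1 mulN1r mulrN.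
have -> : lift 0 0 = 1 :> 'I_2 by apply/val_inj.
by have -> : lift 1 0 = 0 :> 'I_2 by apply/val_inj.
Qed.

Lemma mulmx2E g u i j : (g * u) i j = g i 0 * u 0 j + g i 1 * u 1 j.
Proof.
rewrite mxE !big_ord_recl big_ord0 addr0.
by have -> : lift 0 0 = 1 :> 'I_2 by apply/val_inj.
Qed.

Definition mobius_den g tau : C := (g 1 0)%:C * tau + (g 1 1)%:C.

Lemma mobius_den_neq0 g tau : \det g = 1 -> 0 < complex.Im tau -> mobius_den g tau != 0.
Proof.
move=> g1 t0; apply/eqP => E.
have := congr1 (@complex.Im R) E; have := congr1 (@complex.Re R) E.
rewrite /mobius_den !(ReD, ImD, ReM, ImM) /= !mul0r !addr0 subr0.
move=> e1 /eqP; rewrite mulf_eq0 (gt_eqF t0) orbF => /eqP c0.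
move: e1; rewrite c0 mul0r add0r => d0; move: g1; rewrite det2 c0 d0 !mulr0 subr0.
by move/esym/eqP; rewrite oner_eq0.
Qed.

Lemma Im_mobius g tau : \det g = 1 -> 0 < complex.Im tau ->
  complex.Im (mobius g tau) = complex.Im tau / cn (mobius_den g tau) ^+ 2.
Proof.
move=> g1 t0; have := mobius_den_neq0 g1 t0; rewrite -cn_gt0 => d0.
have dd : cn (mobius_den g tau) ^+ 2 != 0 by rewrite expf_neq0 ?gt_eqF.
move: g1 dd; rewrite det2 /mobius cn_sqr /mobius_den ImM.
case: tau t0 d0 => x y /= t0 _ g1.
rewrite !mul0r !addr0 !subr0 => dd.
move: g1 dd; move: (g 0 0) (g 0 1) (g 1 0) (g 1 1) => a b c d g1 dd.
rewrite -[in RHS](mulr1 y) -[X in _ = y * X / _]g1.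
by field.
Qed.

Lemma mobius_H g tau : \det g = 1 -> 0 < complex.Im tau -> 0 < complex.Im (mobius g tau).
Proof.
move=> g1 t0; rewrite Im_mobius// divr_gt0// exprn_gt0// cn_gt0.
exact: mobius_den_neq0.
Qed.

Lemma mobius_mul g u tau : \det g = 1 -> \det u = 1 -> 0 < complex.Im tau ->
  mobius (g * u) tau = mobius g (mobius u tau).
Proof.
move=> g1 u1 t0; have du := mobius_den_neq0 u1 t0.
have dg := mobius_den_neq0 g1 (mobius_H u1 t0).
have dgu : mobius_den (g * u) tau != 0.
  by apply: mobius_den_neq0 => //; rewrite det_mulmx g1 u1 mulr1.
move: du dg dgu; rewrite /mobius_den /mobius !mulmx2E !rmorphD !rmorphM /=.
move: (g 0 0)%:C (g 0 1)%:C (g 1 0)%:C (g 1 1)%:C (u 0 0)%:C (u 0 1)%:C (u 1 0)%:C (u 1 1)%:C.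
move=> a b c d a' b' c' d' d1 d2 d3; field; rewrite d1 /=.
by apply: contra_neq d3 => <-; ring.
Qed.

Lemma mobius1 tau : mobius 1 tau = tau.
Proof. by rewrite /mobius !mxE /= mul1r mul0r add0r addr0 divr1. Qed.

Lemma mobius_translation (t : R) tau : mobius (translation t) tau = tau + t%:C.
Proof. by rewrite /mobius !mxE /= mul1r mul0r add0r divr1. Qed.

Lemma det_translation (t : R) : \det (translation t) = 1.
Proof. by rewrite det2 !mxE /= mulr1 mulr0 subr0. Qed.

Lemma mobiusK g tau : \det g = 1 -> 0 < complex.Im tau -> mobius g^-1 (mobius g tau) = tau.
Proof.
move=> g1 t0; have gu : g \is a GRing.unit by rewrite unitmxE g1 unitr1.
have g1' : \det g^-1 = 1 by rewrite det_inv g1 invr1.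
by rewrite -mobius_mul// mulVr// mobius1.
Qed.

Lemma mobiusVK g tau : \det g = 1 -> 0 < complex.Im tau -> mobius g (mobius g^-1 tau) = tau.
Proof.
move=> g1 t0; have gu : g \is a GRing.unit by rewrite unitmxE g1 unitr1.
have g1' : \det g^-1 = 1 by rewrite det_inv g1 invr1.
by rewrite -mobius_mul// mulrV// mobius1.
Qed.

Lemma holo_mobius g tau : \det g = 1 -> 0 < complex.Im tau -> holo (mobius g) tau.
Proof.
move=> g1 t0; apply: holo_div; last exact: mobius_den_neq0.
  by apply: holo_add; [apply: holo_mul; [exact: holo_cst|exact: holo_id]|exact: holo_cst].
by apply: holo_add; [apply: holo_mul; [exact: holo_cst|exact: holo_id]|exact: holo_cst].
Qed.

Definition inversion : 'M[R]_2 :=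
  \matrix_(i < 2, j < 2) (if (i == 0) && (j == 1) then -1 else if (i == 1) && (j == 0) then 1 else 0).

Lemma det_inversion : \det inversion = 1.
Proof. by rewrite det2 !mxE /= mulr0 sub0r mulr1 opprK. Qed.

Lemma mobius_inversion tau : mobius inversion tau = - tau^-1.
Proof. by rewrite /mobius !mxE /= mul0r mul1r add0r addr0 rmorphN1 mulN1r. Qed.

(** Products of the generators S and T play the part of SL(2,Z): invariance is checked on
    generators, and [word_to_domain] produces reductions as words. *)
Inductive word : 'M[R]_2 -> Prop :=
  | word_1 : word 1
  | word_S : word inversion
  | word_T (n : int) : word (translation n%:~R)
  | word_mul g u : word g -> word u -> word (g * u).

Lemma word_det g : word g -> \det g = 1.
Proof.
elim=> [|||g' u _ h1 _ h2]; [exact: det1|exact: det_inversion|move=> n; exact: det_translation|].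
by rewrite det_mulmx h1 h2 mulr1.
Qed.

Lemma word_SL2Z g : word g -> SL2Z g.
Proof.
move=> wg; split; first exact: word_det.
elim: wg => [||n|g' u _ h1 _ h2] i j.
- by rewrite mxE; apply: rpred_nat.
- by rewrite mxE; case: ifP => _; [rewrite rpredN rpred1|case: ifP => _; rewrite ?rpred1 ?rpred0].
- by rewrite mxE; case: ifP => _; [exact: rpred1|case: ifP => _; [exact: intr_int|exact: rpred0]].
- by rewrite mulmx2E; apply: rpredD; apply: rpredM.
Qed.

Lemma translationD (s t : R) : translation s * translation t = translation (s + t).
Proof.
apply/matrixP => i j; rewrite mulmx2E !mxE.
case: i => [[|[|//]]] hi; case: j => [[|[|//]]] hj /=; rewrite ?(mul1r, mul0r, mulr0, mulr1, addr0, add0r)//.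
by rewrite addrC.
Qed.

Lemma translation0 : translation (0 : R) = 1.
Proof.
apply/matrixP => i j; rewrite !mxE.
by case: i => [[|[|//]]] hi; case: j => [[|[|//]]] hj /=.
Qed.

Lemma word_inv g : word g -> word g^-1.
Proof.
elim=> [||n|g' u wg h1 wu h2].
- by rewrite invr1; exact: word_1.
- suff -> : inversion^-1 = inversion * (inversion * inversion).
    by do 2?[apply: word_mul]; exact: word_S.
  have iu : inversion \is a GRing.unit by rewrite unitmxE det_inversion unitr1.
  apply: (mulrI iu); rewrite mulrV//.
  apply/matrixP => i j; rewrite !mulmx2E !mxE.
  by case: i => [[|[|//]]] hi; case: j => [[|[|//]]] hj /=;
    rewrite ?(mul1r, mul0r, mulr0, mulr1, addr0, add0r, mulN1r, opprK, oppr0).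
- suff -> : (translation (n%:~R : R))^-1 = translation ((- n)%:~R : R) by exact: word_T.
  have tu : translation (n%:~R : R) \is a GRing.unit by rewrite unitmxE det_translation unitr1.
  by apply: (mulrI tu); rewrite mulrV// translationD mulrNz subrr translation0.
- rewrite invrM ?unitmxE ?word_det ?unitr1//; exact: word_mul.
Qed.

Lemma translate_to_strip tau : exists n : int, `|complex.Re (tau + n%:~R)| <= 1 / 2.
Proof.
have h := floor_itv (complex.Re tau + 1 / 2).
exists (- Num.floor (complex.Re tau + 1 / 2)).
rewrite ReD -(rmorph_int (real_complex R)) /= mulrNz ler_norml.
have /andP[h1 h2] := h; rewrite intrD in h2; lra.
Qed.

(* One inversion multiplies the height of a point of the strip lying below 0.86
   by at least 100/99, since such a point has squared modulus at most 0.9896. *)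
Lemma word_to_domain tau : 0 < complex.Im tau ->
  exists2 g, word g & `|complex.Re (mobius g tau)| <= 1 / 2 /\ 86 / 100 <= complex.Im (mobius g tau).
Proof.
move=> t0; have [n hn] : exists n : nat, 86 / 100 <= complex.Im tau * (100 / 99) ^+ n.
  have bern (n : nat) : 1 + n%:R / 99 <= (100 / 99 : R) ^+ n.
    elim: n => [|n ih]; first by rewrite mul0r addr0 expr0.
    have n0 : (0 : R) <= n%:R by exact: ler0n.
    rewrite exprS -natr1; set p := _ ^+ n in ih *; lra.
  have y1 : 0 < (complex.Im tau)^-1 by rewrite invr_gt0.
  have := archi_boundP (ltW y1); set n := Num.bound _ => hn.
  exists (99 * n)%N; rewrite -ler_pdivrMl//.
  apply: le_trans (bern _); rewrite natrM (mulrC 99) mulfK ?pnatr_eq0//; lra.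
elim: n tau t0 hn => [|n ih] tau t0 hn; have [k hk] := translate_to_strip tau.
  exists (translation k%:~R); first exact: word_T.
  rewrite mobius_translation -(rmorph_int (real_complex R)) in hk *; split => //.
  by rewrite ImD /=; move: hn; rewrite expr0 mulr1; lra.
set tau' := tau + k%:~R in hk.
have et : mobius (translation k%:~R) tau = tau'.
  by rewrite mobius_translation /tau' -(rmorph_int (real_complex R)).
have it : complex.Im tau' = complex.Im tau.
  by rewrite /tau' ImD -(rmorph_int (real_complex R)) /= addr0.
case: (leP (86 / 100) (complex.Im tau)) => [big|small].
  by exists (translation k%:~R); [exact: word_T|rewrite et it].
have t0' : 0 < complex.Im tau' by rewrite it.
have mS := mobius_inversion tau'.
have tS : 0 < complex.Im (- tau'^-1) by rewrite -mS; apply: mobius_H det_inversion _.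
have iS : complex.Im (- tau'^-1) = complex.Im tau' / cn tau' ^+ 2.
  rewrite -mS Im_mobius//; last exact: det_inversion.
  by rewrite /mobius_den !mxE /= mul1r addr0.
have c2 : cn tau' ^+ 2 <= 99 / 100.
  rewrite cn_sqr it -[X in X + _]real_normK ?num_real//.
  have a1 : `|complex.Re tau'| ^+ 2 <= (1 / 2) ^+ 2 by apply: lerXn2r; rewrite ?nnegrE ?normr_ge0//; lra.
  have a2 : complex.Im tau ^+ 2 <= (86 / 100) ^+ 2 by apply: lerXn2r; rewrite ?nnegrE; lra.
  lra.
have c0 : 0 < cn tau' ^+ 2.
  by rewrite exprn_gt0// cn_gt0; apply: contraTneq t0' => ->; rewrite ltxx.
have [|g wg gP] := ih _ tS.
  rewrite iS it; apply: le_trans hn _; rewrite exprS mulrA.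
  apply: ler_wpM2r; first by apply: exprn_ge0; lra.
  have e : (100 / 99 : R) = (99 / 100)^-1 by rewrite invf_div.
  by rewrite ler_wpM2l ?(ltW t0)// e lef_pV2 ?posrE//; lra.
exists (g * (inversion * translation k%:~R)).
  by apply: word_mul => //; apply: word_mul; [exact: word_S|exact: word_T].
rewrite mobius_mul ?word_det//; last by apply: word_mul; [exact: word_S|exact: word_T].
by rewrite mobius_mul ?det_inversion ?det_translation// et mS.
Qed.

End Homographies.

(** * Holomorphy, growth and expansion of j *)

Section ModularInvariant.
Variable R : realType.
Local Notation C := R[i].
Implicit Types (tau z : C) (g : 'M[R]_2).

Lemma qpar1_domain tau : 86 / 100 <= complex.Im tau -> cn (qpar 1 tau) <= 170^-1.
Proof.
move=> y; rewrite cn_qpar expRN lef_pV2 ?posrE ?expR_gt0//.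
apply: le_trans (expR_516 R) _; rewrite ler_expR divr1.
have := pi_ge3 R; move: (pi : R) => p p3.
have : 3 * (86 / 100) <= p * complex.Im tau by apply: ler_pM => //; lra.
lra.
Qed.

Lemma word_invariant (T : Type) (F : C -> T) :
  (forall tau, 0 < complex.Im tau -> F (- tau^-1) = F tau) ->
  (forall tau, 0 < complex.Im tau -> F (tau + 1) = F tau) ->
  forall g tau, word g -> 0 < complex.Im tau -> F (mobius g tau) = F tau.
Proof.
move=> FS FT g tau wg; elim: wg tau => [||n|g' u wg' ihg wu ihu] tau t0.
- by rewrite mobius1.
- by rewrite mobius_inversion FS.
- rewrite mobius_translation (rmorph_int (real_complex R)).
  have nat_case (k : nat) z : 0 < complex.Im z -> F (z + k%:R) = F z.
    move=> z0; elim: k => [|k ih]; first by rewrite addr0.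
    by rewrite -natr1 addrA FT// ImD Im_nat addr0.
  case: n => n; first exact: nat_case.
  rewrite NegzE mulrNz; set z := tau - _.
  have -> : tau = z + n.+1%:R by rewrite subrK.
  by rewrite nat_case// ImD ImN Im_nat subr0.
- by rewrite mobius_mul ?word_det// ihg ?ihu//; apply: mobius_H => //; exact: word_det.
Qed.

Lemma perH_jinv : perH 1 (@jinv R).
Proof. by move=> z; exact: jinv_per. Qed.

Lemma jinv_word g tau : word g -> 0 < complex.Im tau -> jinv (mobius g tau) = jinv tau.
Proof. exact: word_invariant (@jinv_S R) (@jinv_per R) g tau. Qed.

Lemma disc_word g tau : word g -> 0 < complex.Im tau -> (disc (mobius g tau) == 0) = (disc tau == 0).
Proof.
apply: (@word_invariant _ (fun z => disc z == 0)) => z z0; last by rewrite disc_per.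
rewrite disc_S// mulf_eq0 expf_eq0 /=.
by have [t|//] := eqVneq z 0; move: z0; rewrite t ltxx.
Qed.

(** The zero set is invariant under words, and every point can be moved to Im >= 0.86, where the
    estimate for small q excludes zeros. *)
Lemma disc_neq0 tau : 0 < complex.Im tau -> disc tau != 0.
Proof.
move=> t0; have [g wg [_ y]] := word_to_domain t0.
by rewrite -(disc_word wg t0); apply: disc_neq0_small; exact: qpar1_domain.
Qed.

Lemma nearH tau : 0 < complex.Im tau -> nearC tau (fun u => 0 < complex.Im u).
Proof.
move=> t0; exists (complex.Im tau) => // u.
by move=> /(le_lt_trans (cn_Im _)); rewrite ImD ImN ltr_norml => /andP[]; lra.
Qed.

Lemma holoH_jinv : holoH (@jinv R).
Proof.
move=> tau t0; apply: (holo_near (F := fun z => 1728 * e4 z ^+ 3 / disc z)).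
  by apply: nearC_imp (nearH t0) => u u0; rewrite jinvE.
apply: holo_div; last exact: disc_neq0.
  apply: holo_mul; first exact: holo_cst.
  by apply: holo_exp; exact: holoH_e4.
by apply: holo_sub; apply: holo_exp; [exact: holoH_e4|exact: holoH_e6].
Qed.

Let h1 : (0 : R) < 1. Proof. exact: ltr01. Qed.

Lemma disc_bigO : bigO 1 2 (fun z => disc z - 1728 * qpar 1 z ^+ 1).
Proof.
have [|Y hY] := @qpar_small R 1 h1 170^-1; first by rewrite invr_gt0.
by exists Y, (1728 * 160) => z /hY/ltW hz; rewrite expr1; exact: disc_estimate.
Qed.

Lemma e4_bigO : bigO 1 1 (fun z => e4 z ^+ 3 - 1 : C).
Proof.
have L : bigO 1 1 (fun z : C => lambert (@lip4 R) (qpar 1 z)).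
  have [|Y hY] := @qpar_small R 1 h1 170^-1; first by rewrite invr_gt0.
  exists Y, 3 => z /hY/ltW hz; have := lambert4_small hz; rewrite expr1.
  set q := qpar 1 z in hz *; set A := lambert _ _ => hA.
  have x0 := cn_ge0 q.
  have x2 : cn q ^+ 2 <= 170^-1 * cn q by rewrite expr2 ler_wpM2r.
  have x3 : cn q ^+ 3 <= 170^-1 * cn q ^+ 2 by rewrite exprS ler_wpM2r// exprn_ge0.
  rewrite (_ : A = (A - q - 9 * q ^+ 2) + (q + 9 * q ^+ 2)); last by ring.
  apply: le_trans (cnD _ _) _.
  have := cnD q (9 * q ^+ 2); rewrite cnM cn_nat cnX; lra.
apply: (bigO_ext (F := fun z => lambert (@lip4 R) (qpar 1 z) *
   (720 + lambert (@lip4 R) (qpar 1 z) * (720 * 240 + 240 ^+ 3 * lambert (@lip4 R) (qpar 1 z))))).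
  by move=> z; rewrite /e4; ring.
have L0 := bigO_le h1 (leq0n 1) L.
apply: (bigO_mul (n := 0) L).
apply: bigO_add; first exact: bigO_cst.
apply: (bigO_mul (m := 0) (n := 0) L0).
by apply: bigO_add; [exact: bigO_cst|exact: bigO_scale].
Qed.

(** The numerator of j tends to 1728 while the discriminant tends to 0. *)
Lemma blows_up_jinv : blows_up (@jinv R).
Proof.
move=> A; have D1 : bigO 1 1 (@disc R).
  apply: (bigO_ext (F := fun z => (disc z - 1728 * qpar 1 z ^+ 1) + 1728 * qpar 1 z ^+ 1)).
    by move=> z; rewrite subrK.
  apply: bigO_add; first by apply: (bigO_le h1 _ disc_bigO).
  by apply: bigO_scale; exact: bigO_w.
have e0 : 0 < (`|A| + 1)^-1 by rewrite invr_gt0 ltr_wpDl.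
have [Y1 hY1] := bigO1_small h1 D1 e0.
have [Y2 hY2] := bigO1_small h1 e4_bigO (ltac:(by []) : 0 < 2^-1 :> R).
exists (Num.max 0 (Num.max Y1 Y2)) => z; rewrite !gt_max => /and3P[z0 /hY1 d /hY2 e].
rewrite jinvE// cnf cnM cnX cn_nat.
have d0 : 0 < cn (disc z) by rewrite cn_gt0 disc_neq0.
rewrite ltr_pdivlMr//; apply: le_lt_trans (ler_norm _) _.
rewrite normrM (gtr0_norm d0).
have := cn_sub_ge 1 (1 - e4 z ^+ 3); rewrite cn1 subKr cnBC cnX.
have {}d : `|A| * cn (disc z) <= 1.
  have a0 := normr_ge0 A; have : (`|A| + 1) * cn (disc z) < 1.
    by rewrite -ltr_pdivlMl ?mulr1// ltr_wpDl.
  by rewrite mulrDl mul1r; lra.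
lra.
Qed.

Variable K : divringClosed C.

(** E4 and E6 expand with integral coefficients and [disc] starts with 1728 q, whose coefficient is
    invertible in K. *)
Lemma asy_jinv : asy 1 K (@jinv R).
Proof.
apply: (asy_near (F := fun z => 1728 * e4 z ^+ 3 * (disc z)^-1)).
  by exists 0 => z z0; rewrite jinvE.
apply: (asy_mul h1).
  by apply: (asy_scale h1); [exact: rpred_nat|apply: (asy_exp h1); exact: asy_e4].
apply: (asy_inv (n := 1) h1 _ disc_bigO); first by rewrite pnatr_eq0.
by apply: (asy_sub h1); apply: (asy_exp h1); [exact: asy_e4|exact: asy_e6].
Qed.

End ModularInvariant.

(** * Translates of a modular function *)

Section ModularFunctions.
Variable R : realType.
Local Notation C := R[i].
Implicit Types (tau z : C) (g u b : 'M[R]_2) (G : set 'M[R]_2) (f : C -> option C).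

Lemma modular_proj_eq G (x y : hpoint R) (hx : hstar G x) (hy : hstar G y) :
  orbit_of G x = orbit_of G y -> modular_proj hx = modular_proj hy.
Proof. by move=> e; apply: eq_exist. Qed.

Lemma orbit_mobius G g tau : subgroup_SL2R G -> G g -> 0 < complex.Im tau ->
  orbit_of G (Inner (mobius g tau)) = orbit_of G (Inner tau).
Proof.
move=> [GS _ GM GV] Gg t0; have g1 := GS _ Gg; apply/seteqP; split => _ [u Gu <-] /=.
  by exists (u * g); [exact: GM|rewrite /= mobius_mul//; exact: GS].
exists (u * g^-1); first by apply: GM => //; exact: GV.
rewrite /= mobius_mul ?mobiusK//; [exact: GS|exact: GS (GV _ Gg)|exact: mobius_H].
Qed.

Lemma inv2 g : \det g = 1 -> [/\ g^-1 0 0 = g 1 1, g^-1 0 1 = - g 0 1,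
  g^-1 1 0 = - g 1 0 & g^-1 1 1 = g 0 0].
Proof.
move=> g1; have gu : g \is a GRing.unit by rewrite unitmxE g1 unitr1.
pose u : 'M[R]_2 := \matrix_(i, j) (if i == j then g (1 - i) (1 - j) else - g i j).
have e0 : (1 - 0 : 'I_2) = 1 by apply/val_inj.
have e1 : (1 - 1 : 'I_2) = 0 by apply/val_inj.
suff -> : g^-1 = u by rewrite !mxE /= e0 e1.
apply: (mulrI gu); rewrite mulrV//; apply/esym/matrixP => i j; rewrite mulmx2E !mxE /= ?e0 ?e1.
move: g1; rewrite det2 => g1.
have [->|i1] : i = 0 \/ i = 1 by case: i => [[|[|//]]] hi; [left|right]; exact/val_inj.
all: have [->|j1] : j = 0 \/ j = 1 by case: j => [[|[|//]]] hj; [left|right]; exact/val_inj.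
all: rewrite ?i1 ?j1 /= ?e0 ?e1 -?g1; ring.
Qed.

Section Fixed.
Variables (G : set 'M[R]_2) (f : C -> option C) (F : modular_curve G -> option C).
Hypothesis sG : subgroup_SL2R G.
Hypothesis cG : finite_index (G `&` SL2Z (R := R)) (SL2Z (R := R)).
Hypothesis mF : meromorphic_on_curve F.
Hypothesis fF : forall tau (htau : hstar G (Inner tau)), f tau = F (modular_proj htau).

Lemma invariant g tau : G g -> 0 < complex.Im tau -> f (mobius g tau) = f tau.
Proof.
move=> Gg t0; have g1 : \det g = 1 by case: sG => GS _ _ _; exact: GS.
have m0 : hstar G (Inner (mobius g tau)) by exact: mobius_H.
have h0 : hstar G (Inner tau) by [].
rewrite (fF m0) (fF h0); congr F; apply: modular_proj_eq; exact: orbit_mobius.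
Qed.

Let coset g := [set g * u | u in G `&` SL2Z (R := R)].

Let coset_eq g u : \det g = 1 -> \det u = 1 -> coset g = coset u -> G (g^-1 * u).
Proof.
move=> g1 u1 e; have gu : g \is a GRing.unit by rewrite unitmxE g1 unitr1.
have : coset u u.
  exists 1; last by rewrite mulr1.
  split; first by case: sG.
  split; first exact: det1.
  by move=> i j; rewrite mxE; exact: rpred_nat.
by rewrite -e => -[v [Gv _] <-]; rewrite mulKr.
Qed.

Let coset_reps : exists s : seq 'M[R]_2, (forall g, g \in s -> word g) /\
  forall g, word g -> exists2 u, u \in s & coset u = coset g.
Proof.
have fin : finite_set [set coset g | g in word (R := R)].
  apply: sub_finite_set cG => _ [g wg <-]; exists g => //; exact: word_SL2Z.
have /finite_seqP[s es] := fin.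
have hs c : c \in s -> exists2 g, word g & coset g = c.
  by move=> cs; have : [set` s] c by []; rewrite -es.
suff [t [h1 h2]] : exists t : seq 'M[R]_2, (forall g, g \in t -> word g) /\
    forall c, c \in s -> exists2 u, u \in t & coset u = c.
  exists t; split=> // g wg; apply: h2.
  by have : [set coset g | g in word (R := R)] (coset g) by [exists g]; rewrite es.
elim: s hs {es} => [|c s ih] hs; first by exists nil.
have [|t [h1 h2]] := ih; first by move=> c' c's; apply: hs; rewrite inE c's orbT.
have [g wg gc] := hs c (mem_head _ _).
exists (g :: t); split=> [g'|c'].
  by rewrite inE => /predU1P[->//|]; exact: h1.
rewrite inE => /predU1P[->|/h2[u ut uc]]; first by exists g => //; exact: mem_head.
by exists u => //; rewrite inE ut orbT.
Qed.

(** By invariance the translate of f by g depends only on the coset of g^-1 modulo the intersection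
    of G with SL(2,Z), and there are finitely many cosets. *)
Lemma finitely_many_translates : exists2 s : seq 'M[R]_2, (forall g, g \in s -> word g) &
  forall g, word g -> exists2 b, b \in s &
    forall tau, 0 < complex.Im tau -> f (mobius g tau) = f (mobius b tau).
Proof.
have [s [sw sP]] := coset_reps; exists [seq g^-1 | g <- s].
  by move=> _ /mapP[g /sw wg ->]; exact: word_inv.
move=> g wg; have [u us uc] := sP _ (word_inv wg).
exists u^-1; first exact: map_f.
move=> tau t0; have u1 := word_det (sw _ us).
have u1' := word_det (word_inv (sw _ us)).
have gi := coset_eq (word_det (word_inv wg)) u1 (esym uc).
rewrite invrK in gi.
have uu : u \is a GRing.unit by rewrite unitmxE u1 unitr1.
rewrite -(invariant gi (mobius_H u1' t0)) -mobius_mul ?mulrK//.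
by rewrite det_mulmx u1 mulr1 word_det.
Qed.

(** Pigeonhole: among the elements T^-k b^-1 two, for k < l, lie in the same coset, and their
    quotient is b T^(l-k) b^-1. *)
Lemma conjugate_translation b : word b ->
  exists2 m : nat, (0 < m)%N & G (b * translation m%:R * b^-1).
Proof.
move=> wb; have [s [sw sP]] := coset_reps.
pose v (k : nat) := translation (- k%:Z)%:~R * b^-1 : 'M[R]_2.
have wv k : word (v k) by apply: word_mul; [exact: word_T|exact: word_inv].
have [r hr] : {r : nat -> nat & forall k, (r k < size s)%N /\ coset (nth 1 s (r k)) = coset (v k)}.
  apply: (@choice _ _ (fun k i => (i < size s)%N /\ coset (nth 1 s i) = coset (v k))) => k.
  have [u us uc] := sP _ (wv k).
  by exists (index u s); rewrite index_mem us nth_index.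
have [k [l [kl e]]] : exists k l : nat, (k < l)%N /\ r k = r l.
  apply: contrapT => H.
  have inj : injective (fun k : 'I_(size s).+1 => Ordinal (hr k).1).
    move=> i j [] e; apply/val_inj => /=; apply: contrapT => ij.
    have [ltij|ltji|//] := ltngtP i j; apply: H.
      by exists i, j.
    by exists j, i.
  by have := leq_card _ inj; rewrite !card_ord ltnn.
exists (l - k)%N; first by rewrite subn_gt0.
have E : coset (v l) = coset (v k) by rewrite -(hr l).2 -(hr k).2 e.
have := coset_eq (word_det (wv l)) (word_det (wv k)) E.
have b1 := word_det wb; have bu : b \is a GRing.unit by rewrite unitmxE b1 unitr1.
suff -> : (v l)^-1 * v k = b * translation (l - k)%:R * b^-1 by [].
have tu (t : R) : translation t \is a GRing.unit by rewrite unitmxE det_translation unitr1.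
have tV (t : R) : (translation t)^-1 = translation (- t).
  by apply: (mulrI (tu t)); rewrite mulrV// translationD subrr translation0.
rewrite /v invrM ?unitrV// invrK tV !mulrNz opprK !mulrA.
rewrite -[b * _ * translation (- _)]mulrA translationD.
by rewrite natrB ?(ltnW kl).
Qed.

Lemma translate_periodic b (m : nat) tau : word b -> G (b * translation m%:R * b^-1) ->
  0 < complex.Im tau -> f (mobius b (tau + m%:R)) = f (mobius b tau).
Proof.
move=> wb Gb t0; have b1 := word_det wb.
rewrite -(invariant Gb (mobius_H b1 t0)) mobius_mul ?mobiusK//; last 3 first.
- by rewrite det_mulmx b1 det_translation mulr1.
- by rewrite word_det//; exact: word_inv.
- exact: mobius_H.
by rewrite mobius_mul ?det_translation// mobius_translation rmorph_nat.
Qed.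

(** A conjugate of a nontrivial translation has trace 2, differs from the identity, and fixes the
    image of infinity; here this is read off its entries. *)
Lemma translate_cusp b (m : nat) : word b -> (0 < m)%N -> G (b * translation m%:R * b^-1) ->
  cusp G (mobius_bdry b None).
Proof.
move=> wb m0 Gb; have b1 := word_det wb; set g := _ * b^-1 in Gb.
have [i00 i01 i10 i11] := inv2 b1; have b1' := b1; rewrite det2 in b1'.
have tE : [/\ translation m%:R 0 0 = 1 :> R, translation m%:R 0 1 = m%:R :> R,
  translation m%:R 1 0 = 0 :> R & translation m%:R 1 1 = 1 :> R] by rewrite !mxE.
case: tE => t00 t01 t10 t11.
have mm : (m%:R : R) != 0 by rewrite pnatr_eq0 -lt0n.
have g00 : g 0 0 = 1 - m%:R * b 0 0 * b 1 0.
  by rewrite /g !mulmx2E ?(t00, t01, t10, t11, i00, i01, i10, i11) -[X in _ = X - _]b1'; ring.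
have g01 : g 0 1 = m%:R * b 0 0 ^+ 2.
  by rewrite /g !mulmx2E ?(t00, t01, t10, t11, i00, i01, i10, i11); ring.
have g10 : g 1 0 = - (m%:R * b 1 0 ^+ 2).
  by rewrite /g !mulmx2E ?(t00, t01, t10, t11, i00, i01, i10, i11); ring.
have g11 : g 1 1 = 1 + m%:R * b 0 0 * b 1 0.
  by rewrite /g !mulmx2E ?(t00, t01, t10, t11, i00, i01, i10, i11) -[X in _ = X + _]b1'; ring.
have trg : \tr g = 2.
  rewrite /mxtrace !big_ord_recl big_ord0 addr0.
  by have -> : lift 0 0 = 1 :> 'I_2; [apply/val_inj|rewrite g00 g11; ring].
exists g; split=> //.
  split.
  - by case: sG => GS _ _ _; exact: GS.
  - by rewrite trg; ring.
  - move=> g1; have := g01; have := g10; rewrite g1 !mxE /= => /esym/eqP.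
    rewrite oppr_eq0 mulf_eq0 (negbTE mm) expf_eq0 /= => /eqP c0 /esym/eqP.
    rewrite mulf_eq0 (negbTE mm) expf_eq0 /= => /eqP a0.
    by move: b1'; rewrite c0 a0 mul0r mulr0 subr0 => /esym/eqP; rewrite oner_eq0.
  - move=> g1; move: trg; rewrite g1 raddfN /= mxtrace1 => /eqP.
    by rewrite -subr_eq0 -opprD oppr_eq0 -natrD pnatr_eq0.
rewrite /mobius_bdry; case: eqP => [c0|/eqP c0].
  by rewrite g10 c0 expr0n /= mulr0 oppr0 eqxx.
have -> : g 1 0 * (b 0 0 / b 1 0) + g 1 1 = 1 by rewrite g10 g11; field.
rewrite oner_eq0 g00 g01; congr Some; field.
by rewrite c0.
Qed.

(** The image of infinity under b is a cusp, so near i oo the translate is a meromorphic germ at 0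
    evaluated at exp(2 pi i tau / h), where h is the width of that cusp. *)
Lemma translate_growth b : word b -> exists N (Y B : R), forall tau, Y < complex.Im tau ->
  exists2 v, f (mobius b tau) = Some v & cn v * cn (qpar 1 tau) ^+ N <= B.
Proof.
move=> wb; have b1 := word_det wb; have [m m0 Gb] := conjugate_translation wb.
have [h [H [[h0 _] [n [k [dk _ eH]]] _ [M M0 hM]]]] := mF.2 b b1 (translate_cusp wb m0 Gb).
have hk : holo k 0.
  by have /nearC_self /derivable_holo := (near_nearC _ _).1 dk.
have [r0 r00 kb] := holo_cont hk ltr01.
have [r r1 hr] := (near_nearC _ _).1 eH.
have [|Y hY] := @qpar_small R h h0 (Num.min r0 r); first by rewrite lt_min r00.
(* A pole of order n in exp(2 pi i tau / h) has size |q|^(-n/h); the width h is real, so n / h is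
   rounded up. *)
pose N := Num.bound (n%:R / h).
have hN : n%:R / h <= N%:R by apply/ltW/archi_boundP/divr_ge0; rewrite ?ler0n ?ltW.
exists N, (Num.max 0 (Num.max M Y)), (cn (k 0) + 1) => tau.
rewrite !gt_max => /and3P[t0 tM /hY]; rewrite lt_min => /andP[q0 q1].
have q0' : qpar h tau != 0 by exact: qpar_neq0.
have ht : hstar G (Inner (mobius b tau)) by exact: mobius_H.
have := hM tau ht tM; rewrite -(fF ht) -[e2pi _]/(qpar h tau) hr ?subr0// (negbTE q0') /= => ->.
exists (k (qpar h tau) / (qpar h tau) ^+ n) => //.
have kq : cn (k (qpar h tau)) <= cn (k 0) + 1.
  have := kb (qpar h tau); rewrite subr0 => /(_ q0).
  by have := cn_sub_ge (k (qpar h tau)) (k 0); lra.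
rewrite cnf cnX -mulrA -[leRHS]mulr1; apply: ler_pM; rewrite ?cn_ge0//.
  by rewrite mulr_ge0 ?invr_ge0 ?exprn_ge0 ?cn_ge0.
rewrite mulrC ler_pdivrMr ?exprn_gt0 ?cn_gt0// mul1r !cn_qpar -!expRM_natl ler_expR.
rewrite divr1 !mulrN lerN2.
have -> : n%:R * (2 * pi / h * complex.Im tau) = n%:R / h * (2 * pi * complex.Im tau) by ring.
by rewrite ler_wpM2r// !mulr_ge0// ?pi_ge0 ?ltW.
Qed.

Lemma translate_period b : word b -> exists2 m : nat, (0 < m)%N &
  forall tau, 0 < complex.Im tau -> f (mobius b (tau + m%:R)) = f (mobius b tau).
Proof.
move=> wb; have [m m0 Gb] := conjugate_translation wb.
by exists m => // tau; exact: translate_periodic.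
Qed.

End Fixed.

(** Gathers what modularity contributes to the construction of a relation: finitely many translates,
    a common period m, obtained as a product of individual ones, and at most a pole in q at every
    cusp. *)
Theorem modular_translates f : modular_function f -> exists (s : seq 'M[R]_2) (m : nat),
  [/\ (0 < m)%N, forall b, b \in s -> word b,
      forall g, word g -> exists2 b, b \in s &
        forall tau, 0 < complex.Im tau -> f (mobius g tau) = f (mobius b tau),
      forall b tau, b \in s -> 0 < complex.Im tau ->
        f (mobius b (tau + m%:R)) = f (mobius b tau)
    & forall b, word b -> exists N (Y B : R), forall tau, Y < complex.Im tau ->
        exists2 v, f (mobius b tau) = Some v & cn v * cn (qpar 1 tau) ^+ N <= B].
Proof.
move=> [_ [G [sG [_ cG] [F mF fF]]]].
have [s sw sP] := finitely_many_translates sG cG fF.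
have [m m0 hm] : exists2 m : nat, (0 < m)%N & forall b tau, b \in s -> 0 < complex.Im tau ->
    f (mobius b (tau + m%:R)) = f (mobius b tau).
  elim: s sw {sP} => [|b s ih] sw; first by exists 1%N.
  have [|m m0 hm] := ih; first by move=> b' b's; apply: sw; rewrite inE b's orbT.
  have [m' m'0 hm'] := translate_period sG cG fF (sw _ (mem_head _ _)).
  have mult b' (l k : nat) : (forall tau, 0 < complex.Im tau -> f (mobius b' (tau + l%:R)) = f (mobius b' tau)) ->
      forall tau, 0 < complex.Im tau -> f (mobius b' (tau + (k * l)%:R)) = f (mobius b' tau).
    move=> H tau t0; elim: k => [|k ik]; first by rewrite addr0.
    by rewrite mulSn addnC natrD addrA H ?ik// ImD Im_nat addr0.
  exists (m * m')%N; first by rewrite muln_gt0 m0.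
  move=> b' tau; rewrite inE => /predU1P[-> t0|b's t0]; first exact: mult.
  by rewrite mulnC; apply: mult => // tau' t'0; exact: hm.
exists s, m; split=> // b wb.
exact: translate_growth sG cG mF fF _ wb.
Qed.

End ModularFunctions.

(** * Clearing the poles by a polynomial in j *)

Section PoleCancellation.
Variable R : realType.
Local Notation C := R[i].
Implicit Types (tau z p : C) (g b : 'M[R]_2) (f : C -> option C) (D E : {poly C}).

(** Compactness through Cousin's lemma: the hypothesis on pairs merges the witnesses of the four
    quarters into one. *)
Lemma compact_witness (T : Type) (A : T -> C -> Prop) (a b c d : R) : a <= b -> c <= d ->
  (forall x y, exists t, forall z, A x z \/ A y z -> A t z) ->
  (forall z, a <= complex.Re z <= b -> c <= complex.Im z <= d -> exists x, nearC z (A x)) ->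
  exists x, forall z, a <= complex.Re z <= b -> c <= complex.Im z <= d -> A x z.
Proof.
move=> ab cd join loc.
pose P (a b c d : R) := exists x, forall z, a <= complex.Re z <= b -> c <= complex.Im z <= d -> A x z.
apply: (@cousin2 _ P) => //.
  move=> a' b' c' d' _ _ _ _ _ _ [x1 h1] [x2 h2] [x3 h3] [x4 h4].
  have [x5 h5] := join x1 x2; have [x6 h6] := join x3 x4; have [x7 h7] := join x5 x6.
  exists x7 => z /andP[r1 r2] /andP[i1 i2]; apply: h7.
  case: (leP (complex.Im z) ((c' + d') / 2)) => i3; [left; apply: h5|right; apply: h6];
    case: (leP (complex.Re z) ((a' + b') / 2)) => r3; [left; apply: h1|right; apply: h2
      |left; apply: h3|right; apply: h4]; rewrite ?r1 ?r2 ?i1 ?i2 ?i3 ?r3 ?(ltW i3) ?(ltW r3)//.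
move=> x y xab ycd; have [t [r r0 ht]] := loc (x +i* y) xab ycd.
exists (r / 2); first by rewrite divr_gt0.
move=> a' b' c' d' _ /andP[x1 x2] _ _ /andP[y1 y2] _ s1 s2; exists t => z /andP[z1 z2] /andP[z3 z4].
apply: ht; apply: le_lt_trans (cn_ReIm _) _; rewrite ReD ImD ReN ImN /=.
have a1 : `|complex.Re z - x| <= b' - a' by rewrite ler_norml; lra.
have a2 : `|complex.Im z - y| <= d' - c' by rewrite ler_norml; lra.
lra.
Qed.

(** At a pole f is given the value 0; D has to vanish to sufficient order there for the product to
    be holomorphic with that value. *)
Definition clear_poles D f tau := D.[jinv tau] * odflt 0 (f tau).

(** At a pole of order n, the factor (j - j(p))^(n+2) leaves a function of size |u - p|^2, which
    with the value 0 at p has derivative 0 there. The claim covers a whole neighbourhood and all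
    multiples of the factor, ready for a compactness argument. *)
Lemma clear_poles_local f p : 0 < complex.Im p -> meromorphic_at f p ->
  exists k : nat, nearC p (fun z => forall D, ('X - (jinv p)%:P) ^+ k %| D ->
    holo (clear_poles D f) z /\ (f z = None -> D.[jinv z] = 0)).
Proof.
move=> p0 [n [g [/near_nearC dg _ /near_nearC ef]]]; exists n.+2.
have [r r0 hr] := nearC_and (nearH p0) (nearC_and dg ef).
exists r => // z zr D dD; have [z0 [dgz ez]] := hr z zr.
have jz (u : C) : 0 < complex.Im u -> holo (fun u => D.[jinv u]) u.
  by move=> u0; apply: holo_horner; exact: holoH_jinv.
case: (boolP ((z == p) && (0 < n)%N)) ez => [/andP[/eqP zp n0] ez|nzp ez]; last first.
  split; last by rewrite ez.
  have dz : (z - p) ^+ n != 0.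
    by move: nzp; rewrite negb_and -leqNgt leqn0 expf_eq0 subr_eq0 => /orP[/negbTE->|/eqP->];
      rewrite ?andbF ?ltnn.
  apply: (holo_near (F := fun u => D.[jinv u] * (g u / (u - p) ^+ n))).
    exists (if z == p then r else Num.min (r - cn (z - p)) (cn (z - p))).
      by case: eqVneq => [//|zp]; rewrite lt_min subr_gt0 zr cn_gt0 subr_eq0.
    move=> u uz; rewrite /clear_poles.
    have [ur nu] : cn (u - p) < r /\ ~~ ((u == p) && (0 < n)%N).
      move: uz nzp; case: eqVneq => [->|zp] /=; first by move=> ? /negbTE->; rewrite andbF.
      rewrite lt_min => /andP[u1 u2] _; split; first by have := cnD3 u z p; lra.
      by rewrite negb_and; apply/orP; left; apply: contraTneq u2 => ->; rewrite cnBC ltxx.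
    by have [_ [_ ->]] := hr u ur; rewrite (negbTE nu).
  apply: holo_mul; first exact: jz.
  apply: holo_div => //; first exact: derivable_holo.
  by apply: holo_exp; apply: holo_sub; [exact: holo_id|exact: holo_cst].
have Dp : D.[jinv p] = 0.
  by have /dvdpP[E ->] := dD; rewrite hornerM horner_exp hornerXsubC subrr expr0n /= mulr0.
split; last by rewrite zp.
rewrite zp; have /dvdpP[E DE] := dD; exists 0.
have hE : holo (fun u => E.[jinv u]) p by apply: holo_horner; exact: holoH_jinv.
have hg : holo g p by apply: derivable_holo; case: (hr p _) => [|_ []//]; rewrite subrr cn0.
have [rE rE0 bE] := holo_cont hE ltr01; have [rg rg0 bg] := holo_cont hg ltr01.
have [dj /hasder_lip[rj rj0 bj]] := holoH_jinv p0.
set L := cn dj + 1 in bj; have L0 : 0 <= L by rewrite /L addr_ge0 ?cn_ge0.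
apply: (@hasder_quadratic _ _ (fun=> 0) p 0 ((cn E.[jinv p] + 1) * (cn (g p) + 1) * L ^+ n.+2)).
  exact: hasder_cst.
exists (Num.min (Num.min r rE) (Num.min rg rj)).
  by rewrite !lt_min r0 rE0 rg0 rj0.
move=> u; rewrite !lt_min => /andP[/andP[ur uE] /andP[ug uj]]; rewrite subr0.
have [->|up] := eqVneq u p.
  by rewrite /clear_poles Dp mul0r cn0 subrr cn0 expr0n /= mulr0.
have [_ [_ fu]] := hr u ur; rewrite /clear_poles fu (negbTE up) /= DE hornerM horner_exp hornerXsubC.
have d0 : 0 < cn (u - p) by rewrite cn_gt0 subr_eq0.
rewrite cnM [X in X * _]cnM cnf !cnX.
have e1 : cn E.[jinv u] <= cn E.[jinv p] + 1 by have := bE u uE; have := cn_sub_ge E.[jinv u] E.[jinv p]; lra.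
have e2 : cn (g u) <= cn (g p) + 1 by have := bg u ug; have := cn_sub_ge (g u) (g p); lra.
have e3 : cn (jinv u - jinv p) ^+ n.+2 <= L ^+ n.+2 * cn (u - p) ^+ n * cn (u - p) ^+ 2.
  by rewrite -mulrA -exprD addn2 -exprMn; apply: lerXn2r; rewrite ?nnegrE ?cn_ge0 ?mulr_ge0 ?cn_ge0//; exact: bj.
rewrite mulrA ler_pdivrMr ?exprn_gt0//.
have -> : (cn E.[jinv p] + 1) * (cn (g p) + 1) * L ^+ n.+2 * cn (u - p) ^+ 2 * cn (u - p) ^+ n =
  (cn E.[jinv p] + 1) * (L ^+ n.+2 * cn (u - p) ^+ n * cn (u - p) ^+ 2) * (cn (g p) + 1) by ring.
apply: ler_pM => //; first by rewrite mulr_ge0 ?exprn_ge0 ?cn_ge0.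
  exact: cn_ge0.
by apply: ler_pM => //; rewrite ?exprn_ge0 ?cn_ge0.
Qed.

Lemma clear_poles_seq f (s : seq 'M[R]_2) z : (forall tau, 0 < complex.Im tau -> meromorphic_at f tau) ->
  (forall b, b \in s -> word b) -> 0 < complex.Im z ->
  exists2 E, E != 0 & nearC z (fun u => forall D, E %| D -> forall b, b \in s ->
    holo (clear_poles D f) (mobius b u) /\ (f (mobius b u) = None -> D.[jinv u] = 0)).
Proof.
move=> mf sw z0; elim: s sw => [|b s ih] sw.
  by exists 1; [exact: oner_neq0|exists 1].
have [|E E0 nE] := ih; first by move=> b' b's; apply: sw; rewrite inE b's orbT.
have wb := sw b (mem_head _ _); have b1 := word_det wb.
have [k [r r0 hr]] := clear_poles_local (mobius_H b1 z0) (mf _ (mobius_H b1 z0)).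
exists (E * ('X - (jinv (mobius b z))%:P) ^+ k).
  by rewrite mulf_neq0// expf_neq0// polyXsubC_eq0.
have [r' r'0 cb] := holo_cont (holo_mobius b1 z0) (divr_gt0 r0 (ltr0n _ 2)).
have nb : nearC z (fun u => cn (mobius b u - mobius b z) < r).
  by exists r' => // u /cb; have := r0; lra.
apply: nearC_imp (nearC_and nE (nearC_and nb (nearH z0))) => u [hu [bu u0]] D dD b'.
rewrite inE => /predU1P[->|b's].
  have [] := hr _ bu D (dvdp_trans (dvdp_mull _ (dvdpp _)) dD) => h1 h2; split=> //.
  by move=> /h2; rewrite jinv_word.
by apply: hu => //; exact: dvdp_trans (dvdp_mulr _ (dvdpp _)) dD.
Qed.

(** High up, no translate has a pole; the remaining part of the strip is compact, so one product of
    local factors works on all of it. Any other point is moved to the strip by a word, which turns f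
    into one of finitely many translates and leaves j unchanged. *)
Theorem clear_poles_holoH f : modular_function f -> exists D, [/\ D != 0,
  holoH (clear_poles D f) & forall tau, 0 < complex.Im tau -> f tau = None -> D.[jinv tau] = 0].
Proof.
move=> hf; have [s [m [_ sw sP _ sG]]] := modular_translates hf; have [mf _] := hf.
have [M M1 hM] : exists2 M : R, 1 <= M & forall b z, b \in s -> M < complex.Im z -> f (mobius b z) != None.
  elim: s sw {sP} => [|b s ih] sw; first by exists 1.
  have [|M M1 hM] := ih; first by move=> b' b's; apply: sw; rewrite inE b's orbT.
  have [N [Y [B hY]]] := sG _ (sw _ (mem_head _ _)).
  exists (Num.max M Y); first by rewrite le_max M1.
  move=> b' z; rewrite inE gt_max => /predU1P[->|b's] /andP[zM zY]; last exact: hM.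
  by have [v ->] := hY z zY.
pose good D z := forall b, b \in s ->
  holo (clear_poles D f) (mobius b z) /\ (f (mobius b z) = None -> D.[jinv z] = 0).
(* Asking for the property at all multiples of E makes the product of two witnesses a witness. *)
pose A (E : {E | E != 0}) z := forall D, projT1 E %| D -> good D z.
have [||||[E E0] hE] := @compact_witness _ A (- (1 / 2)) (1 / 2) (86 / 100) M.
- lra.
- lra.
- move=> [E1 h1] [E2 h2]; exists (exist _ (E1 * E2) (mulf_neq0 h1 h2)) => z [] h D dD; apply: h => /=.
    exact: dvdp_trans (dvdp_mulr _ (dvdpp _)) dD.
  exact: dvdp_trans (dvdp_mull _ (dvdpp _)) dD.
- move=> z _ /andP[z1 _]; have z0 : 0 < complex.Im z by lra.
  by have [E E0 nE] := clear_poles_seq mf sw z0; exists (exist _ E E0).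
have goodE z : `|complex.Re z| <= 1 / 2 -> 86 / 100 <= complex.Im z -> good E z.
  rewrite ler_norml => zr zi; have [zM|Mz] := leP (complex.Im z) M.
    by apply: hE; rewrite ?zr ?zi//=; exact: dvdpp.
  move=> b bs; have z0 : 0 < complex.Im z by lra.
  have fb := hM _ _ bs Mz; split; last by move=> e; move: fb; rewrite e.
  have bz0 := mobius_H (word_det (sw _ bs)) z0.
  have [n [g [/near_nearC dg _ /near_nearC ef]]] := mf _ bz0.
  have n0 : n = 0%N.
    have := nearC_self ef; rewrite eqxx /=; case: n {ef dg} => //= n e.
    by move: fb; rewrite e.
  apply: (holo_near (F := fun u => E.[jinv u] * g u)).
    apply: nearC_imp ef => u; rewrite n0 andbF /clear_poles => -> /=.
    by rewrite expr0 divr1.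
  apply: holo_mul; first by apply: holo_horner; exact: holoH_jinv.
  by apply: derivable_holo; exact: nearC_self dg.
exists E; split=> //.
- move=> tau t0; have [g wg [gr gi]] := word_to_domain t0.
  have g1 := word_det wg; have gt0 := mobius_H g1 t0.
  have [b bs hb] := sP _ (word_inv wg).
  have [hol _] := goodE _ gr gi _ bs.
  have b1 := word_det (sw _ bs).
  apply: (holo_near (F := fun u => clear_poles E f (mobius b (mobius g u)))).
    apply: nearC_imp (nearH t0) => u u0; have gu0 := mobius_H g1 u0.
    by rewrite /clear_poles -(hb _ gu0) (mobiusK g1 u0) (jinv_word (sw _ bs) gu0) (jinv_word wg u0).
  apply: (holo_comp (F := fun u => mobius b (mobius g u))) => //.
  by apply: holo_comp; apply: holo_mobius.
- move=> tau t0 ft; have [g wg [gr gi]] := word_to_domain t0.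
  have g1 := word_det wg; have gt0 := mobius_H g1 t0.
  have [b bs hb] := sP _ (word_inv wg).
  have [_] := goodE _ gr gi _ bs; rewrite -hb// mobiusK// ft => /(_ erefl).
  by rewrite jinv_word.
Qed.

End PoleCancellation.

(** * Subfields and homogeneous linear systems *)

Definition divringClosed_of (U : unitRingType) (S : {pred U}) (SU : divring_closed S) : divringClosed U :=
  HB.pack_for (divringClosed U) (S : U -> bool) (GRing.isDivringClosed.Build U S SU).

Lemma kernel_vector (F : fieldType) (I J : finType) (A : I -> J -> F) : (#|J| < #|I|)%N ->
  exists c : I -> F, (exists i, c i != 0) /\ forall j, \sum_i c i * A i j = 0.
Proof.
move=> JI; pose M := \matrix_(i < #|I|, j < #|J|) A (enum_val i) (enum_val j).
have : kermx M != 0.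
  rewrite -mxrank_eq0 mxrank_ker -lt0n subn_gt0.
  exact: leq_ltn_trans (rank_leq_col M) JI.
move=> /rowV0Pn[v /sub_kermxP vM v0].
exists (fun i => v 0 (enum_rank i)); split.
  have /existsP[i vi] : [exists i, v 0 i != 0].
    apply: contraNT v0 => /existsPn H; apply/eqP/rowP => i.
    by rewrite mxE; apply/eqP; have := H i; rewrite negbK.
  by exists (enum_val i); rewrite enum_valK.
move=> j; have := congr1 (fun B : 'rV_ _ => B 0 (enum_rank j)) vM; rewrite [RHS]mxE [LHS]mxE => E; rewrite -[RHS]E.
rewrite (reindex (@enum_val I predT)); last exact/onW_bij/enum_val_bij.
by apply: eq_big => // i _; rewrite [M _ _]mxE enum_valK enum_rankK.
Qed.

(** * Growth at infinity and change of period *)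

Section Tame.
Variable R : realType.
Local Notation C := R[i].
Implicit Types (tau z : C) (F G : C -> C) (D : {poly C}).

(** At most a pole at the cusp. *)
Definition tame (h : R) F := exists N, bigO h 0 (fun z => F z * qpar h z ^+ N).

Section Period.
Variable h : R.
Hypothesis h0 : 0 < h.

Lemma bigO_widen F N N' : (N <= N')%N -> bigO h 0 (fun z => F z * qpar h z ^+ N) ->
  bigO h 0 (fun z => F z * qpar h z ^+ N').
Proof.
move=> NN H; apply: (bigO_ext (F := fun z => (F z * qpar h z ^+ N) * qpar h z ^+ (N' - N))).
  by move=> z; rewrite -mulrA -exprD subnKC.
by apply: (bigO_mul (m := 0) (n := 0) H); apply: bigO_le h0 _ _ _ (leq0n _) (bigO_w _ _).
Qed.

Lemma tame_cst k : tame h (fun=> k).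
Proof. by exists 0%N; apply: bigO_ext (bigO_cst h k) => z; rewrite expr0 mulr1. Qed.

Lemma tame_near F G : (exists Y, forall z, Y < complex.Im z -> F z = G z) -> tame h F -> tame h G.
Proof.
move=> [Y hY] [N hN]; exists N; apply: bigO_near hN.
by exists Y => z zY; rewrite hY.
Qed.

Lemma tame_add F G : tame h F -> tame h G -> tame h (fun z => F z + G z).
Proof.
move=> [N hN] [N' hN']; exists (N + N')%N.
apply: (bigO_ext _ (bigO_add (bigO_widen (leq_addr N' N) hN) (bigO_widen (leq_addl N N') hN'))).
by move=> z; rewrite mulrDl.
Qed.

Lemma tame_mul F G : tame h F -> tame h G -> tame h (fun z => F z * G z).
Proof.
move=> [N hN] [N' hN']; exists (N + N')%N.
by apply: (bigO_ext _ (bigO_mul hN hN')) => z; rewrite exprD mulrACA.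
Qed.

Lemma tame_exp F n : tame h F -> tame h (fun z => F z ^+ n).
Proof.
move=> hF; elim: n => [|n ih].
  by apply: tame_near (tame_cst 1); exists 0 => z _; rewrite expr0.
apply: tame_near (tame_mul hF ih).
by exists 0 => z _; rewrite exprS.
Qed.

Lemma tame_sum (I : Type) (r : seq I) (F : I -> C -> C) :
  (forall i, tame h (F i)) -> tame h (fun z => \sum_(i <- r) F i z).
Proof.
move=> hF; elim: r => [|i r ih].
  by apply: tame_near (tame_cst 0); exists 0 => z _; rewrite big_nil.
by apply: tame_near (tame_add (hF i) ih); exists 0 => z _; rewrite big_cons.
Qed.

Lemma tame_horner D F : tame h F -> tame h (fun z => D.[F z]).
Proof.
move=> hF; apply: tame_near (@tame_sum _ (index_enum _) (fun (i : 'I_(size D)) z => D`_i * F z ^+ i) _).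
  by exists 0 => z _; rewrite horner_coef.
by move=> i; apply: tame_mul; [exact: tame_cst|exact: tame_exp].
Qed.

End Period.

Section ChangePeriod.
Variable m : nat.
Hypothesis m0 : (0 < m)%N.
Let hm : (0 : R) < m%:R. Proof. by rewrite ltr0n. Qed.

(** Passing from period 1 to period m replaces q by an m-th root, so that j and f are expanded in
    one parameter. *)
Lemma qpar_root z : qpar 1 z = qpar m%:R z ^+ m.
Proof.
rewrite /qpar -e2piMn divr1 rmorph_nat mulrCA mulfV ?mulr1//.
by rewrite pnatr_eq0 -lt0n.
Qed.

Lemma bigO_root k F : bigO 1 k F -> bigO m%:R k F.
Proof.
move=> H; apply: (@bigO_le _ _ hm (m * k)); first by rewrite leq_pmull.
by case: H => Y [B hB]; exists Y, B => z /hB; rewrite qpar_root cnX -exprM.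
Qed.

Lemma tame_root F : tame 1 F -> tame m%:R F.
Proof.
move=> [N hN]; exists (m * N)%N.
by apply: bigO_ext (bigO_root hN) => z; rewrite exprM -(qpar_root z).
Qed.

Lemma asy_root (K : divringClosed C) F : asy 1 K F -> asy m%:R K F.
Proof.
move=> [N hN]; exists (m * N)%N => k; have [p pK hp] := hN k.
exists (p \Po 'X^m); first by apply: polyOver_comp => //; exact: polyOverXn.
by apply: bigO_ext (bigO_root hp) => z; rewrite exprM horner_comp hornerXn -(qpar_root z).
Qed.

Lemma perH_root F : perH 1 F -> perH m%:R F.
Proof.
move=> pF z z0; have := perH_int m%:Z pF z0.
by rewrite mulr1.
Qed.

End ChangePeriod.

Lemma tame_jinv : tame 1 (@jinv R).
Proof.
have allK : divring_closed (predT : {pred C}) by [].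
exact: (asy_bound ltr01 (asy_jinv (divringClosed_of allK))).
Qed.

Lemma poly_high_order (h : R) (k : nat) (p : {poly C}) : 0 < h -> (forall i, (i < k)%N -> p`_i = 0) ->
  bigO h k (fun z => p.[qpar h z]).
Proof.
move=> h0 pk; have -> : p = drop_poly k p * 'X^k.
  rewrite -[LHS](poly_take_drop k); have -> : take_poly k p = 0; last by rewrite add0r.
  by apply/polyP => i; rewrite coef_take_poly coef0; case: ifP => // /pk.
apply: (bigO_ext (F := fun z => (drop_poly k p).[qpar h z] * qpar h z ^+ k)).
  by move=> z; rewrite hornerM hornerXn.
by apply: (bigO_mul (m := 0)); [exact: bigO_horner|exact: bigO_w].
Qed.

End Tame.

(** * An algebraic relation between j and f *)

Section Siegel.
Variable R : realType.
Local Notation C := R[i].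
Implicit Types (tau z : C) (b g : 'M[R]_2) (D : {poly C}).

(** Selects the order M at which the factor of [schwarz_line] drops to 1/2. The gap 43/100 separates
    the strip Im >= 86/100 from the line at height 43/100; larger gaps only decrease the factor. *)
Lemma geometric_half (h : R) : 0 < h -> exists M : nat, forall s y1 : R, 43 / 100 <= s - y1 ->
  expR (- (2 * pi / h * (s - y1))) ^+ M / (1 - expR (- (2 * pi / h * (s - y1)))) <= 1 / 2.
Proof.
move=> h0; have k0 := kappa_gt0 h0; set k := 2 * pi / h in k0 *.
pose t := expR (- (k * (43 / 100))).
have kk : 0 < k * (43 / 100) by rewrite mulr_gt0.
have t1 : t < 1 by rewrite /t expR_lt1 oppr_lt0.
have t0 : 0 < t := expR_gt0 _.
have [Y hY] := expR_small (ltac:(by rewrite divr_gt0 ?subr_gt0) : 0 < (1 - t) / 2).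
pose M := (Num.bound (`|Y| / (k * (43 / 100)))).+1; exists M => s y1 sy.
set x := expR _.
have xt : x <= t by rewrite ler_expR lerN2 ler_pM2l.
have x0 : 0 < x := expR_gt0 _.
have tM : t ^+ M <= (1 - t) / 2.
  rewrite /t -expRM_natl mulrN; apply/ltW/hY; apply: le_lt_trans (ler_norm Y) _.
  rewrite -ltr_pdivrMr//.
  have := archi_boundP (divr_ge0 (normr_ge0 Y) (ltW kk)); rewrite /M -natr1; set u := Num.bound _; lra.
rewrite ler_pdivrMr ?subr_gt0; last by lra.
have : x ^+ M <= t ^+ M by apply: lerXn2r; rewrite ?nnegrE ?(ltW x0) ?(ltW t0).
lra.
Qed.

(** The family is permuted by words, so a bound B on the strip holds on the whole half-plane, in
    particular on the line at height 43/100. Schwarz' lemma from that line improves it to B / 2 on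
    the strip, and iteration gives 0. A first bound exists by compactness and decay at infinity. *)
Lemma shrinking_eq0 (I : finType) (G : I -> C -> C) (h : R) (M : nat) : 0 < h ->
  (forall s y1 : R, 43 / 100 <= s - y1 ->
    expR (- (2 * pi / h * (s - y1))) ^+ M / (1 - expR (- (2 * pi / h * (s - y1)))) <= 1 / 2) ->
  (forall i, holoH (G i)) -> (forall i, perH h (G i)) -> (forall i, bigO h M (G i)) ->
  (forall i g z, word g -> 0 < complex.Im z -> exists k, G i z = G k (mobius g z)) ->
  forall i z, 0 < complex.Im z -> G i z = 0.
Proof.
move=> h0 hM holG perG bigG invG.
pose strip z := `|complex.Re z| <= 1 / 2 /\ 86 / 100 <= complex.Im z.
have bound1 i : exists B : R, forall z, strip z -> cn (G i z) <= B.
  have [Y [B hY]] := bigO_le h0 (leq0n M) (bigG i).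
  pose A (x : R) z := cn (G i z) <= x.
  have [||||x hx] := @compact_witness _ _ A (- (1 / 2)) (1 / 2) (86 / 100) (Num.max 1 Y).
  - lra.
  - by rewrite le_max; apply/orP; left; lra.
  - move=> x y; exists (Num.max x y) => z; rewrite /A le_max => -[]->//.
    by rewrite orbT.
  - move=> z _ /andP[z1 _]; have z0 : 0 < complex.Im z by lra.
    have [r r0 hr] := holo_cont (holG i _ z0) ltr01.
    exists (cn (G i z) + 1), r => // u /hr; rewrite /A.
    by have := cn_sub_ge (G i u) (G i z); lra.
  exists (Num.max x B) => z [zr zi]; rewrite le_max; have [zY|Yz] := leP (complex.Im z) (Num.max 1 Y).
    by rewrite [X in X || _]hx// ?zi// -ler_norml.
  rewrite gt_max in Yz; case/andP: Yz => _ /hY; rewrite expr0 mulr1 => ->; exact: orbT.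
pose Q (B : R) := forall i z, strip z -> cn (G i z) <= B.
have [B0 QB0] : exists B, Q B.
  have [B hB] := choice bound1; exists (\sum_i `|B i|) => i z /hB hi.
  apply: (le_trans (hi i) (le_trans (ler_norm _) _)).
  by rewrite (bigD1 i)//= lerDl sumr_ge0.
have everywhere B : Q B -> forall i z, 0 < complex.Im z -> cn (G i z) <= B.
  move=> QB i z z0; have [g wg sg] := word_to_domain z0.
  by have [k ->] := invG i g z wg z0; exact: QB.
have half B : Q B -> Q (B / 2).
  move=> QB i z [zr zi].
  have y0 : (0 : R) < 43 / 100 by lra.
  have y1 : (43 / 100 : R) < complex.Im z by lra.
  have lineB x : complex.Re z - h / 2 <= x <= complex.Re z + h / 2 -> cn (G i (x +i* (43 / 100))) <= B.
    by move=> _; exact: everywhere.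
  have := schwarz_line h0 (holG i) (perG i) (bigG i) y0 y1 lineB.
  move=> /le_trans; apply; rewrite [B / 2]mulrC -[2^-1]mul1r.
  apply: ler_wpM2r; last by apply: hM; lra.
  by apply: le_trans (cn_ge0 (G i z)) _; apply: QB.
move=> i z z0; apply: (@cn_le_small _ _ 1) => e e0; rewrite mul1r.
have [n hn] := half_pow_small B0 e0.
apply: le_trans (ltW hn); apply: everywhere => //.
elim: n {hn} => [|n ih]; first by rewrite expr0 divr1.
by have := half _ ih; rewrite -mulrA -invfM -exprSr.
Qed.

(** Siegel's method. The unknowns are the coefficients of a combination of the monomials j^a (D(j)
    f)^b; the linear conditions make this combination and its translates vanish to order M at
    infinity. With more unknowns than conditions there is a nontrivial solution, and [shrinking_eq0]
    makes the combination identically zero. *)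
Theorem algebraic_relation f : modular_function f -> exists2 P : {poly {poly C}}, P != 0 &
  forall tau w, 0 < complex.Im tau -> f tau = Some w -> P.[jinv tau, w] = 0.
Proof.
move=> hf; have [s [m [m0 sw sP sper sgr]]] := modular_translates hf.
have [D [D0 holD _]] := clear_poles_holoH hf.
set h : R := m%:R; have h0 : 0 < h by rewrite ltr0n.
pose n := size s; pose b (i : 'I_n) := nth 1 s i.
have bs i : b i \in s by exact: mem_nth.
have wb i : word (b i) by exact: sw.
have b1 i := word_det (wb i).
pose phi (i : 'I_n) z := clear_poles D f (mobius (b i) z).
have hphi i : holoH (phi i).
  move=> z z0; apply: (holo_comp (F := mobius (b i))); first exact: holo_mobius.
  by apply: holD; exact: mobius_H.
have pphi i : perH h (phi i).
  move=> z z0; have zh : 0 < complex.Im (z + h%:C) by rewrite ImD /= addr0.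
  rewrite /phi /clear_poles (jinv_word (wb i) zh) (jinv_word (wb i) z0) rmorph_nat sper//.
  by rewrite -[m%:R](rmorph_nat (real_complex R)) (perH_root m (@perH_jinv R) z0).
have tphi i : exists N, bigO h 0 (fun z => phi i z * qpar h z ^+ N).
  have [k [Y [B hY]]] := sgr _ (wb i).
  have [N1 hN1] : tame 1 (phi i).
    apply: (tame_near (F := fun z => D.[jinv z] * odflt 0 (f (mobius (b i) z)))).
      by exists 0 => z z0; rewrite /phi /clear_poles (jinv_word (wb i) z0).
    apply: tame_mul; first exact: (tame_horner ltr01 D (@tame_jinv R)).
    by exists k, Y, B => z /hY[v -> hv]; rewrite expr0 mulr1 cnM cnX.
  exact: (tame_root m0 (ex_intro _ N1 hN1)).
have [N [hNj hNp]] : exists N, bigO h 0 (fun z => jinv z * qpar h z ^+ N) /\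
    forall i, bigO h 0 (fun z => phi i z * qpar h z ^+ N).
  have [N1 h1] := tame_root m0 (@tame_jinv R).
  have [N2 h2] := choice tphi.
  exists (N1 + \sum_i N2 i)%N; split; first by apply: bigO_widen h0 _ _ _ _ h1; exact: leq_addr.
  move=> i; apply: bigO_widen h0 _ _ _ _ (h2 i).
  by rewrite (bigD1 i)//= addnCA leq_addr.
have [M hM] := geometric_half h0.
(* T bounds the pole order of the monomials with exponents below L. There are L^2 unknowns and n (T
   + M) = n (2 N L + M) conditions, and this is at most n (2 N + M) L, which is less than L^2. *)
pose L := (n * (2 * N + M)).+1; pose T := (2 * N * L)%N.
pose mono (x : 'I_L * 'I_L) i z := jinv z ^+ x.1 * phi i z ^+ x.2.
have hmono x i : holoH (mono x i).
  by move=> z z0; apply: holo_mul; apply: holo_exp; [exact: holoH_jinv|exact: hphi].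
have pmono x i : perH h (mono x i).
  by move=> z z0; rewrite /mono pphi// (perH_root m (@perH_jinv R) z0).
have bexp (F : C -> C) k : bigO h 0 (fun z => F z * qpar h z ^+ N) ->
    bigO h 0 (fun z => F z ^+ k * qpar h z ^+ (N * k)).
  move=> hF; elim: k => [|k ih].
    by apply: bigO_ext (bigO_cst h 1) => z; rewrite muln0 !expr0 mulr1.
  by apply: bigO_ext (bigO_mul hF ih) => z; rewrite mulnS exprD exprS mulrACA.
have bmono x i : bigO h 0 (fun z => mono x i z * qpar h z ^+ T).
  have := bigO_mul (bexp _ x.1 hNj) (bexp _ x.2 (hNp i)).
  move=> H; apply: (bigO_ext _ (bigO_widen h0 (N := N * x.1 + N * x.2) (N' := T) _ (F := mono x i) _)) => //.
    rewrite /T mul2n -addnn mulnDl leq_add// leq_mul2l (ltnW (ltn_ord _)) orbT//.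
  by apply: bigO_ext H => z; rewrite exprD mulrACA.
have approx xi : exists p : {poly C}, bigO h (T + M) (fun z => mono xi.1 xi.2 z * qpar h z ^+ T - p.[qpar h z]).
  apply: (bigO_poly h0) (bmono _ _).
    by move=> z z0; apply: holo_mul; [exact: hmono|apply: holo_exp; exact: holo_qpar].
  by move=> z z0; rewrite pmono// qpar_per.
have [p hp] := choice approx.
have [|c [[x0 cx0] hc]] := @kernel_vector C ('I_L * 'I_L)%type ('I_n * 'I_(M + T))%type
    (fun x il => (p (x, il.1))`_il.2).
  rewrite !card_prod !card_ord /T /L; set a := (n * (2 * N + M))%N.
  apply: (@leq_ltn_trans (a * a.+1)); last by rewrite ltn_pmul2r.
  by rewrite {2}/a -(mulnA n) leq_mul2l mulnDl addnC leq_add2l leq_pmulr ?orbT.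
pose G i z := \sum_x c x * mono x i z.
have bigG i : bigO h M (G i).
  apply: (@bigO_divwn _ _ _ T).
  pose q := \sum_x c x *: p (x, i).
  apply: (bigO_ext (F := fun z => \sum_x c x * (mono x i z * qpar h z ^+ T - (p (x, i)).[qpar h z]) + q.[qpar h z])).
    move=> z; rewrite /q horner_sum -big_split /= /G mulr_suml; apply: eq_bigr => x _.
    by rewrite hornerZ mulrBr subrK mulrA.
  apply: bigO_add.
    by apply: bigO_sum => x; apply: bigO_scale; rewrite addnC; exact: hp (x, i).
  apply: poly_high_order h0 _ => l lT; rewrite /q coef_sum.
  by have := hc (i, Ordinal lT); rewrite /= => E; rewrite -[RHS]E; apply: eq_bigr => x _; rewrite coefZ.
have hG i : holoH (G i).
  by move=> z z0; apply: holo_sum => x; apply: holo_mul; [exact: holo_cst|exact: hmono].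
have pG i : perH h (G i).
  by move=> z z0; apply: eq_bigr => x _; rewrite pmono.
have invG i g z : word g -> 0 < complex.Im z -> exists k, G i z = G k (mobius g z).
  move=> wg z0; have gz0 := mobius_H (word_det wg) z0.
  have [b' b's hb'] := sP _ (word_mul (wb i) (word_inv wg)).
  have ib : (index b' s < n)%N by rewrite index_mem.
  exists (Ordinal ib); apply: eq_bigr => x _; congr (_ * _).
  rewrite /mono jinv_word//; congr (_ * _ ^+ _); rewrite /phi /clear_poles.
  rewrite !jinv_word//; congr (_ * odflt _ _).
  rewrite /b /= nth_index// -hb'// mobius_mul ?word_det ?mobiusK//; last exact: word_inv.
  exact: word_det.
have G0 := shrinking_eq0 h0 hM hG pG bigG invG.
have [b0 b0s hb0] := sP _ (word_1 R).
have ib0 : (index b0 s < n)%N by rewrite index_mem.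
(* U has Y as outer variable, so [swapXY] restores the convention. Its coefficient at Y^b is D^b
   times the sum of the c(a, b) X^a, so it is nonzero for the b of a nonzero c(a, b). *)
pose U : {poly {poly C}} := \sum_x (c x *: ('X^(x.1) * D ^+ (x.2))) *: 'X^(x.2).
exists (swapXY U); last first.
  move=> tau w t0 fw; rewrite horner2_swapXY /U !horner_sum -[RHS](G0 (Ordinal ib0) tau t0).
  apply: eq_bigr => x _; rewrite /mono /phi /clear_poles /b /= nth_index// jinv_word//; last exact: sw.
  rewrite -hb0// mobius1 fw /= hornerZ hornerXn hornerM hornerZ hornerM hornerXn !horner_exp hornerC.
  by move: (jinv tau) => J; rewrite exprMn !mulrA.
suff : U != 0 by apply: contra_neq => e; rewrite -(swapXYK U) e raddf0.
apply: contraNneq cx0 => U0; rewrite -(mulr0 0).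
have : U`_(x0.2) = 0 by rewrite U0 coef0.
rewrite /U coef_sum.
have -> : \sum_x ((c x *: ('X^(x.1) * D ^+ (x.2))) *: 'X^(x.2))`_(x0.2) =
    (\sum_(a < L) c (a, x0.2) *: 'X^a) * D ^+ x0.2.
  transitivity (\sum_(a < L) \sum_(d < L) ((c (a, d) *: ('X^a * D ^+ d)) *: 'X^d)`_(x0.2)).
    by rewrite pair_bigA; apply: eq_bigr => -[a d].
  rewrite mulr_suml.
  apply: eq_bigr => a _; rewrite (bigD1 x0.2)//= big1 ?addr0.
    by rewrite coefZ coefXn eqxx mulr1 scalerAl.
  by move=> d dx; rewrite coefZ coefXn (_ : (_ == _) = false) ?mulr0//; apply/eqP => /val_inj e; rewrite e eqxx in dx.
move/eqP; rewrite mulf_eq0 expf_eq0 (negbTE D0) andbF orbF => /eqP /(congr1 (fun q : {poly C} => q`_x0.1)).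
rewrite coef0 coef_sum (bigD1 x0.1)//= big1 ?addr0.
  by rewrite coefZ coefXn eqxx mulr1 -surjective_pairing mulr0 => ->.
move=> a ax; rewrite coefZ coefXn (_ : (_ == _) = false) ?mulr0//.
by apply/eqP => /val_inj e; rewrite e eqxx in ax.
Qed.

End Siegel.

(** * From the Fourier series of f to an expansion over K *)

Section FourierExpansion.
Variable R : realType.
Local Notation C := R[i].
Implicit Types (tau z w : C).

Lemma zsum_window (m N : nat) (F : int -> C) : (N <= m)%N ->
  (forall n : nat, (N < n)%N -> F (- n%:Z) = 0) ->
  zsum m F = \sum_(0 <= k < (m + N).+1) F (k%:Z - N%:Z).
Proof.
move=> Nm F0; rewrite /zsum (big_cat_nat (n := (m - N)%N))//=; last by lia.
rewrite big_nat big1 ?add0r; last first.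
  move=> k /andP[_ km]; rewrite (_ : k%:Z - m%:Z = - (m - k)%N%:Z); last by lia.
  by apply: F0; lia.
rewrite -[X in \sum_(X <= _ < _) _]add0n big_addn (_ : (m.*2.+1 - (m - N))%N = (m + N).+1); last by lia.
by apply: eq_bigr => k _; congr F; lia.
Qed.

(** From some index on, each term is a difference of two partial sums within 1 of the limit; the
    finitely many earlier terms are bounded by the sum of their moduli. *)
Lemma convergent_terms_bounded (c : nat -> C) w l (s : nat) :
  seqlim (fun m => \sum_(0 <= k < (m + s).+1) c k * w ^+ k) l ->
  exists2 B : R, 0 <= B & forall k, cn (c k * w ^+ k) <= B.
Proof.
move=> /(_ 1 ltr01)[N0 h0].
pose K0 := (N0 + s).+1.
have S0 (n : nat) : 0 <= \sum_(0 <= k < n) cn (c k * w ^+ k) by apply: sumr_ge0 => k _; exact: cn_ge0.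
exists (2 + \sum_(0 <= k < K0) cn (c k * w ^+ k)); first by rewrite addr_ge0.
move=> k; have [kK|Kk] := ltnP k K0.
  rewrite (big_cat_nat (n := k))//=; last exact: ltnW.
  rewrite (big_ltn kK).
  have := S0 k; have : 0 <= \sum_(k.+1 <= i < K0) cn (c i * w ^+ i) by apply: sumr_ge0 => i _; exact: cn_ge0.
  lra.
have [d kd] : exists d, k = (N0 + d + s).+1 by exists (k - K0)%N; rewrite /K0 in Kk *; lia.
have h1 := h0 (N0 + d)%N (leq_addr _ _).
have h2 := h0 (N0 + d).+1 (leqW (leq_addr _ _)).
rewrite addSn big_nat_recr//= -kd in h2; rewrite -kd in h1.
set u := \sum_(0 <= i < k) _ in h1 h2.
have -> : c k * w ^+ k = (u + c k * w ^+ k - l) - (u - l) by ring.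
apply: le_trans (cnB _ _) _; have := S0 K0; lra.
Qed.

(** Geometric comparison with ratio at most 1/2; the difference on the right is the form that the
    induction on d reproduces. *)
Lemma power_series_tail (c : nat -> C) w (rho B : R) (j d : nat) : 0 < rho -> 0 <= B ->
  (forall k, cn (c k) * rho ^+ k <= B) -> cn w <= rho / 2 ->
  cn (\sum_(0 <= k < j + d) c k * w ^+ k - \sum_(0 <= k < j) c k * w ^+ k)
    <= 2 * B * ((cn w / rho) ^+ j - (cn w / rho) ^+ (j + d)).
Proof.
move=> r0 B0 hB hw; set x := cn w / rho.
have x0 : 0 <= x by rewrite divr_ge0 ?cn_ge0 ?ltW.
have x1 : x <= 1 / 2 by rewrite ler_pdivrMr//; lra.
elim: d => [|d ih]; first by rewrite addn0 !subrr cn0 mulr0.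
rewrite addnS big_nat_recr//=; set u := \sum_(0 <= k < j + d) _ in ih *; set v := \sum_(0 <= k < j) _ in ih *.
have -> : u + c (j + d)%N * w ^+ (j + d) - v = (u - v) + c (j + d)%N * w ^+ (j + d) by ring.
apply: le_trans (cnD _ _) _.
have t1 : cn (c (j + d)%N * w ^+ (j + d)) <= B * x ^+ (j + d).
  rewrite cnM cnX; have -> : cn w ^+ (j + d) = rho ^+ (j + d) * x ^+ (j + d).
    by rewrite -exprMn /x mulrC divfK// gt_eqF.
  by rewrite mulrA ler_wpM2r// exprn_ge0.
have p0 : 0 <= x ^+ (j + d) by exact: exprn_ge0.
rewrite exprSr; move: ih t1 p0; set p := x ^+ (j + d) => ih t1 p0.
have xp : B * (p * x) <= B * (p * (1 / 2)) by rewrite ler_wpM2l// ler_wpM2l.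
lra.
Qed.

Variable K : divringClosed C.

(** Multiplied by w^N the Fourier series becomes a power series in w. Its convergence at the single
    point i (M + 1) bounds the coefficients geometrically; higher up, the truncations, which have
    coefficients in K, approximate it to every order. *)
Lemma asy_fourier (f : C -> option C) (h : nat) (a : int -> C) : (0 < h)%N ->
  fourier_expansion f h a -> (forall n, a n \in K) -> asy h%:R K (fun z => odflt 0 (f z)).
Proof.
move=> h0 [[N aN] [M M0 hM]] aK; set r : R := h%:R; have r0 : 0 < r by rewrite ltr0n.
have rC : (h%:R : C) = r%:C by rewrite rmorph_nat.
have rn : (h%:R : C) != 0 by rewrite pnatr_eq0 -lt0n.
pose c (k : nat) := a (k%:Z - N%:Z).
have key tau v : 0 < complex.Im tau -> f tau = Some v ->
    ((fun m : nat => (zsum m (fun n => a n * e2pi (n%:~R / h%:R * tau))) : R[i]^o) @ \oo --> (v : R[i]^o)) ->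
    seqlim (fun m => \sum_(0 <= k < (m + N).+1) c k * qpar r tau ^+ k) (v * qpar r tau ^+ N).
  move=> t0 fv /cvg_seqlim lv; rewrite mulrC.
  move=> e e0; have [N1 h1] := seqlim_scale (qpar r tau ^+ N) lv e0.
  exists (maxn N1 N) => m; rewrite geq_max => /andP[/h1 hm Nm].
  rewrite (_ : \sum_(0 <= k < (m + N).+1) _ =
    qpar r tau ^+ N * zsum m (fun n => a n * e2pi (n%:~R / h%:R * tau)))//.
  rewrite (@zsum_window m N)//; last by move=> n Nn; rewrite aN ?mul0r// ltnW.
  rewrite mulr_sumr; apply: eq_bigr => k _; rewrite mulrCA; congr (_ * _).
  rewrite /qpar -!e2piMn -e2piD -rC; congr e2pi.
  by rewrite intrB -!pmulrn; field.
pose tau0 : C := 0 +i* (M + 1).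
have t00 : M < complex.Im tau0 by rewrite /=; lra.
have [v0 fv0 /(key _ _ (lt_trans M0 t00) fv0) lim0] := hM tau0 t00.
have [B B0 hB] := convergent_terms_bounded lim0.
pose rho := cn (qpar r tau0).
have rho0 : 0 < rho by rewrite cn_gt0 qpar_neq0.
have {}hB k : cn (c k) * rho ^+ k <= B by have := hB k; rewrite cnM cnX.
have [Y hY] := qpar_small r0 (divr_gt0 rho0 (ltr0n _ 2)).
exists N => j; exists (\poly_(k < j) c k).
  by apply/polyOverP => k; rewrite coef_poly; case: ifP => _; [exact: aK|exact: rpred0].
exists (Num.max M Y), (2 * B / rho ^+ j) => tau; rewrite gt_max => /andP[tM /hY/ltW wt].
have [v fv /(key _ _ (lt_trans M0 tM) fv) lim] := hM tau tM.
rewrite fv /=; apply: (@seqlim_le _ _ _ _ _ j lim) => m jm.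
rewrite horner_poly -(big_mkord predT (fun k => c k * qpar r tau ^+ k)).
have [d ->] : exists d, (m + N).+1 = (j + d)%N by exists ((m + N).+1 - j)%N; lia.
apply: le_trans (power_series_tail j d rho0 B0 hB wt) _.
have -> : 2 * B / rho ^+ j * cn (qpar r tau) ^+ j = 2 * B * (cn (qpar r tau) / rho) ^+ j.
  by rewrite expr_div_n mulrAC mulrA.
rewrite ler_wpM2l ?mulr_ge0// lerBlDr lerDl.
by rewrite exprn_ge0 // divr_ge0 ?cn_ge0 ?ltW.
Qed.

End FourierExpansion.

(** * Projection of coefficients onto K *)

Section RationalSpecialization.
Variables (L : fieldType) (K : divringClosed L).

(* A K-linear projection onto K of the K-span of the x i, extended one vector at a time. *)
Lemma rational_projection (x : nat -> L) n : exists y : nat -> L, (forall i, y i \in K) /\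
  forall k0 (k : nat -> L), k0 \in K -> (forall i, k i \in K) ->
    k0 + \sum_(i < n) k i * x i = 0 -> k0 + \sum_(i < n) k i * y i = 0.
Proof.
elim: n => [|n [y [yK hy]]].
  by exists (fun=> 0); split=> [i|k0 k _ _]; rewrite ?rpred0// !big_ord0.
have [[m0 [m [m0K mK xE]]]|H] := pselect (exists m0 (m : nat -> L), [/\ m0 \in K, forall i, m i \in K &
    x n = m0 + \sum_(i < n) m i * x i]).
  pose v := m0 + \sum_(i < n) m i * y i.
  exists (fun i => if i == n then v else y i); split.
    move=> i; case: ifP => // _; rewrite rpredD//; apply: rpred_sum => j _; exact: rpredM.
  move=> k0 k k0K kK; rewrite !big_ord_recr /= eqxx xE => E.
  have := hy (k0 + k n * m0) (fun i => k i + k n * m i).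
  have -> : k0 + k n * m0 + \sum_(i < n) (k i + k n * m i) * x i = 0.
    rewrite -[RHS]E mulrDr mulr_sumr -addrA; congr (_ + _).
    rewrite [RHS]addrCA; congr (_ + _); rewrite -big_split /=; apply: eq_bigr => i _; ring.
  move=> /(_ _ _ erefl) E'; rewrite -[RHS]E'.
  - rewrite /v mulrDr mulr_sumr -[RHS]addrA; congr (_ + _); rewrite addrCA; congr (_ + _).
    rewrite -big_split /=; apply: eq_bigr => i _.
    by rewrite (ltn_eqF (ltn_ord i)) mulrDl mulrA.
  - by rewrite rpredD// rpredM.
  - by move=> i; rewrite rpredD// rpredM.
(* Here x n is K-independent of 1 and the earlier x i, so its image may be chosen freely. *)
exists (fun i => if i == n then 0 else y i); split.
  by move=> i; case: ifP => // _; exact: rpred0.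
move=> k0 k k0K kK; rewrite !big_ord_recr /= eqxx mulr0 addr0 => E.
have kn : k n = 0.
  apply: contra_notP H => /eqP kn; exists (- (k0 / k n)), (fun i => - (k i / k n)).
  split=> [|i|]; [by rewrite rpredN rpred_div|by rewrite rpredN rpred_div|].
  have -> : \sum_(i < n) - (k i / k n) * x i = - ((\sum_(i < n) k i * x i) / k n).
    by rewrite mulr_suml -sumrN; apply: eq_bigr => i _; rewrite mulNr mulrAC.
  move: E => /eqP; rewrite addrA addrC addr_eq0 => /eqP E.
  by apply: (mulfI kn); rewrite E; field.
move: E; rewrite kn mul0r addr0 => /(hy _ _ k0K kK) E; rewrite -[RHS]E.
by congr (_ + _); apply: eq_bigr => i _; rewrite (ltn_eqF (ltn_ord i)).
Qed.

(** After division by x i0 that entry is 1, which the projection fixes; K-linear relations are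
    insensitive to the division. *)
Lemma rational_specialization (I : finType) (x : I -> L) i0 : x i0 != 0 ->
  exists y : I -> L, [/\ forall i, y i \in K, y i0 = 1 &
    forall k : I -> L, (forall i, k i \in K) -> \sum_i k i * x i = 0 -> \sum_i k i * y i = 0].
Proof.
move=> x0; pose x' n := x (nth i0 (enum I) n) / x i0.
have [y' [yK hy]] := rational_projection x' #|I|.
pose y (i : I) := y' (enum_rank i).
have conv (k u : I -> L) (v : nat -> L) : (forall n : 'I_#|I|, u (enum_val n) = v n) ->
    \sum_i k i * u i = \sum_(n < #|I|) (fun n => k (nth i0 (enum I) n)) n * v n.
  move=> uv; rewrite (reindex (@enum_val I predT)); last exact/onW_bij/enum_val_bij.
  by apply: eq_big => // n _; rewrite uv -(enum_val_nth i0).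
have convx (k : I -> L) : \sum_i k i * (x i / x i0) = \sum_(n < #|I|) (fun n => k (nth i0 (enum I) n)) n * x' n.
  by apply: conv => n; rewrite /x' -(enum_val_nth i0).
have convy (k : I -> L) : \sum_i k i * y i = \sum_(n < #|I|) (fun n => k (nth i0 (enum I) n)) n * y' n.
  by apply: conv => n; rewrite /y enum_valK.
exists y; split=> [i||k kK E]; first exact: yK.
- have delta (u : I -> L) : \sum_i (i == i0)%:R * u i = u i0.
    rewrite (bigD1 i0)//= eqxx mul1r big1 ?addr0// => i /negbTE->; exact: mul0r.
  have := hy (-1) (fun n => (nth i0 (enum I) n == i0)%:R) _ (fun n => rpred_nat _ _).
  rewrite -(convx (fun i => (i == i0)%:R)) -(convy (fun i => (i == i0)%:R)) !delta divff// addNr.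
  move=> /(_ _ erefl) H; apply/eqP; rewrite -subr_eq0 addrC; apply/eqP/H.
  by rewrite rpredN rpred1.
- have := hy 0 (fun n => k (nth i0 (enum I) n)) (rpred0 _) (fun n => kK _).
  rewrite -(convx k) -(convy k) !add0r; apply.
  under eq_bigr do rewrite mulrA.
  by rewrite -mulr_suml E mul0r.
Qed.

End RationalSpecialization.

(** * Polynomials in j, and periodic functions as an integral domain *)

Section PeriodicFunctions.
Variable R : realType.
Local Notation C := R[i].
Implicit Types (tau z : C) (F G U V : C -> C) (P Q S : {poly C}).

(** Both claims follow Horner's scheme together: if P(F) stays away from 0 and F blows up, then P(F)
    F + c blows up. *)
Lemma blows_up_horner P F : blows_up F -> P != 0 ->
  (exists e Y : R, 0 < e /\ forall z, Y < complex.Im z -> e <= cn P.[F z]) /\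
  ((1 < size P)%N -> blows_up (fun z => P.[F z])).
Proof.
move=> bF; elim/poly_ind: P => [|P c ih]; first by rewrite eqxx.
have [->|P0] := eqVneq P 0.
  rewrite mul0r add0r polyC_eq0 => c0; split; last by rewrite size_polyC c0.
  by exists (cn c), 0; split=> [|z _]; rewrite ?cn_gt0// hornerC.
have [[e [Y [e0 hY]]] _] := ih P0.
have bl : blows_up (fun z => (P * 'X + c%:P).[F z]).
  move=> A; have [Y' hY'] := bF ((`|A| + cn c) / e).
  exists (Num.max Y Y') => z; rewrite gt_max => /andP[/hY h1 /hY'].
  rewrite ltr_pdivrMr// !hornerE => h2.
  have h3 : cn (F z) * e <= cn P.[F z] * cn (F z) by rewrite mulrC ler_wpM2r ?cn_ge0.
  have := cn_sub_ge (P.[F z] * F z) (- c); rewrite opprK cnN cnM.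
  have := ler_norm A; lra.
move=> _; split=> //; have [Y1 hY1] := bl 1.
by exists 1, Y1; split=> // z /hY1/ltW.
Qed.

(** A nonconstant polynomial in j blows up at infinity, whereas local vanishing would propagate
    upwards. *)
Lemma poly_jinv_not_locally_zero P p : P != 0 -> 0 < complex.Im p ->
  ~ nearC p (fun z => P.[jinv z] = 0).
Proof.
move=> P0 p0 np; have [s1|s1] := leqP (size P) 1.
  have := nearC_self np; move: P0; rewrite (size1_polyC s1) polyC_eq0 hornerC => /eqP c0 /c0//.
apply: (blowup_not_locally_constant _ _ p0 np).
  by move=> z z0; apply: holo_horner; exact: holoH_jinv.
exact: (blows_up_horner (@blows_up_jinv R) P0).2.
Qed.

Variable h : R.
Hypothesis h0 : 0 < h.

(** By [flat_eq0], U has a first nonzero coefficient in its expansion, and that term dominates near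
    infinity. *)
Lemma eventually_nonzero U : holoH U -> perH h U -> tame h U ->
  ~ (forall z, 0 < complex.Im z -> U z = 0) -> exists Y : R, forall z, Y < complex.Im z -> U z != 0.
Proof.
move=> hU pU [N bU] nU; pose V z := U z * qpar h z ^+ N.
have hV : holoH V.
  by move=> z z0; apply: holo_mul; [exact: hU|apply: holo_exp; exact: holo_qpar].
have pV : perH h V by move=> z z0; rewrite /V pU// qpar_per.
have [m nm] : exists m, ~ bigO h m V.
  apply: contrapT => H; apply: nU => z z0; have := flat_eq0 h0 hV pV _ z0.
  move=> /(_ _)/eqP; rewrite mulf_eq0 expf_eq0 (negbTE (qpar_neq0 _ _)) andbF orbF => E.
  by apply/eqP/E => m; apply: contrapT => nm; apply: H; exists m.
have [p hp] := bigO_poly h0 m hV pV bU.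
have ex : exists i, (i < m)%N && (p`_i != 0).
  apply: contrapT => H; apply: nm.
  apply: (bigO_ext (F := fun z => (V z - p.[qpar h z]) + p.[qpar h z])).
    by move=> z; rewrite subrK.
  apply: bigO_add => //; apply: poly_high_order => // i im; apply/eqP; apply: contrapT => pi.
  by apply: H; exists i; rewrite im /=; apply/negP.
case: (ex_minnP ex) => i /andP[im pi] mini.
have : bigO h i.+1 (fun z => V z - p`_i * qpar h z ^+ i).
  apply: (bigO_ext (F := fun z => (V z - p.[qpar h z]) + (p - p`_i *: 'X^i).[qpar h z])).
    by move=> z; rewrite hornerD hornerN hornerZ hornerXn addrA subrK.
  apply: bigO_add; first exact: bigO_le hp.
  apply: poly_high_order => // k; rewrite ltnS leq_eqVlt => /predU1P[->|ki].
    by rewrite !coefE eqxx mulr1 subrr.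
  rewrite !coefE (ltn_eqF ki) mulr0 subr0; apply: contrapT => /eqP pk.
  by have := mini k; rewrite pk (ltn_trans ki im) leqNgt ki => /(_ isT).
move=> /bigO_pos[Y [B [Y0 B0 hY]]].
have pc : 0 < cn p`_i by rewrite cn_gt0.
have [Y' hY'] := qpar_small h0 (divr_gt0 pc (ltr_wpDl B0 ltr01)).
exists (Num.max Y Y') => z; rewrite gt_max => /andP[/hY h1 /hY' h2].
have w0 : 0 < cn (qpar h z) by rewrite cn_gt0 qpar_neq0.
apply: contraTneq h1 => Uz; rewrite /V Uz mul0r sub0r cnN cnM cnX -ltNge exprS mulrA.
rewrite ltr_pM2r ?exprn_gt0//; move: h2; rewrite ltr_pdivlMr ?ltr_wpDl//.
move: w0; set w := cn _; lra.
Qed.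

(** If U is not identically zero, it has no zeros near infinity, so V vanishes there; then V is flat
    at the cusp and hence zero. *)
Lemma periodic_integral U V : holoH U -> perH h U -> tame h U -> holoH V -> perH h V -> tame h V ->
  (forall z, 0 < complex.Im z -> U z * V z = 0) ->
  (forall z, 0 < complex.Im z -> U z = 0) \/ (forall z, 0 < complex.Im z -> V z = 0).
Proof.
move=> hU pU tU hV pV tV UV; have [|nU] := pselect (forall z, 0 < complex.Im z -> U z = 0); first by left.
right; have [Y hY] := eventually_nonzero hU pU tU nU.
apply: (flat_eq0 h0 hV pV) => m; apply: (bigO_near (F := fun=> 0)); last exact: bigO_0.
exists (Num.max 0 Y) => z; rewrite gt_max => /andP[z0 /hY Uz].
by have /eqP := UV z z0; rewrite mulf_eq0 (negbTE Uz) => /eqP.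
Qed.

End PeriodicFunctions.

(** * Relations between j and f: irreducibility and descent to K *)

Section Relations.
Variable R : realType.
Local Notation C := R[i].
Implicit Types (tau z w : C) (P Q S : {poly {poly C}}) (D : {poly C}).
Variable f : C -> option C.

Definition relation P := forall tau w, 0 < complex.Im tau -> f tau = Some w -> P.[jinv tau, w] = 0.

(** Lexicographic minimality in the degree in X and the degree in Y of the leading coefficient. It
    forces the cofactor of any relation dividing P to be constant, and it survives a specialization
    of the coefficients that keeps the leading one nonzero. *)
Definition minimal_relation P := [/\ P != 0, relation P &
  forall Q, Q != 0 -> relation Q -> (size P <= size Q)%N /\
    (size Q = size P -> (size (lead_coef P) <= size (lead_coef Q))%N)].

Lemma exists_minimal (T : Type) (A : T -> Prop) (mu : T -> nat) : (exists x, A x) ->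
  exists2 x, A x & forall y, A y -> (mu x <= mu y)%N.
Proof.
move=> [x0 Ax0]; have ex : exists n, `[< exists2 x, A x & mu x = n >].
  by exists (mu x0); apply/asboolP; exists x0.
case: (ex_minnP ex) => n /asboolP[x Ax <-] mini.
by exists x => // y Ay; apply: mini; apply/asboolP; exists y.
Qed.

Lemma exists_minimal_relation : (exists2 P, P != 0 & relation P) -> exists P, minimal_relation P.
Proof.
move=> [P0 h1 h2].
have [Q [Q0 rQ] mQ] := @exists_minimal _ (fun P => P != 0 /\ relation P) (fun P => size P)
  (ex_intro _ P0 (conj h1 h2)).
have [P [[P1 rP] sP] mP] := @exists_minimal _ (fun P => (P != 0 /\ relation P) /\ size P = size Q)
  (fun P => size (lead_coef P)) (ex_intro _ Q (conj (conj Q0 rQ) erefl)).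
exists P; split=> // S S0 rS; rewrite sP; split; first exact: mQ.
by move=> sS; apply: mP.
Qed.

Lemma horner2_sum P x y : P.[x, y] = \sum_(i < size P) (P`_i).[y] * x ^+ i.
Proof.
rewrite (horner_coef P) horner_sum; apply: eq_bigr => i _.
by rewrite hornerM horner_exp hornerC.
Qed.

Lemma holo_horner2 P (F G : C -> C) z : holo F z -> holo G z -> holo (fun u => P.[F u, G u]) z.
Proof.
move=> hF hG; apply: (holo_near (F := fun u => \sum_(i < size P) (P`_i).[G u] * F u ^+ i)).
  by exists 1 => // u _; rewrite horner2_sum.
by apply: holo_sum => i; apply: holo_mul; [exact: holo_horner|exact: holo_exp].
Qed.

Variable D : {poly C}.
Hypothesis D0 : D != 0.
Hypothesis holD : holoH (clear_poles D f).
Hypothesis poleD : forall tau, 0 < complex.Im tau -> f tau = None -> D.[jinv tau] = 0.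
Hypothesis mf : forall tau, 0 < complex.Im tau -> meromorphic_at f tau.

(** The exponent exceeds the degree of P in Y, so every pole of f is compensated and the product
    even vanishes there. Relations become identities between holomorphic functions on the
    half-plane. *)
Definition cleared P z := D.[jinv z] ^+ (sizeY P).+1 * P.[jinv z, odflt 0 (f z)].

Lemma holoH_cleared P : holoH (cleared P).
Proof.
move=> z z0; pose n := (sizeY P).+1.
apply: (holo_near (F := fun u => \sum_(i < size P) \sum_(k < n)
   P`_i`_k * jinv u ^+ i * D.[jinv u] ^+ (n - k) * clear_poles D f u ^+ k)).
  exists 1 => // u _; rewrite /cleared horner2_sum mulr_sumr; apply: eq_bigr => i _.
  rewrite (@horner_coef_wide _ n P`_i); last by rewrite /n leqW ?max_size_coefXY.
  rewrite mulr_suml mulr_sumr; apply: eq_bigr => k _; rewrite /clear_poles.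
  move: (odflt 0 (f u)) (jinv u) => x J.
  have -> : D.[J] ^+ n = D.[J] ^+ (n - k) * D.[J] ^+ k by rewrite -exprD subnK// ltnW.
  rewrite exprMn; move: (D.[J] ^+ (n - k)) (D.[J] ^+ k) (x ^+ k) (J ^+ i) (P`_i)`_k => A B X Y c.
  by ring.
have hj := holoH_jinv z0.
apply: holo_sum => i; apply: holo_sum => k; apply: holo_mul; last by apply: holo_exp; exact: holD.
apply: holo_mul; last by apply: holo_exp; exact: holo_horner.
by apply: holo_mul; [exact: holo_cst|exact: holo_exp].
Qed.

(** The zeros of D(j) are harmless: if P(j, f) were nonzero at a point where f is finite, it would
    be so nearby, forcing D(j) to vanish on a neighbourhood. *)
Lemma relation_cleared P : relation P <-> forall z, 0 < complex.Im z -> cleared P z = 0.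
Proof.
split=> [rP z z0|cP tau w t0 fw].
  rewrite /cleared; case E: (f z) => [w|] /=; first by rewrite rP// mulr0.
  by rewrite (poleD z0 E) expr0n mul0r.
apply: contrapT => /eqP nz.
have [n [g [/near_nearC dg _ /near_nearC ef]]] := mf t0.
have n0 : n = 0%N.
  by have := nearC_self ef; rewrite eqxx /= fw; case: n {ef dg}.
have {}ef : nearC tau (fun z => f z = Some (g z)).
  by apply: nearC_imp ef => z; rewrite n0 andbF expr0 divr1.
have gw : g tau = w by have := nearC_self ef; rewrite fw => -[].
have hg : holo g tau by apply: derivable_holo; exact: nearC_self dg.
have := ccont_neq (holo_cont (holo_horner2 P (holoH_jinv t0) hg)); rewrite gw => /(_ _ nz) nP.
apply: (poly_jinv_not_locally_zero D0 t0).
apply: nearC_imp (nearC_and nP (nearC_and ef (nearH t0))) => z [Pz [fz z0]].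
have /eqP := cP z z0; rewrite /cleared fz /= mulf_eq0 (negbTE Pz) orbF expf_eq0.
by move/eqP.
Qed.

Variable h : nat.
Hypothesis h0 : (0 < h)%N.
Hypothesis perf : is_periodic f h.
Hypothesis tamef : tame h%:R (fun z => odflt 0 (f z)).

Let r0 : (0 : R) < h%:R. Proof. by rewrite ltr0n. Qed.

Lemma perH_cleared P : perH h%:R (cleared P).
Proof.
move=> z z0; rewrite /cleared (perH_root h (@perH_jinv R) z0).
by rewrite rmorph_nat perf.
Qed.

Let tamej : tame h%:R (@jinv R).
Proof. exact: (tame_root h0 (@tame_jinv R)). Qed.

Lemma tame_cleared P : tame h%:R (cleared P).
Proof.
apply: tame_mul; first by apply: tame_exp; exact: (tame_horner r0 D tamej).
apply: (tame_near (F := fun u => \sum_(i < size P) (P`_i).[odflt 0 (f u)] * jinv u ^+ i)).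
  by exists 0 => u _; rewrite horner2_sum.
apply: (tame_sum r0) => i; apply: tame_mul; first exact: (tame_horner r0 P`_i tamef).
exact: tame_exp.
Qed.

(** The cleared functions of P and Q have product zero and lie in the integral domain of
    [periodic_integral]. *)
Lemma relation_prime P Q : relation (P * Q) -> relation P \/ relation Q.
Proof.
move=> rPQ; rewrite !relation_cleared.
apply: (periodic_integral r0 (@holoH_cleared P) (@perH_cleared P) (@tame_cleared P)
  (@holoH_cleared Q) (@perH_cleared Q) (@tame_cleared Q)) => z z0; rewrite /cleared.
case E: (f z) => [w|] /=; last by rewrite (poleD z0 E) expr0n !mul0r.
have := rPQ z w z0 E; rewrite hornerM hornerM => e.
by rewrite mulrACA e mulr0.
Qed.

Hypothesis defined_near_infinity : exists Y : R, forall z, Y < complex.Im z -> f z != None.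

(** By minimality Q has the same degree in X as P, so S does not involve X; comparing leading
    coefficients, S does not involve Y either. *)
Lemma minimal_factor_unit P Q S : minimal_relation P -> P = Q * S -> relation Q ->
  S \is a GRing.unit.
Proof.
move=> [P0 rP mP] PE rQ; have : Q * S != 0 by rewrite -PE.
rewrite mulf_eq0 negb_or => /andP[Q0 S0].
have [le1 le2] := mP Q Q0 rQ.
have sS : size S = 1%N.
  have := size_mul Q0 S0; rewrite -PE; move: (size_poly_gt0 S) (size_poly_gt0 Q) le1; rewrite S0 Q0.
  by move: (size P) (size Q) (size S) => a b c; lia.
have [s ES] : exists s, S = s%:P by exists S`_0; apply: size1_polyC; rewrite sS.
have s0 : s != 0 by move: S0; rewrite ES polyC_eq0.
have lP : lead_coef P = lead_coef Q * s by rewrite PE lead_coefM ES lead_coefC.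
have lQ0 : lead_coef Q != 0 by rewrite lead_coef_eq0.
have sQ : size Q = size P.
  by have := size_mul Q0 S0; rewrite -PE sS addn1.
have ss : size s = 1%N.
  have := le2 sQ; rewrite lP size_mul//; move: (size_poly_gt0 s) (size_poly_gt0 (lead_coef Q)); rewrite s0 lQ0.
  by move: (size s) (size (lead_coef Q)) => a b; lia.
rewrite poly_unitE sS eqxx /= ES coefC eqxx poly_unitE ss eqxx /= unitfE.
by move: s0; rewrite (size1_polyC (eq_leq ss)) polyC_eq0 coefC eqxx.
Qed.

(** P is not a nonzero constant, since it vanishes at some point near infinity where f is finite. In
    a factorization one factor is a relation by [relation_prime], and the other is then a unit. *)
Lemma minimal_irreducible P : minimal_relation P -> irreducible_elt P.
Proof.
move=> mP; have [P0 rP _] := mP; split=> // [|Q S PE].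
  apply/negP; rewrite poly_unitE => /andP[/eqP sP]; rewrite poly_unitE => /andP[/eqP sP0 u].
  have [Y hY] := defined_near_infinity; pose tau : C := 0 +i* (`|Y| + 1).
  have t0 : 0 < complex.Im tau by rewrite /= ltr_wpDl.
  have : f tau != None by apply: hY; rewrite /=; have := ler_norm Y; lra.
  case E: (f tau) => [w|] // _.
  have := rP tau w t0 E; rewrite (size1_polyC (eq_leq sP)) hornerC.
  rewrite (size1_polyC (eq_leq sP0)) hornerC => e.
  by move: u; rewrite e unitr0.
have [rQ|rS] : relation Q \/ relation S by apply: relation_prime; rewrite -PE.
  by right; exact: (minimal_factor_unit mP PE).
by left; apply: (minimal_factor_unit mP _ rS); rewrite mulrC.
Qed.

Variable K : divringClosed C.
Hypothesis asyf : asy h%:R K (fun z => odflt 0 (f z)).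

Let asyj : asy h%:R K (@jinv R).
Proof. exact: (asy_root h0 (asy_jinv K)). Qed.

(* The K-rational expansions of the monomials j^a f^b turn a relation between them into
   infinitely many K-linear relations between its coefficients. *)
Lemma relation_specialize (I : finType) (e : I -> nat * nat) (x y : I -> C) :
  (forall k : I -> C, (forall i, k i \in K) -> \sum_i k i * x i = 0 -> \sum_i k i * y i = 0) ->
  relation (\sum_i (x i *: 'X^((e i).2)) *: 'X^((e i).1)) ->
  relation (\sum_i (y i *: 'X^((e i).2)) *: 'X^((e i).1)).
Proof.
move=> xy rx; set Q := \sum_i (y i *: _) *: _.
pose E i z := jinv z ^+ (e i).1 * odflt 0 (f z) ^+ (e i).2.
have evalE (u : I -> C) z : (\sum_i (u i *: 'X^((e i).2)) *: 'X^((e i).1)).[jinv z, odflt 0 (f z)] = \sum_i u i * E i z.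
  rewrite !horner_sum; apply: eq_bigr => i _; rewrite /E.
  move: (odflt 0 (f z)) (jinv z) => v J.
  by rewrite hornerZ hornerXn hornerM hornerZ hornerXn horner_exp hornerC mulrAC mulrA.
have aE i : asy h%:R K (E i) by apply: (asy_mul r0); apply: (asy_exp r0).
have [N hN] : exists N, forall i m, exists2 p, p \is a polyOver K &
    bigO h%:R m (fun z => E i z * qpar h%:R z ^+ N - p.[qpar h%:R z]).
  have [N' hN'] := choice aE; exists (\sum_i N' i)%N => i.
  have Ni : (N' i <= \sum_i N' i)%N by rewrite (bigD1 i)//= leq_addr.
  exact: (asy_widen r0 Ni (hN' i)).
pose V z := \sum_i y i * E i z.
have flatV m : bigO h%:R m V.
  apply: (@bigO_divwn _ _ _ N); move: (m + N)%N => k.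
  have [p hp] : {p : I -> {poly C} & forall i, p i \is a polyOver K /\
      bigO h%:R k (fun z => E i z * qpar h%:R z ^+ N - (p i).[qpar h%:R z])}.
    by apply: (@choice _ _ (fun i p => p \is a polyOver K /\
      bigO h%:R k (fun z => E i z * qpar h%:R z ^+ N - p.[qpar h%:R z]))) => i;
      have [p pK hp] := hN i k; exists p.
  have split_sum (u : I -> C) z : (\sum_i u i * E i z) * qpar h%:R z ^+ N =
      \sum_i u i * (E i z * qpar h%:R z ^+ N - (p i).[qpar h%:R z]) + (\sum_i u i *: p i).[qpar h%:R z].
    rewrite horner_sum -big_split /= mulr_suml; apply: eq_bigr => i _.
    by rewrite hornerZ mulrBr subrK; exact/esym/mulrA.
  have small (u : I -> C) : bigO h%:R k (fun z => \sum_i u i * (E i z * qpar h%:R z ^+ N - (p i).[qpar h%:R z])).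
    by apply: bigO_sum => i; apply: bigO_scale; exact: (hp i).2.
  have xflat : bigO h%:R k (fun z => (\sum_i x i *: p i).[qpar h%:R z]).
    apply: (bigO_near (F := fun z => - (\sum_i x i * (E i z * qpar h%:R z ^+ N - (p i).[qpar h%:R z])))).
      have [Y hY] := defined_near_infinity; exists (Num.max 0 Y) => z; rewrite gt_max => /andP[z0 /hY].
      case fz: (f z) => [w|] // _; have := split_sum x z.
      have := rx z w z0 fz; have := evalE x z; rewrite fz /= => -> ->; rewrite mul0r => /esym.
      exact: addr0_eq.
    by apply: bigO_opp.
  apply: (bigO_ext (F := fun z => \sum_i y i * (E i z * qpar h%:R z ^+ N - (p i).[qpar h%:R z]) +
    (\sum_i y i *: p i).[qpar h%:R z])); first by move=> z; rewrite -split_sum.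
  apply: bigO_add => //; apply: poly_high_order => // l lk; rewrite coef_sum.
  (* The l-th coefficient gives an equation between the x i with coefficients in K, which the
     hypothesis [xy] carries over to the y i. *)
  have := poly_flat r0 xflat lk; rewrite coef_sum => E0.
  under eq_bigr => i _ do rewrite coefZ mulrC.
  apply: xy => [i|]; first exact: (polyOverP (hp i).1).
  by rewrite -[RHS]E0; apply: eq_bigr => i _; rewrite coefZ mulrC.
apply/relation_cleared => z z0.
apply: (flat_eq0 r0 (@holoH_cleared Q) (@perH_cleared Q) _ z0) => m.
have [N2 hN2] : tame h%:R (fun z => D.[jinv z] ^+ (sizeY Q).+1).
  by apply: tame_exp; exact: (tame_horner r0 D tamej).
apply: (@bigO_divwn _ _ _ N2).
apply: (bigO_ext (F := fun z => V z * (D.[jinv z] ^+ (sizeY Q).+1 * qpar h%:R z ^+ N2))).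
  by move=> u; rewrite /cleared evalE -/(V u) mulrCA mulrA.
by rewrite -[(m + N2)%N]addn0; apply: bigO_mul.
Qed.

(** Specialize the coefficients of P so that the leading coefficient of its leading coefficient
    becomes 1. No degree rises, since zero coefficients stay zero, and by minimality of P none of
    the two relevant degrees drops. *)
Theorem relation_over_K P : minimal_relation P ->
  exists2 Q, minimal_relation Q & forall i k : nat, (Q`_i)`_k \in K.
Proof.
move=> [P0 rP mP]; have lP0 : lead_coef P != 0 by rewrite lead_coef_eq0.
pose n := sizeY P; pose l := lead_coef P.
have sl : (0 < size P)%N by rewrite size_poly_gt0.
have ll : (0 < size l)%N by rewrite size_poly_gt0.
have ln : (size l <= n)%N := max_size_lead_coefXY P.
have i1 : ((size P).-1 < size P)%N by lia.
have i2 : ((size l).-1 < n)%N by lia.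
pose x (i : 'I_(size P) * 'I_n) := (P`_i.1)`_i.2.
pose i0 : 'I_(size P) * 'I_n := (Ordinal i1, Ordinal i2).
have x0 : x i0 != 0 by rewrite /x /= -!lead_coefE lead_coef_eq0.
have [y [yK y1 xy]] := rational_specialization K x0.
pose e (i : 'I_(size P) * 'I_n) : nat * nat := (i.1 : nat, i.2 : nat).
pose build (u : 'I_(size P) * 'I_n -> C) : {poly {poly C}} := \sum_i (u i *: 'X^((e i).2)) *: 'X^((e i).1).
have coefE' u (a b : nat) : (build u)`_a`_b = \sum_i u i * ((e i == (a, b))%:R).
  rewrite /build coef_sum coef_sum; apply: eq_bigr => i _.
  rewrite coefZ coefXn /e xpair_eqE (eq_sym a); case: (_ == a) => /=; last by rewrite !mulr0 coef0.
  by rewrite mulr1 coefZ coefXn (eq_sym b).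
have coef_in u (i : 'I_(size P) * 'I_n) : (build u)`_(i.1)`_(i.2) = u i.
  case: i => a0 b0; rewrite coefE' (bigD1 (a0, b0))//= /e /= eqxx mulr1 big1 ?addr0// => -[a b] ab.
  rewrite (_ : (_ == _) = false) ?mulr0//; apply/negbTE; apply: contra ab.
  by rewrite !xpair_eqE.
have coef_out u (a b : nat) : ~~ ((a < size P) && (b < n))%N -> (build u)`_a`_b = 0.
  move=> H; rewrite coefE' big1// => i _; rewrite (_ : (_ == _) = false) ?mulr0//.
  by apply: contraNF H => /eqP[<- <-]; rewrite !ltn_ord.
have PE : P = build x.
  apply/polyP => a; apply/polyP => b; case: (boolP ((a < size P) && (b < n))%N) => H.
    by have /andP[ha hb] := H; rewrite (coef_in x (Ordinal ha, Ordinal hb)).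
  rewrite coef_out//; move: H; rewrite negb_and -!leqNgt => /orP[H|H].
    by rewrite (nth_default 0 H) coef0.
  by rewrite nth_default// (leq_trans (max_size_coefXY _ _) H).
have rQ : relation (build y) by apply: relation_specialize xy _; rewrite -/(build x) -PE.
have lead1 : (build y)`_(size P).-1`_(size l).-1 = 1 by rewrite (coef_in y i0).
have Q0 : build y != 0.
  by apply: contra_eq_neq lead1 => ->; rewrite !coef0 eq_sym oner_neq0.
have sQ : (size (build y) <= size P)%N.
  by apply/leq_sizeP => a Pa; apply/polyP => b; rewrite coef0 coef_out// ltnNge Pa.
have [sP _] := mP _ Q0 rQ.
have sPQ : size (build y) = size P by apply/eqP; rewrite eqn_leq sQ.
have slQ : (size (lead_coef (build y)) <= size l)%N.
  apply/leq_sizeP => b lb; rewrite lead_coefE sPQ.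
  have [bn|nb] := ltnP b n; last by rewrite coef_out// negb_and -!leqNgt nb orbT.
  (* The vanishing of one coefficient of P is itself a K-linear relation, so the corresponding
     coefficient of [build y] vanishes too. *)
  pose i : 'I_(size P) * 'I_n := (Ordinal i1, Ordinal bn).
  rewrite (coef_in y i); have xi : x i = 0 by rewrite /x /= -lead_coefE nth_default.
  have delta (u : 'I_(size P) * 'I_n -> C) : \sum_i' (i' == i)%:R * u i' = u i.
    by rewrite (bigD1 i)//= eqxx mul1r big1 ?addr0// => i' /negbTE->; exact: mul0r.
  have := xy (fun i' => (i' == i)%:R) (fun=> rpred_nat _ _).
  by rewrite !delta; apply.
exists (build y).
  split=> // S S0 rS; have [h1 h2] := mP S S0 rS; rewrite sPQ; split=> // /h2.
  exact: leq_trans.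
move=> a b; rewrite coefE'; apply: rpred_sum => i _; apply: rpredM => //; exact: rpred_nat.
Qed.

End Relations.

Theorem propositionA1 (R : realType) (K : {pred R[i]}) (hK : divring_closed K)
    (f : R[i] -> option R[i]) (hf : modular_function f)
    (h : nat) (hh : is_period f h)
    (a : int -> R[i]) (ha : fourier_expansion f h a)
    (haK : forall n : int, a n \in K) :
  defined_over f K.
Proof.
have [h0 perf _] := hh; have mf := hf.1.
have asyf : asy h%:R (divringClosed_of hK) (fun z => odflt 0 (f z)) by exact: (asy_fourier h0 ha).
have r0 : (0 : R) < h%:R by rewrite ltr0n.
have tamef : tame h%:R (fun z => odflt 0 (f z)) := asy_bound r0 asyf.
have defined : exists Y : R, forall z, Y < complex.Im z -> f z != None.
  by have [_ [M _ hM]] := ha; exists M => z /hM[w ->].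
have [D [D0 holD poleD]] := clear_poles_holoH hf.
have [P mP] := exists_minimal_relation (algebraic_relation hf).
have [Q mQ QK] := relation_over_K D0 holD poleD mf h0 perf defined asyf mP.
exists Q; split=> //; last by have [_ rQ _] := mQ.
exact: (minimal_irreducible D0 holD poleD mf h0 perf tamef defined mQ).
Qed.
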